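(* For every $q\ge2$ there is a constant $C_q$ depending only on $q$ such that the following holds. Let $\nu>\frac{2q}{q-1}$ and let $\pi=\pi_\nu\propto\exp(-V_\nu)$ on $\mathbb{R}^d$ with $V_\nu(x)=\frac{d+\nu}{2}\ln(1+\|x\|^2)$. Then for any $\Delta_0\ge C_q(1+\nu\ln(d+\nu))$, the Langevin diffusion satisfies $$\frac{d}{4\nu}\exp\Big(\frac{\Delta_0}{\nu}\Big)\le\mathscr{C}^{\mathrm{LD}}_{R_q,R_\infty}(\pi,\Delta_0,1)\le\frac d\nu\exp\Big(\frac{C_q\Delta_0}{\nu}\Big).$$ Further, LMC with an appropriate step size $h>0$ satisfies $$\frac{d}{4h\nu}\exp\Big(\frac{\Delta_0}{\nu}\Big)\le\mathscr{C}^{\mathrm{LMC}}_{R_q,R_\infty}(\pi,h,\Delta_0,1)\le\frac{d}{h\nu}\exp\Big(\frac{C_q\Delta_0}{\nu}\Big).$$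
   Context: Langevin diffusion for $\pi\propto e^{-V}$: $\mathrm{d}X_t=-\nabla V(X_t)\,\mathrm{d}t+\sqrt2\,\mathrm{d}B_t$, $\rho_t$ the law of $X_t$. Langevin Monte Carlo (LMC) with step size $h>0$: $x_{k+1}=x_k-h\nabla V(x_k)+\sqrt{2h}\,\xi_k$, with $(\xi_k)$ i.i.d. standard Gaussian vectors independent of $x_0$, $\mu_k$ the law of $x_k$. Complexities: for two divergences $\mathcal{D},\mathcal{D}'$, $\mathscr{C}^{\mathrm{LMC}}_{\mathcal{D},\mathcal{D}'}(\pi,h,\Delta_0,\varepsilon)$ is the smallest $k\in\mathbb{N}$ such that for any $\mu_0$ with $\mathcal{D}'(\mu_0\,\|\,\pi)\le\Delta_0$, LMC with step size $h$ satisfies $\mathcal{D}(\mu_k\,\|\,\pi)\le\varepsilon$. $\mathscr{C}^{\mathrm{LD}}_{\mathcal{D},\mathcal{D}'}(\pi,\Delta_0,\varepsilon)$ is the smallest $T\in\mathbb{R}_+$ such that for any $\rho_0$ with $\mathcal{D}'(\rho_0\,\|\,\pi)\le\Delta_0$, the Langevin diffusion satisfies $\mathcal{D}(\rho_T\,\|\,\pi)\le\varepsilon$. Rényi divergence: for $1<q<\infty$, $R_q(\rho\,\|\,\pi)=\frac1{q-1}\ln\big\|\frac{\mathrm{d}\rho}{\mathrm{d}\pi}\big\|_{L^q(\pi)}^q$ if $\rho\ll\pi$ and $+\infty$ otherwise; $R_\infty(\rho\,\|\,\pi)=\ln\|\mathrm{d}\rho/\mathrm{d}\pi\|_{L^\infty(\pi)}$.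 *)

(* Defs.v *)
From HB Require Import structures.
From mathcomp Require Import all_boot all_order all_algebra.
From mathcomp Require Import all_classical all_reals all_analysis.
Set Implicit Arguments.
Unset Strict Implicit.
Unset Printing Implicit Defensive.
Import Order.TTheory GRing.Theory Num.Theory.
Import numFieldNormedType.Exports.
Local Open Scope classical_set_scope.
Local Open Scope ring_scope.

Definition measure_rV_display : measure_display.
Proof. exact: measure_tuple_display default_measure_display. Qed.

(* The product (= Borel) sigma-algebra of R^d, generated by the coordinate
   maps, exactly as the library does for n.-tuple. *)
Section measurable_rV.
Context (R : realType) (d : nat).

Let coord : 'I_d -> 'rV[R]_d -> R := fun i v => v ord0 i.

Let rV_set0 : g_sigma_preimage coord set0.
Proof. exact: sigma_algebra0. Qed.

Let rV_setC A : g_sigma_preimage coord A -> g_sigma_preimage coord (~` A).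
Proof. exact: sigma_algebraC. Qed.

Let rV_bigcup (F : _^nat) : (forall i, g_sigma_preimage coord (F i)) ->
  g_sigma_preimage coord (\bigcup_i (F i)).
Proof. exact: sigma_algebra_bigcup. Qed.

HB.instance Definition _ := @isMeasurable.Build measure_rV_display
  'rV[R]_d (g_sigma_preimage coord) rV_set0 rV_setC rV_bigcup.

Lemma measurable_coord_rV (i : 'I_d) :
  measurable_fun [set: 'rV[R]_d] (fun v : 'rV[R]_d => v ord0 i).
Proof.
move=> _ Y mY; rewrite setTI; apply: sub_sigma_algebra => /=.
rewrite -bigcup_seq/=; exists i => /=; first by rewrite mem_index_enum.
by exists Y => //; rewrite setTI.
Qed.

Lemma measurable_fun_rV d1 (T : measurableType d1) (f : T -> 'rV[R]_d) :
  (forall i, measurable_fun setT (fun x => f x ord0 i)) ->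
  measurable_fun setT f.
Proof.
move=> mf _ A mA; rewrite setTI.
suff : g_sigma_preimage (fun i => coord i \o f) `<=` measurable.
  apply; rewrite g_sigma_preimage_comp; exists A => //; by rewrite setTI.
apply: smallest_sub; first exact: sigma_algebra_measurable.
rewrite -bigcup_seq/= => B [i _] [C mC <-]; exact: mf.
Qed.

End measurable_rV.

(* Lebesgue measure on R^d, as the iterated product of the one-dimensional
   one, transported along R * R^d = R^(d+1). *)
Section lebesgue_rV.
Context (R : realType).

Definition cons_rV d (p : R * 'rV[R]_d) : 'rV[R]_d.+1 :=
  \row_i (if unlift ord0 i is Some j then p.2 ord0 j else p.1).

Definition uncons_rV d (v : 'rV[R]_d.+1) : R * 'rV[R]_d :=
  (v ord0 ord0, \row_i v ord0 (lift ord0 i)).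

Lemma cons_rVK d : cancel (@cons_rV d) (@uncons_rV d).
Proof.
move=> [x v]; rewrite /uncons_rV mxE unlift_none; congr pair.
by apply/rowP => i; rewrite !mxE liftK.
Qed.

Lemma measurable_cons_rV d : measurable_fun setT (@cons_rV d).
Proof.
apply: measurable_fun_rV => i; under eq_fun do rewrite mxE.
case: unliftP => [j _|_]; last exact: measurable_fst.
exact: (measurableT_comp (measurable_coord_rV j) measurable_snd).
Qed.

Lemma measurable_uncons_rV d : measurable_fun setT (@uncons_rV d).
Proof.
apply: measurable_fun_pair; first exact: measurable_coord_rV.
apply: measurable_fun_rV => i; under eq_fun do rewrite mxE.
exact: measurable_coord_rV.
Qed.

Section step.
Context (d : nat) (m : {sigma_finite_measure set 'rV[R]_d -> \bar R}).

Definition lebesgue_rVS : set 'rV[R]_d.+1 -> \bar R :=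
  pushforward (@lebesgue_measure R \x m)%E (@cons_rV d).

Let lebesgue_rVS0 : lebesgue_rVS set0 = 0%E.
Proof. by rewrite /lebesgue_rVS /pushforward preimage_set0 measure0. Qed.

Let lebesgue_rVS_ge0 A : (0 <= lebesgue_rVS A)%E.
Proof. by rewrite /lebesgue_rVS /pushforward measure_ge0. Qed.

Let lebesgue_rVS_sigma_additive : semi_sigma_additive lebesgue_rVS.
Proof.
move=> F mF tF mUF; rewrite /lebesgue_rVS /pushforward preimage_bigcup.
apply: measure_semi_sigma_additive.
- by move=> n; rewrite -[X in measurable X]setTI; exact: measurable_cons_rV.
- apply/trivIsetP => /= i j _ _ ij; rewrite -preimage_setI.
  by move/trivIsetP : tF => /(_ _ _ _ _ ij) ->//; rewrite preimage_set0.
- rewrite -preimage_bigcup -[X in measurable X]setTI.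
  exact: measurable_cons_rV.
Qed.

HB.instance Definition _ := isMeasure.Build _ _ _ lebesgue_rVS
  lebesgue_rVS0 lebesgue_rVS_ge0 lebesgue_rVS_sigma_additive.

Lemma lebesgue_rVS_box A B : measurable A -> measurable B ->
  lebesgue_rVS (@uncons_rV d @^-1` (A `*` B)) =
  (@lebesgue_measure R A * m B)%E.
Proof.
move=> mA mB; rewrite /lebesgue_rVS /pushforward -comp_preimage.
rewrite (_ : _ \o _ = id) ?preimage_id ?product_measure1E//.
by apply/funext => x; exact: cons_rVK.
Qed.

Let lebesgue_rVS_sigma_finite : sigma_finite setT lebesgue_rVS.
Proof.
have /sigma_finiteP[F [TF ndF Foo]] := sigma_finiteT (@lebesgue_measure R).
have /sigma_finiteP[G [TG ndG Goo]] := sigma_finiteT m.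
exists (fun n => @uncons_rV d @^-1` (F n `*` G n)).
  rewrite -preimage_bigcup (_ : \bigcup_n _ = setT) ?preimage_setT//.
  apply/seteqP; split => // -[x y] _.
  have [n _ Fx] : (\bigcup_n F n) x by rewrite -TF.
  have [k _ Gy] : (\bigcup_n G n) y by rewrite -TG.
  exists (maxn n k) => //; split => /=.
  - by move: Fx; exact/subsetPset/ndF/leq_maxl.
  - by move: Gy; exact/subsetPset/ndG/leq_maxr.
move=> k; have [mF Fk] := Foo k; have [mG Gk] := Goo k; split.
  rewrite -[X in measurable X]setTI; apply: measurable_uncons_rV => //.
  exact: measurableX.
by rewrite lebesgue_rVS_box// lte_mul_pinfty// ge0_fin_numE.
Qed.

HB.instance Definition _ := Measure_isSigmaFinite.Build _ _ _ lebesgue_rVS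
  lebesgue_rVS_sigma_finite.

End step.

Fixpoint lebesgue_rV (d : nat) :
    {sigma_finite_measure set 'rV[R]_d -> \bar R} :=
  match d with
  | 0 => \d_(0 : 'rV[R]_0)
  | d'.+1 => lebesgue_rVS (lebesgue_rV d')
  end.

Lemma lebesgue_rV_box (d : nat) (A : 'I_d -> set R) :
  (forall i, measurable (A i)) ->
  lebesgue_rV d [set v | forall i, A i (v ord0 i)] =
  (\prod_(i < d) @lebesgue_measure R (A i))%E.
Proof.
elim: d A => [A _|d IHd A mA].
  by rewrite big_ord0 /= diracE mem_set// => -[].
have mB : measurable [set v : 'rV[R]_d | forall i, A (lift ord0 i) (v ord0 i)].
  rewrite (_ : mkset _ = \bigcap_(i in [set: 'I_d])
      (fun v : 'rV[R]_d => v ord0 i) @^-1` A (lift ord0 i)).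
    apply: fin_bigcap_measurable => // i _; rewrite -[X in measurable X]setTI.
    by apply: measurable_coord_rV.
  by apply/seteqP; split=> [v Av i _|v Av i]; exact: Av.
rewrite big_ord_recl -IHd// -lebesgue_rVS_box//=; congr lebesgue_rVS.
apply/seteqP; split=> v /=.
  by move=> Av; split=> //= i; rewrite mxE.
move=> [A0 AS] i; case: (unliftP ord0 i) => [j ->|->//].
by have := AS j; rewrite mxE.
Qed.

End lebesgue_rV.

Section divergences.
Context {d : measure_display} {T : measurableType d} {R : realType}.
Implicit Types rho pi : probability T R.
Local Open Scope ereal_scope.

Definition renyi (q : R) rho pi : \bar R :=
  if `[< rho `<< pi >] then
    (q - 1)^-1%:E *
      lne (Lnorm pi q%:E (Radon_Nikodym (charge_of_finite_measure rho) pi) `^ q)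
  else +oo.

Definition renyi_oo rho pi : \bar R :=
  if `[< rho `<< pi >] then
    lne (Lnorm pi +oo (Radon_Nikodym (charge_of_finite_measure rho) pi))
  else +oo.

End divergences.

Section euclidean.
Context {R : realType} {d : nat}.
Implicit Types V : 'rV[R]_d -> R.

(* The library norm on 'rV[R]_d is the sup norm. *)
Definition sqnorm2 (x : 'rV[R]_d) : R := \sum_(i < d) x ord0 i ^+ 2.

Definition grad V (x : 'rV[R]_d) : 'rV[R]_d :=
  \row_i 'D_(delta_mx ord0 i) V x.

(* pi is proportional to exp (- V) *)
Definition is_gibbs V (pi : probability 'rV[R]_d R) : Prop :=
  exists c : R, forall A : set 'rV[R]_d, measurable A ->
    pi A = (c%:E * \int[lebesgue_rV R d]_(x in A) (expR (- V x))%:E)%E.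

Definition V_nu (nu : R) (x : 'rV[R]_d) : R :=
  (d%:R + nu) / 2 * ln (1 + sqnorm2 x).

End euclidean.

Section processes.
Context {R : realType} {d : nat} {dO : measure_display}
  {Omega : measurableType dO} (P : probability Omega R).

(* Mutual independence of a sequence of random vectors. Taking A i := setT for
   some indices gives the product rule for every finite subfamily. *)
Definition independent_seq (Y : nat -> Omega -> 'rV[R]_d) : Prop :=
  forall (n : nat) (A : nat -> set 'rV[R]_d), (forall i, measurable (A i)) ->
    P (\bigcap_(i < n) (Y i @^-1` A i)) =
    (\prod_(i < n) P (Y i @^-1` A i))%E.

(* The sigma-algebra of the random vector Z is independent of that of the
   process (Y t)_(t >= 0). *)
Definition independent_process (Z : Omega -> 'rV[R]_d)
    (Y : R -> Omega -> 'rV[R]_d) : Prop :=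
  forall (n : nat) (t : nat -> R) (B : set 'rV[R]_d) (A : nat -> set 'rV[R]_d),
    (forall i, 0 <= t i) -> measurable B -> (forall i, measurable (A i)) ->
    P (Z @^-1` B `&` \bigcap_(i < n) (Y (t i) @^-1` A i)) =
    (P (Z @^-1` B) * P (\bigcap_(i < n) (Y (t i) @^-1` A i)))%E.

(* Y has law N(0, s^2 I_d); the second parameter of normal_prob is the standard
   deviation. *)
Definition gaussian_vector (s : R) (Y : Omega -> 'rV[R]_d) : Prop :=
  forall A : 'I_d -> set R, (forall i, measurable (A i)) ->
    P [set w | forall i, A i (Y w ord0 i)] =
    (\prod_(i < d) normal_prob 0 s (A i))%E.

Definition brownian_motion (B : R -> {RV P >-> 'rV[R]_d}) : Prop :=
  [/\ {ae P, forall w, B 0 w = 0},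
      {ae P, forall w, {within [set t | 0 <= t], continuous (B ^~ w)}},
      (forall s t, 0 <= s -> s < t ->
         gaussian_vector (Num.sqrt (t - s)) (fun w => B t w - B s w)) &
      (forall t : nat -> R, 0 <= t 0 -> (forall k, t k <= t k.+1) ->
         independent_seq (fun k w => B (t k.+1) w - B (t k) w))].

(* dX_t = - grad V (X_t) dt + sqrt 2 dB_t, X_0 independent of B. The noise is
   additive, so the equation is its pathwise integral form. *)
Definition langevin_diffusion (V : 'rV[R]_d -> R)
    (X B : R -> {RV P >-> 'rV[R]_d}) : Prop :=
  [/\ brownian_motion B,
      independent_process (X 0) B,
      {ae P, forall w, {within [set t | 0 <= t], continuous (X ^~ w)}} &
      {ae P, forall w, forall t, 0 <= t -> forall i : 'I_d,
         X t w ord0 i = X 0 w ord0 i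
           - (\int[@lebesgue_measure R]_(s in `[0, t]) grad V (X s w) ord0 i)
           + Num.sqrt 2 * B t w ord0 i}].

Definition langevin_monte_carlo (V : 'rV[R]_d -> R) (h : R)
    (x xi : nat -> {RV P >-> 'rV[R]_d}) : Prop :=
  [/\ (forall k, gaussian_vector 1 (xi k)),
      independent_seq (fun k => if k is k'.+1 then xi k' else x 0) &
      (forall k w, x k.+1 w =
         x k w - h *: grad V (x k w) + Num.sqrt (2 * h) *: xi k w)].

End processes.

Section complexity.
Context {R : realType} {d : nat}.
Local Notation divergence :=
  (probability 'rV[R]_d R -> probability 'rV[R]_d R -> \bar R).
Implicit Types (V : 'rV[R]_d -> R) (pi : probability 'rV[R]_d R).

(* The initial law rho_0 ranges over the laws of X 0, for all Langevin
   diffusions X on all probability spaces. *)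
Definition ld_times (D D' : divergence) V pi (Delta0 eps : R) : set R :=
  [set T : R | 0 <= T /\
    forall (dO : measure_display) (Omega : measurableType dO)
      (P : probability Omega R) (X B : R -> {RV P >-> 'rV[R]_d}),
      langevin_diffusion V X B ->
      (D' (distribution P (X 0%R)) pi <= Delta0%:E)%E ->
      (D (distribution P (X T)) pi <= eps%:E)%E].

Definition lmc_steps (D D' : divergence) V pi (h Delta0 eps : R) : set nat :=
  [set k |
    forall (dO : measure_display) (Omega : measurableType dO)
      (P : probability Omega R) (x xi : nat -> {RV P >-> 'rV[R]_d}),
      langevin_monte_carlo V h x xi ->
      (D' (distribution P (x 0%N)) pi <= Delta0%:E)%E ->
      (D (distribution P (x k)) pi <= eps%:E)%E].

Definition smallest disp (S : porderType disp) (A : set S) (a : S) : Prop :=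
  A a /\ lbound A a.

Definition is_complexity_LD (D D' : divergence) V pi
    (Delta0 eps T : R) : Prop :=
  smallest (ld_times D D' V pi Delta0 eps) T.

Definition is_complexity_LMC (D D' : divergence) V pi (h Delta0 eps : R)
    (k : nat) : Prop :=
  smallest (lmc_steps D D' V pi h Delta0 eps) k.

End complexity.

(* Main.v *)
(* Upper bound. pi is a Gaussian mixture over the logarithm w of its scale, so a weighted Hardy
   inequality in w together with the Gaussian Poincare inequality gives the weak Poincare inequality
   Var_pi f <= K S^-nu + K S^2 int |grad f|^2 dpi for bounded f and every S. One LMC step P satisfies
   pi P <= (1 + K h^(3/2)) pi by approximate detailed balance, and P g is regular enough for the
   inequality to make Var_pi (P^k g) decrease down to S^-nu within a time of order S^2; as
   mu_0 <= e^Delta_0 pi, duality then gives R_q <= 1. The diffusion is the almost sure limit of its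
   Euler schemes, which are LMC runs, and {R_q <= 1} is closed under such limits.
   Lower bound. Start from N(0, S^2 I) with S as large as R_oo <= Delta_0 allows. The second moment
   of a coordinate loses at most 2 h (d + nu) per step while the fourth moment stays of order S^4,
   so (Paley-Zygmund) the law is still spread at scale S at time of order S^2 / (d + nu), where pi
   has too little mass for R_q <= 1.
   That a Langevin diffusion exists for this initial law needs a Brownian motion: it is built on
   [0, 1] by dyadic refinement of Gaussian increments, and Picard iteration then solves the equation
   path by path. *)
From HB Require Import structures.
Require Import Defs.
From mathcomp Require Import all_boot all_order all_algebra.
From mathcomp Require Import all_classical all_reals all_analysis.
From mathcomp Require Import measurable_realfun ess_sup_inf ring lra.
Set Implicit Arguments.
Unset Strict Implicit.
Unset Printing Implicit Defensive.
Import Order.TTheory GRing.Theory Num.Theory.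
Import numFieldNormedType.Exports.
Local Open Scope classical_set_scope.
Local Open Scope ring_scope.

(** Everything is proved for the discrete chain, whose kernel has an explicit Gaussian density; no
    semigroup or Fokker-Planck theory is used. The upper bound closes because a step from two points
    gives two shifted Gaussians: Cauchy-Schwarz against their chi-squared divergence bounds the
    slope of P g by the local standard deviation of g. The energy in the weak Poincare inequality
    for P g is then the variance lost in the step, and the inequality becomes a recursion valid for
    every bounded measurable g. Two obstacles shape the rest. The potential is not convex, so the
    drift need not contract; an inversion identity shows that it expands very little. The chain does
    not preserve pi; the defect h^(3/2) per step adds up to h^(1/2) over a fixed time, so h is taken
    small after everything else. Applied to indicators, this gives mu_k(A) <= a pi(A) + b, and a
    divergence bound is recovered from it. Spare powers of d + nu and logarithms go into the
    constant of the exponent, which the lower bound on Delta_0 allows. For the lower bounds, LMC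
    runs are Euler schemes of one constructed diffusion. *)

Notation mcoord_rV := measurable_coord_rV (only parsing).
Notation mcons_rV := measurable_cons_rV (only parsing).
Notation cont_mfun := continuous_measurable_fun (only parsing).
Notation mcompT := measurableT_comp (only parsing).
Notation mEFinP := measurable_EFinP (only parsing).
Notation mfM := measurable_funM (only parsing).
Notation mfD := measurable_funD (only parsing).
Notation mfB := measurable_funB (only parsing).
Notation mfX := measurable_funX (only parsing).
Notation mfTS := measurable_funTS (only parsing).
Notation emfunM := emeasurable_funM (only parsing).
Notation mfun_pair := measurable_fun_pair (only parsing).
Notation mfunPT := measurable_funPT (only parsing).
Notation mindic := measurable_indic (only parsing).
Notation mfubini_F := measurable_fun_fubini_tonelli_F (only parsing).
Notation mfst := measurable_fst (only parsing).
Notation msnd := measurable_snd (only parsing).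
Notation mitv := measurable_itv (only parsing).
Notation mcst := measurable_cst (only parsing).
Notation mfunT := (measurable_fun setT) (only parsing).

Lemma eq_ler d (T : porderType d) (x y : T) : x = y -> (x <= y)%O.
Proof. by move=> ->. Qed.

(** A hook for [mes], a depth-bounded search for measurability; it is re-bound as closure properties
    of new functions become available. [pos] below is the analogue for signs. *)
Ltac mes_step k := fail.
Ltac mes_upto n := lazymatch n with | O => fail | S ?m => intros; first [ done
  | exact: mcst | exact: measurable_id | exact: mfst | exact: msnd
  | exact: mfunPT | exact: mitv | exact: measurableT | apply/mEFinP; mes_upto m | match goal with
   | H : measurable_fun _ _ |- _ => first [exact: H | apply: (mcompT H); mes_upto m]
   | H : forall _, measurable_fun _ _ |- _ => first [exact: H | apply: (mcompT (H _)); mes_upto m]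
   end | apply: mfM; mes_upto m | apply: mfD; mes_upto m | apply: mfB; mes_upto m
  | apply: mfX; mes_upto m | apply: emfunM; mes_upto m | apply: emeasurable_funD; mes_upto m
  | apply: mfun_pair; mes_upto m | mes_step ltac:(fun _ => mes_upto m) | exact: mcoord_rV
  | apply: (mcompT (@measurable_expR _)); mes_upto m | apply: (mcompT (mcoord_rV _)); mes_upto m
  | apply: mindic; mes_upto m | apply: (mcompT (mindic _)); mes_upto m
  | lazymatch goal with |- mfunT _ => fail | |- _ => apply: mfTS; mes_upto m end
  | apply: (mcompT mfst); mes_upto m | apply: (mcompT msnd); mes_upto m ] end.
Ltac mes := mes_upto 8%N.

Ltac pos_step k := fail.
Ltac pos_upto n := lazymatch n with | O => fail | S ?m => intros; first [ done
  | exact: expR_ge0 | exact: expR_gt0 | exact: sqr_ge0 | exact: powR_ge0 | exact: sqrtr_ge0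
  | exact: ltW | match goal with | H : forall _, is_true (0 <= _)%R |- _ => exact: H
   | H : forall _, is_true (0 <= _)%E |- _ => exact: H
   | H : forall _, is_true (_ <= _ <= _)%R |- _ => by case/andP: (H _) end | solve [lra]
  | rewrite lee_fin; pos_upto m | rewrite lte_fin; pos_upto m | apply: mulr_ge0; pos_upto m
  | apply: mulr_gt0; pos_upto m | apply: divr_ge0; pos_upto m | apply: divr_gt0; pos_upto m
  | apply: addr_ge0; pos_upto m | rewrite invr_ge0; pos_upto m | rewrite invr_gt0; pos_upto m
  | apply: exprn_ge0; pos_upto m | apply: exprn_gt0; pos_upto m | apply: mule_ge0; pos_upto m
  | apply: adde_ge0; pos_upto m | apply: integral_ge0; pos_upto m | apply: prodr_ge0; pos_upto m
  | apply: sumr_ge0; pos_upto m | pos_step ltac:(fun _ => pos_upto m) | apply: ltW; pos_upto m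
  | rewrite gt_eqF//; pos_upto m | rewrite sqrtr_gt0; pos_upto m ] end.
Ltac pos := pos_upto 6%N.

(** * Integration against a density, and the Cauchy-Schwarz inequality *)

Section measure_tools.
Context d (T : measurableType d) (R : realType).
Local Open Scope ereal_scope.

Import HBNNSimple.

(** The hypothesis on sets is the identity for indicators; it extends to simple functions by
    linearity, and both sides pass to increasing limits. *)
Lemma ge0_integral_density (m mu : {measure set T -> \bar R}) (p : T -> R) :
 measurable_fun [set: T] p -> (forall x, (0 <= p x)%R) ->
 (forall A, measurable A -> m A = \int[mu]_(x in A) (p x)%:E) ->
 forall f : T -> \bar R, measurable_fun [set: T] f -> (forall x, 0 <= f x) ->
 \int[m]_x f x = \int[mu]_x (f x * (p x)%:E).
Proof.
move=> mp p0 mE f mf f0.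
pose h := nnsfun_approx measurableT mf.
have mh n : mfunT (EFin \o h n) by mes.
have ndh x : {homo (fun n => (h n x)%:E) : a b / (a <= b)%N >-> a <= b}.
 by move=> a b ab; rewrite lee_fin; exact/lefP/nd_nnsfun_approx.
have -> : \int[m]_x f x = lim (\int[m]_x (EFin \o h n) x @[n --> \oo]).
 under eq_integral do rewrite -(cvg_lim _ (cvg_nnsfun_approx measurableT mf (fun x _ => f0 x) I))//.
 apply: monotone_convergence => //; first by move=> n x _; rewrite lee_fin.
have -> : \int[mu]_x (f x * (p x)%:E) = lim (\int[mu]_x ((h n x)%:E * (p x)%:E) @[n --> \oo]).
 transitivity (\int[mu]_x lim ((h n x)%:E * (p x)%:E @[n --> \oo])).
  apply: eq_integral => x _; apply/esym/cvg_lim => //; apply: cvgeZr => //.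
  exact: cvg_nnsfun_approx. apply: monotone_convergence => //.
 - by move=> n; apply: emfunM => //; exact/mEFinP.
 - by move=> n x _; rewrite -EFinM lee_fin mulr_ge0.
 - by move=> x _ a b ab; rewrite lee_wpmul2r ?lee_fin//; exact: ndh.
congr (limn _); apply/funext => n.
transitivity (\int[m]_x (\sum_(y \in range (h n)) (y * \1_(h n @^-1` [set y]) x)%:E)).
 by apply: eq_integral => t tE; rewrite /= fimfunE -fsumEFin.
rewrite ge0_integral_fsum//; last 2 first.
- by move=> r; apply/mEFinP; exact: mfM.
- by move=> m0 y Ey; exact: nnfun_muleindic_ge0.
transitivity (\int[mu]_x (\sum_(y \in range (h n))
  (y * \1_(h n @^-1` [set y]) x)%:E * (p x)%:E)); last first. apply: eq_integral => x xE.
 rewrite -ge0_mule_fsuml => [|y]; last exact: nnfun_muleindic_ge0.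
 by rewrite fsumEFin// -(fimfunE _ x).
rewrite ge0_integral_fsum//; last 2 first.
- move=> y; apply: emfunM; apply/mEFinP => //. exact: mfM.
- move=> m0 y Ey; apply: mule_ge0; last pos. exact: nnfun_muleindic_ge0.
apply: eq_fsbigr => r rhn.
under eq_integral do rewrite EFinM.
rewrite integralZl_indic_nnsfun//.
under [RHS]eq_integral do rewrite EFinM -muleA.
rewrite ge0_integralZl//; last 3 first.
- apply: emfunM; apply/mEFinP => //.
- by move=> t Et; rewrite mule_ge0 ?lee_fin.
- by move: rhn; rewrite inE => -[t _ <-]; rewrite lee_fin.
rewrite integral_indic// setIT mE//; congr (_ * _).
rewrite integral_mkcond; apply: eq_integral => x _.
by rewrite epatch_indic muleC.
Qed.

Lemma bounded_integrable (P : {finite_measure set T -> \bar R}) (f : T -> R) (M : R) :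
 mfunT f -> (forall x, (`|f x| <= M)%R) -> P.-integrable setT (EFin \o f).
Proof.
move=> mf fM; apply: measurable_bounded_integrable => //.
 by rewrite -ge0_fin_numE ?measure_ge0// fin_num_measure.
exists M; split; first by rewrite num_real.
by move=> N MN x _; exact: (le_trans (fM x) (ltW MN)).
Qed.

(** Hoelder with exponents 2 and 2, squared so that no root of an extended real appears. *)
Lemma cauchy_schwarz_integral (mu : {measure set T -> \bar R}) (f g : T -> R) :
 mfunT f -> mfunT g -> (\int[mu]_x (`|f x * g x|)%:E) ^+ 2 <=
 (\int[mu]_x (f x ^+ 2)%:E) * \int[mu]_x (g x ^+ 2)%:E.
Proof.
move=> mf mg.
have h := @hoelder _ T R mu f g 2 2 mf mg.
have {}h : 'N[mu]_1[EFin \o (f \* g)%R] <= 'N[mu]_2%:E[EFin \o f] * 'N[mu]_2%:E[EFin \o g].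
 by apply: h => //; rewrite [X in _ = X](splitr 1%R) !mul1r.
rewrite Lnorm1 in h.
have -> : \int[mu]_x (`|f x * g x|)%:E = \int[mu]_x `|(EFin \o (f \* g)%R) x|.
 by apply: eq_integral.
have N2 (k : T -> R) : ('N[mu]_2%:E[EFin \o k]) ^+ 2 = \int[mu]_x (k x ^+ 2)%:E.
 have -> : ('N[mu]_2%:E[EFin \o k]) ^+ 2 = 'N[mu]_2%:E[EFin \o k] `^ 2.
  have := Lnorm_ge0 mu 2%:E (EFin \o k); case: (Lnorm _ _ _) => [r| |]//=.
  - by rewrite lee_fin => r0; rewrite -EFinM -expr2 powR_mulrn.
  - by move=> _; rewrite mulyy ifF// pnatr_eq0.
 rewrite poweR_Lnorm//; apply: eq_integral => x _ /=. by rewrite powR_mulrn// real_normK ?num_real.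
rewrite -!N2.
set a := (\int[mu]_x _) in h *; set b := Lnorm _ _ _ in h *; set c := Lnorm _ _ _ in h *.
have -> : b ^+ 2 * c ^+ 2 = (b * c) * (b * c) by rewrite muleACA.
by apply: lee_pmul => //; apply: integral_ge0.
Qed.

End measure_tools.

(** * Independence, from generators to sigma-algebras *)

Section independence_tools.
Context d (T : measurableType d) (R : realType) (P : probability T R).
Local Open Scope ereal_scope.

(** For fixed [E] both sides are finite measures in [A]; they agree on the pi-system [G], hence on
    the sigma-algebra that it generates. *)
Lemma indep_g_sigma1 (E : set T) (G : set (set T)) :
 measurable E -> setI_closed G -> G setT -> G `<=` measurable ->
 (forall A, G A -> P (E `&` A) = P E * P A) -> forall A, <<s G >> A -> P (E `&` A) = P E * P A.
Proof.
move=> mE GI GT Gm GE A GA.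
pose k : {nonneg R} := NngNum (fine_ge0 (measure_ge0 P E)).
have := @g_sigma_algebra_measure_unique _ R T G Gm (fun=> setT) (fun=> GT) _
 (mrestr P mE) (mscale k P) GI _ _ A GA.
rewrite /mrestr /= /mscale /= fineK ?fin_num_measure// setIC; apply.
- by apply/seteqP; split => // x _; exists 0%N.
- by move=> B GB; rewrite /mrestr setIC GE// fineK ?fin_num_measure.
- move=> n; rewrite /mrestr setTI. by rewrite -ge0_fin_numE ?measure_ge0// fin_num_measure.
Qed.

Lemma indep_g_sigma (N : nat) (G : nat -> set (set T)) :
 (forall i, setI_closed (G i)) -> (forall i, G i setT) -> (forall i, G i `<=` measurable) ->
 (forall A : nat -> set T, (forall i, G i (A i)) ->
  P (\bigcap_(i < N) A i) = \prod_(i < N) P (A i)) ->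
 forall A : nat -> set T, (forall i, <<s G i >> (A i)) ->
  P (\bigcap_(i < N) A i) = \prod_(i < N) P (A i).
Proof.
move=> GI GT Gm GP.
have sm i : <<s G i >> `<=` measurable.
 by apply: smallest_sub => //; exact: sigma_algebra_measurable.
(* The families are upgraded one at a time: the first [m] sets are in the generated sigma-algebras,
   the others still in the generators. *)
suff H m : (m <= N)%N -> forall A : nat -> set T,
  (forall i, (i < m)%N -> <<s G i >> (A i)) -> (forall i, (m <= i)%N -> G i (A i)) ->
  P (\bigcap_(i < N) A i) = \prod_(i < N) P (A i).
 move=> A sA; pose A' i := if (i < N)%N then A i else setT.
 have E1 : \bigcap_(i < N) A i = \bigcap_(i < N) A' i.
  by apply: eq_bigcapr => i /= iN; rewrite /A' iN. rewrite E1 (H N)//.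
 - by apply: eq_bigr => i _; rewrite /A' ltn_ord.
 - by move=> i iN; rewrite /A' iN.
 - by move=> i; rewrite leqNgt /A' => /negbTE ->.
elim: m => [_ A _ A0|m IH mN A A1 A2]; first by apply: GP => i; exact: A0.
pose up B i := if i == m then B else A i.
pose E := \bigcap_(i in [set i | (i < N)%N /\ i != m]) A i.
have mA i : measurable (A i).
 have [im|im] := ltnP i m.+1; [exact: (sm _ _ (A1 _ im))|exact: (Gm _ _ (A2 _ im))].
have mE : measurable E. apply: fin_bigcap_measurable => //.
 by apply: (@sub_finite_set _ _ `I_N) => // i [].
have upE B : \bigcap_(i < N) up B i = E `&` B. apply/seteqP; split => [x h|x [h1 h2] i iN].
  split; last by have := h m mN; rewrite /up eqxx.
  by move=> i [iN im]; have := h i iN; rewrite /up (negbTE im).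
 by rewrite /up; case: ifPn => // im; exact: h1.
have prE B : \prod_(i < N) P (up B i) = P B * \prod_(i < N | i != Ordinal mN) P (A i).
 rewrite (bigD1 (Ordinal mN))//= {1}/up eqxx; congr (_ * _).
 by apply: eq_bigr => i im; rewrite /up ifN.
have key B : G m B -> P (E `&` B) = P B * \prod_(i < N | i != Ordinal mN) P (A i).
 move=> GB; rewrite -upE -prE; apply: IH; first exact: ltnW.
  by move=> i im; rewrite /up ltn_eqF//; apply: A1; exact: ltnW.
 move=> i; rewrite leq_eqVlt /up => /predU1P[<-|mi]; first by rewrite eqxx.
 by rewrite gtn_eqF//; exact: A2.
have PE : P E = \prod_(i < N | i != Ordinal mN) P (A i).
 by rewrite -[E]setIT key// probability_setT mul1e.
have -> : \bigcap_(i < N) A i = E `&` A m. rewrite -upE; apply: eq_bigcapr => i _; rewrite /up.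
 by case: eqP => [->|].
have key2 B : G m B -> P (E `&` B) = P E * P B by move=> GB; rewrite key// PE muleC.
rewrite (indep_g_sigma1 mE (GI m) (GT m) (Gm m) key2 (A1 m (ltnSn m))) PE.
by rewrite [RHS](bigD1 (Ordinal mN))//= muleC.
Qed.

End independence_tools.

(** * Finite measures on R^d are determined by orthants and by boxes *)

Section rV_uniqueness.
Context (R : realType) (d : nat).
Local Open Scope ereal_scope.

Definition orthant (a : 'I_d -> R) : set 'rV[R]_d := [set v | forall i, (a i < v ord0 i)%R].

Lemma measurable_box (A : 'I_d -> set R) : (forall i, measurable (A i)) ->
 measurable [set v : 'rV[R]_d | forall i, A i (v ord0 i)].
Proof.
move=> mA; rewrite (_ : mkset _ = \bigcap_(i in [set: 'I_d])
  (fun v : 'rV[R]_d => v ord0 i) @^-1` A i).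
 apply: fin_bigcap_measurable => // i _; rewrite -[X in measurable X]setTI. mes.
by apply/seteqP; split=> [v Av i _|v Av i]; exact: Av.
Qed.

Lemma measurable_orthant a : measurable (orthant a).
Proof.
have -> : orthant a = [set v | forall i, `]a i, +oo[%classic (v ord0 i)].
 by apply/seteqP; split => v /= h i; have := h i; rewrite /= in_itv/= andbT.
exact: (@measurable_box (fun i => `]a i, +oo[%classic) (fun=> mitv _)).
Qed.

Lemma measurable_orthantE : (@measurable _ 'rV[R]_d) = <<s range orthant >>.
Proof.
apply/seteqP; split; last first. apply: smallest_sub; first exact: sigma_algebra_measurable.
 by move=> _ [a _ <-]; exact: measurable_orthant.
apply: smallest_sub; first mes.
rewrite -bigcup_seq => B [i _] [C mC <-]; rewrite setTI.
have {}mC : <<s @RGenOInfty.G R >> C by rewrite -[<<s _ >>]RGenOInfty.measurableE.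
pose S := [set D | <<s range orthant >> ((fun v : 'rV[R]_d => v ord0 i) @^-1` D)].
suff : <<s @RGenOInfty.G R >> `<=` S by exact.
apply: smallest_sub. split; rewrite /S /=.
 - by rewrite preimage_set0; exact: sigma_algebra0.
 - by move=> D /= hD; rewrite setTD preimage_setC; exact: sigma_algebraC.
 - by move=> F hF; rewrite /= preimage_bigcup; exact: sigma_algebra_bigcup.
move=> _ [x ->]; rewrite /S /=.
(* A half-space is a countable union of orthants: the bounds on the other coordinates go to minus
   infinity. *)
have -> : (fun v : 'rV[R]_d => v ord0 i) @^-1` `]x, +oo[%classic =
 \bigcup_k orthant (fun j => if j == i then x else - k%:R)%R.
 apply/seteqP; split => v /=; rewrite in_itv/= andbT.
  move=> xv; pose m := (\sum_(j < d) `|v ord0 j|)%R.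
  exists (Num.trunc m).+1 => // j; case: eqP => [->//|_].
  rewrite ltrNl; apply: (@le_lt_trans _ _ m); last first.
   by rewrite -natr1 -ltrBlDr; have := truncnS_gt m; rewrite -natr1 ltrBlDr.
  rewrite (le_trans (ler_norm _))// normrN /m (bigD1 j)//= lerDl. pos.
 by move=> [k _] /(_ i); rewrite eqxx.
by apply: sigma_algebra_bigcup => k; apply: sub_sigma_algebra; eexists.
Qed.

Lemma setI_closed_orthant : setI_closed (range orthant).
Proof.
move=> _ _ [a _ <-] [b _ <-]; exists (fun i => Num.max (a i) (b i)) => //.
apply/seteqP; split => v /=. by move=> h; split => i; have := h i; rewrite gt_max => /andP[].
by move=> [h1 h2] i; rewrite gt_max h1 h2.
Qed.

Lemma bigcup_orthant : \bigcup_k orthant (fun=> - k%:R)%R = setT.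
Proof.
apply/seteqP; split => // v _; pose m := (\sum_(j < d) `|v ord0 j|)%R.
exists (Num.trunc m).+1 => // j.
rewrite ltrNl; apply: (@le_lt_trans _ _ m); last exact: truncnS_gt.
rewrite (le_trans (ler_norm _))// normrN /m (bigD1 j)//= lerDl.
pos.
Qed.

Lemma rV_measure_unique (m1 m2 : {measure set 'rV[R]_d -> \bar R}) :
 m1 setT < +oo -> (forall a, m1 (orthant a) = m2 (orthant a)) ->
 forall A, measurable A -> m1 A = m2 A.
Proof.
move=> m1oo m12; apply: (@measure_unique _ _ _ (range orthant) (fun k => orthant (fun=> - k%:R)%R)).
- exact: measurable_orthantE.
- exact: setI_closed_orthant.
- by move=> k; eexists.
- exact: bigcup_orthant.
- by move=> _ [a _ <-].
- move=> k; apply: le_lt_trans m1oo; apply: le_measure => //; rewrite inE//.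
 exact: measurable_orthant.
Qed.

Lemma rV_measure_unique_box (m1 m2 : {measure set 'rV[R]_d -> \bar R}) :
 m1 setT < +oo -> (forall A : 'I_d -> set R, (forall i, measurable (A i)) ->
  m1 [set v | forall i, A i (v ord0 i)] = m2 [set v | forall i, A i (v ord0 i)]) ->
 forall A, measurable A -> m1 A = m2 A.
Proof.
move=> m1oo m12; apply: rV_measure_unique => // a.
have -> : orthant a = [set v | forall i, `]a i, +oo[%classic (v ord0 i)].
 by apply/seteqP; split => v /= h i; have := h i; rewrite /= in_itv/= andbT.
exact: (m12 (fun i => `]a i, +oo[%classic) (fun=> mitv _)).
Qed.

End rV_uniqueness.

(** * Product probabilities and the standard Gaussian law on R^d *)

Section prob_product.
Context d1 d2 (T1 : measurableType d1) (T2 : measurableType d2) (R : realType)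
 (P1 : probability T1 R) (P2 : probability T2 R).
Local Open Scope ereal_scope.

Definition prod_prob : set (T1 * T2) -> \bar R := P1 \x P2.

HB.instance Definition _ := Measure.on prod_prob.

Let prod_prob_setT : prod_prob setT = 1.
Proof.
transitivity (P1 setT * P2 setT); last by rewrite !probability_setT mule1.
by rewrite -product_measure1E// setXTT.
Qed.

HB.instance Definition _ := Measure_isProbability.Build _ _ _ prod_prob prod_prob_setT.

Lemma prod_probE A B : measurable A -> measurable B -> prod_prob (A `*` B) = P1 A * P2 B.
Proof. exact: product_measure1E. Qed.

Lemma ge0_integral_prod_prob (f : T1 * T2 -> \bar R) :
 measurable_fun [set: T1 * T2] f -> (forall x, 0 <= f x) ->
 \int[prod_prob]_x f x = \int[P1]_x \int[P2]_y f (x, y).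
Proof. by move=> mf f0; rewrite fubini_tonelli1. Qed.

Lemma ge0_integral_prod_probC (f : T1 * T2 -> \bar R) :
 measurable_fun [set: T1 * T2] f -> (forall x, 0 <= f x) ->
 \int[prod_prob]_x f x = \int[P2]_y \int[P1]_x f (x, y).
Proof. by move=> mf f0; rewrite ge0_integral_prod_prob// fubini_tonelli. Qed.

End prob_product.

Section gauss.
Context (R : realType).
Local Open Scope ereal_scope.

HB.instance Definition _ d := isMeasurableFun.Build _ _ _ _ (@cons_rV R d) (@mcons_rV R d).

Definition cons_mfun d : {mfun (R * 'rV[R]_d)%type >-> 'rV[R]_d.+1} := @cons_rV R d.

(** Lebesgue measure over the default measurable structure of [R], so that it can be a factor in
    products with ['rV[R]_d]; [normalm] does the same for the normal law. *)
Definition lebR : set R -> \bar R := lebesgue_measure.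

HB.instance Definition _ := @isMeasure.Build _ R R lebR
 (measure0 (@lebesgue_measure R)) (measure_ge0 (@lebesgue_measure R))
 (@measure_semi_sigma_additive _ _ _ (@lebesgue_measure R)).

HB.instance Definition _ := @Measure_isSigmaFinite.Build _ R R lebR
 (sigma_finiteT (@lebesgue_measure R)).

Lemma ge0_integral_lebR (D : set R) (f : R -> \bar R) :
 measurable D -> measurable_fun D f -> (forall x, D x -> 0 <= f x) ->
 \int[lebR]_(x in D) f x = \int[@lebesgue_measure R]_(x in D) f x.
Proof.
move=> mD mf f0.
have mid : @measurable_fun _ _ (measurableTypeR R) R setT (fun x => x). mes.
have := @ge0_integral_pushforward _ _ (measurableTypeR R) R R (fun x => x) mid
 (@lebesgue_measure R) D f mD mf (fun x Dx => f0 x (set_mem Dx)).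
rewrite preimage_id => <-.
exact: (@eq_measure_integral _ _ R D (pushforward (@lebesgue_measure R) (fun x : measurableTypeR R => (x : R))) lebR).
Qed.

Definition normalm (m s : R) : set R -> \bar R := normal_prob m s.

Section normalm_instances.
Variables m s : R.

HB.instance Definition _ := @isMeasure.Build _ R R (normalm m s)
 (measure0 (normal_prob m s)) (measure_ge0 (normal_prob m s))
 (@measure_semi_sigma_additive _ _ _ (normal_prob m s)).

HB.instance Definition _ := @Measure_isProbability.Build _ R R (normalm m s)
 (probability_setT (normal_prob m s)).

End normalm_instances.

Definition stdnormal : set R -> \bar R := normalm 0 1.

HB.instance Definition _ := Probability.on stdnormal.

(** The recursion mirrors that of [lebesgue_rV], so that Gaussian and Lebesgue integrals can be
    compared one coordinate at a time. *)
Fixpoint gauss (d : nat) : probability 'rV[R]_d R := match d with | 0 => \d_(0%R : 'rV[R]_0)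
 | d'.+1 => distribution (prod_prob stdnormal (gauss d')) (cons_mfun d') end.

Lemma ge0_integral_gaussS d (f : 'rV[R]_d.+1 -> \bar R) :
 measurable_fun [set: 'rV[R]_d.+1] f -> (forall x, 0 <= f x) -> \int[gauss d.+1]_x f x =
 \int[stdnormal]_t \int[gauss d]_v f (cons_rV (t, v)).
Proof.
move=> mf f0 /=; rewrite ge0_integral_pushforward//.
rewrite preimage_setT ge0_integral_prod_prob//=.
mes.
Qed.

Lemma ge0_integral_lebesgueS d (f : 'rV[R]_d.+1 -> \bar R) :
 measurable_fun [set: 'rV[R]_d.+1] f -> (forall x, 0 <= f x) -> \int[lebesgue_rV R d.+1]_x f x =
 \int[lebR]_t \int[lebesgue_rV R d]_v f (cons_rV (t, v)).
Proof.
move=> mf f0 /=.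
transitivity (\int[(lebR \x lebesgue_rV R d)]_x (f \o @cons_rV R d) x).
 have h1 := @ge0_integral_pushforward _ _ (R * 'rV[R]_d)%type _ R
  (@cons_rV R d) (@mcons_rV R d) (lebR \x lebesgue_rV R d).
 have h2 := h1 setT f measurableT mf (fun x _ => f0 x). rewrite preimage_setT in h2; rewrite -h2.
 apply: (@eq_measure_integral _ _ R setT (pushforward (lebR \x lebesgue_rV R d) (@cons_rV R d)) (lebesgue_rVS (lebesgue_rV R d))) => A mA _.
 have mX : measurable (@cons_rV R d @^-1` A). by rewrite -[X in measurable X]setTI; exact: mcons_rV.
 pose g x := lebesgue_rV R d (xsection (@cons_rV R d @^-1` A) x).
 change (\int[@lebesgue_measure R]_x g x = \int[lebR]_x g x).
 by rewrite ge0_integral_lebR//; exact: measurable_fun_xsection.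
rewrite fubini_tonelli1//.
- mes.
- by move=> x; exact: f0.
Qed.

Lemma gauss_box d (A : 'I_d -> set R) : (forall i, measurable (A i)) ->
 gauss d [set v | forall i, A i (v ord0 i)] = \prod_(i < d) stdnormal (A i).
Proof.
elim: d A => [A _|d IHd A mA]. by rewrite big_ord0 /= diracE mem_set// => -[].
rewrite big_ord_recl -(IHd (fun i => A (lift ord0 i)))//= -prod_probE//; last first.
 exact: (@measurable_box R d (fun i => A (lift ord0 i))).
rewrite /distribution /pushforward; congr prod_prob.
apply/seteqP; split=> -[t v] /=.
 move=> Av; split=> //=; first by have := Av ord0; rewrite mxE unlift_none.
 by move=> i; have := Av (lift ord0 i); rewrite mxE liftK.
move=> [A0 AS] i; rewrite mxE.
by case: (unliftP ord0 i) => [j ->|->//]; exact: AS.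
Qed.

End gauss.
Arguments stdnormal R : clear implicits.
Arguments lebR R : clear implicits.

(** * Gaussian densities and affine images of Gaussians *)

Section tools.
Context (R : realType).
Local Open Scope ereal_scope.

Lemma R_measure_unique (m1 m2 : {measure set R -> \bar R}) :
 m1 setT < +oo -> (forall a, m1 `]a, +oo[%classic = m2 `]a, +oo[%classic) ->
 forall A, measurable A -> m1 A = m2 A.
Proof.
move=> m1oo m12; apply: (@measure_unique _ _ _ (@RGenOInfty.G R)
 (fun k => `](- k%:R)%R, +oo[%classic)).
- exact: RGenOInfty.measurableE.
- move=> _ _ [a ->] [b ->]; exists (Num.max a b).
 by apply/seteqP; split => v /=; rewrite !in_itv/= !andbT gt_max => /andP.
- by move=> k; eexists.
- apply/seteqP; split => // v _; exists (Num.trunc `|v|%R).+1 => //=.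
 rewrite in_itv/= andbT ltrNl; apply: le_lt_trans (truncnS_gt _).
 by rewrite (le_trans (ler_norm _))// normrN.
- by move=> _ [a ->].
- move=> k; apply: le_lt_trans m1oo; apply: le_measure => //; rewrite inE//.
Qed.

(** Both sides are finite measures in [A], so rays suffice; on a ray it is the substitution y = u +
    s z in the integral of the density. *)
Lemma stdnormal_affine (u s : R) (A : set R) : (0 < s)%R -> measurable A ->
 stdnormal R ((fun z => (u + s * z)%R) @^-1` A) = normalm u s A.
Proof.
move=> s0 mA.
have mF : measurable_fun [set: R] (fun z : R => u + s * z)%R. by apply: mfD => //; exact: mfM.
have mp (v t : R) D : measurable_fun D (fun x => (normal_pdf v t x)%:E).
 by apply/mEFinP/mfTS; exact: measurable_normal_pdf.
pose F : {mfun R >-> R} := HB.pack (fun z : R => u + s * z)%R (isMeasurableFun.Build _ _ _ _ _ mF).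
apply: (R_measure_unique (m1 := distribution (stdnormal R) F) (m2 := normalm u s)) => //.
 apply: (@le_lt_trans _ _ 1); last exact: ltry.
 exact: (probability_le1 (distribution (stdnormal R) F) measurableT).
move=> a; rewrite /distribution /pushforward /stdnormal /normalm /normal_prob /=.
pose b := ((a - u) / s)%R.
have aE : a = (u + s * b)%R by rewrite /b mulrC divfK ?gt_eqF// addrC subrK.
have -> : (fun z : R => u + s * z)%R @^-1` `]a, +oo[%classic = `]b, +oo[%classic.
 apply/seteqP; split => x /=; rewrite !in_itv/= !andbT {1}aE ltrD2l ltr_pM2l//.
change (normal_prob 0 1 `]b, +oo[%classic = normal_prob u s `]a, +oo[%classic).
rewrite /normal_prob !integral_itv_obnd_cbnd; last 2 first. mes. mes.
have dF x : is_derive x (1%R : R) (fun z : R => u + s * z)%R s.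
 apply: is_derive_eq; rewrite ?scaler0 ?add0r ?addr0 /GRing.scale/= ?mulr1 ?mulr0 ?add0r ?mul1r//.
have dE : (fun z : R => u + s * z)%R^`()%classic = cst s.
 by apply/funext => x; rewrite derive1E; exact: derive_val.
rewrite [in RHS]aE (@increasing_ge0_integration_by_substitutiony _ (fun z => u + s * z)%R (normal_pdf u s) b).
- apply: eq_integral => x _; congr EFin; rewrite dE.
 transitivity (normal_pdf u s (u + s * x) * s)%R; last by [].
 rewrite !normal_pdfE ?gt_eqF//= /normal_fun /normal_peak !subr0 expr1n mul1r.
 rewrite (_ : u + s * x - u = s * x)%R; last pos.
 rewrite -mulrA [(expR _ * s)%R]mulrC mulrA; congr (_ * expR _)%R.
  rewrite -mulrnAr sqrtrM ?sqr_ge0// sqrtr_sqr gtr0_norm// invfM mulrC mulrA.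
  by rewrite divff ?gt_eqF// mul1r. by field; rewrite gt_eqF.
- by move=> x y _ _ xy; rewrite ltrD2l ltr_pM2l.
- by rewrite dE => x _; exact: cvg_cst.
- by rewrite dE; exact: is_cvg_cst.
- by rewrite dE; exact: is_cvg_cst.
- split; first mes. apply: cvg_at_right_filter; apply: (@cvgD _ R^o); first exact: cvg_cst.
 by apply: (@cvgM _ R); [exact: cvg_cst|exact: cvg_id].
- apply: (@cvg_comp _ _ _ (fun x => s * x)%R (fun y => u + y)%R _ +oo%R); last exact: cvg_addrl.
 by first [apply/gt0_cvgMry => //|apply/gt0_cvgMly => //].
- by apply: continuous_subspaceT => x; apply: continuous_normal_pdf; rewrite gt_eqF.
- by move=> x _; exact: normal_pdf_ge0.
Qed.

Lemma ge0_integral_stdnormal_affine (u s : R) (f : R -> \bar R) : (0 < s)%R ->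
 measurable_fun [set: R] f -> (forall x, 0 <= f x) -> \int[stdnormal R]_z f (u + s * z)%R =
 \int[lebR R]_y (f y * (normal_pdf u s y)%:E).
Proof.
move=> s0 mf f0.
have mF : measurable_fun [set: R] (fun z : R => u + s * z)%R. by apply: mfD => //; exact: mfM.
transitivity (\int[pushforward (stdnormal R) (fun z : R => u + s * z)%R]_y f y).
 by rewrite ge0_integral_pushforward.
have hA A : measurable A -> normalm u s A = \int[lebR R]_(x in A) (normal_pdf u s x)%:E.
 move=> mA; rewrite ge0_integral_lebR//.
 - by apply/mEFinP/mfTS; exact: measurable_normal_pdf.
 - by move=> x _; rewrite lee_fin normal_pdf_ge0.
rewrite -(ge0_integral_density (measurable_normal_pdf u s) (normal_pdf_ge0 u s) hA mf f0).
apply: eq_measure_integral => A mA _; exact: stdnormal_affine.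
Qed.

(** The density of N(u, s^2 I). *)
Definition gpdf d (u : 'rV[R]_d) (s : R) (y : 'rV[R]_d) : R :=
 (\prod_(i < d) normal_pdf (u ord0 i) s (y ord0 i))%R.

Lemma gpdf_ge0 d (u : 'rV[R]_d) s y : (0 <= gpdf u s y)%R.
Proof. by apply: prodr_ge0 => i _; exact: normal_pdf_ge0. Qed.

Lemma mgpdf d (u : 'rV[R]_d) s : mfunT (gpdf u s).
Proof.
apply: measurable_prod => i _.
by apply: mcompT; [exact: measurable_normal_pdf|exact: mcoord_rV].
Qed.

Lemma gpdfE d (u : 'rV[R]_d) s y : s != 0%R ->
 gpdf u s y = (normal_peak s ^+ d * expR (- sqnorm2 (y - u) / (s ^+ 2 *+ 2)))%R.
Proof.
move=> s0; rewrite /gpdf (eq_bigr (fun i => normal_peak s *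
 expR (- (y ord0 i - u ord0 i) ^+ 2 / (s ^+ 2 *+ 2)))%R); last first.
 by move=> i _; rewrite normal_pdfE.
rewrite big_split/= prodr_const card_ord -expR_sum; congr (_ * expR _)%R.
rewrite /sqnorm2 mulNr mulr_suml -sumrN; apply: eq_bigr => i _.
by rewrite !mxE mulNr.
Qed.

Lemma mrVD d dT (T : measurableType dT) (f g : T -> 'rV[R]_d) :
 mfunT f -> mfunT g -> mfunT (fun x => f x + g x)%R.
Proof.
move=> mf mg; apply: measurable_fun_rV => i; under eq_fun do rewrite mxE.
by apply: mfD; apply: (mcompT (mcoord_rV i)).
Qed.

Lemma mrVZ d dT (T : measurableType dT) (a : T -> R) (f : T -> 'rV[R]_d) :
 mfunT a -> mfunT f -> mfunT (fun x => a x *: f x)%R.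
Proof.
move=> ma mf; apply: measurable_fun_rV => i; under eq_fun do rewrite mxE.
by apply: mfM => //; apply: (mcompT (mcoord_rV i)).
Qed.

Lemma measurable_rVN d dT (T : measurableType dT) (f : T -> 'rV[R]_d) :
 mfunT f -> mfunT (fun x => - f x)%R.
Proof.
move=> mf; apply: measurable_fun_rV => i; under eq_fun do rewrite mxE.
by apply: mcompT => //; apply: (mcompT (mcoord_rV i)).
Qed.

Lemma msqnorm2 d dT (T : measurableType dT) (f : T -> 'rV[R]_d) :
 mfunT f -> mfunT (fun x => sqnorm2 (f x)).
Proof.
move=> mf; apply: measurable_sum => i; apply: mfX.
exact: (mcompT (mcoord_rV i)).
Qed.

Definition tail_rV d (u : 'rV[R]_d.+1) : 'rV[R]_d := \row_i u ord0 (lift ord0 i).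

Lemma affine_cons_rV d (u : 'rV[R]_d.+1) s t v :
 (u + s *: cons_rV (t, v) = cons_rV (u ord0 ord0 + s * t, tail_rV u + s *: v))%R.
Proof.
apply/rowP => i; rewrite !mxE; case: (unliftP ord0 i) => [j ->|->]. by rewrite !mxE.
by [].
Qed.

Lemma gpdf_cons_rV d (u : 'rV[R]_d.+1) s t v :
 (gpdf u s (cons_rV (t, v)) = normal_pdf (u ord0 ord0) s t * gpdf (tail_rV u) s v)%R.
Proof.
rewrite /gpdf big_ord_recl mxE unlift_none/=; congr (_ * _)%R.
by apply: eq_bigr => i _; rewrite !mxE liftK.
Qed.

(** The passage between the noise [z] and the position y = u + s z of a step; by Tonelli it reduces
    to one coordinate at a time. *)
Lemma ge0_gauss_affine d (u : 'rV[R]_d) (s : R) (f : 'rV[R]_d -> \bar R) :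
 (0 < s)%R -> measurable_fun [set: 'rV[R]_d] f -> (forall x, 0 <= f x) ->
 \int[gauss R d]_z f (u + s *: z)%R = \int[lebesgue_rV R d]_y (f y * (gpdf u s y)%:E).
Proof.
move=> s0; elim: d u f => [u f mf f0|d IH u f mf f0]. rewrite /= !integral_dirac//; last 2 first.
 - by apply: emfunM => //; apply/mEFinP; exact: mgpdf.
 - apply: mcompT => //; apply: mrVD => //. by apply: mrVZ => //; exact: measurable_id.
 by rewrite !diracE !mem_set// !mul1e /gpdf big_ord0 mule1; congr f; apply/rowP => -[].
have mc t : measurable_fun [set: 'rV[R]_d] (fun v => cons_rV (t, v)).
 exact: (mcompT (@mcons_rV R d) (measurable_pair1 t)).
rewrite ge0_integral_gaussS//; last first. apply: mcompT => //; apply: mrVD => //.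
 by apply: mrVZ => //; exact: measurable_id.
rewrite ge0_integral_lebesgueS//; last 2 first.
- apply: emfunM => //; apply/mEFinP; exact: mgpdf.
- by move=> x; rewrite mule_ge0// lee_fin gpdf_ge0.
pose H (t : R) := \int[lebesgue_rV R d]_w (f (cons_rV (t, w)) * (gpdf (tail_rV u) s w)%:E).
transitivity (\int[stdnormal R]_t H (u ord0 ord0 + s * t)%R).
 apply: eq_integral => t _; under eq_integral do rewrite affine_cons_rV.
 rewrite (IH (tail_rV u) (fun w => f (cons_rV ((u ord0 ord0 + s * t)%R, w))))//. mes.
rewrite ge0_integral_stdnormal_affine//; last 2 first.
- apply: (@mfubini_F _ _ R _ R (lebesgue_rV R d)
  (fun p => f (cons_rV p) * (gpdf (tail_rV u) s p.2)%:E)). apply: emfunM; first mes.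
  apply/mEFinP; apply: mcompT => //; exact: mgpdf. by move=> x; rewrite mule_ge0// lee_fin gpdf_ge0.
- by move=> t; apply: integral_ge0 => w _; rewrite mule_ge0// lee_fin gpdf_ge0.
apply: eq_integral => t _; rewrite /H -ge0_integralZr//.
- apply: eq_integral => w _; rewrite gpdf_cons_rV EFinM -muleA; congr (_ * _). exact: muleC.
- apply: emfunM; first mes. by apply/mEFinP; exact: mgpdf.
- by move=> x _; rewrite mule_ge0// lee_fin gpdf_ge0.
- by rewrite lee_fin normal_pdf_ge0.
Qed.

Lemma integral_gpdf d (u : 'rV[R]_d) s : (0 < s)%R -> \int[lebesgue_rV R d]_y (gpdf u s y)%:E = 1.
Proof.
move=> s0; have := ge0_gauss_affine u s0 (@mcst _ _ _ _ _ 1) (fun=> lee01).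
have -> : \int[gauss R d]_z cst 1 (u + s *: z)%R = 1.
 by rewrite integral_cst//= probability_setT mule1.
move=> ->; by apply: eq_integral => y _; rewrite mul1e.
Qed.

End tools.

Ltac mes_step k ::= first [ apply: mrVD; k tt | apply: mrVZ; k tt | apply: measurable_rVN; k tt
 | apply: msqnorm2; k tt | exact: mgpdf | exact: measurable_normal_pdf ].
Ltac pos_step k ::= first [ exact: gpdf_ge0 | exact: normal_pdf_ge0 | exact: normal_peak_ge0 ].

(** * A weighted Hardy inequality on an interval *)

Section hardy.
Context (R : realType).
Local Open Scope ereal_scope.

Lemma lebR_itvcc (a b : R) : (a <= b)%R -> lebR R `[a, b]%classic = (b - a)%:E.
Proof.
move=> ab; rewrite /lebR lebesgue_measure_itv/= lte_fin.
by move: ab; rewrite le_eqVlt => /predU1P[->|->]; rewrite ?ltxx ?subrr// EFinB.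
Qed.

Lemma integral_derive_lebR (F q : R -> R) (a b : R) : (a <= b)%R ->
 (forall x, x \in `[a, b]%R -> is_derive x (1%R : R) F (q x)) ->
 (forall x, x \in `[a, b]%R -> {for x, continuous q}) ->
 (forall x, x \in `[a, b]%R -> (0 <= q x)%R) ->
 \int[lebR R]_(x in `[a, b]) (q x)%:E = (F b - F a)%:E.
Proof.
rewrite le_eqVlt => /predU1P[-> _ _ q0|ab dF cq q0].
 rewrite set_itv1 subrr ge0_integral_lebR ?integral_set1//.
 - exact: measurable_fun_set1.
 - by move=> x ->; rewrite lee_fin q0// in_itv/= lexx.
have cq' : {within `[a, b], continuous q}.
 by apply: continuous_in_subspaceT => x; rewrite inE; exact: cq.
rewrite ge0_integral_lebR//; last first. by apply/mEFinP; exact: subspace_continuous_measurable_fun.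
rewrite (@continuous_FTC2 _ q F)//; last first.
 move=> x xab; rewrite derive1E; apply: derive_val; apply: dF. exact: subset_itv_oo_cc.
split.
- by move=> x xab; case: (dF x (subset_itv_oo_cc xab)).
- apply: cvg_at_right_filter; apply: differentiable_continuous; apply/derivable1_diffP.
 by have := dF a; rewrite in_itv/= lexx ltW// => /(_ isT) [].
- apply: cvg_at_left_filter; apply: differentiable_continuous; apply/derivable1_diffP.
 by have := dF b; rewrite in_itv/= lexx ltW// => /(_ isT) [].
Qed.

Lemma lebR_itvco (a b : R) : (a <= b)%R -> lebR R `[a, b[%classic = (b - a)%:E.
Proof.
move=> ab; rewrite /lebR lebesgue_measure_itv/= lte_fin.
by move: ab; rewrite le_eqVlt => /predU1P[->|->]; rewrite ?ltxx ?subrr// EFinB.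
Qed.

Lemma sqr_integral_itv_le (x y : R) (a : R -> R) : (x <= y)%R ->
 measurable_fun [set: R] a -> (forall t, (0 <= a t)%R) ->
 (\int[lebR R]_(t in `[x, y[) (a t)%:E) ^+ 2 <=
 (y - x)%:E * \int[lebR R]_(t in `[x, y[) (a t ^+ 2)%:E.
Proof.
move=> xy ma a0; pose A := `[x, y[%classic.
have mA : measurable A by mes.
have mi : measurable_fun [set: R] (\1_A : R -> R) by pos.
have := @cauchy_schwarz_integral _ _ R (lebR R) (\1_A) (\1_A \* a)%R mi (mfM mi ma).
have -> : \int[lebR R]_x (`|\1_A x * (\1_A \* a)%R x|)%:E = \int[lebR R]_(t in A) (a t)%:E.
 rewrite [RHS]integral_mkcond; apply: eq_integral => t _.
 rewrite patchE /= indicE; case: (t \in A) => /=; last by rewrite mul0r normr0.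
 by rewrite !mul1r ger0_norm.
have -> : \int[lebR R]_x (\1_A x ^+ 2)%:E = (y - x)%:E.
 rewrite (eq_integral (EFin \o \1_A)); last first.
  by move=> t _ /=; rewrite indicE; case: (_ \in _); rewrite /= ?expr1n// expr0n.
 by rewrite integral_indic// setIT; exact: lebR_itvco.
suff -> : \int[lebR R]_x ((\1_A \* a)%R x ^+ 2)%:E = \int[lebR R]_(t in A) (a t ^+ 2)%:E by [].
rewrite [RHS]integral_mkcond; apply: eq_integral => t _.
rewrite patchE /= indicE; case: (t \in A) => /=; last by rewrite mul0r expr0n.
by rewrite mul1r.
Qed.

(** Cauchy-Schwarz bounds (phi x - phi m)^2 by |x - m| times the integral of a^2 between m and x.
    After integration against [p] and exchange of the integrals, the weight of a(t)^2 is the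
    integral of |x - m| p over the points beyond [t] as seen from [m], and this is what [W]
    dominates. The increment hypothesis stands for |phi'| <= a without differentiability. *)
Lemma hardy (l m r : R) (p W a phi : R -> R) : (l <= m)%R -> (m <= r)%R ->
 measurable_fun [set: R] p -> measurable_fun [set: R] W ->
 measurable_fun [set: R] a -> measurable_fun [set: R] phi ->
 (forall x, (0 <= p x)%R) -> (forall x, (0 <= W x)%R) -> (forall x, (0 <= a x)%R) ->
 (forall t, (m <= t)%R -> (t <= r)%R ->
  \int[lebR R]_(x in `[t, r]) ((x - m) * p x)%:E <= (W t)%:E) ->
 (forall t, (l <= t)%R -> (t <= m)%R ->
  \int[lebR R]_(x in `[l, t]) ((m - x) * p x)%:E <= (W t)%:E) -> (forall x y, (x <= y)%R ->
  (`|phi y - phi x|)%:E <= \int[lebR R]_(t in `[x, y[) (a t)%:E) ->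
 \int[lebR R]_(x in `[l, r]) ((phi x - phi m) ^+ 2 * p x)%:E <=
 \int[lebR R]_(t in `[l, r]) (a t ^+ 2 * W t)%:E.
Proof.
move=> lm mr mp mW ma mphi p0 W0 a0 H1 H2 Hphi.
(* [k x t] means that [t] lies between [m] and [x]; [A x] is the same relation as a half-open
   interval, the shape in which increments of [phi] are bounded. *)
pose k (x t : R) : bool := if (t < m)%R then (x <= t)%R else (t < x)%R.
pose A (x : R) : set R := if (x < m)%R then `[x, m[%classic else `[m, x[%classic.
have kA x t : A x t = k x t. rewrite /A /k; case: ltP => xm; rewrite /= in_itv/=; apply/propext.
  split=> [/andP[xt tm]|]; first by rewrite tm.
  case: ifPn => [tm ->//|]; rewrite -leNgt => mt tx; by have := lt_trans xm (le_lt_trans mt tx); rewrite ltxx.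
 split=> [/andP[mt tx]|]; first by rewrite ltNge mt. case: ifPn => [tm xt|]; last pos.
 by have := le_lt_trans (le_trans xm xt) tm; rewrite ltxx.
have mA x : measurable (A x) by rewrite /A; case: ifP => _; exact: mitv.
have step1 x : ((phi x - phi m) ^+ 2)%:E <= `|x - m|%:E * \int[lebR R]_(t in A x) (a t ^+ 2)%:E.
 rewrite -[X in (X ^+ 2)%:E <= _]/(phi x - phi m)%R -real_normK ?num_real//.
 have [xm|mx] := ltP x m. have -> : A x = `[x, m[%classic by rewrite /A xm.
  rewrite -(normrN (phi x - phi m)%R) opprB -(normrN (x - m)%R) opprB (ger0_norm (_ : 0 <= m - x)%R) ?subr_ge0; last pos.
  apply: le_trans (sqr_integral_itv_le (ltW xm) ma a0).
  by rewrite EFin_expe; apply: lee_pmul; rewrite ?lee_fin//; exact/Hphi/ltW.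
 have -> : A x = `[m, x[%classic by rewrite /A ltNge mx.
 rewrite (ger0_norm (_ : 0 <= x - m)%R) ?subr_ge0//. apply: le_trans (sqr_integral_itv_le mx ma a0).
 by rewrite EFin_expe; apply: lee_pmul; rewrite ?lee_fin//; exact/Hphi.
pose K (z : R * R) : \bar R := if (l <= z.1 <= r)%R && k z.1 z.2
 then (p z.1 * `|z.1 - m| * a z.2 ^+ 2)%:E else 0.
have K0 z : 0 <= K z. by rewrite /K; case: ifP => // _; rewrite lee_fin !mulr_ge0// sqr_ge0.
have mK : measurable_fun [set: R * R] K. apply: measurable_fun_ifT => //. apply: measurable_and.
   by apply: measurable_and; apply: measurable_fun_ler.
  apply: measurable_fun_ifT; first exact: measurable_fun_ltr. exact: measurable_fun_ler.
  exact: measurable_fun_ltr. apply/mEFinP; apply: mfM. apply: mfM; first exact: mcompT.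
  by apply: mcompT => //; apply: mfB. by apply: mfX; exact: mcompT.
apply: (@le_trans _ _ (\int[lebR R]_x \int[lebR R]_t K (x, t))).
 rewrite integral_mkcond; apply: ge0_le_integral => //.
 - move=> x _; rewrite patchE; case: ifP => // _. by rewrite lee_fin mulr_ge0// sqr_ge0.
 - apply/(measurable_restrictT _ _).1 => //. apply/mEFinP/mfTS/mfM => //. by apply: mfX; exact: mfB.
 - exact: (mfubini_F K). move=> x _; rewrite patchE; case: ifPn => [|_]; last exact: integral_ge0.
 rewrite inE/= in_itv/= => lxr. have -> : \int[lebR R]_t K (x, t) =
   (p x * `|x - m|)%:E * \int[lebR R]_(t in A x) (a t ^+ 2)%:E.
  rewrite -ge0_integralZl//; last 3 first.
  - apply/mEFinP/mfTS; exact: mfX.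
  - pos.
  - by rewrite lee_fin mulr_ge0. rewrite [RHS]integral_mkcond; apply: eq_integral => t _.
  rewrite patchE /K /= lxr (_ : (t \in A x) = k x t); first mes.
  by apply/idP/idP => [/set_mem|h]; [rewrite kA|apply/mem_set; rewrite kA].
 rewrite mulrC EFinM [in leRHS]EFinM -muleA; apply: lee_wpmul2l; first pos. exact: step1.
rewrite (fubini_tonelli K)// [leRHS]integral_mkcond.
apply: ge0_le_integral => //.
- by move=> t _; exact: integral_ge0.
- exact: (measurable_fun_fubini_tonelli_G K).
- apply/(measurable_restrictT _ _).1 => //. by apply/mEFinP/mfTS/mfM => //; exact: mfX.
move=> t _; rewrite patchE; case: ifPn => [|]; rewrite ?notin_setE ?inE/= in_itv/=; last first.
 move=> ltr; rewrite integral0_eq// => x _; rewrite /K /=; case: ifPn => // /andP[/andP[lx xr]].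
 rewrite /k; case: ifPn => [tm xt|]. by case: ltr; rewrite (le_trans lx xt) (le_trans (ltW tm) mr).
 by rewrite -leNgt => mt tx; case: ltr; rewrite (le_trans lm mt) (le_trans (ltW tx) xr).
move=> /andP[lt tr]; rewrite EFinM.
have mq (D : set R) (q : R -> R) : measurable_fun [set: R] q ->
 measurable_fun D (fun x => (q x)%:E) by move=> mq; exact/mEFinP/mfTS.
have main (D : set R) (q : R -> R) : measurable D -> measurable_fun [set: R] q ->
  (forall x, D x -> (0 <= q x)%R) ->
  (forall x, (l <= x <= r)%R -> k x t -> D x /\ (p x * `|x - m| = q x)%R) ->
  \int[lebR R]_(x in D) (q x)%:E <= (W t)%:E ->
  \int[lebR R]_x K (x, t) <= (a t ^+ 2)%:E * (W t)%:E. move=> mD mmq q0 Dq h.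
 apply: (@le_trans _ _ (\int[lebR R]_(x in D) ((a t ^+ 2)%:E * (q x)%:E))); last first.
  rewrite ge0_integralZl//; [|exact: mq|by rewrite lee_fin sqr_ge0].
  by apply: lee_wpmul2l => //; rewrite lee_fin sqr_ge0.
 rewrite [leRHS]integral_mkcond; apply: ge0_le_integral => //.
 - mes.
 - apply/(measurable_restrictT _ _).1 => //; apply: emfunM => //; exact: mq.
 move=> x _; rewrite patchE /K /=; case: ifPn => [/andP[lxr kx]|_].
  by have [Dx <-] := Dq x lxr kx; rewrite mem_set// -EFinM mulrC.
 by case: ifPn => //; rewrite inE => Dx; rewrite -EFinM lee_fin mulr_ge0 ?sqr_ge0 ?q0.
have [tm|mt] := ltP t m. apply: (main `[l, t]%classic (fun x => (m - x) * p x)%R) => //.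
 - by apply: mfM => //; exact: mfB.
 - move=> x; rewrite /= in_itv/= => /andP[_ xt]. pos.
 - move=> x /andP[lx xr]; rewrite /k tm => xt; split; first by rewrite /= in_itv/= lx.
  by rewrite mulrC distrC ger0_norm// subr_ge0 (le_trans xt (ltW tm)).
 - by apply: H2 => //; exact: ltW.
apply: (main `[t, r]%classic (fun x => (x - m) * p x)%R) => //.
- by apply: mfM => //; exact: mfB.
- move=> x; rewrite /= in_itv/= => /andP[tx _]. pos.
- move=> x /andP[lx xr]; rewrite /k ltNge mt/= => tx; split. by rewrite /= in_itv/= xr ltW.
 by rewrite mulrC ger0_norm// subr_ge0 (le_trans mt (ltW tx)).
- exact: H1.
Qed.

End hardy.

Section limit_interval.
Context (R : realType).

(** Primitives and the Hardy inequality live on bounded intervals; monotone convergence carries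
    their bounds to lines and half-lines. *)
Lemma integral_lim_itv (D : set R) (f : R -> R) (c : \bar R) :
 measurable D -> measurable_fun [set: R] f -> (forall x, 0 <= f x) ->
 (forall n : nat, (\int[lebR R]_(x in D `&` `[(- n%:R)%R, (n%:R)%R]) (f x)%:E <= c)%E) ->
 (\int[lebR R]_(x in D) (f x)%:E <= c)%E.
Proof.
move=> mD mf f0 fin.
have := @ge0_nondecreasing_set_cvg_integral _ _ R (fun n : nat => D `&` `[- n%:R, n%:R]%classic)
 (fun x => (f x)%:E) (lebR R).
rewrite -setI_bigcupr.
have -> : \bigcup_i `[- i%:R, i%:R]%classic = [set: R].
 apply/seteqP; split => // x _; exists (Num.trunc `|x|).+1 => //=.
 by rewrite in_itv/= -ler_norml ltW// truncnS_gt.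
rewrite setIT => /= h.
have {}h : (\int[lebR R]_(x in D `&` `[(- i%:R)%R, (i%:R)%R]) (f x)%:E)%E @[i --> \oo] -->
 (\int[lebR R]_(x in D) (f x)%:E)%E. apply: h.
- move=> n m nm; apply/subsetPset => x [Dx] /=; rewrite !in_itv/= => /andP[x1 x2]; split => //=.
 by rewrite ?in_itv/= (le_trans _ x1) ?lerN2 ?ler_nat// (le_trans x2)// ler_nat.
- by move=> n; apply: measurableI.
- by move=> n; apply/mEFinP/mfTS.
- pos.
apply: (cvge_le _ h).
by apply: nearW => n; exact: fin.
Qed.

End limit_interval.

(** * Expectations of bounded measurable functions *)

Section bounded_expectation.
Context d (T : measurableType d) (R : realType).
Implicit Types (P : probability T R) (f g : T -> R).

Definition bmf f := mfunT f /\ exists K, forall x, `|f x| <= K.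

(** [fine] gives the value 0 to infinite integrals; on bounded measurable functions nothing is lost,
    as [EE] records. *)
Definition E P f : R := fine (\int[P]_x (f x)%:E)%E.

Lemma bmf_integrable P f : bmf f -> P.-integrable setT (EFin \o f).
Proof. by move=> [mf [K fK]]; exact: bounded_integrable mf fK. Qed.

Lemma EE P f : bmf f -> (E P f)%:E = (\int[P]_x (f x)%:E)%E.
Proof. by move=> bf; rewrite fineK//; exact: (integrable_fin_num measurableT (bmf_integrable P bf)). Qed.

Lemma bmf_cst c : bmf (fun=> c).
Proof. by split; [exact: mcst|exists `|c|]. Qed.

Lemma bmfD f g : bmf f -> bmf g -> bmf (fun x => f x + g x).
Proof.
move=> [mf [K fK]] [mg [L gL]]; split; first exact: mfD.
by exists (K + L) => x; rewrite (le_trans (ler_normD _ _))// lerD.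
Qed.

Lemma bmfN f : bmf f -> bmf (fun x => - f x).
Proof.
move=> [mf [K fK]]; split; first exact: mcompT.
by exists K => x; rewrite normrN.
Qed.

Lemma bmfB f g : bmf f -> bmf g -> bmf (fun x => f x - g x).
Proof. by move=> bf bg; apply: bmfD => //; exact: bmfN. Qed.

Lemma bmfM f g : bmf f -> bmf g -> bmf (fun x => f x * g x).
Proof.
move=> [mf [K fK]] [mg [L gL]]; split; first exact: mfM.
by exists (K * L) => x; rewrite normrM ler_pM.
Qed.

Lemma bmfX f n : bmf f -> bmf (fun x => f x ^+ n).
Proof.
move=> [mf [K fK]]; split; first exact: mfX.
exists (K ^+ n) => x; rewrite normrX lerXn2r ?nnegrE//.
exact: le_trans (fK x).
Qed.

Lemma bmf_norm f : bmf f -> bmf (fun x => `|f x|).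
Proof.
move=> [mf [K fK]]; split; first exact: mcompT.
by exists K => x; rewrite normr_id.
Qed.

Lemma bmf01 f : mfunT f -> (forall x, 0 <= f x <= 1) -> bmf f.
Proof.
move=> mf f01; split => //; exists 1 => x.
by have /andP[f0 f1] := f01 x; rewrite ger0_norm.
Qed.

Lemma bmf_indic (A : set T) : measurable A -> bmf (\1_A : T -> R).
Proof.
move=> mA; apply: bmf01; first mes.
by move=> x; rewrite indicE ler0n lern1 leq_b1.
Qed.

Lemma eq_E P f g : f =1 g -> E P f = E P g.
Proof. by move=> fg; rewrite /E; congr fine; apply: eq_integral => x _; rewrite fg. Qed.

Lemma E_cst P c : E P (fun=> c) = c.
Proof. by rewrite /E integral_cst//= probability_setT mule1. Qed.

Lemma ED P f g : bmf f -> bmf g -> E P (fun x => f x + g x) = E P f + E P g.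
Proof.
move=> bf bg; apply: EFin_inj; rewrite EFinD !EE//; last exact: bmfD.
under eq_integral do rewrite EFinD.
by rewrite integralD_EFin//; exact: bmf_integrable.
Qed.

Lemma EN P f : bmf f -> E P (fun x => - f x) = - E P f.
Proof.
move=> bf; apply/eqP; rewrite -subr_eq0 opprK -ED//; last exact: bmfN.
by rewrite (@eq_E _ _ (fun=> 0)) ?E_cst// => x; rewrite addNr.
Qed.

Lemma EB P f g : bmf f -> bmf g -> E P (fun x => f x - g x) = E P f - E P g.
Proof. by move=> bf bg; rewrite ED ?EN//; exact: bmfN. Qed.

Lemma EZ P c f : bmf f -> E P (fun x => c * f x) = c * E P f.
Proof.
move=> bf; apply: EFin_inj; rewrite EFinM !EE//; last exact: (bmfM (bmf_cst c) bf).
under eq_integral do rewrite EFinM.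
by rewrite integralZl//; exact: bmf_integrable.
Qed.

Lemma E_ge0 P f : (forall x, 0 <= f x) -> 0 <= E P f.
Proof. by move=> f0; apply: fine_ge0; apply: integral_ge0 => x _; rewrite lee_fin. Qed.

Lemma le_E P f g : bmf f -> bmf g -> (forall x, f x <= g x) -> E P f <= E P g.
Proof.
move=> bf bg fg; rewrite -subr_ge0 -EB//; apply: E_ge0 => x.
by rewrite subr_ge0.
Qed.

Lemma E01 P f : mfunT f -> (forall x, 0 <= f x <= 1) -> 0 <= E P f <= 1.
Proof.
move=> mf f01; rewrite E_ge0 => [|x]; last by case/andP: (f01 x).
rewrite -[leRHS](E_cst P); apply: le_E; [exact: bmf01|exact: bmf_cst|].
by move=> x; case/andP: (f01 x).
Qed.

Lemma ler_norm_E P f : bmf f -> `|E P f| <= E P (fun x => `|f x|).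
Proof.
move=> bf; have bn := bmf_norm bf; rewrite ler_norml; apply/andP; split.
 rewrite -EN//; apply: le_E => //; first exact: bmfN. by move=> x; rewrite lerNl -normrN ler_norm.
by apply: le_E => // x; exact: ler_norm.
Qed.

Lemma E_sqrB P f c : bmf f ->
 E P (fun x => (f x - c) ^+ 2) = E P (fun x => f x ^+ 2) - E P f ^+ 2 + (E P f - c) ^+ 2.
Proof.
move=> bf; rewrite (@eq_E _ _ (fun x => f x ^+ 2 - 2 * c * f x + c ^+ 2)); last first.
 by move=> x; ring.
have b2 := bmfX 2 bf; have bc := bmf_cst (c ^+ 2).
have b3 := bmfM (bmf_cst (2 * c)) bf.
rewrite ED//; last exact: bmfB.
rewrite EB// EZ// E_cst; ring.
Qed.

Lemma var_le P f c : bmf f -> E P (fun x => f x ^+ 2) - E P f ^+ 2 <= E P (fun x => (f x - c) ^+ 2).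
Proof. by move=> bf; rewrite E_sqrB// lerDl sqr_ge0. Qed.

Lemma sqr_E_le P f : bmf f -> E P f ^+ 2 <= E P (fun x => f x ^+ 2).
Proof.
move=> bf; rewrite -subr_ge0; have := E_sqrB P (E P f) bf.
by rewrite subrr expr0n addr0 => <-; apply: E_ge0 => x; exact: sqr_ge0.
Qed.

End bounded_expectation.

Section expectation_prod.
Context d1 d2 (T1 : measurableType d1) (T2 : measurableType d2) (R : realType)
 (P1 : probability T1 R) (P2 : probability T2 R).

Lemma bmf_pairl (f : T1 * T2 -> R) : bmf f -> forall x, bmf (fun y => f (x, y)).
Proof.
move=> [mf [K fK]] x; split; last by exists K => y; exact: fK.
by apply: (mcompT mf); exact: measurable_pair1.
Qed.

Lemma bmf_E2 (f : T1 * T2 -> R) : bmf f -> bmf (fun x => E P2 (fun y => f (x, y))).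
Proof.
move=> [mf [K fK]].
(* Tonelli gives measurability of a partial integral for nonnegative integrands; adding [K] makes it
   so and is undone afterwards. *)
have mg : mfunT (fun x => E P2 (fun y => f (x, y) + K)).
 rewrite /E; apply: (mcompT (fine_measurable measurableT)).
 apply: (@mfubini_F _ _ _ _ R P2 (fun z => (f z + K)%:E)). by apply/mEFinP; exact: mfD.
 move=> z; rewrite lee_fin -lerBlDr sub0r; have := fK z. by rewrite ler_norml => /andP[].
have bf x : bmf (fun y => f (x, y)) by apply: bmf_pairl; split => //; exists K.
split. rewrite (_ : (fun x => _) = (fun x => E P2 (fun y => f (x, y) + K) - K)). exact: mfB.
 apply/funext => x; rewrite ED ?E_cst ?addrK//; exact: bmf_cst.
exists K => x; rewrite (le_trans (ler_norm_E _ (bf x)))//.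
rewrite -[leRHS](E_cst P2); apply: le_E => //; first exact: bmf_norm. exact: bmf_cst.
Qed.

Lemma E_prod (f : T1 * T2 -> R) : bmf f ->
 E (prod_prob P1 P2) f = E P1 (fun x => E P2 (fun y => f (x, y))).
Proof.
move=> bf; have [mf [K fK]] := bf.
suff : E (prod_prob P1 P2) (fun z => f z + K) = E P1 (fun x => E P2 (fun y => f (x, y) + K)).
 rewrite ED ?E_cst//; last exact: bmf_cst.
 rewrite (@eq_E _ _ _ P1 _ (fun x => E P2 (fun y => f (x, y)) + K)); last first.
  by move=> x; rewrite ED ?E_cst//; [exact: bmf_pairl|exact: bmf_cst].
 rewrite ED ?E_cst//; [|exact: bmf_E2|exact: bmf_cst]. by move=> /addIr.
have bfK : bmf (fun z => f z + K) by apply: bmfD => //; exact: bmf_cst.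
apply: EFin_inj; rewrite !EE//; last exact: bmf_E2 bfK.
rewrite ge0_integral_prod_prob//; last first.
- move=> z; rewrite lee_fin -lerBlDr sub0r; have := fK z. by rewrite ler_norml => /andP[].
- by apply/mEFinP; exact: bfK.1.
by apply: eq_integral => x _; rewrite EE//; exact: bmf_pairl bfK x.
Qed.

End expectation_prod.

(** * The Gaussian Poincare inequality *)

Section gaussian_poincare.
Context (R : realType).

Lemma is_derive_normal_pdf01 (x : R) :
 is_derive x (1 : R) (normal_pdf 0 1) (- x * normal_pdf 0 1 x).
Proof.
rewrite normal_pdfE// /normal_fun.
by apply: is_derive_eq; rewrite /GRing.scale/= !subr0 expr1n; field.
Qed.

Definition enorm d (v : 'rV[R]_d) := Num.sqrt (sqnorm2 v).

Lemma sqnorm2_ge0 d (v : 'rV[R]_d) : 0 <= sqnorm2 v.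
Proof. pos. Qed.

Lemma measurable_sqrtr : measurable_fun [set: R] (@Num.sqrt R).
Proof. by apply: cont_mfun; exact: sqrt_continuous. Qed.

Lemma E_gaussS d (f : 'rV[R]_d.+1 -> R) : bmf f ->
 E (gauss R d.+1) f = E (stdnormal R) (fun t => E (gauss R d) (fun v => f (cons_rV (t, v)))).
Proof.
move=> [mf [K fK]].
have bf : bmf (f \o @cons_rV R d). split; first exact: (mcompT mf (@mcons_rV R d)).
 by exists K => z; exact: fK.
rewrite -(E_prod _ _ bf) /E; congr fine.
rewrite /= integral_distribution//; first mes.
exact: (bmf_integrable _ bf).
Qed.

Lemma bmf_cons d (f : 'rV[R]_d.+1 -> R) : bmf f ->
 @bmf _ (R * 'rV[R]_d)%type R (fun z => f (@cons_rV R d z)).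
Proof.
move=> [mf [K fK]]; split; first exact: (mcompT mf (@mcons_rV R d)).
by exists K => z; exact: fK.
Qed.

(** [A] plays the role of |grad f| along straight lines. Only integrated increments are required,
    which suits functions P g with [g] merely bounded and measurable. *)
Definition upper_gradient d (f A : 'rV[R]_d -> R) : Prop :=
 forall x v s t, s <= t -> (`|f (x + t *: v) - f (x + s *: v)|%:E <=
  \int[lebR R]_(r in `[s, t[) (enorm v * A (x + r *: v))%:E)%E.

(** Hardy with m = 0 and W = p: the derivative of the density p is - x p, so the integral of x p
    from t on is at most p(t). Hence the constant 1. *)
Lemma stdnormal_hardy (phi a : R -> R) : mfunT phi -> mfunT a -> (forall t, 0 <= a t) ->
 (forall x y, x <= y -> (`|phi y - phi x|%:E <= \int[lebR R]_(t in `[x, y[) (a t)%:E)%E) ->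
 (\int[lebR R]_x ((phi x - phi 0%R) ^+ 2 * normal_pdf 0 1 x)%:E <=
 \int[lebR R]_x (a x ^+ 2 * normal_pdf 0 1 x)%:E)%E.
Proof.
move=> mphi ma a0 Hphi; pose p := @normal_pdf R 0 1.
have mp : mfunT p by exact: measurable_normal_pdf.
have p0 x : 0 <= p x by pos.
have dp x : is_derive x (1 : R) (- p : R -> R) (x * p x). have := is_derive_normal_pdf01 x => dp.
 by apply: is_derive_eq; rewrite mulNr opprK.
have dp' x : is_derive x (1 : R) (p : R -> R) (- x * p x) by exact: is_derive_normal_pdf01.
have cp : continuous p by apply: continuous_normal_pdf.
have cq : continuous (fun x : R => x * p x) by move=> x; apply: (@cvgM _ R); [exact: cvg_id|exact: cp].
have cq' : continuous (fun x : R => - x * p x).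
 by move=> x; apply: (@cvgM _ R); [apply: (@cvgN _ R^o); exact: cvg_id|exact: cp].
have fin (n : nat) : (\int[lebR R]_(x in `[(- n%:R)%R, (n%:R)%R]) ((phi x - phi 0) ^+ 2 * p x)%:E <=
  \int[lebR R]_x (a x ^+ 2 * p x)%:E)%E.
 apply: (@le_trans _ _ (\int[lebR R]_(t in `[(- n%:R)%R, (n%:R)%R]) (a t ^+ 2 * p t)%:E)%E).
  apply: hardy => //.
  - move=> t t0 tn; under eq_integral do rewrite subr0.
   rewrite (@integral_derive_lebR _ (- p))//=; last 2 first.
   - by move=> x _; exact: cq.
   - by move=> x; rewrite in_itv/= => /andP[tx _]; rewrite mulr_ge0// (le_trans t0).
   by rewrite lee_fin opprK addrC lerBlDr lerDl.
  - move=> t nt t0; under eq_integral do rewrite sub0r.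
   rewrite (@integral_derive_lebR _ p)//=; last 2 first.
   - by move=> x _; exact: cq'.
   - by move=> x; rewrite in_itv/= => /andP[_ xt]; rewrite mulr_ge0// oppr_ge0 (le_trans xt).
   by rewrite lee_fin lerBlDr lerDl. apply: ge0_subset_integral => //.
 - by apply/mEFinP; apply: mfM => //; exact: mfX.
 - by move=> x _; rewrite lee_fin mulr_ge0// sqr_ge0.
apply: integral_lim_itv => //.
- apply: mfM => //. by apply: mfX; exact: mfB.
- pos.
- by move=> n; rewrite setTI; exact: fin.
Qed.

Lemma stdnormal_pdfE (f : R -> \bar R) : mfunT f -> (forall x, 0 <= f x)%E ->
 (\int[stdnormal R]_x f x = \int[lebR R]_x (f x * (normal_pdf 0 1 x)%:E))%E.
Proof.
move=> mf f0; rewrite -(@ge0_integral_stdnormal_affine R 0 1 f ltr01)//.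
by apply: eq_integral => x _; rewrite add0r mul1r.
Qed.

Lemma stdnormal_poincare (phi a : R -> R) : bmf phi -> bmf a -> (forall t, 0 <= a t) ->
 (forall x y, x <= y -> (`|phi y - phi x|%:E <= \int[lebR R]_(t in `[x, y[) (a t)%:E)%E) ->
 E (stdnormal R) (fun x => phi x ^+ 2) - E (stdnormal R) phi ^+ 2 <=
 E (stdnormal R) (fun x => a x ^+ 2).
Proof.
move=> bphi ba a0 Hphi; apply: le_trans (var_le (stdnormal R) (phi 0) bphi) _.
have bp : bmf (fun x => (phi x - phi 0) ^+ 2). by apply: bmfX; apply: bmfB => //; exact: bmf_cst.
rewrite -lee_fin !EE//; last exact: bmfX.
rewrite !stdnormal_pdfE//; last 4 first.
- by apply/mEFinP; exact: (bmfX 2 ba).1.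
- pos.
- by apply/mEFinP; exact: bp.1.
- pos.
exact: stdnormal_hardy bphi.1 ba.1 a0 Hphi.
Qed.

(** [stdnormal_hardy] for the identity, whose upper gradient is 1. *)
Lemma stdnormal_second_moment : (\int[stdnormal R]_x (x ^+ 2)%:E <= 1)%E.
Proof.
have p0 x : 0 <= @normal_pdf R 0 1 x by pos.
rewrite stdnormal_pdfE//; last 2 first.
- mes.
- pos.
have := @stdnormal_hardy id (fun=> 1) (@measurable_id _ _ _) (mcst _) (fun=> ler01).
under eq_integral do rewrite subr0.
move=> h; apply: le_trans (h _) _.
 move=> x y xy; rewrite integral_cst//= lebR_itvco// mul1e lee_fin ger0_norm//. pos.
under eq_integral do rewrite expr1n.
have := @stdnormal_pdfE (cst 1%E) (mcst _) (fun=> lee01).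
rewrite integral_cst//= probability_setT mule1 => h1; rewrite h1 le_eqVlt; apply/orP; left; apply/eqP.
by apply: eq_integral => x _; rewrite mul1r mul1e.
Qed.

Lemma cons_rV_line d (t s : R) (v w : 'rV[R]_d) :
 cons_rV (t, v + s *: w) = cons_rV (t, v) + s *: cons_rV (0, w).
Proof.
apply/rowP => i; rewrite !mxE; case: (unliftP ord0 i) => [j _|_]. by rewrite !mxE.
by rewrite mulr0 addr0.
Qed.

Lemma cons_rV_line0 d (t s : R) (v : 'rV[R]_d) :
 cons_rV (t + s, v) = cons_rV (t, v) + s *: cons_rV (1, 0).
Proof.
apply/rowP => i; rewrite !mxE; case: (unliftP ord0 i) => [j _|_]. by rewrite !mxE mulr0 addr0.
by rewrite mulr1.
Qed.

Lemma sqnorm2_cons d (t : R) (v : 'rV[R]_d) : sqnorm2 (cons_rV (t, v)) = t ^+ 2 + sqnorm2 v.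
Proof.
rewrite /sqnorm2 big_ord_recl mxE unlift_none/=; congr (_ + _).
by apply: eq_bigr => i _; rewrite !mxE liftK.
Qed.

Lemma sqnorm20 d : sqnorm2 (0 : 'rV[R]_d) = 0.
Proof. by rewrite /sqnorm2 big1// => i _; rewrite mxE expr0n. Qed.

(** Variance splits along the first coordinate: the conditional variance is bounded by induction,
    the conditional mean [psi] by the one-dimensional case. Each coordinate direction is charged the
    full [A], whence the factor [d], which becomes the factor d of the upper bounds. *)
Lemma gauss_poincare d (f A : 'rV[R]_d -> R) : bmf f -> bmf A -> (forall x, 0 <= A x) ->
 upper_gradient f A -> E (gauss R d) (fun x => f x ^+ 2) - E (gauss R d) f ^+ 2 <=
 d%:R * E (gauss R d) (fun x => A x ^+ 2).
Proof.
elim: d f A => [|d IH] f A bf bA A0 ug.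
 rewrite mul0r subr_le0 (@eq_E _ _ _ _ _ (fun=> f 0 ^+ 2)); last first.
  by move=> x; congr (f _ ^+ 2); apply/rowP => -[].
 rewrite (@eq_E _ _ _ _ f (fun=> f 0)) ?E_cst// => x. by congr (f _); apply/rowP => -[].
have bfc := bmf_cons bf; have bAc := bmf_cons bA.
have b2 := bmfX 2 bf; have bA2 := bmfX 2 bA.
pose psi t := E (gauss R d) (fun v => f (cons_rV (t, v))).
pose al t := E (gauss R d) (fun v => A (cons_rV (t, v))).
have bpsi : bmf psi by exact: (bmf_E2 (gauss R d) bfc).
have bal : bmf al by exact: (bmf_E2 (gauss R d) bAc).
have bA2' := bmf_E2 (gauss R d) (bmf_cons bA2).
have bf2' := bmf_E2 (gauss R d) (bmf_cons b2).
(* The mean of [A] is an upper gradient of the mean of [f]: use [A] in the first coordinate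
   direction, of norm 1, and exchange the integrals. *)
have psi_al x y : x <= y -> (`|psi y - psi x|%:E <= \int[lebR R]_(t in `[x, y[) (al t)%:E)%E.
 move=> xy; rewrite /psi -EB; [|exact: bmf_pairl bfc y|exact: bmf_pairl bfc x].
 pose g v := f (cons_rV (y, v)) - f (cons_rV (x, v)).
 have bg : bmf g by apply: bmfB; [exact: bmf_pairl bfc y|exact: bmf_pairl bfc x].
 apply: (@le_trans _ _ (\int[gauss R d]_v `|g v|%:E)%E).
  by rewrite -EE ?lee_fin ?ler_norm_E//; exact: bmf_norm.
 apply: (@le_trans _ _ (\int[gauss R d]_v \int[lebR R]_(t in `[x, y[) (A (cons_rV (t, v)))%:E)%E).
  have mAc : mfunT (fun z : 'rV[R]_d * R => (A (cons_rV (z.2, z.1)))%:E).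
   apply/mEFinP; apply: (mcompT bA.1). apply: (mcompT (@mcons_rV R d)). mes.
  apply: ge0_le_integral => //.
  - by apply/mEFinP; apply: mcompT => //; exact: bg.1.
  - under eq_fun do rewrite integral_mkcond. apply: (@mfubini_F _ _ _ _ R (lebR R)
    (fun z : 'rV[R]_d * R => (fun t => (A (cons_rV (t, z.1)))%:E) \_ `[x, y[ z.2)%E).
    rewrite (_ : (fun z => _) = (fun z : 'rV[R]_d * R => if (x <= z.2 < y) then (A (cons_rV (z.2, z.1)))%:E else 0%E)).
     apply: measurable_fun_ifT => //.
     by apply: measurable_and; [apply: measurable_fun_ler|apply: measurable_fun_ltr].
    by apply/funext => z; rewrite patchE mem_setE in_itv/=.
   by move=> z; rewrite patchE; case: ifP => // _; rewrite lee_fin.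
  move=> v _; have := ug (cons_rV (0, v)) (cons_rV (1, 0)) x y xy.
  rewrite -!cons_rV_line0 !add0r; under eq_integral do rewrite -cons_rV_line0 add0r.
  by rewrite /enorm sqnorm2_cons sqnorm20 expr1n addr0 sqrtr1; under eq_integral do rewrite mul1r.
 under eq_integral do rewrite integral_mkcond. rewrite [X in (_ <= X)%E]integral_mkcond.
 rewrite (@fubini_tonelli _ _ _ _ R (gauss R d) (lebR R)
  (fun z : 'rV[R]_d * R => (fun t => (A (cons_rV (t, z.1)))%:E) \_ `[x, y[ z.2)%E)//=.
 - apply: eq_ler; apply: eq_integral => t _. rewrite patchE; case: ifPn => txy; last first.
   by rewrite integral0_eq// => v _; rewrite patchE (negbTE txy).
  under eq_integral do rewrite patchE txy. by rewrite /al EE//; exact: bmf_pairl bAc t.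
 - rewrite (_ : (fun z => _) = (fun z : 'rV[R]_d * R => if (x <= z.2 < y) then (A (cons_rV (z.2, z.1)))%:E else 0%E)).
   apply: measurable_fun_ifT => //.
    by apply: measurable_and; [apply: measurable_fun_ler|apply: measurable_fun_ltr].
   apply/mEFinP; apply: (mcompT bA.1). apply: (mcompT (@mcons_rV R d)). mes.
  by apply/funext => z; rewrite patchE mem_setE in_itv/=.
 - by move=> z; rewrite patchE; case: ifP => // _; rewrite lee_fin.
have al0 t : 0 <= al t by apply: E_ge0.
have h1 := stdnormal_poincare bpsi bal al0 psi_al.
have h2 : E (stdnormal R) (fun x => al x ^+ 2) <=
  E (stdnormal R) (fun t => E (gauss R d) (fun v => A (cons_rV (t, v)) ^+ 2)).
 by apply: le_E => //; [exact: bmfX|move=> t; apply: sqr_E_le; exact: bmf_pairl bAc t].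
have h3 : E (stdnormal R) (fun t => E (gauss R d) (fun v => f (cons_rV (t, v)) ^+ 2)) -
  E (stdnormal R) (fun t => psi t ^+ 2) <=
  d%:R * E (stdnormal R) (fun t => E (gauss R d) (fun v => A (cons_rV (t, v)) ^+ 2)).
 rewrite -EB//; last exact: bmfX. rewrite -EZ//; apply: le_E.
 - by apply: bmfB => //; exact: bmfX.
 - by apply: bmfM => //; exact: bmf_cst.
 move=> t; apply: IH => //; [exact: bmf_pairl bfc t|exact: bmf_pairl bAc t|].
 move=> v w s t' st'; have := ug (cons_rV (t, v)) (cons_rV (0, w)) s t' st'.
 rewrite !cons_rV_line; under [in X in (_ <= X)%E -> _]eq_integral do rewrite -cons_rV_line.
 by rewrite /enorm sqnorm2_cons expr0n add0r.
rewrite !(E_gaussS bA2) !(E_gaussS b2) (E_gaussS bf) -/psi.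
have := lerD h3 (le_trans h1 h2); rewrite -natr1 mulrDl mul1r.
by apply: le_trans; rewrite addrA subrK.
Qed.

Lemma gauss_second_moment d : (\int[gauss R d]_z (sqnorm2 z)%:E <= d%:R%:E)%E.
Proof.
elim: d => [|d IH]. rewrite integral0_eq// => z _; rewrite /sqnorm2 big_ord0//.
rewrite ge0_integral_gaussS//; last 2 first.
- by apply/mEFinP; exact: msqnorm2.
- by move=> z; rewrite lee_fin sqnorm2_ge0.
have m2 : mfunT (fun v : 'rV[R]_d => sqnorm2 v) by exact: msqnorm2.
apply: (@le_trans _ _ (\int[stdnormal R]_t ((t ^+ 2)%:E + d%:R%:E))%E).
 apply: ge0_le_integral => //.
 - by move=> t _; apply: integral_ge0 => v _; rewrite lee_fin sqnorm2_ge0.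
 - apply: (@mfubini_F _ _ _ _ R (gauss R d) (fun z : R * 'rV[R]_d => (sqnorm2 (cons_rV z))%:E)).
   by apply/mEFinP; apply: msqnorm2; exact: mcons_rV. by move=> z; rewrite lee_fin sqnorm2_ge0.
 - by apply: emeasurable_funD => //; apply/mEFinP; exact: mfX.
 move=> t _; under eq_integral do rewrite sqnorm2_cons EFinD. rewrite ge0_integralD//=.
 - rewrite integral_cst//= probability_setT mule1 leeD2l//.
 - pos.
 - by move=> v _; rewrite lee_fin sqnorm2_ge0.
 - mes.
rewrite ge0_integralD//=.
- apply: (@le_trans _ _ ((1 : R)%:E + d%:R%:E)%E); last by rewrite -EFinD lee_fin -natr1 addrC.
 apply: leeD; first exact: stdnormal_second_moment.
 by rewrite integral_cst//= probability_setT mule1.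
- pos.
- mes.
Qed.

End gaussian_poincare.

Section real_integrals.
Context d (T : measurableType d) (R : realType) (m : {measure set T -> \bar R}).
Implicit Types (D : set T) (f g : T -> R).

Lemma integralZ_EFin D (c : R) f : measurable D -> 0 <= c -> mfunT f -> (forall x, 0 <= f x) ->
 (\int[m]_(x in D) (c * f x)%:E = c%:E * \int[m]_(x in D) (f x)%:E)%E.
Proof.
move=> mD c0 mf f0; under eq_integral do rewrite EFinM.
apply: ge0_integralZl => //; first exact/mEFinP/mfTS.
by move=> x _; rewrite lee_fin.
Qed.

Lemma le_integral_EFin D f g : measurable D -> mfunT f ->
 mfunT g -> (forall x, 0 <= f x) -> (forall x, D x -> f x <= g x) ->
 (\int[m]_(x in D) (f x)%:E <= \int[m]_(x in D) (g x)%:E)%E.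
Proof.
move=> mD mf mg f0 fg; apply: ge0_le_integral => //.
- by move=> x _; rewrite lee_fin.
- exact/mEFinP/mfTS.
- exact/mEFinP/mfTS.
Qed.

Lemma subset_integral_EFin (A B : set T) f : measurable A -> measurable B -> A `<=` B ->
 mfunT f -> (forall x, 0 <= f x) -> (\int[m]_(x in A) (f x)%:E <= \int[m]_(x in B) (f x)%:E)%E.
Proof.
move=> mA mB AB mf f0; apply: ge0_subset_integral => //.
- exact/mEFinP/mfTS.
- by move=> x _; rewrite lee_fin.
Qed.

Lemma integral_prob_cst (P : probability T R) (c : \bar R) : (\int[P]_x cst c x = c)%E.
Proof. by rewrite integral_cst//= probability_setT mule1. Qed.

End real_integrals.

(** * The target law as a Gaussian mixture over the logarithm of the scale *)

Section mixture.
Context (R : realType).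

Lemma integral_lebR_shift (G : R -> R) (c : R) : continuous G -> (forall x, 0 <= G x) ->
 (\int[lebR R]_x (G (x + c))%:E = \int[lebR R]_x (G x)%:E)%E.
Proof.
move=> cG G0.
have mG : measurable_fun [set: R] G by exact: cont_mfun.
have dF (x : R) : is_derive x (1 : R) (fun y : R => y + c) 1. by apply: is_derive_eq; rewrite addr0.
have dE : (fun y : R => y + c)^`()%classic = cst 1.
 by apply/funext => x; rewrite derive1E; apply: derive_val.
have mG' : measurable_fun [set: R] (fun x => (G (x + c))%:E). apply/mEFinP; apply: mcompT => //.
 exact: mfD.
rewrite (@ge0_integral_lebR _ setT (fun x => (G (x + c))%:E))//; last by move=> x _; rewrite lee_fin.
rewrite (@ge0_integral_lebR _ setT (fun x => (G x)%:E))//; last 2 first.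
- exact/mEFinP.
- by move=> x _; rewrite lee_fin.
rewrite [RHS](@increasing_ge0_integration_by_substitutionT _ (fun y => y + c))//.
- by apply: eq_integral => x _; rewrite dE /=; congr EFin; rewrite /GRing.mul/= mulr1.
- by move=> x y xy; rewrite ltrD2r.
- by rewrite dE => x; exact: cvg_cst.
- by rewrite dE; exact: is_cvg_cst.
- by rewrite dE; exact: is_cvg_cst.
- exact: cvg_addrr_Ny.
- exact: cvg_addrr.
Qed.

(** Unnormalised density of w = ln sigma when sigma^-2 is chi-squared with nu degrees of freedom;
    [pi] is a multivariate Student law, that is, N(0, sigma^2 I) with this random scale. *)
Definition mixw (nu w : R) := expR (- nu * w - expR (- 2 * w) / 2).

Lemma mixw_ge0 nu w : 0 <= mixw nu w. Proof. exact: expR_ge0. Qed.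

Lemma is_derive_expRM (c w : R) : is_derive w (1 : R) (fun v => expR (c * v)) (c * expR (c * w)).
Proof. by apply: is_derive_eq; rewrite /GRing.scale/=; ring. Qed.

Lemma is_derive_mixw nu w : is_derive w (1 : R) (mixw nu) ((expR (- 2 * w) - nu) * mixw nu w).
Proof. by apply: is_derive_eq; rewrite /GRing.scale/= /mixw; field. Qed.

Lemma continuous_is_derive (F q : R -> R) : (forall x, is_derive x (1 : R) F (q x)) -> continuous F.
Proof.
move=> dF x; apply: differentiable_continuous; apply/derivable1_diffP.
by case: (dF x).
Qed.

Lemma continuous_mixw nu : continuous (mixw nu).
Proof. exact: continuous_is_derive (is_derive_mixw nu). Qed.

Lemma mmixw nu : measurable_fun [set: R] (mixw nu).
Proof. exact: cont_mfun (@continuous_mixw nu). Qed.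

Lemma integral_expRM (c a b : R) : a <= b -> c != 0 ->
 (\int[lebR R]_(x in `[a, b]) (expR (c * x))%:E = (expR (c * b) / c - expR (c * a) / c)%:E)%E.
Proof.
move=> ab c0.
have d x : is_derive x (1 : R) (fun x => expR (c * x) / c) (expR (c * x)).
 by apply: is_derive_eq; rewrite /GRing.scale/=; field.
rewrite (@integral_derive_lebR _ (fun x => expR (c * x) / c))//.
- move=> x _; exact: (@continuous_is_derive _ (fun x => c * expR (c * x)) (is_derive_expRM c)).
Qed.

Lemma mixw_le_pos nu w : mixw nu w <= expR (- nu * w).
Proof. by rewrite ler_expR lerBlDr lerDl divr_ge0// expR_ge0. Qed.

Lemma mixw_tail nu t : 0 < nu ->
 (\int[lebR R]_(w in `[t, +oo[) (mixw nu w)%:E <= (expR (- nu * t) / nu)%:E)%E.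
Proof.
move=> nu0; apply: integral_lim_itv => //; [exact: mmixw|exact: mixw_ge0|move=> n].
have [tn|nt] := leP t n%:R; last first.
 rewrite (_ : _ `&` _ = set0) ?integral_set0 ?lee_fin ?divr_ge0 ?expR_ge0 ?ltW//.
 apply/seteqP; split => x //=; rewrite !in_itv/= andbT => -[tx /andP[_ xn]].
 by have := lt_le_trans nt (le_trans tx xn); rewrite ltxx.
apply: (@le_trans _ _ (\int[lebR R]_(x in `[t, n%:R]) (expR (- nu * x))%:E)%E).
 apply: (@le_trans _ _ (\int[lebR R]_(x in `[t, n%:R]) (mixw nu x)%:E)%E).
  apply: ge0_subset_integral => //.
  - exact: measurableI.
  - by apply/mEFinP/mfTS; exact: mmixw.
  - by move=> x _; rewrite lee_fin mixw_ge0.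
  - by move=> x []/=; rewrite !in_itv/= andbT => -> /andP[_ ->]. apply: ge0_le_integral => //.
 - by move=> x _; rewrite lee_fin mixw_ge0.
 - by apply/mEFinP/mfTS; exact: mmixw.
 - apply/mEFinP/mfTS; apply: cont_mfun. exact: continuous_is_derive (is_derive_expRM _).
 - by move=> x _; rewrite lee_fin mixw_le_pos.
rewrite integral_expRM//; last by rewrite oppr_eq0 gt_eqF.
rewrite lee_fin !invrN !mulrN opprK addrC lerBlDr lerDl.
by rewrite divr_ge0 ?expR_ge0// ltW.
Qed.

Lemma mixw_le_neg nu w : 0 < nu -> mixw nu w <= expR ((nu + 1) / 2 * ln (nu + 1)) * expR w.
Proof.
move=> nu0; rewrite -expRD ler_expR.
set a := nu + 1; have a0 : 0 < a by rewrite /a; lra.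
(* The tangent of the exponential at [ln a]; with a = nu + 1 the linear bound on the exponent has
   slope a - nu = 1 in [w]. *)
have := expR_ge1Dx (- 2 * w - ln a); rewrite expRB lnK// => h.
have {}h : a * (1 + (- 2 * w - ln a)) <= expR (- 2 * w). by rewrite mulrC -ler_pdivlMr.
have -> : nu = a - 1 by rewrite /a; ring.
nra.
Qed.

Definition mixM (nu : R) : R := fine (\int[lebR R]_w (mixw nu w)%:E)%E.

Lemma mixM_bound nu : 0 < nu -> (\int[lebR R]_w (mixw nu w)%:E <=
 (expR ((nu + 1) / 2 * ln (nu + 1)) + nu^-1)%:E)%E.
Proof.
move=> nu0; have mm (D : set R) : measurable_fun D (fun w => (mixw nu w)%:E).
 by apply/mEFinP/mfTS; exact: mmixw.
have -> : [set: R] = `]-oo, 0[%classic `|` `[0, +oo[%classic.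
 by apply/seteqP; split => // x _ /=; rewrite !in_itv/= andbT; apply/orP; case: ltP.
rewrite ge0_integral_setU//=; last 2 first.
- by move=> x _; rewrite lee_fin mixw_ge0.
- apply/disj_setPS => x /= []; rewrite !in_itv/= andbT => x0 x0'.
 by have := lt_le_trans x0 x0'; rewrite ltxx.
rewrite EFinD; apply: leeD; last first.
 by apply: le_trans (mixw_tail _ nu0) _; rewrite mulr0 expR0 div1r.
apply: integral_lim_itv => //; [exact: mmixw|exact: mixw_ge0|move=> n].
set K := expR (_ * ln _).
have mK : measurable_fun [set: R] (fun x => K * expR x). by apply: mfM.
apply: (@le_trans _ _ (\int[lebR R]_(x in `[(- n%:R)%R, 0%R]) (K * expR x)%:E)%E).
 apply: (@le_trans _ _ (\int[lebR R]_(x in `[(- n%:R)%R, 0%R]) (mixw nu x)%:E)%E).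
  apply: ge0_subset_integral => //.
  - exact: measurableI.
  - by move=> x _; rewrite lee_fin mixw_ge0.
  - by move=> x []/=; rewrite !in_itv/= => /ltW -> /andP[->]. apply: ge0_le_integral => //.
 - by move=> x _; rewrite lee_fin mixw_ge0.
 - by apply/mEFinP/mfTS.
 - by move=> x _; rewrite lee_fin mixw_le_neg.
rewrite integralZ_EFin ?expR_ge0//.
under eq_integral do rewrite -[X in expR X]mul1r.
rewrite integral_expRM ?oner_eq0// ?oppr_le0// -EFinM lee_fin !divr1 mulr0 expR0.
by rewrite ler_piMr ?expR_ge0// lerBlDr lerDl expR_ge0.
Qed.

(** On [0, 1] the double exponential costs at most a factor e^(-1/2), and the remaining exponential
    has mass at least 1 / (2 nu) there. *)
Lemma mixM_lower nu : 1 <= nu -> ((expR (- 2^-1) / (2 * nu))%:E <= \int[lebR R]_w (mixw nu w)%:E)%E.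
Proof.
move=> nu1; have nu0 : 0 < nu by exact: lt_le_trans nu1.
have mE : measurable_fun [set: R] (fun x => expR (- nu * x)).
 by apply: cont_mfun; exact: continuous_is_derive (is_derive_expRM _).
have key (x : R) : 0 <= x -> expR (- 2^-1) * expR (- nu * x) <= mixw nu x.
 move=> x0; rewrite -expRD ler_expR.
 have : expR (- 2 * x) <= 1 by rewrite -[leRHS]expR0 ler_expR; lra. lra.
apply: (@le_trans _ _ (\int[lebR R]_(x in `[0%R, 1%R]) (expR (- 2^-1) * expR (- nu * x))%:E)%E).
 rewrite integralZ_EFin ?expR_ge0//. rewrite integral_expRM//; last by rewrite oppr_eq0 gt_eqF.
 rewrite -EFinM lee_fin ler_wpM2l ?expR_ge0// mulr0 expR0 mulr1. have h : expR (- nu) <= 2^-1.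
  rewrite expRN lef_pV2 ?posrE ?expR_gt0//. apply: le_trans (expR_ge1Dx nu); lra.
 rewrite !invrN !mulrN opprK invfM addrC -mulrBl. apply: ler_wpM2r; [by rewrite invr_ge0 ltW|lra].
apply: (@le_trans _ _ (\int[lebR R]_(x in `[0%R, 1%R]) (mixw nu x)%:E)%E).
 apply: le_integral_EFin => //.
 - exact: mfM.
 - exact: mmixw.
 - by move=> x; rewrite /= in_itv/= => /andP[x0 _]; exact: key.
apply: ge0_subset_integral => //.
- by apply/mEFinP; exact: mmixw.
- by move=> x _; rewrite lee_fin mixw_ge0.
Qed.

Lemma mixME nu : 0 < nu -> (mixM nu)%:E = (\int[lebR R]_w (mixw nu w)%:E)%E.
Proof.
move=> nu0; rewrite fineK// ge0_fin_numE; last first.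
 by apply: integral_ge0 => x _; rewrite lee_fin mixw_ge0.
exact: le_lt_trans (mixM_bound nu0) (ltry _).
Qed.

Lemma mixM_gt0 nu : 1 <= nu -> 0 < mixM nu.
Proof.
move=> nu1; have nu0 : 0 < nu by exact: lt_le_trans nu1.
have := mixM_lower nu1; rewrite -mixME// lee_fin; apply: lt_le_trans.
by rewrite divr_gt0 ?expR_gt0// mulr_gt0.
Qed.

Variable d : nat.
Implicit Types x : 'rV[R]_d.

(** With c = ln(1 + |x|^2) / 2, the integrand is e^(-V(x)) times [mixw (d + nu)] shifted by c, up to
    a constant; the shift leaves the integral unchanged. *)
Lemma integral_mixw_gpdf nu x : 0 < nu -> (\int[lebR R]_w (mixw nu w * gpdf 0 (expR w) x)%:E =
 (normal_peak 1 ^+ d * mixM (d%:R + nu) * expR (- V_nu nu x))%:E)%E.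
Proof.
move=> nu0; set n := d%:R + nu; have n0 : 0 < n by rewrite ltr_wpDl.
have Q0 : 0 < 1 + sqnorm2 x. by rewrite ltr_pwDl//; apply: sumr_ge0 => i _; exact: sqr_ge0.
set K := normal_peak 1 ^+ d; set c := ln (1 + sqnorm2 x) / 2.
have K0 : 0 <= K by rewrite exprn_ge0// normal_peak_ge0.
have e w : mixw nu w * gpdf 0 (expR w) x = K * expR (- V_nu nu x) * mixw n (w + - c).
 rewrite gpdfE ?gt_eqF ?expR_gt0// subr0.
 have -> : normal_peak (expR w) = expR (- w) * normal_peak 1 :> R.
  rewrite /normal_peak -!mulrnAr [Num.sqrt (expR w ^+ 2 * _)]sqrtrM ?sqr_ge0//.
  by rewrite sqrtr_sqr ger0_norm ?expR_ge0// expr1n mul1r invfM expRN.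
 rewrite exprMn /mixw /V_nu -/n -/K -!expRM_natl. have -> : sqnorm2 x = expR (2 * c) - 1.
  by rewrite /c mulrC divfK ?lnK ?posrE// addrAC subrr add0r.
 have -> : expR (- 2 * (w + - c)) = expR (- 2 * w) * expR (2 * c).
  by rewrite -expRD; congr expR; ring. have -> : (expR (2 * w) *+ 2)^-1 = expR (- 2 * w) / 2 :> R.
  by rewrite -[X in X^-1]mulr_natr invfM -expRN; congr (expR _ * _); ring.
 rewrite [1 + _]addrC subrK expRK /n.
 transitivity (K * (expR (- nu * w - expR (- 2 * w) / 2) * expR (d%:R * - w) *
  expR (- (expR (2 * c) - 1) * (expR (- 2 * w) / 2)))); first by ring.
 move: (expR (2 * c)) (expR (- 2 * w)) => a b.
 by rewrite -[RHS]mulrA -!expRD; congr (_ * expR _); field.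
transitivity (\int[lebR R]_w ((K * expR (- V_nu nu x))%:E * (mixw n (w + - c))%:E)%E)%E.
 by apply: eq_integral => w _; rewrite e EFinM.
rewrite ge0_integralZl//; last 3 first.
- apply/mEFinP; apply: (mcompT (@mmixw n)). exact: mfD.
- by move=> w _; rewrite lee_fin mixw_ge0.
- by rewrite lee_fin mulr_ge0 ?expR_ge0.
rewrite (integral_lebR_shift _ (@continuous_mixw n) (@mixw_ge0 n)) -mixME// -EFinM.
by congr EFin; ring.
Qed.

Lemma measurable_V_nu nu : measurable_fun [set: 'rV[R]_d] (V_nu nu).
Proof.
apply: mfM => //; apply: mcompT; first exact: measurable_ln.
by apply: mfD => //; exact: msqnorm2.
Qed.

Lemma measurable_gpdf0_exp : mfunT (fun z : 'rV[R]_d * R => gpdf 0 (expR z.2) z.1).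
Proof.
rewrite (_ : (fun z => _) = (fun z : 'rV[R]_d * R =>
 (expR (- z.2) * normal_peak 1) ^+ d * expR (- sqnorm2 z.1 * (expR (- 2 * z.2) / 2)))).
 apply: mfM. apply: mfX; apply: mfM => //. by do 2 apply: mcompT => //.
 apply: mcompT => //; apply: mfM. apply: mcompT => //. by apply: msqnorm2; exact: mfst.
 apply: mfM => //; apply: mcompT => //. by apply: mfM => //; exact: msnd.
apply/funext => z; rewrite gpdfE ?gt_eqF ?expR_gt0// subr0; congr (_ ^+ _ * expR (_ * _)).
 rewrite /normal_peak -!mulrnAr [Num.sqrt (expR _ ^+ 2 * _)]sqrtrM ?sqr_ge0//.
 by rewrite sqrtr_sqr ger0_norm ?expR_ge0// expr1n mul1r invfM expRN.
by rewrite -[expR _ ^+ 2]expRM_natl mulNr expRN -mulr_natr invfM.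
Qed.

(** [is_gibbs] leaves the sign of its constant open; total mass 1 forces it to be nonnegative, and
    then sets extend to nonnegative functions. *)
Lemma gibbs_density nu (pi : probability 'rV[R]_d R) : is_gibbs (V_nu nu) pi ->
 exists2 c : R, 0 <= c & forall F : 'rV[R]_d -> \bar R, mfunT F -> (forall x, 0 <= F x)%E ->
 (\int[pi]_x F x = c%:E * \int[lebesgue_rV R d]_x (F x * (expR (- V_nu nu x))%:E))%E.
Proof.
move=> [c Hc].
have mV : measurable_fun [set: 'rV[R]_d] (fun x => (expR (- V_nu nu x))%:E).
 apply/mEFinP; apply: mcompT => //. by apply: mcompT => //; exact: measurable_V_nu.
have c0 : 0 <= c. rewrite leNgt; apply/negP => c0; have := Hc setT measurableT.
 rewrite probability_setT => h.
 have : ((1 : \bar R) <= 0)%E by rewrite h; apply: mule_le0_ge0; [rewrite lee_fin ltW|apply: integral_ge0 => x _; rewrite lee_fin expR_ge0].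
 by rewrite lee_fin ler10.
exists c => // F mF F0.
rewrite (@ge0_integral_density _ _ R pi (lebesgue_rV R d) (fun x => c * expR (- V_nu nu x)))//.
- rewrite -ge0_integralZl//; first by apply: eq_integral => x _; rewrite EFinM muleCA.
 + exact: emfunM.
 + by move=> x _; rewrite mule_ge0// lee_fin expR_ge0.
- by apply: mfM => //; exact/mEFinP.
- by move=> x; rewrite mulr_ge0 ?expR_ge0.
- move=> A mA; transitivity (c%:E * \int[lebesgue_rV R d]_(x in A) (expR (- V_nu nu x))%:E)%E; first exact: Hc.
 rewrite -ge0_integralZl//. exact: mfTS.
Qed.

Lemma gibbs_mixture nu (pi : probability 'rV[R]_d R) : 1 <= nu -> is_gibbs (V_nu nu) pi ->
 forall F : 'rV[R]_d -> \bar R, mfunT F -> (forall x, 0 <= F x)%E ->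
 (\int[pi]_x F x = (mixM nu)^-1%:E *
  \int[lebR R]_w ((mixw nu w)%:E * \int[gauss R d]_z F (expR w *: z)%R))%E.
Proof.
move=> nu1 /gibbs_density[c c0 Hpi]; have nu0 : 0 < nu by exact: lt_le_trans nu1.
have mV : measurable_fun [set: 'rV[R]_d] (fun x => (expR (- V_nu nu x))%:E).
 apply/mEFinP; apply: mcompT => //. by apply: mcompT => //; exact: measurable_V_nu.
set K := normal_peak 1 ^+ d * mixM (d%:R + nu).
have K0 : 0 < K. rewrite mulr_gt0 ?exprn_gt0 ?normal_peak_gt0//.
 by rewrite mixM_gt0// (le_trans nu1)// lerDr.
have mix F : measurable_fun [set: 'rV[R]_d] F -> (forall x, 0 <= F x)%E ->
  (K%:E * \int[lebesgue_rV R d]_x (F x * (expR (- V_nu nu x))%:E) =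
  \int[lebR R]_w ((mixw nu w)%:E * \int[gauss R d]_z F (expR w *: z)%R))%E. move=> mF F0.
 have m1 : mfunT (fun z : 'rV[R]_d * R => (F z.1 * (mixw nu z.2 * gpdf 0 (expR z.2) z.1)%:E)%E).
  apply: emfunM. by apply: mcompT => //; exact: mfst.
  apply/mEFinP; apply: mfM; last exact: measurable_gpdf0_exp.
  by apply: (mcompT (@mmixw nu)); exact: msnd. rewrite -ge0_integralZl//; last 3 first.
 - exact: emfunM.
 - by move=> x _; rewrite mule_ge0// lee_fin expR_ge0.
 - by rewrite lee_fin ltW.
 transitivity (\int[lebesgue_rV R d]_x \int[lebR R]_w (F x * (mixw nu w * gpdf 0 (expR w) x)%:E))%E.
  apply: eq_integral => x _; rewrite ge0_integralZl//; last 2 first.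
  - apply/mEFinP; apply: mfM; first exact: mmixw.
   exact: (mcompT measurable_gpdf0_exp (measurable_pair1 x)).
  - by move=> w _; rewrite lee_fin mulr_ge0 ?mixw_ge0 ?gpdf_ge0.
  by rewrite integral_mixw_gpdf// -/K EFinM muleCA.
 rewrite (@fubini_tonelli _ _ _ _ R (lebesgue_rV R d) (lebR R)
  (fun z : 'rV[R]_d * R => (F z.1 * (mixw nu z.2 * gpdf 0 (expR z.2) z.1)%:E)%E))//=; last first.
  by move=> z; rewrite mule_ge0// lee_fin mulr_ge0 ?mixw_ge0 ?gpdf_ge0. apply: eq_integral => w _.
 transitivity (\int[lebesgue_rV R d]_x ((mixw nu w)%:E * (F x * (gpdf 0 (expR w) x)%:E)))%E.
  by apply: eq_integral => x _; rewrite EFinM muleCA. rewrite ge0_integralZl//; last 3 first.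
 - by apply: emfunM => //; apply/mEFinP; exact: mgpdf.
 - by move=> x _; rewrite mule_ge0// lee_fin gpdf_ge0.
 - by rewrite lee_fin mixw_ge0.
 congr (_ * _)%E; rewrite -(@ge0_gauss_affine _ d 0 (expR w) F (expR_gt0 _) mF F0).
 by apply: eq_integral => z _; rewrite add0r.
(* Testing with F = 1 identifies the unknown normalising constant [c] as [K / mixM nu]. *)
have h1 : (c / K * mixM nu)%:E = 1%E.
 transitivity (c%:E * (K^-1%:E * (K%:E * \int[lebesgue_rV R d]_x (cst 1%E x * (expR (- V_nu nu x))%:E))))%E; last first.
  rewrite [X in (_ * X)%E]muleA -EFinM mulVf ?gt_eqF// mul1e -Hpi//.
  exact: (@integral_prob_cst _ _ R pi 1%E).
 rewrite mix// EFinM mixME// EFinM -muleA; congr (_ * (_ * _))%E.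
 by apply: eq_integral => w _; rewrite integral_prob_cst !mule1.
move=> F mF F0; rewrite Hpi//.
have -> : c = (mixM nu)^-1 * K.
 have := EFin_inj h1; have := gt_eqF K0; have := gt_eqF (mixM_gt0 nu1) => /negbT M0 /negbT k0 h2.
 apply: (mulIf M0); rewrite mulrAC mulVf// mul1r -[RHS]mulr1 -h2. by field.
by rewrite EFinM -muleA mix.
Qed.

End mixture.

(** * The drift map of one step *)

Section drift.
Context (R : realType) (d : nat).
Implicit Types x y v : 'rV[R]_d.

Definition dotp x y : R := \sum_(i < d) x ord0 i * y ord0 i.

Lemma sqnorm2_comb a b x y :
 sqnorm2 (a *: x + b *: y) = a ^+ 2 * sqnorm2 x + b ^+ 2 * sqnorm2 y + 2 * a * b * dotp x y.
Proof.
rewrite /sqnorm2 /dotp !mulr_sumr -!big_split/=; apply: eq_bigr => i _.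
by rewrite !mxE; ring.
Qed.

Lemma sqnorm2Z a x : sqnorm2 (a *: x) = a ^+ 2 * sqnorm2 x.
Proof. by rewrite /sqnorm2 mulr_sumr; apply: eq_bigr => i _; rewrite !mxE; ring. Qed.

Lemma sqnorm2B x y : sqnorm2 (x - y) = sqnorm2 x + sqnorm2 y - 2 * dotp x y.
Proof.
rewrite -[x in LHS]scale1r -scaleN1r sqnorm2_comb; ring.
Qed.

Lemma sqnorm2_subC x y : sqnorm2 (x - y) = sqnorm2 (y - x).
Proof. by rewrite -opprB -scaleN1r sqnorm2Z sqrrN expr1n mul1r. Qed.

Definition Qn x : R := 1 + sqnorm2 x.

Lemma Qn_ge1 x : 1 <= Qn x. Proof. by rewrite lerDl sqnorm2_ge0. Qed.
Lemma Qn_gt0 x : 0 < Qn x. Proof. exact: lt_le_trans (Qn_ge1 x). Qed.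
Lemma Qn_neq0 x : Qn x != 0. Proof. by rewrite gt_eqF// Qn_gt0. Qed.

(* The squared distance of the images of x and y under inversion is nonnegative. *)
Lemma sqr_sqnorm2_sub x y : (sqnorm2 x - sqnorm2 y) ^+ 2 <= sqnorm2 (x - y) * (Qn x * Qn y).
Proof.
have := sqnorm2_ge0 (Qn y *: x + (- Qn x) *: y).
rewrite sqnorm2_comb sqnorm2B /Qn -subr_ge0 => h; rewrite -subr_ge0.
pos.
Qed.

Lemma grad_V_nu nu x : grad (V_nu nu) x = ((d%:R + nu) / Qn x) *: x.
Proof.
apply/rowP => i; rewrite !mxE.
pose g (t : R) : R := (d%:R + nu) / 2 * ln (Qn x + 2 * t * x ord0 i + t ^+ 2).
have sE (t : R) : 1 + sqnorm2 (t *: delta_mx ord0 i + x) = Qn x + 2 * t * x ord0 i + t ^+ 2.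
 rewrite -[x in LHS]scale1r sqnorm2_comb /Qn. have -> : sqnorm2 (delta_mx ord0 i : 'rV[R]_d) = 1.
  rewrite /sqnorm2 (bigD1 i)//= mxE !eqxx expr1n big1 ?addr0// => j ji.
  by rewrite mxE (negbTE ji) andbF expr0n. have -> : dotp (delta_mx ord0 i) x = x ord0 i.
  rewrite /dotp (bigD1 i)//= mxE !eqxx mul1r big1 ?addr0// => j ji.
  by rewrite mxE (negbTE ji) andbF mul0r. ring.
have -> : 'D_(delta_mx ord0 i) (V_nu nu) x = 'D_1 g (0 : R).
 have h : (fun t : R => t^-1 *: ((V_nu nu \o shift x) (t *: delta_mx ord0 i) - V_nu nu x)) =
   (fun t : R => t^-1 *: ((g \o shift 0) (t *: (1 : R)) - g 0)).
  apply/funext => t /=; rewrite /V_nu sE /g /= /GRing.scale/= mulr1 addr0.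
  by rewrite mulr0 mul0r addr0 expr0n/= addr0. by rewrite /derive h.
have Q0 := Qn_gt0 x.
apply: derive_val.
have dl : is_derive (0 : R) (1 : R) (fun t : R => Qn x + 2 * t * x ord0 i + t ^+ 2) (2 * x ord0 i).
 by apply: is_derive_eq; rewrite /GRing.scale/=; ring.
have dln : is_derive (Qn x) (1 : R) (@ln R) (Qn x)^-1 by exact: is_derive1_ln.
have e0 : Qn x + 2 * 0 * x ord0 i + 0 ^+ 2 = Qn x by pos.
have dc : is_derive (0 : R) (1 : R) (@ln R \o (fun t : R => Qn x + 2 * t * x ord0 i + t ^+ 2)) ((Qn x)^-1 * (2 * x ord0 i)).
 by apply: is_derive1_comp; rewrite ?e0.
have -> : g = (fun t => (d%:R + nu) / 2 *: (@ln R \o (fun t : R => Qn x + 2 * t * x ord0 i + t ^+ 2)) t) by [].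
by apply: is_derive_eq; rewrite /GRing.scale/=; field; exact: Qn_neq0.
Qed.

(* One LMC step without the noise: x - h grad V(x) with c = h (d + nu). *)
Definition drift (c : R) x : 'rV[R]_d := (1 - c / Qn x) *: x.

Lemma driftE nu h x : x - h *: grad (V_nu nu) x = drift (h * (d%:R + nu)) x.
Proof. by rewrite grad_V_nu scalerA /drift scalerBl scale1r mulrA. Qed.

(** [V_nu] is not convex and the drift may expand. In the exact expansion, with X = [Qn x] and Y =
    [Qn y], the only expanding term is c (X - Y)^2 / (X Y) times a factor in [0, 1], and the
    inversion inequality [sqr_sqnorm2_sub] bounds it by c |x - y|^2. *)
Lemma drift_lip c x y : 0 <= c <= 1 -> sqnorm2 (drift c x - drift c y) <= (1 + c) * sqnorm2 (x - y).
Proof.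
move=> /andP[c0 c1]; rewrite /drift -[X in _ + X]scaleNr sqnorm2_comb.
have := sqr_sqnorm2_sub x y; have := sqnorm2B x y; have := sqnorm2_ge0 (x - y).
set D := dotp x y; set dl := sqnorm2 (x - y) => dl0 dlE h.
have Qx := Qn_ge1 x; have Qy := Qn_ge1 y.
have Qx0 := Qn_neq0 x; have Qy0 := Qn_neq0 y.
have -> : D = (sqnorm2 x + sqnorm2 y - dl) / 2 by pos.
have -> : sqnorm2 x = Qn x - 1 by rewrite /Qn addrC addKr.
have -> : sqnorm2 y = Qn y - 1 by rewrite /Qn addrC addKr.
have {}h : (Qn x - Qn y) ^+ 2 <= dl * (Qn x * Qn y).
 by move: h; rewrite /Qn; congr (_ ^+ 2 <= _); ring.
move: (Qn x) (Qn y) Qx Qy Qx0 Qy0 h => X Y X1 Y1 X0 Y0 h.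
have -> : (1 - c / X) ^+ 2 * (X - 1) + (- (1 - c / Y)) ^+ 2 * (Y - 1) +
  2 * (1 - c / X) * - (1 - c / Y) * ((X - 1 + (Y - 1) - dl) / 2) =
 (1 - c / X) * (1 - c / Y) * dl + c * ((X - Y) ^+ 2 / (X * Y)) * (1 - c / (X * Y)).
 by field; rewrite X0 Y0.
have Xp : 0 < X by pos.
have Yp : 0 < Y by pos.
have h2 : (X - Y) ^+ 2 / (X * Y) <= dl by rewrite ler_pdivrMr// mulr_gt0.
have cX : 0 <= c / X <= 1. apply/andP; split; first pos.
 by rewrite ler_pdivrMr// mul1r (le_trans c1).
have cY : 0 <= c / Y <= 1. apply/andP; split; first pos.
 by rewrite ler_pdivrMr// mul1r (le_trans c1).
have XY0 : 0 < X * Y by pos.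
have cXY : 0 <= c / (X * Y) <= 1. apply/andP; split; first pos.
 by rewrite ler_pdivrMr// mul1r (le_trans c1)// -[1]mulr1 ler_pM.
have h3 : 0 <= (X - Y) ^+ 2 / (X * Y) by rewrite divr_ge0 ?sqr_ge0// ltW.
rewrite [leRHS]mulrDl [1 * dl]mul1r; apply: lerD. rewrite ler_piMl// mulr_ile1//; try lra.
rewrite -mulrA ler_wpM2l// (le_trans _ h2)// ler_piMr//; lra.
Qed.

Lemma measurable_Qn : measurable_fun [set: 'rV[R]_d] Qn.
Proof. by apply: mfD => //; exact: msqnorm2. Qed.

Lemma measurable_drift c : measurable_fun [set: 'rV[R]_d] (drift c).
Proof.
apply: mrVZ => //; apply: mfB => //; apply: mfM => //.
rewrite (_ : (fun x => _) = (fun x => expR (- ln (Qn x)))).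
 apply: mcompT => //; apply: mcompT => //.
 by apply: mcompT; [exact: measurable_ln|exact: measurable_Qn].
by apply/funext => x; rewrite expRN lnK// posrE Qn_gt0.
Qed.

End drift.

(** * Gaussian means under a shift of the centre *)

Section gaussian_mean.
Context (R : realType) (d : nat).
Implicit Types (u : 'rV[R]_d) (f g : 'rV[R]_d -> R) (s : R).

Definition gE u s f : R := E (gauss R d) (fun z => f (u + s *: z)).

Lemma measurable_affine u s : measurable_fun [set: 'rV[R]_d] (fun z => u + s *: z).
Proof. mes. Qed.

Lemma bmf_affine u s f : bmf f -> bmf (fun z : 'rV[R]_d => f (u + s *: z)).
Proof.
move=> [mf [K fK]]; split; last by exists K.
exact: (mcompT mf (measurable_affine u s)).
Qed.

Lemma gpdf_gt0 u s y : 0 < s -> 0 < gpdf u s y.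
Proof.
move=> s0; rewrite gpdfE ?gt_eqF// mulr_gt0 ?expR_gt0// exprn_gt0//.
by apply: normal_peak_gt0; rewrite gt_eqF.
Qed.

Lemma gE_lebesgue u s f : 0 < s -> bmf f ->
 (lebesgue_rV R d).-integrable setT (EFin \o (fun y => f y * gpdf u s y)) /\
 (gE u s f)%:E = (\int[lebesgue_rV R d]_y (f y * gpdf u s y)%:E)%E.
Proof.
move=> s0 bf; have [mf [K fK]] := bf; have mp := @mgpdf _ _ u s.
have K0 : 0 <= K by exact: le_trans (fK 0).
have iK : (\int[lebesgue_rV R d]_y (K * gpdf u s y)%:E = K%:E)%E.
 rewrite integralZ_EFin// ?integral_gpdf ?mule1// => y; exact: gpdf_ge0.
have intK : (lebesgue_rV R d).-integrable setT (EFin \o (fun y => K * gpdf u s y)).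
 apply/integrableP; split; first by apply/mEFinP; exact: mfM.
 rewrite (eq_integral (fun y => (K * gpdf u s y)%:E)) ?iK ?ltry// => y _ /=.
 by rewrite ger0_norm// mulr_ge0 ?gpdf_ge0.
have intf : (lebesgue_rV R d).-integrable setT (EFin \o (fun y => f y * gpdf u s y)).
 apply: le_integrable intK => //; first by apply/mEFinP; exact: mfM.
 move=> y _ /=; rewrite lee_fin !normrM ler_wpM2r// (le_trans (fK y))//. exact: ler_norm.
split => //.
have bfK : bmf (fun y => f y + K) by apply: bmfD => //; exact: bmf_cst.
have fK0 y : 0 <= f y + K by have := fK y; rewrite ler_norml; lra.
have : (gE u s (fun y => f y + K))%:E = (\int[lebesgue_rV R d]_y ((f y + K) * gpdf u s y)%:E)%E.
 rewrite /gE EE; last exact: (bmf_affine u s bfK).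
 rewrite (@ge0_gauss_affine _ d u s (fun y => (f y + K)%:E))//. by apply/mEFinP; exact: bfK.1.
rewrite /gE ED ?E_cst; [|exact: bmf_affine|exact: bmf_cst].
under eq_integral do rewrite mulrDl EFinD.
rewrite integralD//= iK EFinD => /(congr1 (fun x => x - K%:E)%E).
by rewrite !addeK.
Qed.

(** Completing the square: p'^2 / p is the stated constant times the Gaussian density centred at 2
    u' - u. The value is one plus the chi-squared divergence. *)
Lemma integral_chi2 u u' s : 0 < s -> (\int[lebesgue_rV R d]_y (gpdf u' s y ^+ 2 / gpdf u s y)%:E =
 (expR (sqnorm2 (u' - u) / s ^+ 2))%:E)%E.
Proof.
move=> s0; have s0' : s != 0 by rewrite gt_eqF.
rewrite (eq_integral (fun y => (expR (sqnorm2 (u' - u) / s ^+ 2) * gpdf (2 *: u' - u) s y)%:E)).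
 rewrite integralZ_EFin ?expR_ge0// ?integral_gpdf ?mule1//; first exact: mgpdf. pos.
move=> y _; congr EFin; rewrite !gpdfE//.
have p0 : normal_peak s != 0 by rewrite gt_eqF// normal_peak_gt0.
rewrite exprMn -expRM_natl invfM -expRN.
rewrite mulrACA [X in _ = X]mulrCA -!expRD.
have -> : normal_peak s ^+ d ^+ 2 / normal_peak s ^+ d = normal_peak s ^+ d.
 by move: (expf_neq0 d p0) => k0; field.
congr (_ * expR _).
have : sqnorm2 (y - (2 *: u' - u)) = 2 * sqnorm2 (y - u') - sqnorm2 (y - u) + 2 * sqnorm2 (u' - u).
 rewrite /sqnorm2 !mulr_sumr -sumrB -big_split/=; apply: eq_bigr => i _. by rewrite !mxE; ring.
have -> : s ^+ 2 *+ 2 = s ^+ 2 * 2 by pos.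
move=> ->; move: (sqnorm2 (y - u')) (sqnorm2 (y - u)) (sqnorm2 (u' - u)) => a b c; clear -s0'.
by field.
Qed.

(** Cauchy-Schwarz for the centred function times sqrt(p) against (p' - p) / sqrt(p). Having the
    variance of [f] on the right, and not a sup norm, is what later lets a slope be paid for by a
    decrease of variance. *)
Lemma gE_chi2 u u' s f : 0 < s -> bmf f -> (gE u' s f - gE u s f) ^+ 2 <=
 (gE u s (fun y => f y ^+ 2) - gE u s f ^+ 2) * (expR (sqnorm2 (u' - u) / s ^+ 2) - 1).
Proof.
move=> s0 bf; set c := gE u s f; pose g y := f y - c.
have bc := @bmf_cst _ 'rV[R]_d R c.
have bg : bmf g by exact: bmfB.
have bg2 : bmf (fun y => g y ^+ 2) by exact: bmfX.
have mp v := @mgpdf _ _ v s.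
have gE0 v : gE v s g = gE v s f - c. rewrite /gE EB ?E_cst//; exact: bmf_affine.
have varE : gE u s (fun y => f y ^+ 2) - c ^+ 2 = gE u s (fun y => g y ^+ 2).
 rewrite /gE /g E_sqrB; last exact: bmf_affine. by rewrite -/(gE u s f) -/c subrr expr0n addr0.
rewrite varE -gE0.
pose p := gpdf u s; pose p' := gpdf u' s.
have p0 y : 0 < p y by exact: gpdf_gt0.
have p0' y : 0 < p' y by exact: gpdf_gt0.
have mq : mfunT (fun y => (Num.sqrt (p y))^-1).
 rewrite (_ : (fun y => _) = (fun y => expR (- ln (Num.sqrt (p y))))).
  apply: mcompT => //; apply: mcompT => //. apply: mcompT; first mes.
  by apply: mcompT; [exact: measurable_sqrtr|exact: mp].
 by apply/funext => y; rewrite expRN lnK// posrE sqrtr_gt0.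
pose F y := g y * Num.sqrt (p y); pose G y := (p' y - p y) / Num.sqrt (p y).
have mF : mfunT F. apply: mfM; first exact: bg.1.
 by apply: mcompT; [exact: measurable_sqrtr|exact: mp].
have mG : mfunT G. by apply: mfM => //; apply: mfB; exact: mp.
have := cauchy_schwarz_integral (lebesgue_rV R d) mF mG.
have -> : (\int[lebesgue_rV R d]_y (F y ^+ 2)%:E = (gE u s (fun y => g y ^+ 2))%:E)%E.
 rewrite (gE_lebesgue u s0 bg2).2; apply: eq_integral => y _; congr EFin.
 by rewrite /F exprMn sqr_sqrtr// ltW.
have -> : (\int[lebesgue_rV R d]_y (G y ^+ 2)%:E = (expR (sqnorm2 (u' - u) / s ^+ 2) - 1)%:E)%E.
 have mG2 : mfunT (fun y => G y ^+ 2) by exact: mfX.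
 (* The identity (p' - p)^2 / p + 2 p' = p'^2 / p + p keeps every integrand nonnegative. *)
 have : (\int[lebesgue_rV R d]_y (G y ^+ 2 + 2 * p' y)%:E =
     \int[lebesgue_rV R d]_y (p' y ^+ 2 / p y + p y)%:E)%E.
  apply: eq_integral => y _; congr EFin; rewrite /G exprMn exprVn sqr_sqrtr ?ltW//.
  by field; rewrite gt_eqF. have mr : mfunT (fun y => p' y ^+ 2 / p y).
  rewrite (_ : (fun y => _) = (fun y => p' y ^+ 2 * (Num.sqrt (p y))^-1 ^+ 2)).
   by apply: mfM; apply: mfX => //; exact: mp.
  by apply/funext => y; rewrite exprVn sqr_sqrtr// ltW. under eq_integral do rewrite EFinD.
 under [X in _ = X -> _]eq_integral do rewrite EFinD. rewrite ge0_integralD//=; last 4 first.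
 - pos.
 - mes.
 - by move=> y _; rewrite lee_fin mulr_ge0// ltW.
 - by apply/mEFinP; apply: mfM => //; exact: mp. rewrite ge0_integralD//=; last 4 first.
 - by move=> y _; rewrite lee_fin divr_ge0 ?sqr_ge0// ltW.
 - mes.
 - by move=> y _; rewrite lee_fin ltW.
 - by apply/mEFinP; exact: mp.
 rewrite integral_chi2// integral_gpdf// integralZ_EFin//; last 2 first.
 - exact: mp.
 - pos. rewrite integral_gpdf// mule1 => /(congr1 (fun x => x - 2%:E)%E).
 rewrite addeK// => ->; set a := expR _. by transitivity ((a + 1 - 2)%:E) => //; congr EFin; ring.
have h : (`|gE u' s g|%:E <= \int[lebesgue_rV R d]_y (`|F y * G y|)%:E)%E.
 have -> : gE u' s g = gE u' s g - gE u s g by rewrite (gE0 u) -/c subrr subr0.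
 have [i1 e1] := gE_lebesgue u s0 bg; have [i2 e2] := gE_lebesgue u' s0 bg.
 apply: (@le_trans _ _ (`|\int[lebesgue_rV R d]_y (g y * p' y - g y * p y)%:E|)%E).
  have -> : (\int[lebesgue_rV R d]_y (g y * p' y - g y * p y)%:E = (gE u' s g - gE u s g)%:E)%E.
   by under eq_integral do rewrite EFinB; rewrite integralB//= -e1 -e2. by [].
 apply: le_trans (le_abse_integral _ _ _) _ => //.
  apply/mEFinP; apply: mfB; apply: mfM => //; try exact: bg.1; exact: mp.
 apply: eq_ler; apply: eq_integral => y _. rewrite /F /G /=; congr (`|_|%:E).
 have : Num.sqrt (p y) != 0 by pos. by move=> q0; field.
move=> H; rewrite -lee_fin; apply: (@le_trans _ _ ((`|gE u' s g|%:E) ^+ 2)%E).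
 by rewrite -EFin_expe real_normK ?num_real.
by rewrite [leRHS]EFinM; apply: le_trans H; rewrite !expe2 lee_pmul.
Qed.

End gaussian_mean.

(** * Local slopes and their integrals along segments and rays *)

Section slope.
Context (R : realType).

(** Continuous induction: the supremum of the good points is good by [closed], and [step] moves
    beyond it unless it is [b]. *)
Lemma real_induction (P : R -> Prop) (a b : R) : a <= b -> P a ->
 (forall c, a <= c -> c < b -> P c -> exists t, [/\ c < t, t <= b & P t]) ->
 (forall c, a < c -> c <= b ->
  (forall e, 0 < e -> exists t, [/\ a <= t, c - e < t, t <= c & P t]) -> P c) -> P b.
Proof.
move=> ab Pa step closed.
pose S := [set t | [/\ a <= t, t <= b & P t]].
have Sa : S a by split.
have hS : has_sup S by split; [exists a|exists b => t []].
set c := sup S.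
have ac : a <= c by apply: sup_upper_bound.
have cb : c <= b by apply: ge_sup; [exists a|move=> t []].
have Pc : P c. move: ac; rewrite le_eqVlt => /predU1P[<-//|ac]; apply: closed => // e e0.
 have [t [at' tb Pt] ct] := sup_adherent e0 hS. by exists t; split => //; apply: sup_upper_bound.
move: cb; rewrite le_eqVlt => /predU1P[<-//|cb].
have [t [ct tb Pt]] := step c ac cb Pc.
have : t <= c by apply: sup_upper_bound => //; split => //; rewrite (le_trans ac)// ltW.
by rewrite leNgt ct.
Qed.

Lemma is_derive_exp2 (k x : R) :
 is_derive x (1 : R) (fun t => expR (k * t ^+ 2)) (2 * k * x * expR (k * x ^+ 2)).
Proof. by apply: is_derive_eq; rewrite /GRing.scale/=; ring. Qed.

(** First-order behaviour at 0 of the square root of the chi-squared divergence; it turns [gE_chi2]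
    into a slope. *)
Lemma sqrt_exp_small (kappa e : R) : 0 <= kappa -> 0 < e -> exists2 dl, 0 < dl &
 forall t, `|t| < dl -> Num.sqrt (expR (kappa ^+ 2 * t ^+ 2) - 1) <= (kappa + e) * `|t|.
Proof.
move=> k0 e0; pose r := (kappa + e) ^+ 2.
have kr : kappa ^+ 2 < r by rewrite /r ltrXn2r ?nnegrE ?addr_ge0// 1?ltW// ltrDl.
have [dl dl0 Hdl] : exists2 dl, 0 < dl & forall t : R, `|t| < dl -> kappa ^+ 2 * expR (kappa ^+ 2 * t ^+ 2) <= r.
 have : continuous (fun t : R => kappa ^+ 2 * expR (kappa ^+ 2 * t ^+ 2)).
  move=> t; apply: (@cvgM _ R); first exact: cvg_cst.
  exact: (continuous_is_derive (is_derive_exp2 (kappa ^+ 2))).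
 move=> /(_ 0) /cvgr_lt /(_ r); rewrite expr0n/= mulr0 expR0 mulr1 => /(_ kr).
 rewrite near_nbhs => /nbhs_ballP[dl /= dl0 H]; exists dl => // t tdl.
 by apply/ltW/H; rewrite /ball/= sub0r normrN.
exists dl => // t tdl.
have r0 : 0 <= (kappa + e) * `|t| by pos.
rewrite -(ger0_norm r0) -sqrtr_sqr ler_wsqrtr//.
have h : expR (kappa ^+ 2 * t ^+ 2) - 1 <= kappa ^+ 2 * t ^+ 2 * expR (kappa ^+ 2 * t ^+ 2).
 have := expR_ge1Dx (- (kappa ^+ 2 * t ^+ 2)); rewrite expRN.
 set z := expR _; have z0 : 0 < z by exact: expR_gt0. rewrite -(ler_pM2r z0) mulVf ?gt_eqF//; lra.
apply: le_trans h _; rewrite exprMn -/r real_normK ?num_real// mulrAC.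
by rewrite ler_wpM2r ?sqr_ge0// Hdl.
Qed.

(** A mean value inequality for functions with a pointwise slope bound and no derivative. Continuous
    induction carries the estimate with a linear slack e' (t - a), which pays for the local errors
    and is then sent to 0. *)
Lemma local_slope_integral (phi gam : R -> R) : continuous gam -> (forall x, 0 <= gam x) ->
 (forall x e, 0 < e -> exists2 dl, 0 < dl & forall y, `|y - x| < dl ->
  `|phi y - phi x| <= (gam x + e) * `|y - x|) -> forall a b, a <= b ->
 (`|phi b - phi a|%:E <= \int[lebR R]_(t in `[a, b[) (gam t)%:E)%E.
Proof.
move=> cg g0 H a b ab; apply/lee_addgt0Pr => e e0.
have mg : measurable_fun [set: R] gam by exact: cont_mfun.
pose I (t : R) := (\int[lebR R]_(r in `[a, t[) (gam r)%:E)%E.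
suff : (`|phi b - phi a|%:E <= I b + (e / (b - a + 1) * (b - a))%:E)%E.
 move=> h; apply: le_trans h _; rewrite leeD2l// lee_fin mulrAC ler_pdivrMr; last lra.
 by rewrite ler_pM2l//; lra.
set e' := e / (b - a + 1); have e'0 : 0 < e' by rewrite divr_gt0//; lra.
have IS c t : a <= c -> c <= t -> (I t = I c + \int[lebR R]_(r in `[c, t[) (gam r)%:E)%E.
 move=> ac ct; rewrite /I. have -> : `[a, t[%classic = `[a, c[%classic `|` `[c, t[%classic.
  apply/seteqP; split => r /=; rewrite !in_itv/=.
   by move=> /andP[ar rt]; have [rc|cr] := ltP r c; [left; rewrite ar|right; rewrite rt].
  by move=> [/andP[-> /lt_le_trans ->]//|/andP[cr ->]]; rewrite (le_trans ac).
 rewrite ge0_integral_setU//=.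
 - exact/mEFinP/mfTS.
 - pos.
 - apply/disj_setPS => r /= []; rewrite !in_itv/= => /andP[_ rc] /andP[cr _].
  by have := lt_le_trans rc cr; rewrite ltxx.
apply: (@real_induction (fun t => (`|phi t - phi a|%:E <= I t + (e' * (t - a))%:E)%E) a b) => //.
- rewrite subrr normr0 subrr mulr0 adde0; apply: integral_ge0 => r _. pos.
- move=> c ac cb Pc. have e10 : 0 < e' / 2 by pos. have [d1 d10 Hd1] := H c _ e10.
 have [d2 d20 Hd2] : exists2 d2, 0 < d2 & forall t : R, `|c - t| < d2 -> gam c - e' / 2 <= gam t.
  move: (cg c) => /cvgr_gt /(_ (gam c - e' / 2)). have h : gam c - e' / 2 < gam c by pos.
  move=> /(_ h); rewrite near_nbhs => /nbhs_ballP[d2 /= d20 Hd]; exists d2 => // t td.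
  by apply/ltW/Hd. pose dl := Num.min (Num.min d1 d2) (b - c) / 2.
 have dl0 : 0 < dl by rewrite divr_gt0// !lt_min d10 d20 subr_gt0.
 have [dl1 dl2 dlb] : [/\ dl < d1, dl < d2 & dl <= b - c].
  have m0 : 0 < Num.min (Num.min d1 d2) (b - c) by rewrite !lt_min d10 d20 subr_gt0.
  have m1 : Num.min (Num.min d1 d2) (b - c) <= d1 by rewrite !ge_min lexx.
  have m2 : Num.min (Num.min d1 d2) (b - c) <= d2 by rewrite !ge_min lexx !orbT.
  have m3 : Num.min (Num.min d1 d2) (b - c) <= b - c by rewrite ge_min lexx orbT.
  by rewrite /dl; split; lra. exists (c + dl); split; [by rewrite ltrDl|lra|].
 rewrite (IS c)//; last by rewrite lerDl ltW.
 have h1 : (((gam c - e' / 2) * dl)%:E <= \int[lebR R]_(r in `[c, (c + dl)%R[) (gam r)%:E)%E.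
  have [neg|pos] := leP (gam c - e' / 2) 0.
   apply: (@le_trans _ _ 0%E); first by rewrite lee_fin mulr_le0_ge0// ltW.
   by apply: integral_ge0 => r _; rewrite lee_fin.
  apply: (@le_trans _ _ (\int[lebR R]_(r in `[c, (c + dl)%R[) cst (gam c - e' / 2)%:E r)%E).
   rewrite integral_cst//= lebR_itvco; last by rewrite lerDl ltW.
   by rewrite -EFinM lee_fin [_ + dl]addrC addrK. apply: le_integral_EFin => //; first pos.
  move=> r; rewrite /= in_itv/= => /andP[cr rc]; apply: Hd2. by rewrite ler0_norm ?opprB; lra.
 have h2 : `|phi (c + dl) - phi c| <= (gam c + e' / 2) * dl.
  have := Hd1 (c + dl); rewrite [c + dl - c]addrC addKr gtr0_norm//; exact.
 have -> : c + dl - a = (c - a) + dl by ring. rewrite mulrDr EFinD addeACA.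
 apply: (@le_trans _ _ (`|phi c - phi a|%:E + `|phi (c + dl) - phi c|%:E)%E).
  have -> : phi (c + dl) - phi a = (phi c - phi a) + (phi (c + dl) - phi c) by ring.
  by rewrite -EFinD lee_fin ler_normD.
 apply: leeD => //; apply: (@le_trans _ _ (((gam c - e' / 2) * dl)%:E + (e' * dl)%:E)%E).
  rewrite -EFinD lee_fin; apply: le_trans h2 _. by apply: eq_ler; field. by rewrite leeD2r.
- move=> c ac cb Hc; apply/lee_addgt0Pr => eps eps0. have [d1 d10 Hd1] := H c _ ltr01.
 have gc1 : 0 < gam c + 1 by rewrite ltr_wpDl. pose dl := Num.min d1 (eps / (gam c + 1)).
 have dl0 : 0 < dl by rewrite lt_min d10 divr_gt0. have [t [at' ct tc Pt]] := Hc dl dl0.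
 have h1 : `|phi t - phi c| <= eps. have tdl : `|t - c| < dl by rewrite ler0_norm; lra.
  apply: le_trans (Hd1 t _) _; first by rewrite (lt_le_trans tdl)// ge_min lexx.
  rewrite mulrC -ler_pdivlMr// (le_trans (ltW tdl))// ge_min lexx orbT//.
 apply: (@le_trans _ _ (`|phi t - phi a|%:E + `|phi t - phi c|%:E)%E).
  have -> : phi c - phi a = (phi t - phi a) + (phi c - phi t) by ring.
  by rewrite -EFinD lee_fin [`|phi t - phi c|]distrC ler_normD. apply: leeD; last mes.
 apply: le_trans Pt _; apply: leeD.
  rewrite (IS t c)// leeDl//; apply: integral_ge0 => r _; by rewrite lee_fin.
 by rewrite lee_fin ler_pM2l// lerD2r.
Qed.

Variable d : nat.
Implicit Types (f A : 'rV[R]_d -> R) (x v : 'rV[R]_d).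

(** The pointwise form of [upper_gradient]. It is what can be checked on P g, and it integrates both
    along segments and along w -> e^w z. *)
Definition slope f A : Prop := (forall x v, continuous (fun t : R => A (x + t *: v))) /\
 (forall x v e, 0 < e -> exists2 dl, 0 < dl & forall t, `|t| < dl ->
  `|f (x + t *: v) - f x| <= (enorm v * A x + e) * `|t|).

Lemma slope_upper_gradient f A : (forall x, 0 <= A x) -> slope f A -> upper_gradient f A.
Proof.
move=> A0 [cA H] x v a b ab.
apply: (@local_slope_integral (fun t => f (x + t *: v)) (fun t => enorm v * A (x + t *: v))) => //.
- by move=> t; apply: (@cvgM _ R); [exact: cvg_cst|exact: cA].
- pos.
- move=> t e e0; have [dl dl0 Hdl] := H (x + t *: v) v e e0.
 exists dl => // y /Hdl; congr (`|f _ - _| <= _). by rewrite -addrA -scalerDl [t + _]addrC subrK.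
Qed.

(** The curve w -> e^w z, of speed e^w |z|, is the one along which the mixture varies its scale. *)
Lemma slope_radial f A z : (forall x, 0 <= A x) -> slope f A -> forall a b, a <= b ->
 (`|f (expR b *: z) - f (expR a *: z)|%:E <=
 \int[lebR R]_(w in `[a, b[) (expR w * enorm z * A (expR w *: z))%:E)%E.
Proof.
move=> A0 [cA H] a b ab.
apply: (@local_slope_integral (fun w => f (expR w *: z)) (fun w => expR w * enorm z * A (expR w *: z))) => //.
- move=> w; apply: (@cvgM _ R); first by apply: (@cvgM _ R); [exact: continuous_expR|exact: cvg_cst].
 have h : {for expR w, continuous (fun t : R => A (t *: z))}.
  have := cA 0 z (expR w); rewrite /continuous_at add0r.
  by under [in X in X -> _]eq_fun do rewrite add0r.
 have : {for w, continuous ((fun t : R => A (t *: z)) \o expR)}.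
  by apply: continuous_comp; [exact: continuous_expR|exact: h]. exact.
- pos.
move=> w e e0; set B := enorm z * A (expR w *: z).
have B0 : 0 <= B by pos.
have E0 := expR_gt0 w.
(* The error will be B e1 + e2 (e^w + e1); each term is at most e / 2. *)
pose e1 := e / (2 * (B + 1)); pose e2 := e / (2 * (expR w + e1)).
have e10 : 0 < e1 by pos.
have e20 : 0 < e2 by pos.
have [d1 d10 Hd1] := H (expR w *: z) z e2 e20.
have [d2 d20 Hd2] : exists2 d2, 0 < d2 & forall y, `|y - w| < d2 -> `|expR y - expR w| <= (expR w + e1) * `|y - w|.
 have /cvgr_lt /(_ (expR w + e1)) := @continuous_expR R w; rewrite ltrDl => /(_ e10).
 rewrite near_nbhs => /nbhs_ballP[d2 /= d20 Hd]; exists d2 => // y yw.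
 have ey : expR y <= expR w + e1 by apply/ltW/Hd; rewrite /ball/= distrC.
 have h1 : expR y - expR w <= expR y * (y - w). have := expR_ge1Dx (w - y); rewrite expRB => h.
  have : expR y * (1 + (w - y)) <= expR w by rewrite mulrC -ler_pdivlMr// expR_gt0. nra.
 have h2 : expR w * (y - w) <= expR y - expR w. have := expR_ge1Dx (y - w); rewrite expRB => h.
  have : expR w * (1 + (y - w)) <= expR y by rewrite mulrC -ler_pdivlMr// expR_gt0. nra.
 have [wy|yw'] := leP w y. rewrite !ger0_norm ?subr_ge0 ?ler_expR//; apply: le_trans h1 _.
  by rewrite ler_wpM2r ?subr_ge0. rewrite !ler0_norm ?subr_le0 ?ler_expR ?(ltW yw')//.
 have := ltW yw'; nra.
pose d3 := Num.min d2 (d1 / (expR w + e1)).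
have We1 : 0 < expR w + e1 by pos.
exists d3; first by rewrite lt_min d20 divr_gt0.
move=> y; rewrite lt_min => /andP[y2 y1]; have hy := Hd2 y y2.
have y3 : `|expR y - expR w| < d1. by apply: le_lt_trans hy _; rewrite mulrC -ltr_pdivlMr.
have := Hd1 _ y3; rewrite -scalerDl (addrC (expR w)) subrK -/B => h; apply: le_trans h _.
apply: (@le_trans _ _ ((B + e2) * ((expR w + e1) * `|y - w|))).
 by rewrite ler_wpM2l// addr_ge0// ltW.
rewrite mulrA ler_wpM2r//.
have b1 : B * e1 <= e / 2. rewrite /e1 mulrA ler_pdivrMr ?mulr_gt0 ?ltr_wpDl//.
 have -> : e / 2 * (2 * (B + 1)) = B * e + e by field. by rewrite lerDl ltW.
have b2 : e2 * (expR w + e1) = e / 2 by rewrite /e2; field; rewrite gt_eqF.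
rewrite -mulrA -/B mulrDl b2 mulrDr; lra.
Qed.

End slope.

(** * Smoothing by one LMC step *)

Section lmc_operator.
Context (R : realType) (d : nat) (c s : R).
Hypothesis (c01 : 0 <= c <= 1) (s0 : 0 < s).
Implicit Types (f g : 'rV[R]_d -> R) (x y v : 'rV[R]_d).

Definition lmcP g x : R := gE (drift c x) s g.

(** The variance of [g] after one step from [x]; if [pi] were invariant, its mean under [pi] would
    be exactly the variance lost in the step. *)
Definition lvar g x : R := gE (drift c x) s (fun y => g y ^+ 2) - gE (drift c x) s g ^+ 2.

Lemma bmf_lmcP g : bmf g -> bmf (lmcP g).
Proof.
move=> [mg [K gK]]; apply: (@bmf_E2 _ _ _ _ R (gauss R d) (fun z => g (drift c z.1 + s *: z.2))).
split; last by exists K => z.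
apply: (mcompT mg); apply: mrVD. by apply: (mcompT (@measurable_drift R d c)); exact: mfst.
mes.
Qed.

Lemma lvar_ge0 g x : bmf g -> 0 <= lvar g x.
Proof. by move=> bg; rewrite subr_ge0; apply: sqr_E_le; exact: bmf_affine. Qed.

Lemma lvar_le g K x : bmf g -> (forall y, `|g y| <= K) -> lvar g x <= K ^+ 2.
Proof.
move=> bg gK; rewrite lerBlDr (@le_trans _ _ (K ^+ 2))//; last by rewrite lerDl sqr_ge0.
rewrite -[leRHS](E_cst (gauss R d)); apply: le_E.
- exact: (@bmf_affine _ _ _ s (fun y => g y ^+ 2) (bmfX 2 bg)).
- exact: bmf_cst.
- move=> z; rewrite -real_normK ?num_real// lerXn2r ?nnegrE//. exact: le_trans (gK 0).
Qed.

Lemma bmf_lvar g : bmf g -> bmf (lvar g).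
Proof.
move=> bg; have bg2 := bmfX 2 bg.
by apply: bmfB; [exact: (bmf_lmcP bg2)|exact/bmfX/bmf_lmcP].
Qed.

Lemma drift_line x v (t t' : R) : sqnorm2 (drift c (x + t' *: v) - drift c (x + t *: v)) / s ^+ 2 <=
 (enorm v * ((1 + c) / s)) ^+ 2 * (t' - t) ^+ 2.
Proof.
have h : x + t' *: v - (x + t *: v) = (t' - t) *: v by rewrite opprD addrACA subrr add0r scalerBl.
have [c0 c1] := andP c01.
rewrite ler_pdivrMr ?exprn_gt0//; apply: le_trans (drift_lip _ _ c01) _.
rewrite h sqnorm2Z !exprMn sqr_sqrtr ?sqnorm2_ge0// exprVn.
have -> : sqnorm2 v * ((1 + c) ^+ 2 / s ^+ 2) * (t' - t) ^+ 2 * s ^+ 2 =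
 (1 + c) ^+ 2 * ((t' - t) ^+ 2 * sqnorm2 v) by field; rewrite gt_eqF.
apply: ler_wpM2r; first pos.
rewrite expr2 ler_peMl//; lra.
Qed.

Lemma lmcP_slope g x v (t t' : R) : bmf g ->
 `|lmcP g (x + t' *: v) - lmcP g (x + t *: v)| <= Num.sqrt (lvar g (x + t *: v)) *
  Num.sqrt (expR ((enorm v * ((1 + c) / s)) ^+ 2 * (t' - t) ^+ 2) - 1).
Proof.
move=> bg; rewrite -sqrtrM ?lvar_ge0// -sqrtr_sqr ler_wsqrtr//.
apply: le_trans (gE_chi2 _ _ s0 bg) _; apply: ler_wpM2l; first exact: (lvar_ge0 _ bg).
by rewrite lerB// ler_expR drift_line.
Qed.

Lemma lmcP_line_continuous g x v : bmf g -> continuous (fun t : R => lmcP g (x + t *: v)).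
Proof.
move=> bg t; have [mg [K gK]] := bg; pose k := enorm v * ((1 + c) / s).
have [c0 c1] := andP c01.
have k0 : 0 <= k by pos.
have K0 : 0 <= K by exact: le_trans (gK 0).
have [dl dl0 Hdl] := sqrt_exp_small k0 ltr01.
apply/cvgrPdist_lt => e e0; apply/nbhs_ballP.
have C0 : 0 < (K + 1) * (k + 1) by rewrite mulr_gt0// ltr_wpDl.
exists (Num.min dl (e / ((K + 1) * (k + 1)))) => /=; first by rewrite lt_min dl0 divr_gt0.
move=> r; rewrite /ball/= lt_min => /andP[r1 r2].
rewrite distrC; apply: le_lt_trans (lmcP_slope _ _ _ _ bg) _.
rewrite -/k; apply: (@le_lt_trans _ _ (K * ((k + 1) * `|r - t|))).
 apply: ler_pM; rewrite ?sqrtr_ge0//.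
  by rewrite -[leRHS]ger0_norm// -sqrtr_sqr ler_wsqrtr// lvar_le. by apply: Hdl; rewrite distrC.
move: r2; rewrite ltr_pdivlMr// mulrC distrC; apply: le_lt_trans.
by rewrite -mulrA ler_wpM2r// ?mulr_ge0 ?addr_ge0// lerDl.
Qed.

Lemma lvar_line_continuous g x v : bmf g -> continuous (fun t : R => lvar g (x + t *: v)).
Proof.
move=> bg t; have c2 := @lmcP_line_continuous _ x v (bmfX 2 bg).
have c1 := @lmcP_line_continuous _ x v bg.
by apply: (@cvgB _ R^o); [exact: (c2 t)|apply: (@cvgM _ R); exact: (c1 t)].
Qed.

(** Moving the start by t moves the centre of the Gaussian by at most (1 + c) |t| |v|, so [gE_chi2]
    and [sqrt_exp_small] bound the slope by (1 + c) / s times the local standard deviation, for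
    every bounded measurable [g]. *)
Lemma slope_lmcP g : bmf g -> slope (lmcP g) (fun x => (1 + c) / s * Num.sqrt (lvar g x)).
Proof.
move=> bg; have [c0 c1] := andP c01.
have cs0 : 0 <= (1 + c) / s by pos.
split=> [x v t|x v e e0]. apply: (@cvgM _ R); first exact: cvg_cst.
 have : {for t, continuous (Num.sqrt \o (fun t : R => lvar g (x + t *: v)))}.
  by apply: continuous_comp; [exact: lvar_line_continuous|exact: sqrt_continuous]. exact.
have k0 : 0 <= enorm v * ((1 + c) / s) by pos.
have V1 : 0 < Num.sqrt (lvar g x) + 1 by pos.
have [dl dl0 Hdl] := sqrt_exp_small k0 (divr_gt0 e0 V1).
exists dl => // t /Hdl ht.
have := lmcP_slope x v 0 t bg; rewrite scale0r addr0 subr0 => h; apply: le_trans h _.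
apply: (@le_trans _ _ (Num.sqrt (lvar g x) * ((enorm v * ((1 + c) / s) + e / (Num.sqrt (lvar g x) + 1)) * `|t|))).
 by rewrite ler_wpM2l ?sqrtr_ge0.
rewrite mulrA ler_wpM2r// mulrDr lerD//; first pos.
by rewrite mulrCA ler_piMr ?(ltW e0)// ler_pdivrMr// mul1r lerDl.
Qed.

End lmc_operator.

Ltac mes_step k ::= first [ apply: mrVD; k tt | apply: mrVZ; k tt | apply: measurable_rVN; k tt
 | apply: msqnorm2; k tt | exact: mgpdf | exact: measurable_normal_pdf
 | apply: (mcompT (@measurable_drift _ _ _)); k tt | apply: (mcompT (@measurable_sqrtr _)); k tt
 | exact: mmixw ].
Ltac pos_step k ::= first
 [ exact: gpdf_ge0 | exact: normal_pdf_ge0 | exact: normal_peak_ge0 | exact: sqnorm2_ge0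
 | exact: Qn_gt0 | exact: mixw_ge0 ].

(** * The weak Poincare inequality for the target *)

Section weak_poincare.
Context (R : realType) (d : nat) (nu : R).
Hypothesis nu1 : 1 <= nu.
Let nu0 : 0 < nu. Proof. exact: lt_le_trans nu1. Qed.
Implicit Types (f A : 'rV[R]_d -> R) (pi : probability 'rV[R]_d R).

Lemma measurable_enorm dT (T : measurableType dT) (F : T -> 'rV[R]_d) :
 mfunT F -> mfunT (fun x => enorm (F x)).
Proof.
move=> mF; apply: (mcompT (@measurable_sqrtr R)).
mes.
Qed.

Definition radial f (w : R) : R := E (gauss R d) (fun z => f (expR w *: z)).

Lemma bmf_scale f (a : R) : bmf f -> bmf (fun z : 'rV[R]_d => f (a *: z)).
Proof.
move=> bf; have := bmf_affine 0 a bf.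
by under eq_fun do rewrite add0r.
Qed.

Lemma bmf_radial f : bmf f -> bmf (radial f).
Proof.
move=> [mf [K fK]]; apply: (@bmf_E2 _ _ _ _ R (gauss R d) (fun z => f (expR z.1 *: z.2))).
split; last by exists K => z.
apply: (mcompT mf); apply: mrVZ; last mes.
by apply: mcompT.
Qed.

Lemma gibbs_radial pi f : is_gibbs (V_nu nu) pi -> bmf f -> (forall x, 0 <= f x) ->
 (mixM nu * E pi f)%:E = (\int[lebR R]_w (mixw nu w * radial f w)%:E)%E.
Proof.
move=> gpi bf f0; rewrite EFinM [X in (_ * X)%E]EE// (gibbs_mixture nu1 gpi); last 2 first.
- by apply/mEFinP; exact: bf.1.
- pos.
rewrite muleA -EFinM mulfV ?mul1e; last by rewrite gt_eqF// mixM_gt0.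
by apply: eq_integral => w _; rewrite EFinM EE//; exact: bmf_scale.
Qed.

(** The Gaussian Poincare inequality at scale e^w; the factor e^(2 w) is unbounded over the mixture,
    which forces the cutoff at scale [S]. *)
Lemma radial_var_le f A w : bmf f -> bmf A -> (forall x, 0 <= A x) -> upper_gradient f A ->
 radial (fun x => f x ^+ 2) w - radial f w ^+ 2 <=
 d%:R * (expR w ^+ 2 * radial (fun x => A x ^+ 2) w).
Proof.
move=> bf bA A0 ug; have E0 := expR_ge0 w.
have bA2 := bmfX 2 bA.
rewrite -[expR w ^+ 2 * _](EZ _ _ (bmf_scale (expR w) bA2)).
have -> : (fun z : 'rV[R]_d => expR w ^+ 2 * A (expR w *: z) ^+ 2) = (fun z => (expR w * A (expR w *: z)) ^+ 2).
 by apply/funext => z; rewrite exprMn.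
apply: (@gauss_poincare R d (fun z => f (expR w *: z)) (fun z => expR w * A (expR w *: z))).
- exact: bmf_scale.
- by apply: bmfM; [exact: bmf_cst|exact: bmf_scale].
- pos.
move=> x v a b ab; have := ug (expR w *: x) (expR w *: v) a b ab.
rewrite !scalerDr !scalerA ![expR w * _]mulrC => h; apply: le_trans h _.
apply: eq_ler; apply: eq_integral => r _; congr EFin.
rewrite /enorm sqnorm2Z sqrtrM ?sqr_ge0// sqrtr_sqr ger0_norm//.
by rewrite scalerDr !scalerA ![expR w * _]mulrC; ring.
Qed.

Definition radial_slope A w : R := expR w * Num.sqrt (d%:R * radial (fun x => A x ^+ 2) w).

Lemma radial_slope_sqr A w : bmf A ->
 radial_slope A w ^+ 2 = expR w ^+ 2 * (d%:R * radial (fun x => A x ^+ 2) w).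
Proof.
move=> bA; rewrite exprMn sqr_sqrtr// mulr_ge0//.
by apply: E_ge0 => z; exact: sqr_ge0.
Qed.

Lemma radial_slope_ge0 A w : 0 <= radial_slope A w.
Proof. pos. Qed.

Lemma measurable_radial_slope A : bmf A -> mfunT (radial_slope A).
Proof.
move=> bA; apply: mfM => //.
apply: mcompT; first exact: measurable_sqrtr.
by apply: mfM => //; exact: (bmf_radial (bmfX 2 bA)).1.
Qed.

(** At z the radial slope is e^w |z| A(e^w z); averaging over z and Cauchy-Schwarz with E |z|^2 <= d
    gives [radial_slope]. *)
Lemma radial_increment f A a b : bmf f -> bmf A -> (forall x, 0 <= A x) -> slope f A -> a <= b ->
 (`|radial f b - radial f a|%:E <= \int[lebR R]_(w in `[a, b[) (radial_slope A w)%:E)%E.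
Proof.
move=> bf bA A0 sl ab; rewrite /radial -EB; [|exact: bmf_scale|exact: bmf_scale].
pose g (z : 'rV[R]_d) := f (expR b *: z) - f (expR a *: z).
have bg : bmf g by apply: bmfB; exact: bmf_scale.
have mA : mfunT A by exact: bA.1.
pose F (z : 'rV[R]_d * R) := expR z.2 * enorm z.1 * A (expR z.2 *: z.1).
have F0 z : 0 <= F z by pos.
have mF : mfunT F. apply: mfM; first apply: mfM.
 - by apply: mcompT => //; exact: msnd.
 - by apply: measurable_enorm; exact: mfst.
 - apply: (mcompT mA); apply: mrVZ; last mes. by apply: mcompT => //; exact: msnd.
have mF2 : mfunT (fun z : 'rV[R]_d * R => ((fun w => (F (z.1, w))%:E) \_ `[a, b[) z.2)%E.
 rewrite (_ : (fun z => _) = (fun z : 'rV[R]_d * R => if (a <= z.2 < b) then (F z)%:E else 0%E)).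
  apply: measurable_fun_ifT => //; last mes.
  by apply: measurable_and; [apply: measurable_fun_ler|apply: measurable_fun_ltr].
 by apply/funext => -[x w]; rewrite patchE mem_setE in_itv/=.
have F20 (z : 'rV[R]_d * R) : (0 <= ((fun w => (F (z.1, w))%:E) \_ `[a, b[) z.2)%E.
 by rewrite patchE; case: ifP => // _; rewrite lee_fin.
apply: (@le_trans _ _ (\int[gauss R d]_z (`|g z|)%:E)%E).
 by rewrite -EE ?lee_fin ?ler_norm_E//; exact: bmf_norm.
apply: (@le_trans _ _ (\int[gauss R d]_z \int[lebR R]_(w in `[a, b[) (F (z, w))%:E)%E).
 apply: ge0_le_integral => //.
 - by apply/mEFinP; apply: mcompT => //; exact: bg.1.
 - under eq_fun do rewrite integral_mkcond. exact: (@mfubini_F _ _ _ _ R (lebR R) _ mF2 F20).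
 - by move=> z _; exact: (slope_radial z A0 sl ab).
under eq_integral do rewrite integral_mkcond.
rewrite [X in (_ <= X)%E]integral_mkcond.
rewrite (@fubini_tonelli _ _ _ _ R (gauss R d) (lebR R) _ mF2 F20)/=.
apply: ge0_le_integral => //.
- by move=> w _; apply: integral_ge0 => z _; exact: (F20 (z, w)).
- exact: (@measurable_fun_fubini_tonelli_G _ _ _ _ R (gauss R d) _ mF2 F20).
- apply/(measurable_restrictT _ _).1 => //; apply/mEFinP/mfTS. exact: measurable_radial_slope.
move=> w _; rewrite patchE; case: ifPn => wab; last first.
 by rewrite integral0_eq// => z _; rewrite patchE (negbTE wab).
under eq_integral do rewrite patchE wab.
rewrite /F /=.
have -> : (\int[gauss R d]_x (expR w * enorm x * A (expR w *: x))%:E =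
 (expR w)%:E * \int[gauss R d]_x (`|enorm x * A (expR w *: x)|)%:E)%E.
 have mm : mfunT (fun x : 'rV[R]_d => `|enorm x * A (expR w *: x)|).
  apply: mcompT => //; apply: mfM; last exact: (bmf_scale _ bA).1. exact: measurable_enorm.
 rewrite -integralZ_EFin ?expR_ge0//. apply: eq_integral => x _; rewrite ger0_norm ?mulrA//. pos.
rewrite /radial_slope EFinM lee_pmul2l//; last first. pos.
have me : mfunT (@enorm R d) by exact: measurable_enorm.
have := cauchy_schwarz_integral (gauss R d) me (bmf_scale (expR w) bA).1.
set I := (\int[_]_x _)%E.
have -> : (\int[gauss R d]_x (enorm x ^+ 2)%:E = \int[gauss R d]_x (sqnorm2 x)%:E)%E.
 by apply: eq_integral => x _; rewrite sqr_sqrtr ?sqnorm2_ge0.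
have -> : (\int[gauss R d]_x (A (expR w *: x) ^+ 2)%:E = (radial (fun x => A x ^+ 2) w)%:E)%E.
 by rewrite -EE//; exact: (bmf_scale _ (bmfX 2 bA)).
move=> h; have r0 : 0 <= radial (fun x => A x ^+ 2) w by apply: E_ge0 => z; exact: sqr_ge0.
have {}h : (I ^+ 2 <= (d%:R * radial (fun x => A x ^+ 2) w)%:E)%E.
 apply: le_trans h _; rewrite EFinM; apply: lee_wpmul2r; last exact: gauss_second_moment. pos.
have I0 : (0 <= I)%E by apply: integral_ge0 => x _; rewrite lee_fin.
move: I0 h; case: I => [i| |]; rewrite ?expe2//.
- rewrite lee_fin -EFinM !lee_fin => i0 h. by rewrite -[i]ger0_norm// -sqrtr_sqr ler_wsqrtr.
Qed.

(** [m] is the mode: the derivative of [mixw nu] is (e^(-2 w) - nu) [mixw nu], and e^(-2 m) = nu. On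
    each side |x - m| <= C |e^(-2 x) - nu|, and the right-hand side integrates to at most C
    [mixw nu t]. To the right of [m] the derivative saturates at nu while x - m grows, so C is
    linear in the cutoff [r]. *)
Lemma mixw_hardy r : 0 <= r -> let m := - (ln nu / 2) in let C := (1 + 2 * (r - m)) / (2 * nu) in
 (forall t, m <= t -> t <= r ->
  (\int[lebR R]_(x in `[t, r]) ((x - m) * mixw nu x)%:E <= (C * mixw nu t)%:E)%E) /\
 (forall l t, l <= t -> t <= m ->
  (\int[lebR R]_(x in `[l, t]) ((m - x) * mixw nu x)%:E <= (C * mixw nu t)%:E)%E).
Proof.
move=> r0 m C; have m0 : m <= 0 by rewrite oppr_le0 divr_ge0// ln_ge0.
have L0 : 0 <= r - m by lra.
have C0 : 0 <= C by pos.
have em : expR (- 2 * m) = nu by rewrite /m mulNr mulrN opprK mulrCA mulfV// mulr1 lnK.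
have e2 x : expR (- 2 * x) = nu * expR (2 * (m - x)). by rewrite -em -expRD; congr expR; ring.
have mG (G : R -> R) : continuous G -> mfunT (fun x => G x * mixw nu x).
 move=> cG; apply: mfM; last exact: mmixw. exact: cont_mfun.
have cexp : continuous (fun x : R => expR (- 2 * x)) by exact: continuous_is_derive (is_derive_expRM _).
split=> [t mt tr|l t lt tm].
- have dF x : is_derive x (1 : R) (fun y => - mixw nu y) ((nu - expR (- 2 * x)) * mixw nu x).
  have h := is_derive_mixw nu x; apply: is_derive_eq; ring.
 have q0 x : m <= x -> 0 <= nu - expR (- 2 * x).
  move=> mx; rewrite e2 subr_ge0 -[leRHS]mulr1 ler_pM2l// -[leRHS]expR0 ler_expR; lra.
 apply: (@le_trans _ _ (\int[lebR R]_(x in `[t, r]) (C * (`|nu - expR (- 2 * x)| * mixw nu x))%:E)%E).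
  apply: ge0_le_integral => //.
  + move=> x /=; rewrite in_itv/= => /andP[tx _]; rewrite lee_fin mulr_ge0 ?mixw_ge0// subr_ge0.
   exact: le_trans mt tx.
  + apply/mEFinP/mfTS; apply: mG => x. by apply: (@cvgB _ R^o); [exact: cvg_id|exact: cvg_cst].
  + apply/mEFinP/mfTS; apply: mfM => //; apply: mG => x.
   apply: (@cvg_norm _ R^o); apply: (@cvgB _ R^o); [exact: cvg_cst|exact: cexp].
  + move=> x /=; rewrite in_itv/= => /andP[tx xr]; rewrite lee_fin mulrA.
   have mx := le_trans mt tx. rewrite ler_wpM2r ?mixw_ge0// ger0_norm ?q0// e2.
   have -> : expR (2 * (m - x)) = (expR (2 * (x - m)))^-1 by rewrite -expRN; congr expR; ring.
   set u := x - m; have u0 : 0 <= u by rewrite subr_ge0. have ur : u <= r - m by rewrite lerD2r.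
   have h : (expR (2 * u))^-1 <= (1 + 2 * u)^-1. rewrite lef_pV2 ?posrE ?expR_gt0//; last lra.
    exact: expR_ge1Dx. apply: (@le_trans _ _ (C * (nu - nu * (1 + 2 * u)^-1))); last first.
    by rewrite ler_wpM2l// lerB// ler_pM2l. have u2 : 1 + 2 * u != 0 by pos.
   have -> : C * (nu - nu * (1 + 2 * u)^-1) = (1 + 2 * (r - m)) / (1 + 2 * u) * u.
    by rewrite /C; field; rewrite u2 gt_eqF. by rewrite ler_peMl// ler_pdivlMr ?mul1r; lra.
 have mm : mfunT (fun x : R => `|nu - expR (- 2 * x)| * mixw nu x).
  by apply: mG => x; apply: (@cvg_norm _ R^o); apply: (@cvgB _ R^o); [exact: cvg_cst|exact: cexp].
 rewrite integralZ_EFin//; last pos.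
 rewrite (_ : (\int[lebR R]_(x in `[t, r]) _ = \int[lebR R]_(x in `[t, r]) ((nu - expR (- 2 * x)) * mixw nu x)%:E)%E); last first.
  apply: eq_integral => x; rewrite mem_setE in_itv/= => /andP[tx _].
  by rewrite ger0_norm// q0// (le_trans mt).
 rewrite (@integral_derive_lebR _ (fun y => - mixw nu y))//.
 + rewrite -EFinM lee_fin ler_wpM2l// opprK addrC lerBlDr lerDl; exact: mixw_ge0.
 + move=> x _; apply: (@cvgM _ R); last exact: continuous_mixw.
  by apply: (@cvgB _ R^o); [exact: cvg_cst|exact: cexp].
 + move=> x; rewrite in_itv/= => /andP[tx _]; rewrite mulr_ge0 ?mixw_ge0// q0//. exact: le_trans tx.
- have q0 x : x <= m -> 2 * nu * (m - x) <= expR (- 2 * x) - nu. move=> xm; rewrite e2.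
  have := expR_ge1Dx (2 * (m - x)); rewrite -(ler_pM2l nu0); lra.
 apply: (@le_trans _ _ (\int[lebR R]_(x in `[l, t]) (C * (`|expR (- 2 * x) - nu| * mixw nu x))%:E)%E).
  apply: ge0_le_integral => //.
  + move=> x /=; rewrite in_itv/= => /andP[_ xt]; rewrite lee_fin mulr_ge0 ?mixw_ge0// subr_ge0.
   exact: le_trans xt tm.
  + apply/mEFinP/mfTS; apply: mG => x. by apply: (@cvgB _ R^o); [exact: cvg_cst|exact: cvg_id].
  + apply/mEFinP/mfTS; apply: mfM => //; apply: mG => x.
   apply: (@cvg_norm _ R^o); apply: (@cvgB _ R^o); [exact: cexp|exact: cvg_cst].
  + move=> x /=; rewrite in_itv/= => /andP[_ xt]; rewrite lee_fin mulrA. have xm := le_trans xt tm.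
   rewrite ler_wpM2r ?mixw_ge0//; apply: le_trans (ler_wpM2l C0 (ler_norm _)).
   apply: (@le_trans _ _ ((2 * nu)^-1 * (2 * nu * (m - x)))).
    by rewrite mulKf// gt_eqF// mulr_gt0. apply: (@le_trans _ _ (C * (2 * nu * (m - x)))).
    rewrite ler_wpM2r ?mulr_ge0 ?(ltW nu0) ?subr_ge0// /C ler_peMl ?invr_ge0 ?mulr_ge0 ?(ltW nu0)//.
    lra. by rewrite ler_wpM2l// q0.
 have mm : mfunT (fun x : R => `|expR (- 2 * x) - nu| * mixw nu x).
  by apply: mG => x; apply: (@cvg_norm _ R^o); apply: (@cvgB _ R^o); [exact: cexp|exact: cvg_cst].
 rewrite integralZ_EFin//; last pos. have q1 x : x <= t -> 0 <= expR (- 2 * x) - nu.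
  move=> xt; apply: le_trans (q0 x (le_trans xt tm)).
  by rewrite mulr_ge0 ?mulr_ge0 ?(ltW nu0)// subr_ge0 (le_trans xt).
 rewrite (_ : (\int[lebR R]_(x in `[l, t]) _ = \int[lebR R]_(x in `[l, t]) ((expR (- 2 * x) - nu) * mixw nu x)%:E)%E); last first.
  by apply: eq_integral => x; rewrite mem_setE in_itv/= => /andP[_ xt]; rewrite ger0_norm// q1.
 have dm x := @is_derive_mixw R nu x. rewrite (@integral_derive_lebR _ (mixw nu))//.
 + rewrite -EFinM lee_fin ler_wpM2l// lerBlDr lerDl; exact: mixw_ge0.
 + move=> x _; apply: (@cvgM _ R); last exact: continuous_mixw.
  by apply: (@cvgB _ R^o); [exact: cexp|exact: cvg_cst].
 + by move=> x; rewrite in_itv/= => /andP[_ xt]; rewrite mulr_ge0 ?mixw_ge0// q1.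
Qed.

(** The variance is at most the second moment about [c], the mean of [f] at the modal scale. Scales
    above [S] have mass of order S^-nu and [f] lies in [0, 1]. Below [S], the variance at fixed
    scale is handled by [radial_var_le], the variation of the means by [hardy], both with e^(2 w) <=
    S^2. *)
Theorem weak_poincare pi f A (S : R) : is_gibbs (V_nu nu) pi -> 1 <= S ->
 mfunT f -> (forall x, 0 <= f x <= 1) -> bmf A -> (forall x, 0 <= A x) -> slope f A ->
 E pi (fun x => f x ^+ 2) - E pi f ^+ 2 <=
 4 * expR (- nu * ln S) + 3 * d%:R * S ^+ 3 * E pi (fun x => A x ^+ 2).
Proof.
move=> gpi S1 mf f01 bA A0 sl; have S0 : 0 < S by exact: lt_le_trans S1.
have bf : bmf f by exact: bmf01.
have ug := slope_upper_gradient A0 sl.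
set r := ln S; have r0 : 0 <= r by exact: ln_ge0.
have [HR HL] := mixw_hardy r0; set m := - (ln nu / 2) in HR HL.
set C := (1 + 2 * (r - m)) / (2 * nu) in HR HL.
have m0 : m <= 0 by rewrite oppr_le0 divr_ge0// ln_ge0.
have C0 : 0 <= C by pos.
have M0 := mixM_gt0 nu1.
have rad01 w : 0 <= radial f w <= 1 by apply: E01 => //; exact: (bmf_scale _ bf).1.
set c := radial f m; have /andP[c0 c1] : 0 <= c <= 1 by exact: rad01.
apply: le_trans (var_le pi c bf) _.
rewrite -(ler_pM2l M0) -lee_fin.
pose G (x : 'rV[R]_d) := (f x - c) ^+ 2.
have bG : bmf G by apply: bmfX; apply: bmfB => //; exact: bmf_cst.
have G0 x : 0 <= G x by pos.
have bA2 := bmfX 2 bA; have bf2 := bmfX 2 bf.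
rewrite (gibbs_radial gpi bG G0).
have radG w : radial G w <= d%:R * (expR w ^+ 2 * radial (fun x => A x ^+ 2) w) + (radial f w - c) ^+ 2.
 rewrite /radial /G E_sqrB; last exact: bmf_scale. by rewrite lerD2r; exact: radial_var_le.
have radG1 w : radial G w <= 1.
 rewrite -[leRHS](E_cst (gauss R d)); apply: le_E; [exact: bmf_scale|exact: bmf_cst|].
 move=> z; have /andP[f0 f1] := f01 (expR w *: z).
 rewrite /G -real_normK ?num_real// exprn_ile1// ler_norml; lra.
have mw := @mmixw R nu.
have mrG : mfunT (fun w => mixw nu w * radial G w). by apply: mfM => //; exact: (bmf_radial bG).1.
have rG0 w : 0 <= mixw nu w * radial G w by rewrite mulr_ge0 ?mixw_ge0//; exact: E_ge0.
pose a := radial_slope A; have ma := measurable_radial_slope bA.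
pose B w := mixw nu w * (S ^+ 2 * (d%:R * radial (fun x => A x ^+ 2) w)).
have rA0 w : 0 <= radial (fun x => A x ^+ 2) w by apply: E_ge0 => z; exact: sqr_ge0.
have B0 w : 0 <= B w by rewrite /B mulr_ge0 ?mixw_ge0// mulr_ge0 ?sqr_ge0// mulr_ge0.
have mB : mfunT B. apply: mfM => //; apply: mfM => //; apply: mfM => //. exact: (bmf_radial bA2).1.
have eS w : w <= r -> expR w ^+ 2 <= S ^+ 2.
 by move=> wr; rewrite lerXn2r ?nnegrE ?expR_ge0 ?(ltW S0)// -[S]lnK// ler_expR.
have IB : (\int[lebR R]_w (B w)%:E = (mixM nu * (d%:R * S ^+ 2 * E pi (fun x => A x ^+ 2)))%:E)%E.
 transitivity (\int[lebR R]_w (d%:R * S ^+ 2 * (mixw nu w * radial (fun x => A x ^+ 2) w))%:E)%E.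
  by apply: eq_integral => w _; congr EFin; rewrite /B; ring. rewrite integralZ_EFin//.
 - rewrite -(gibbs_radial gpi bA2) => [|x]; last pos. by rewrite -EFinM; congr EFin; ring.
 - pos.
 - by apply: mfM => //; exact: (bmf_radial bA2).1.
 - by move=> w; rewrite mulr_ge0 ?mixw_ge0.
have -> : [set: R] = `]-oo, r[%classic `|` `[r, +oo[%classic.
 by apply/seteqP; split => // x _ /=; rewrite !in_itv/= andbT; apply/orP; case: ltP.
rewrite ge0_integral_setU//=; last 3 first.
- exact/mEFinP/mfTS.
- pos.
- apply/disj_setPS => x /= []; rewrite !in_itv/= andbT => x0 x0'.
 by have := lt_le_trans x0 x0'; rewrite ltxx.
rewrite mulrDr EFinD [X in (X <= _)%E]addeC; apply: leeD.
 apply: (@le_trans _ _ (\int[lebR R]_(w in `[r, +oo[) (mixw nu w)%:E)%E).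
  by apply: le_integral_EFin => // w _; rewrite ler_piMr ?mixw_ge0.
 apply: le_trans (mixw_tail _ nu0) _; rewrite lee_fin.
 have Ml : expR (- 2^-1) / (2 * nu) <= mixM nu by have := mixM_lower nu1; rewrite -mixME// lee_fin.
 have e12 : 2^-1 <= expR (- 2^-1) :> R by have := expR_ge1Dx (- 2^-1 : R); lra.
 (* This is the origin of the constant 4 in front of S^-nu. *)
 have : (4 * nu)^-1 <= mixM nu. apply: le_trans Ml; rewrite -[leRHS]mulrC.
  have -> : (4 * nu)^-1 = (2 * nu)^-1 * 2^-1 by pos. by rewrite ler_wpM2l// invr_ge0 mulr_ge0// ltW.
 move=> h; rewrite mulrA [leRHS]mulrC; apply: ler_wpM2l; first mes.
 move: h; rewrite invfM; set x := nu^-1; lra.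
apply: integral_lim_itv => //.
(* Any left end below both [m] and [- n] serves; the bound obtained does not depend on it. *)
move=> n; set l := - (n%:R + 1 + `|m|) : R.
have lm : l <= m by rewrite /l; have := ler_norm (- m); rewrite normrN; have : 0 <= n%:R :> R by []; lra.
apply: (@le_trans _ _ (\int[lebR R]_(w in `[l, r]) (mixw nu w * radial G w)%:E)%E).
 apply: subset_integral_EFin => //; first exact: measurableI.
 move=> x [] /=; rewrite !in_itv/= => /ltW -> /andP[nx _]; rewrite andbT.
 by apply: le_trans nx; rewrite /l lerN2; have := normr_ge0 m; lra.
apply: (@le_trans _ _ (\int[lebR R]_(w in `[l, r]) (B w + (radial f w - c) ^+ 2 * mixw nu w)%:E)%E).
 have mh : mfunT (fun w => (radial f w - c) ^+ 2 * mixw nu w).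
  by apply: mfM => //; apply: mfX; apply: mfB => //; exact: (bmf_radial bf).1.
 apply: le_integral_EFin => //; first exact: mfD.
 move=> w /=; rewrite in_itv/= => /andP[_ wr]; rewrite [_ ^+ 2 * mixw _ _]mulrC -mulrDr.
 rewrite ler_wpM2l ?mixw_ge0// (le_trans (radG w))// lerD2r mulrCA.
 by rewrite ler_wpM2r ?eS// mulr_ge0.
have mh : mfunT (fun w => (radial f w - c) ^+ 2 * mixw nu w).
 by apply: mfM => //; apply: mfX; apply: mfB => //; exact: (bmf_radial bf).1.
under eq_integral do rewrite EFinD.
rewrite ge0_integralD//=; last 4 first.
- pos.
- exact/mEFinP/mfTS.
- by move=> w _; rewrite lee_fin mulr_ge0 ?sqr_ge0 ?mixw_ge0.
- exact/mEFinP/mfTS.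
have mr : m <= r by pos.
have h2 : (\int[lebR R]_(w in `[l, r]) ((radial f w - c) ^+ 2 * mixw nu w)%:E <=
  C%:E * \int[lebR R]_w (B w)%:E)%E.
 apply: (@le_trans _ _ (\int[lebR R]_(t in `[l, r]) (a t ^+ 2 * (C * mixw nu t))%:E)%E).
  apply: hardy => //.
  - by apply: mfM.
  - exact: (bmf_radial bf).1.
  - pos.
  - by move=> x; rewrite mulr_ge0 ?mixw_ge0.
  - exact: radial_slope_ge0.
  - by move=> t lt tm; exact: HL.
  - by move=> x y xy; apply: radial_increment.
 have maa : mfunT (fun t => a t ^+ 2 * (C * mixw nu t)). by apply: mfM; [exact: mfX|exact: mfM].
 rewrite -integralZ_EFin//. apply: (@le_trans _ _ (\int[lebR R]_(w in `[l, r]) (C * B w)%:E)%E).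
  apply: le_integral_EFin => //; first exact: mfM.
   by move=> x; rewrite mulr_ge0 ?sqr_ge0// mulr_ge0 ?mixw_ge0.
  move=> w /=; rewrite in_itv/= => /andP[_ wr].
  rewrite /a radial_slope_sqr// mulrCA ler_wpM2l// mulrC ler_wpM2l ?mixw_ge0//.
  by rewrite ler_wpM2r ?eS// mulr_ge0. apply: subset_integral_EFin => //; first exact: mfM.
 by move=> w; rewrite mulr_ge0.
have h1 : (\int[lebR R]_(w in `[l, r]) (B w)%:E <= \int[lebR R]_w (B w)%:E)%E.
 exact: subset_integral_EFin.
apply: le_trans (leeD h1 h2) _; rewrite IB -EFinM -EFinD lee_fin.
set I := E pi _; have I0 : 0 <= I by apply: E_ge0 => x; exact: sqr_ge0.
(* The logarithms in [C] are crudely bounded by [S], whence S^3 in the statement; this only affects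
   the constant in the exponent of the final bound. *)
have C3 : 1 + C <= 3 * S. have lS : ln S < S by exact: ln_sublinear.
 have lnu : ln nu < nu by exact: ln_sublinear.
 rewrite -/r in lS; have Snu : S <= S * nu by rewrite ler_peMr// ltW. have : C <= 1 + S.
  rewrite /C ler_pdivrMr ?mulr_gt0//.
  have fin (x1 x2 x3 x4 x5 : R) : x1 < x4 -> x2 < x5 -> x4 <= x3 -> 1 <= x5 ->
   1 + 2 * (x1 + x2 / 2) <= 2 * x5 + 2 * x3 by lra.
  have -> : r - m = r + ln nu / 2 by rewrite /m opprK.
  have -> : (1 + S) * (2 * nu) = 2 * nu + 2 * (S * nu) by ring. exact: fin lS lnu Snu nu1. lra.
have -> : mixM nu * (d%:R * S ^+ 2 * I) + C * (mixM nu * (d%:R * S ^+ 2 * I)) =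
 (mixM nu * (d%:R * S ^+ 2 * I)) * (1 + C) by ring.
have -> : mixM nu * (3 * d%:R * S ^+ 3 * I) = (mixM nu * (d%:R * S ^+ 2 * I)) * (3 * S) by ring.
by rewrite ler_wpM2l// mulr_ge0 ?(ltW M0)// mulr_ge0// mulr_ge0 ?sqr_ge0.
Qed.

End weak_poincare.

(** * Approximate detailed balance and almost invariance *)

Section log_bounds.
Context (R : realType).

Lemma derive_ge0_le (f df : R -> R) (r : R) : 1 <= r ->
 (forall x : R, 1 <= x -> is_derive x (1 : R) f (df x)) ->
 (forall x : R, 1 <= x -> 0 <= df x) -> f 1 <= f r.
Proof.
rewrite le_eqVlt => /predU1P[<-//|r1] fE df0.
have [||x xr] := @MVT R f df 1 r r1.
- by move=> x; rewrite in_itv/= => /andP[x1 _]; apply: fE; exact: ltW.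
- apply: derivable_within_continuous => x; rewrite in_itv/= => /andP[x1 _]. by have [] := fE x x1.
move: xr; rewrite in_itv/= => /andP[x1 _] e.
by rewrite -subr_ge0 e mulr_ge0 ?subr_ge0 ?(ltW r1)// df0// ltW.
Qed.

Lemma norm_le_sqr (a b : R) : 0 <= b -> a ^+ 2 <= b ^+ 2 -> `|a| <= b.
Proof. by move=> b0 h; rewrite -[b]ger0_norm// -!sqrtr_sqr ler_wsqrtr. Qed.

Lemma ln_ge_frac (r : R) : 1 <= r -> 2 * (r - 1) / (r + 1) <= ln r.
Proof.
move=> r1; rewrite -subr_ge0.
have h := @derive_ge0_le (fun x => ln x - 2 * (x - 1) / (x + 1)) (fun x => x^-1 - 4 / (x + 1) ^+ 2) r r1.
apply: le_trans (h _ _); first by rewrite ln1 subrr mulr0 mul0r subrr.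
- move=> x x1; have x0 : 0 < x by exact: lt_le_trans x1. have xn : x + 1 != 0 by pos.
 have dl : is_derive x (1 : R) (@ln R) x^-1 by exact: is_derive1_ln.
 by apply: is_derive_eq; rewrite /GRing.scale/=; field; rewrite xn gt_eqF.
- move=> x x1; have x0 : 0 < x by exact: lt_le_trans x1. have xn : x + 1 != 0 by pos.
 have -> : x^-1 - 4 / (x + 1) ^+ 2 = (x - 1) ^+ 2 / (x * (x + 1) ^+ 2).
  by field; rewrite xn gt_eqF. pos.
Qed.

Lemma ln_le_sinh (r : R) : 1 <= r -> ln r <= (r - r^-1) / 2.
Proof.
move=> r1; rewrite -subr_ge0.
have h := @derive_ge0_le (fun x => (x - x^-1) / 2 - ln x) (fun x => (1 + (x ^+ 2)^-1) / 2 - x^-1) r r1.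
apply: le_trans (h _ _); first by rewrite ln1 invr1 subrr mul0r subr0.
- move=> x x1; have x0 : 0 < x by exact: lt_le_trans x1. have xn : x != 0 by pos.
 have dl : is_derive x (1 : R) (@ln R) x^-1 by exact: is_derive1_ln.
 have dv : is_derive x (1 : R) (fun y : R => y^-1) (- (x ^+ 2)^-1).
  have h1 : (id x : R) != 0 by []. have := is_deriveV h1 (is_derive_id x (1 : R)).
  by rewrite /GRing.scale/= mulr1. by apply: is_derive_eq; rewrite /GRing.scale/=; field.
- move=> x x1; have x0 : 0 < x by exact: lt_le_trans x1.
 have -> : (1 + (x ^+ 2)^-1) / 2 - x^-1 = (1 - x^-1) ^+ 2 / 2 by pos. pos.
Qed.

(** [g] is sinh(u) - u with u = ln(X / Y): nonpositive for u <= 0 and of third order at 0. The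
    hypothesis is the inversion inequality with z = |x - y|. *)
Lemma sinh_ln_le (X Y z : R) : 1 <= X -> 1 <= Y -> 0 <= z -> (X - Y) ^+ 2 <= z ^+ 2 * (X * Y) ->
 let g := (X / Y - Y / X) / 2 - ln (X / Y) in g <= z ^+ 2 / 2 /\ g <= z ^+ 3 / 2.
Proof.
move=> X1 Y1 z0 h g.
have X0 : 0 < X by pos.
have Y0 : 0 < Y by pos.
have [XY|YX] := leP X Y. have r1 : 1 <= Y / X by rewrite ler_pdivlMr// mul1r. have : g <= 0.
  have := ln_le_sinh r1; rewrite invf_div.
  have -> : ln (Y / X) = - ln (X / Y) by rewrite !ln_div ?posrE// opprB. by rewrite /g; lra.
 have := sqr_ge0 z; have : 0 <= z ^+ 3 by pos. pos.
have r1 : 1 <= X / Y by rewrite ler_pdivlMr// mul1r ltW.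
have gle : g <= (X - Y) ^+ 2 / (X * Y) * ((X - Y) / (2 * (X + Y))). have := ln_ge_frac r1.
 have -> : 2 * (X / Y - 1) / (X / Y + 1) = 2 * (X - Y) / (X + Y).
  by field; rewrite !gt_eqF// addr_gt0.
 rewrite /g => hl; rewrite lerBlDr; apply: (@le_trans _ _ ((X - Y) ^+ 2 / (X * Y) * ((X - Y) / (2 * (X + Y))) + 2 * (X - Y) / (X + Y))); last pos.
 apply: eq_ler; field. by rewrite !gt_eqF// addr_gt0.
have XY0 : 0 < X + Y by pos.
have q0 : 0 <= (X - Y) / (2 * (X + Y)) by rewrite divr_ge0 ?mulr_ge0 ?subr_ge0 ?(ltW YX) ?(ltW XY0).
have h2 : (X - Y) ^+ 2 / (X * Y) <= z ^+ 2 by rewrite ler_pdivrMr ?mulr_gt0.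
have {}gle : g <= z ^+ 2 * ((X - Y) / (2 * (X + Y))) by apply: le_trans gle _; exact: ler_wpM2r.
split; apply: le_trans gle _. rewrite ler_wpM2l ?sqr_ge0// ler_pdivrMr ?mulr_gt0//; lra.
have h3 : X - Y <= z * (X + Y). apply: le_trans (ler_norm _) _; apply: norm_le_sqr; first pos.
 apply: le_trans h _; rewrite exprMn ler_wpM2l ?sqr_ge0//; nra.
have -> : z ^+ 3 / 2 = z ^+ 2 * (z / 2) by ring.
rewrite ler_wpM2l ?sqr_ge0// ler_pdivrMr ?mulr_gt0//; lra.
Qed.

End log_bounds.

Section almost_invariance.
Context (R : realType) (d : nat) (nu : R).
Hypothesis nu1 : 1 <= nu.
Let n : R := d%:R + nu.
Let n1 : 1 <= n. Proof. by rewrite (le_trans nu1)// lerDr. Qed.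
Implicit Types (x y z : 'rV[R]_d) (s : R).

(** Logarithm of the ratio of the flows e^(-V(x)) p(x, y) and e^(-V(y)) p(y, x) of one step.
    First-order terms cancel, leaving sinh(u) - u with u = ln(Qn x / Qn y) and a cubic term; the
    last line comes from the squared drifts. *)
Definition db_exponent s x y : R := n / 2 * ((Qn x / Qn y - Qn y / Qn x) / 2 - ln (Qn x / Qn y)
  - sqnorm2 (x - y) * (Qn x - Qn y) / (2 * (Qn x * Qn y)))
 - s ^+ 2 / 8 * n ^+ 2 * ((Qn x)^-1 - (Qn y)^-1) * (1 - (Qn x)^-1 - (Qn y)^-1).

(** h (d + nu) for the step h = s^2 / 2, so that [s] is the size of the noise. *)
Definition cstep s : R := s ^+ 2 / 2 * n.

Lemma detailed_balance s x y : 0 < s -> expR (- V_nu nu x) * gpdf (drift (cstep s) x) s y =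
 expR (- V_nu nu y) * gpdf (drift (cstep s) y) s x * expR (db_exponent s x y).
Proof.
move=> s0; rewrite !gpdfE ?gt_eqF//.
have -> : s ^+ 2 *+ 2 = s ^+ 2 * 2 by pos.
rewrite !mulrA ![_ * normal_peak s ^+ d]mulrC -!mulrA; congr (_ * _).
rewrite -!expRD; congr expR; rewrite /V_nu -/n -/(Qn x) -/(Qn y).
rewrite /drift -[- (_ *: x)]scaleNr -[- (_ *: y)]scaleNr.
have e1 := sqnorm2_comb 1 (- (1 - cstep s / Qn x)) y x.
have e2 := sqnorm2_comb 1 (- (1 - cstep s / Qn y)) x y.
rewrite !scale1r in e1 e2; rewrite e1 e2 {e1 e2}.
have dC : dotp y x = dotp x y by rewrite /dotp; apply: eq_bigr => i _; rewrite mulrC.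
have e3 := sqnorm2B x y.
rewrite dC /db_exponent ln_div ?posrE ?Qn_gt0// /cstep.
have -> : dotp x y = (sqnorm2 x + sqnorm2 y - sqnorm2 (x - y)) / 2 by pos.
have -> : sqnorm2 x = Qn x - 1 by rewrite /Qn addrC addKr.
have -> : sqnorm2 y = Qn y - 1 by rewrite /Qn addrC addKr.
have Qx := Qn_neq0 x; have Qy := Qn_neq0 y; have s0' : s != 0 by pos.
move: (ln (Qn x)) (ln (Qn y)) => lx ly.
move: (Qn x) (Qn y) (sqnorm2 (x - y)) Qx Qy => X Y z2 Qx Qy.
by field; rewrite Qx Qy s0'.
Qed.

(** Two bounds for two uses: the cubic one makes the defect of order s^3 when z is of order s, the
    quadratic one keeps its exponential integrable against a Gaussian. *)
Lemma db_exponent_le s x y : let z := enorm (x - y) in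
 db_exponent s x y <= n ^+ 2 * (z ^+ 2 + s ^+ 2 * z) /\
 db_exponent s x y <= n ^+ 2 * (z ^+ 3 + s ^+ 2 * z).
Proof.
move=> z; have z0 : 0 <= z by exact: sqrtr_ge0.
have z2 : sqnorm2 (x - y) = z ^+ 2 by rewrite sqr_sqrtr ?sqnorm2_ge0.
have h : (Qn x - Qn y) ^+ 2 <= z ^+ 2 * (Qn x * Qn y).
 by rewrite -z2; have := sqr_sqnorm2_sub x y; rewrite /Qn; congr (_ ^+ 2 <= _); ring.
rewrite /db_exponent z2; have X1 := Qn_ge1 x; have Y1 := Qn_ge1 y.
move: (Qn x) (Qn y) h X1 Y1 => X Y h X1 Y1.
have X0 : 0 < X by pos.
have Y0 : 0 < Y by pos.
have XY0 : 0 < X * Y by pos.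
have [g2 g3] := sinh_ln_le X1 Y1 z0 h.
set g := _ - ln _ in g2 g3 *.
have XY1 : 1 <= X * Y by rewrite -[1]mulr1 ler_pM.
have hz : `|X - Y| <= z * (X * Y). apply: norm_le_sqr; first pos.
 apply: le_trans h _; rewrite exprMn ler_wpM2l ?sqr_ge0//. by rewrite expr2 ler_peMr// (ltW XY0).
have h1 : `|X - Y| <= X * Y by rewrite ler_norml; apply/andP; split; nra.
pose w := (X - Y) / (X * Y).
have wz : `|w| <= z by rewrite /w normf_div (gtr0_norm XY0) ler_pdivrMr//.
have w1 : `|w| <= 1 by rewrite /w normf_div (gtr0_norm XY0) ler_pdivrMr// mul1r.
have -> : z ^+ 2 * (X - Y) / (2 * (X * Y)) = z ^+ 2 * w / 2. by rewrite /w; field; rewrite !gt_eqF.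
have -> : X^-1 - Y^-1 = - w by rewrite /w; field; rewrite !gt_eqF.
pose q := 1 - X^-1 - Y^-1.
have q1 : `|q| <= 1. have : 0 < X^-1 by pos. have : 0 < Y^-1 by pos.
 have : X^-1 <= 1 by rewrite invf_le1. have : Y^-1 <= 1 by rewrite invf_le1.
 by rewrite /q ler_norml => *; apply/andP; split; lra.
rewrite -/q.
have n0 : 0 <= n by exact: le_trans n1.
have nn : n <= n ^+ 2 by rewrite expr2 ler_peMl.
have t3 : - (s ^+ 2 / 8 * n ^+ 2 * - w * q) <= n ^+ 2 * (s ^+ 2 * z). have wq : w * q <= z.
  by rewrite (le_trans (ler_norm _))// normrM (le_trans _ wz)// ler_piMr.
 have -> : - (s ^+ 2 / 8 * n ^+ 2 * - w * q) = n ^+ 2 * (s ^+ 2 * (w * q / 8)) by field.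
 rewrite ler_wpM2l ?sqr_ge0// ler_wpM2l ?sqr_ge0//; lra.
have key u : 0 <= u -> g <= u / 2 -> - (z ^+ 2 * w) <= u ->
  n / 2 * (g - z ^+ 2 * w / 2) <= n ^+ 2 * u.
 move=> u0 gu wu; apply: (@le_trans _ _ (n * u)); last by rewrite ler_wpM2r.
 rewrite -mulrA ler_wpM2l//; lra.
have zw u : `|w| <= u -> - (z ^+ 2 * w) <= z ^+ 2 * u.
 move=> wu; rewrite -mulrN ler_wpM2l ?sqr_ge0// (le_trans _ wu)// -normrN ler_norm//.
split; rewrite [leRHS]mulrDr; apply: lerD => //; apply: key => //; rewrite ?exprn_ge0//.
 by have := zw 1 w1; rewrite mulr1.
by have := zw z wz; rewrite -exprSr.
Qed.

(** e^(|y|^2 / 4) times the standard density is a multiple of the density with variance 2. The value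
    is 2^(d / 2). *)
Lemma gauss_exp_moment : (\int[gauss R d]_z (expR (sqnorm2 z / 4))%:E =
 ((normal_peak 1 / normal_peak (Num.sqrt 2)) ^+ d)%:E)%E.
Proof.
have s2 : 0 < Num.sqrt 2 :> R by pos.
have mf : mfunT (fun y : 'rV[R]_d => expR (sqnorm2 y / 4)).
 by apply: mcompT => //; apply: mfM => //; exact: msqnorm2.
transitivity (\int[gauss R d]_z (fun y => (expR (sqnorm2 y / 4))%:E) (0 + 1 *: z)%R)%E.
 by apply: eq_integral => z _; rewrite add0r scale1r.
rewrite (@ge0_gauss_affine _ d 0 1 (fun y => (expR (sqnorm2 y / 4))%:E))//; last first. mes.
set rho := normal_peak 1 / _.
have rho0 : 0 <= rho by pos.
transitivity (\int[lebesgue_rV R d]_y (rho ^+ d * gpdf 0 (Num.sqrt 2) y)%:E)%E.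
 apply: eq_integral => y _; rewrite -EFinM; congr EFin.
 rewrite !gpdfE ?gt_eqF// !subr0 expr1n sqr_sqrtr//.
 rewrite mulrA -exprMn /rho divfK; last by rewrite gt_eqF// normal_peak_gt0// gt_eqF.
 rewrite mulrCA -expRD; congr (_ * expR _).
 by rewrite -[1 *+ 2]/(2 : R) -[2 *+ 2]mulr_natr -natrM; field.
rewrite integralZ_EFin ?exprn_ge0//; last 2 first.
- exact: mgpdf.
- pos.
by rewrite integral_gpdf// mule1.
Qed.

Definition ai_const : R := (2 + 2 * 64 ^+ 2) * n ^+ 2 * expR (1 + n ^+ 2 / 8) *
 (normal_peak 1 / normal_peak (Num.sqrt 2)) ^+ d.

Lemma ai_const_ge0 : 0 <= ai_const.
Proof.
apply: mulr_ge0; last pos.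
apply: mulr_ge0; last mes.
pos.
Qed.

(** The displacement is at most s W with W^2 = 2 (|z|^2 + n^2). In e^t <= 1 + t e^t the cubic bound
    is used for the factor t and the quadratic one in the exponential, where n^2 s^2 <= 1/64 keeps
    the total below |z|^2 / 4 plus constants. *)
Lemma db_exponent_gauss_le s y z : 0 < s -> s <= 1 -> n ^+ 2 * s ^+ 2 <= 64^-1 ->
 expR (db_exponent s (drift (cstep s) y + s *: z) y) <=
 1 + s ^+ 3 * ((2 + 2 * 64 ^+ 2) * n ^+ 2 * expR (1 + n ^+ 2 / 8)) * expR (sqnorm2 z / 4).
Proof.
move=> s0 s1 sn; set x := _ + _.
have [e2 e3] := db_exponent_le s x y; set zt := enorm (x - y) in e2 e3.
have zt0 : 0 <= zt by pos.
pose W := Num.sqrt (2 * (sqnorm2 z + n ^+ 2)).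
have W0 : 0 <= W by pos.
have n0 : 0 <= n by exact: le_trans n1.
have W2 : W ^+ 2 = 2 * (sqnorm2 z + n ^+ 2).
 by rewrite sqr_sqrtr// mulr_ge0// addr_ge0 ?sqr_ge0 ?sqnorm2_ge0.
have ztW : zt <= s * W. apply: le_trans (ler_norm _) _; apply: norm_le_sqr; first pos.
 rewrite exprMn W2 /zt /enorm sqr_sqrtr ?sqnorm2_ge0//.
 have -> : x - y = s *: z + (- (cstep s / Qn y)) *: y.
  by apply/rowP => i; rewrite /x /drift !mxE; ring.
 have := sqnorm2_ge0 (s *: z + (cstep s / Qn y) *: y). rewrite !sqnorm2_comb.
 have : (cstep s / Qn y) ^+ 2 * sqnorm2 y <= s ^+ 2 * n ^+ 2.
  have -> : sqnorm2 y = Qn y - 1 by rewrite /Qn addrC addKr.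
  have Q1 := Qn_ge1 y; have Q0 := Qn_neq0 y.
  have -> : (cstep s / Qn y) ^+ 2 * (Qn y - 1) = s ^+ 2 * n ^+ 2 * (s ^+ 2 / 4 * ((Qn y - 1) / Qn y ^+ 2)).
   by rewrite /cstep; field. apply: ler_piMr; first pos. apply: mulr_ile1.
  - pos.
  - pos.
  - have : s ^+ 2 <= 1 by rewrite expr_le1// ltW. lra.
  - rewrite ler_pdivrMr ?exprn_gt0 ?Qn_gt0// mul1r; nra. lra.
have sW0 : 0 <= s * W by pos.
have b2 : n ^+ 2 * (zt ^+ 2 + s ^+ 2 * zt) <= n ^+ 2 * s ^+ 2 * (W ^+ 2 + W).
 rewrite -mulrA ler_wpM2l ?sqr_ge0// mulrDr -exprMn lerD ?lerXn2r ?nnegrE//.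
 by rewrite ler_wpM2l ?sqr_ge0// (le_trans ztW)// ler_piMl.
have b3 : n ^+ 2 * (zt ^+ 3 + s ^+ 2 * zt) <= n ^+ 2 * s ^+ 3 * (W ^+ 3 + W).
 rewrite -mulrA ler_wpM2l ?sqr_ge0// mulrDr -exprMn lerD ?lerXn2r ?nnegrE//.
 have -> : s ^+ 3 * W = s ^+ 2 * (s * W) by ring. by rewrite ler_wpM2l ?sqr_ge0.
set e := db_exponent _ _ _ in e2 e3 *.
have B0 : 0 <= n ^+ 2 * s ^+ 3 * (W ^+ 3 + W).
 by rewrite !mulr_ge0 ?exprn_ge0 ?(ltW s0)// addr_ge0 ?exprn_ge0.
have h1 : expR e <= 1 + n ^+ 2 * s ^+ 3 * (W ^+ 3 + W) * expR (n ^+ 2 * s ^+ 2 * (W ^+ 2 + W)).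
 have [e0|e0] := leP e 0. apply: (@le_trans _ _ 1); first by rewrite -[leRHS]expR0 ler_expR.
  by rewrite lerDl mulr_ge0 ?expR_ge0. have : expR e <= 1 + e * expR e.
  have := expR_ge1Dx (- e); rewrite expRN => hh.
  have := ler_wpM2r (expR_ge0 e) hh; rewrite mulVf ?gt_eqF ?expR_gt0//; lra.
 move=> hh; apply: le_trans hh _; rewrite lerD2l; apply: ler_pM; rewrite ?expR_ge0 ?(ltW e0)//.
  exact: le_trans e3 b3. rewrite ler_expR; exact: le_trans e2 b2.
apply: le_trans h1 _; rewrite lerD2l.
have -> : s ^+ 3 * ((2 + 2 * 64 ^+ 2) * n ^+ 2 * expR (1 + n ^+ 2 / 8)) * expR (sqnorm2 z / 4) =
 n ^+ 2 * s ^+ 3 * ((2 + 2 * 64 ^+ 2) * expR (1 + n ^+ 2 / 8 + sqnorm2 z / 4)).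
 by rewrite [expR (_ + _ + _)]expRD; ring.
rewrite -[leLHS]mulrA ler_wpM2l ?mulr_ge0 ?exprn_ge0 ?(ltW s0)//.
pose t := W ^+ 2 / 32; have t0 : 0 <= t by rewrite divr_ge0 ?sqr_ge0.
(* From t / 2 <= e^(t / 2) with t = W^2 / 32; the polynomial factor is thus absorbed, at the price
   of the constant 64^2. *)
have et : W ^+ 4 <= 64 ^+ 2 * expR t.
 have -> : W ^+ 4 = 64 ^+ 2 * (t / 2) ^+ 2 by rewrite /t; field. rewrite ler_wpM2l ?sqr_ge0//.
 have -> : expR t = expR (t / 2) ^+ 2 by rewrite -expRM_natl; congr expR; field.
 have t2 : 0 <= t / 2 by pos. rewrite lerXn2r ?nnegrE ?expR_ge0//.
 by apply: le_trans (expR_ge1Dx _); rewrite lerDr.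
move: (64 ^+ 2) (sqr_ge0 (64 : R)) et => k k0 et.
have W3 : W ^+ 3 + W <= 2 + 2 * W ^+ 4. have [W1|W1] := leP W 1.
  have : W ^+ 3 <= 1 by rewrite exprn_ile1. have : 0 <= W ^+ 4 by rewrite exprn_ge0. lra.
 have : W ^+ 3 <= W ^+ 4 by rewrite ler_eXn2l// ltW.
 have : W ^+ 1 <= W ^+ 4 by rewrite ler_eXn2l// ltW. rewrite expr1; lra.
have et1 : 1 <= expR t by rewrite -[leLHS]expR0 ler_expR.
have h2 : W ^+ 3 + W <= (2 + 2 * k) * expR t by nra.
apply: (@le_trans _ _ ((2 + 2 * k) * expR t * expR (n ^+ 2 * s ^+ 2 * (W ^+ 2 + W)))).
 by rewrite ler_wpM2r ?expR_ge0.
rewrite -mulrA -expRD; apply: ler_wpM2l; first lra.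
rewrite ler_expR.
have : n ^+ 2 * s ^+ 2 * (W ^+ 2 + W) <= 64^-1 * (2 * W ^+ 2 + 1).
 apply: (@le_trans _ _ (64^-1 * (W ^+ 2 + W))).
  by apply: ler_wpM2r => //; rewrite addr_ge0// sqr_ge0.
 apply: ler_wpM2l => //; have := sqr_ge0 (W - 1); nra.
rewrite /t W2; have := sqnorm2_ge0 z; lra.
Qed.

(** By approximate detailed balance, the mass flowing into y is e^(-V(y)) times the mean of e^defect
    over one step started at y, which is 1 + O(s^3). The bound is one-sided, against nonnegative
    functions. *)
Lemma lmcP_almost_invariant (pi : probability 'rV[R]_d R) s (f : 'rV[R]_d -> R) :
 is_gibbs (V_nu nu) pi -> 0 < s -> s <= 1 -> n ^+ 2 * s ^+ 2 <= 64^-1 ->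
 bmf f -> (forall x, 0 <= f x) -> E pi (lmcP (cstep s) s f) <= (1 + ai_const * s ^+ 3) * E pi f.
Proof.
move=> gpi s0 s1 sn bf f0; have [k k0 Hk] := gibbs_density gpi.
have [mf _] := bf.
pose u : 'rV[R]_d -> 'rV[R]_d := drift (cstep s).
have mu : measurable_fun [set: 'rV[R]_d] u by exact: measurable_drift.
have bPf : bmf (lmcP (cstep s) s f) by exact: bmf_lmcP.
have Pf0 x : 0 <= lmcP (cstep s) s f x by apply: E_ge0.
have e1 : (\int[pi]_x (f x)%:E = k%:E * \int[lebesgue_rV R d]_x ((f x)%:E * (expR (- V_nu nu x))%:E))%E.
 by apply: Hk; [exact/mEFinP|move=> x; rewrite lee_fin].
have e2 : (\int[pi]_x (lmcP (cstep s) s f x)%:E =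
  k%:E * \int[lebesgue_rV R d]_x ((lmcP (cstep s) s f x)%:E * (expR (- V_nu nu x))%:E))%E.
 by apply: Hk; [apply/mEFinP; exact: bPf.1|move=> x; rewrite lee_fin].
rewrite -lee_fin EFinM [leLHS]EE// [X in (_ <= _ * X)%E]EE// e1 e2.
rewrite [leRHS]muleCA; apply: lee_wpmul2l; first mes.
have mV : measurable_fun [set: 'rV[R]_d] (fun x => expR (- V_nu nu x)). apply: mcompT => //.
 by apply: mcompT => //; exact: measurable_V_nu.
have mg : mfunT (fun z : 'rV[R]_d * 'rV[R]_d => gpdf (u z.1) s z.2).
 rewrite (_ : (fun z : 'rV[R]_d * 'rV[R]_d => gpdf (u z.1) s z.2) = (fun z : 'rV[R]_d * 'rV[R]_d =>
  normal_peak s ^+ d * expR (- sqnorm2 (z.2 - u z.1) / (s ^+ 2 *+ 2)))).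
  apply: mfM => //; apply: mcompT => //; apply: mfM => //.
  apply: mcompT => //; apply: msqnorm2; apply: mrVD. mes.
  by apply: measurable_rVN; apply: (mcompT mu); exact: mfst.
 by apply/funext => z; rewrite gpdfE// gt_eqF.
have mE : mfunT (fun z : 'rV[R]_d * 'rV[R]_d => expR (- V_nu nu z.1) * gpdf (u z.1) s z.2 * f z.2).
 apply: mfM; first apply: mfM => //.
 - by apply: (mcompT mV); exact: mfst.
 - by apply: (mcompT mf); exact: msnd.
have g0 x y : 0 <= gpdf (u x) s y by pos.
apply: (@le_trans _ _ (\int[lebesgue_rV R d]_x \int[lebesgue_rV R d]_y (expR (- V_nu nu x) * gpdf (u x) s y * f y)%:E)%E).
 apply: eq_ler; apply: eq_integral => x _.
 rewrite /lmcP (gE_lebesgue _ s0 bf).2 muleC -integralZ_EFin ?expR_ge0//.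
 - by apply: eq_integral => y _; congr EFin; ring.
 - by apply: mfM => //; exact: mgpdf.
 - pos.
rewrite (@fubini_tonelli _ _ _ _ R (lebesgue_rV R d) (lebesgue_rV R d)
 (fun p => (expR (- V_nu nu p.1) * gpdf (u p.1) s p.2 * f p.2)%:E))//=; last 2 first.
- mes.
- by move=> z; rewrite lee_fin !mulr_ge0 ?expR_ge0.
have mfV : mfunT (fun y => f y * expR (- V_nu nu y)) by exact: mfM.
have fV0 y : 0 <= f y * expR (- V_nu nu y) by pos.
have C0 : 0 <= 1 + ai_const * s ^+ 3.
 by rewrite addr_ge0// mulr_ge0 ?ai_const_ge0// exprn_ge0// ltW.
rewrite (_ : (_ * _)%E = \int[lebesgue_rV R d]_y ((1 + ai_const * s ^+ 3) * (f y * expR (- V_nu nu y)))%:E)%E; last first.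
 by rewrite integralZ_EFin//; congr (_ * _)%E.
apply: ge0_le_integral => //.
- by move=> y _; apply: integral_ge0 => x _; rewrite lee_fin !mulr_ge0 ?expR_ge0.
- apply: (@measurable_fun_fubini_tonelli_G _ _ _ _ R (lebesgue_rV R d) (fun p => (expR (- V_nu nu p.1) * gpdf (u p.1) s p.2 * f p.2)%:E)).
  mes. by move=> z; rewrite lee_fin !mulr_ge0 ?expR_ge0.
- by apply/mEFinP; exact: mfM.
move=> y _.
set K := s ^+ 3 * ((2 + 2 * 64 ^+ 2) * n ^+ 2 * expR (1 + n ^+ 2 / 8)).
have K0 : 0 <= K. apply: mulr_ge0; first pos. apply: mulr_ge0; last mes. pos.
pose G x := 1 + K * expR (sqnorm2 (s^-1 *: (x - u y)) / 4).
have mG : mfunT G. apply: mfD => //; apply: mfM => //; apply: mcompT => //.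
 apply: mfM => //; apply: msqnorm2; apply: mrVZ => //. mes.
have G0 x : 0 <= G x by pos.
have pt x : expR (- V_nu nu x) * gpdf (u x) s y * f y <= f y * expR (- V_nu nu y) * (G x * gpdf (u y) s x).
 rewrite detailed_balance// -/u mulrC -!mulrA ler_wpM2l// ler_wpM2l ?expR_ge0//.
 rewrite mulrC ler_wpM2r ?g0//. have := db_exponent_gauss_le y (s^-1 *: (x - u y)) s0 s1 sn.
 by rewrite scalerA mulfV ?gt_eqF// scale1r -/u addrC subrK.
have mGg : mfunT (fun x => G x * gpdf (u y) s x). by apply: mfM => //; exact: mgpdf.
have Gg0 x : 0 <= G x * gpdf (u y) s x by pos.
apply: (@le_trans _ _ (\int[lebesgue_rV R d]_x (f y * expR (- V_nu nu y) * (G x * gpdf (u y) s x))%:E)%E).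
 apply: le_integral_EFin => //.
 - apply: mfM => //; apply: mfM => //. exact: (mcompT mg (measurable_pair2 y)).
 - exact: mfM.
 - by move=> x; rewrite !mulr_ge0 ?expR_ge0.
rewrite integralZ_EFin// [X in (_ <= X%:E)%E]mulrC [leRHS]EFinM; apply: lee_wpmul2l; first pos.
have := @ge0_gauss_affine R d (u y) s (EFin \o G) s0.
rewrite /= => <-//; last mes.
rewrite (eq_integral (fun z => (1 + K * expR (sqnorm2 z / 4))%:E)); last first.
 move=> z _; rewrite /G; congr (1 + K * expR (sqnorm2 _ / 4))%:E.
 by rewrite [_ + s *: z]addrC addrK scalerA mulVf ?gt_eqF// scale1r.
under eq_integral do rewrite EFinD.
have me : mfunT (fun z : 'rV[R]_d => expR (sqnorm2 z / 4)).
 by apply: mcompT => //; apply: mfM => //; exact: msqnorm2.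
rewrite ge0_integralD//=.
- rewrite integral_cst//= probability_setT mule1 integralZ_EFin//.
 rewrite gauss_exp_moment -EFinM -EFinD lee_fin lerD2l /ai_const /K. by apply: eq_ler; ring.
- by move=> z _; rewrite lee_fin mulr_ge0 ?expR_ge0.
- by apply/mEFinP; exact: mfM.
Qed.

End almost_invariance.

(** * Renyi divergences: densities, events and duality *)

Section renyi_lemmas.
Context d (T : measurableType d) (R : realType) (rho pi : probability T R).
Implicit Types (f g : T -> R) (q D a M : R).

Definition is_density f : Prop := [/\ mfunT f, (forall x, 0 <= f x) &
   forall A, measurable A -> rho A = (\int[pi]_(x in A) (f x)%:E)%E].

Lemma measurable_fun_powR f (p : R) : mfunT f -> mfunT (fun x => f x `^ p).
Proof. by move=> mf; exact: (@mcompT _ _ _ _ _ _ (@powR R ^~ p)). Qed.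

(** One version of the density, finite and nonnegative everywhere, computes both divergences. *)
Lemma renyi_density : rho `<< pi -> exists2 f, is_density f &
 renyi_oo rho pi = lne (ess_sup pi (EFin \o f)) /\ forall q, q != 0 -> renyi q rho pi =
  ((q - 1)^-1%:E * lne (\int[pi]_x (f x `^ q)%:E))%E.
Proof.
move=> dom; pose f0 := Radon_Nikodym_SigmaFinite.f rho pi.
have f00 := Radon_Nikodym_SigmaFinite.f_ge0 dom.
have ff := Radon_Nikodym_SigmaFinite.f_fin_num dom.
have fi := Radon_Nikodym_SigmaFinite.f_integrable dom.
have mf0 : mfunT f0 by exact: measurable_int fi.
pose f x := fine (f0 x).
have fE x : (f x)%:E = f0 x by rewrite /f fineK//; exact: ff.
have mf : mfunT f by exact: (mcompT (fine_measurable measurableT)).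
exists f. split => // [x|A mA]; first by rewrite -lee_fin fE; exact: f00.
 rewrite (Radon_Nikodym_SigmaFinite.f_integral dom mA). by apply: eq_integral => x _; rewrite fE.
have f_ge0 x : 0 <= f x by rewrite -lee_fin fE; exact: f00.
have aeq := ae_eq_Radon_Nikodym_SigmaFinite dom measurableT.
have mRN : mfunT (Radon_Nikodym (charge_of_finite_measure rho) pi). mes.
split. rewrite /renyi_oo asboolT// unlock /= probability_setT lte01; congr lne.
 apply: eq_ess_sup; apply: filterS aeq => x /(_ I) e /=. by rewrite -e -/f0 -fE /= ger0_norm.
move=> q q0; rewrite /renyi asboolT// powR_Lnorm//; congr (_ * lne _)%E.
apply: ae_eq_integral => //.
- by apply: (mcompT (measurable_poweR q)); exact: mcompT.
- by apply/mEFinP; exact: measurable_fun_powR.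
by apply: filterS aeq => x /(_ I) e _ /=; rewrite -e -/f0 -fE /= ger0_norm.
Qed.

Lemma density_integral f (g : T -> \bar R) : is_density f -> mfunT g ->
 (forall x, 0 <= g x)%E -> (\int[rho]_x g x = \int[pi]_x (g x * (f x)%:E))%E.
Proof. by move=> [mf f0 fE] mg g0; apply: ge0_integral_density. Qed.

(** With its converse [renyi_oo_ge], this reduces R_oo <= D to the domination rho <= e^D pi, the
    only form used below. *)
Lemma renyi_oo_le D : (renyi_oo rho pi <= D%:E)%E ->
 forall A, measurable A -> (rho A <= (expR D)%:E * pi A)%E.
Proof.
have [dom|ndom] := pselect (rho `<< pi); last by rewrite /renyi_oo asboolF.
have [f [mf f0 fE] [-> _]] := renyi_density dom; move=> h A mA.
have {}h : (ess_sup pi (EFin \o f) <= (expR D)%:E)%E.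
 have [e0|e0] := leP 0%E (ess_sup pi (EFin \o f)).
  by rewrite -[leLHS]lneK ?in_itv/= ?e0 ?leey// -[(expR D)%:E]/(expeR D%:E) lee_expeR.
 by apply: (le_trans (ltW e0)); rewrite lee_fin expR_ge0.
move: h => /ess_supP h; rewrite fE// -[leRHS]integral_cst//.
apply: ae_ge0_le_integral => //.
- pos.
- exact/mEFinP/mfTS.
- pos.
by apply: filterS h => x hx _.
Qed.

Lemma measure_le_dominates M : (forall A, measurable A -> rho A <= M%:E * pi A)%E -> rho `<< pi.
Proof.
move=> h; apply/null_content_dominatesP => A mA pA.
by apply/eqP; rewrite eq_le measure_ge0 andbT (le_trans (h A mA))// pA mule0.
Qed.

(** On the set where f exceeds M, the integral of f - M is nonnegative by choice of the set and
    nonpositive by domination. *)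
Lemma density_ae_le f M : 0 <= M -> is_density f ->
 (forall A, measurable A -> rho A <= M%:E * pi A)%E -> {ae pi, forall x, ((f x)%:E <= M%:E)%E}.
Proof.
move=> M0 [mf f0 fE] h; have mfE : mfunT (EFin \o f) by exact/mEFinP.
apply/(ae_le_measureP pi M%:E mfE).
set A := _ @^-1` _.
have mA : measurable A by rewrite -[A]setTI; apply: mfE => //; exact: emeasurable_itv.
have AM x : A x -> M < f x by rewrite /A/= in_itv/= andbT lte_fin.
have mfMx : mfunT (fun x => f x - M) by exact: mfB.
have AE : (rho A = \int[pi]_(x in A) (`|(f x - M)%:E|) + M%:E * pi A)%E.
 rewrite fE// -[X in (_ = _ + X)%E]integral_cst// -ge0_integralD//.
 - apply: eq_integral => x; rewrite inE => /AM fM /=.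
  by rewrite -EFinD ger0_norm ?subrK// subr_ge0 ltW.
 - exact/mEFinP/mfTS/mcompT.
have pfin : (M%:E * pi A)%E \is a fin_num by rewrite fin_numM// fin_num_measure.
have /eqP i0 : (\int[pi]_(x in A) (`|(f x - M)%:E|) == 0)%E.
 rewrite eq_le; apply/andP; split; last by apply: integral_ge0.
 by have := h A mA; rewrite AE -leeBrDr// subee.
move: i0 => /ae_eq_integral_abs => /(_ mA).
move=> /(_ _)/wrap[]; first exact/mEFinP/mfTS.
move=> [N [mN N0 subN]]; apply: (subset_measure0 _ mN) => // x Ax.
by apply: subN => /= /(_ Ax) fx; have := AM x Ax; rewrite -subr_gt0 -lte_fin fx ltxx.
Qed.

Lemma renyi_oo_ge D : (forall A, measurable A -> rho A <= (expR D)%:E * pi A)%E ->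
 (renyi_oo rho pi <= D%:E)%E.
Proof.
move=> h; have dom := measure_le_dominates h.
have [f df [-> _]] := renyi_density dom.
have h2 : (ess_sup pi (EFin \o f) <= (expR D)%:E)%E.
 by apply/ess_supP; exact: density_ae_le (expR_ge0 D) df h.
have [e0|e0] := leP 0%E (ess_sup pi (EFin \o f)).
 by rewrite -[D%:E]expeRK lee_lne ?in_itv/= ?e0 ?leey//= lee_fin expR_ge0.
by rewrite le0_lneNy ?leNye// ltW.
Qed.

Lemma renyi_le1P f q : 1 < q -> is_density f ->
 renyi q rho pi = ((q - 1)^-1%:E * lne (\int[pi]_x (f x `^ q)%:E))%E ->
 (renyi q rho pi <= 1%:E)%E <-> (\int[pi]_x (f x `^ q)%:E <= (expR (q - 1))%:E)%E.
Proof.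
move=> q1 df ->; have q10 : 0 < q - 1 by rewrite subr_gt0.
set I := (\int[_]_x _)%E.
have I0 : (0 <= I)%E by apply: integral_ge0 => x _; rewrite lee_fin powR_ge0.
have -> : ((q - 1)^-1%:E * lne I <= 1%:E)%E = (lne I <= (q - 1)%:E)%E.
 by rewrite muleC lee_pdivrMr// mul1e.
rewrite -[(q - 1)%:E]expeRK lee_lne ?in_itv/= ?I0 ?leey//= ?lee_fin ?expR_ge0//.
Qed.

(** Let A be the set where the density f exceeds 2 a. There 2 a pi(A) <= rho(A) <= a pi(A) + D, so
    rho(A) <= 2 D. The q-th moment is the mean of f^(q-1) under rho: at most (2 a)^(q-1) off A, and
    at most M^(q-1) on A. *)
Lemma renyi_le1_of_sets q a M D : 1 < q -> 0 <= a -> 0 <= M -> 0 <= D ->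
 (forall A, measurable A -> rho A <= a%:E * pi A + D%:E)%E ->
 (forall A, measurable A -> rho A <= M%:E * pi A)%E ->
 (2 * a) `^ (q - 1) + M `^ (q - 1) * (2 * D) <= expR (q - 1) -> (renyi q rho pi <= 1%:E)%E.
Proof.
move=> q1 a0 M0 D0 hD hM hq; have dom := measure_le_dominates hM.
have [f df [_ rE]] := renyi_density dom.
have q0 : 0 < q by pos.
have q10 : 0 < q - 1 by pos.
apply/(renyi_le1P q1 df (rE q _)); first pos.
have [mf f0 fE] := df; have fM := density_ae_le M0 df hM.
pose A := [set x | 2 * a < f x].
have mA : measurable A. by rewrite -[A]setTI; apply: measurable_fun_ltr.
have rA : (rho A <= (2 * D)%:E)%E. have h1 : ((2 * a)%:E * pi A <= rho A)%E.
  rewrite fE// -[leLHS]integral_cst//; apply: ge0_le_integral => //.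
  - by move=> x _; rewrite lee_fin mulr_ge0.
  - exact/mEFinP/mfTS.
  - by move=> x Ax; rewrite lee_fin ltW. have := hD A mA; move: h1.
 rewrite -[pi A]fineK ?fin_num_measure// -[rho A]fineK ?fin_num_measure//.
 by rewrite -!EFinM -EFinD !lee_fin; lra.
pose g x := (2 * a) `^ (q - 1) + M `^ (q - 1) * \1_A x.
have mg : mfunT g. by apply: mfD => //; apply: mfM.
have g0 x : 0 <= g x by pos.
apply: (@le_trans _ _ (\int[pi]_x ((g x)%:E * (f x)%:E))%E). apply: ae_ge0_le_integral => //.
 - pos.
 - by apply/mEFinP; exact: measurable_fun_powR.
 - by move=> x _; rewrite -EFinM lee_fin mulr_ge0.
 - by apply/mEFinP; exact: mfM. apply: filterS fM => x; rewrite lee_fin => fMx _.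
 rewrite -EFinM lee_fin -mulr_powRB1// mulrC ler_wpM2r//. have [xA|xA] := boolP (x \in A).
  rewrite /g indicE xA mulr1 (@le_trans _ _ (M `^ (q - 1)))//.
   by rewrite ge0_ler_powR ?nnegrE// ltW. by rewrite lerDr powR_ge0.
 rewrite /g indicE (negbTE xA) mulr0 addr0 ge0_ler_powR ?nnegrE ?mulr_ge0 ?(ltW q10)//.
 by rewrite leNgt; apply: contra xA => h; rewrite inE.
rewrite -density_integral//; last mes.
under eq_integral do rewrite EFinD EFinM.
rewrite ge0_integralD//; last 3 first.
- pos.
- by move=> x _; rewrite -EFinM lee_fin mulr_ge0 ?powR_ge0.
- by apply/mEFinP; exact: mfM.
rewrite integral_cst// ge0_integralZl//; last 2 first.
- mes.
- pos.
rewrite integral_indic// setIT /= probability_setT mule1.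
apply: (@le_trans _ _ (((2 * a) `^ (q - 1))%:E + (M `^ (q - 1) * (2 * D))%:E)%E).
 by rewrite leeD2l// EFinM lee_wpmul2l// lee_fin powR_ge0.
by rewrite -EFinD lee_fin.
Qed.

(** R_q <= 1 says that the density has norm at most e^((q-1)/q) in L^q(pi); this is the Hoelder dual
    statement, tested on one [g]. *)
Definition dual_bound q g : Prop :=
 E rho g <= expR ((q - 1) / q) * E pi (fun x => g x `^ (q / (q - 1))) `^ ((q - 1) / q).

Lemma bmf_powR g r : 0 <= r -> bmf g -> (forall x, 0 <= g x) -> bmf (fun x => g x `^ r).
Proof.
move=> r0 [mg [K gK]] g0; split; first exact: measurable_fun_powR.
exists (K `^ r) => x; rewrite ger0_norm ?powR_ge0// ge0_ler_powR ?nnegrE//. exact: le_trans (gK x).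
by rewrite (le_trans _ (gK x))// ler_norm.
Qed.

Lemma dual_bound_of_renyi q g : 1 < q -> (renyi q rho pi <= 1%:E)%E ->
 bmf g -> (forall x, 0 <= g x) -> dual_bound q g.
Proof.
move=> q1 rq bg g0.
have q0 : 0 < q by pos.
have q10 : 0 < q - 1 by pos.
have [dom|ndom] := pselect (rho `<< pi); last by move: rq; rewrite /renyi asboolF.
have [f df [_ rE]] := renyi_density dom.
have /(renyi_le1P q1 df (rE q _)) := rq; rewrite gt_eqF// => /(_ isT) fq.
have [mf f0 fE] := df; have [mg _] := bg.
set p := q / (q - 1); have p0 : 0 < p by rewrite divr_gt0.
have pq : q^-1 + p^-1 = 1 by rewrite /p; field; rewrite !gt_eqF.
have := @hoelder _ _ _ pi f g q p mf mg q0 p0 pq.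
have -> : ('N[pi]_1%:E[EFin \o (f \* g)%R] = (E rho g)%:E)%E.
 rewrite Lnorm1 [RHS]EE// (density_integral df) => [||x]; last pos.
 - by apply: eq_integral => x _ /=; rewrite ger0_norm ?mulr_ge0// mulrC EFinM.
 - mes.
have bgp : bmf (fun x => g x `^ p) by apply: bmf_powR => //; exact: ltW.
have -> : ('N[pi]_p%:E[EFin \o g] = (E pi (fun x => g x `^ p) `^ p^-1)%:E)%E.
 rewrite unlock -poweR_EFin EE//; congr (_ `^ _)%E.
 by apply: eq_integral => x _ /=; rewrite ger0_norm.
have -> : p^-1 = (q - 1) / q by rewrite /p invf_div.
rewrite /dual_bound => h; rewrite -lee_fin; apply: le_trans h _.
rewrite EFinM lee_wpmul2r ?lee_fin ?powR_ge0//.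
have -> : ('N[pi]_q%:E[EFin \o f])%E = ((\int[pi]_x (f x `^ q)%:E) `^ q^-1)%E.
 rewrite unlock; congr (_ `^ _)%E. by apply: eq_integral => x _ /=; rewrite ger0_norm.
have I0 : (0 <= \int[pi]_x (f x `^ q)%:E)%E by apply: integral_ge0 => x _; rewrite lee_fin powR_ge0.
move: fq I0; case: (\int[pi]_x (f x `^ q)%:E)%E => [i| |]//=; rewrite ?lee_fin// => iq i0.
apply: (@le_trans _ _ (expR (q - 1) `^ q^-1)).
 by rewrite ge0_ler_powR ?nnegrE ?invr_ge0 ?expR_ge0// ltW.
by rewrite -expRM mulrC.
Qed.

(** Test on min(f, n)^(q-1): the truncated q-th moment I satisfies I <= e^((q-1)/q) I^((q-1)/q), and
    I is finite thanks to the truncation, so a power of it can be divided out. Then n tends to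
    infinity. *)
Lemma renyi_of_dual_bound q : 1 < q ->
 (forall g, bmf g -> (forall x, 0 <= g x) -> dual_bound q g) -> (renyi q rho pi <= 1%:E)%E.
Proof.
move=> q1 H; have q0 : 0 < q by exact: lt_trans q1.
have q10 : 0 < q - 1 by pos.
have p0 : 0 < q / (q - 1) by pos.
have r0 : 0 < (q - 1) / q by pos.
(* Absolute continuity also follows from the duality, tested on indicators of null sets. *)
have dom : rho `<< pi. apply/null_content_dominatesP => A mA pA.
 have := H _ (bmf_indic R mA) (fun x => ler0n _ _); rewrite /dual_bound.
 have -> : E pi (fun x => \1_A x `^ (q / (q - 1))) = 0.
  rewrite (@eq_E _ _ _ _ _ (\1_A)) => [|x]; last first.
   by rewrite indicE; case: (_ \in _); rewrite ?powR1 ?powR0 ?gt_eqF.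
  by rewrite /E integral_indic// setIT pA. rewrite powR0 ?gt_eqF// mulr0.
 rewrite /E integral_indic// setIT => h.
 apply/eqP; rewrite eq_le measure_ge0 andbT -[leLHS]fineK ?fin_num_measure//.
have [f df [_ rE]] := renyi_density dom.
apply/(renyi_le1P q1 df (rE q _)); first pos.
have [mf f0 fE] := df.
pose m (n : nat) x := Num.min (f x) n%:R.
have m0 n x : 0 <= m n x by rewrite le_min f0/=.
have bm n : bmf (m n). split; first exact: measurable_minr.
 by exists n%:R => x; rewrite ger0_norm// ge_min lexx orbT.
have bq n : bmf (fun x => m n x `^ q) by apply: bmf_powR => //; exact: ltW.
have bq1 n : bmf (fun x => m n x `^ (q - 1)) by apply: bmf_powR => //; exact: ltW.
have In n : E pi (fun x => m n x `^ q) <= expR (q - 1).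
 set I := E pi _; have I0 : 0 <= I by apply: E_ge0 => x; exact: powR_ge0.
 have [->|Ine] := eqVneq I 0; first mes. have Ip : 0 < I by pos.
 have h1 : I <= E rho (fun x => m n x `^ (q - 1)).
  rewrite -lee_fin !EE// (density_integral df); last 2 first.
  - by apply/mEFinP; exact: (bq1 n).1.
  - pos. apply: ge0_le_integral => //.
  - pos.
  - by apply/mEFinP; exact: (bq n).1.
  - by apply/mEFinP; apply: mfM => //; exact: (bq1 n).1.
  move=> x _; rewrite -EFinM lee_fin -mulr_powRB1// mulrC ler_wpM2l ?powR_ge0//.
  by rewrite ge_min lexx.
 have := H _ (bq1 n) (fun x => powR_ge0 _ _); rewrite /dual_bound => /(le_trans h1).
 have -> : E pi (fun x => (m n x `^ (q - 1)) `^ (q / (q - 1))) = I.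
  apply: eq_E => x; rewrite -powRrM; congr (_ `^ _); field; rewrite gt_eqF//.
 move=> h2; have h3 : I `^ q^-1 <= expR ((q - 1) / q). have e : I = I `^ q^-1 * I `^ ((q - 1) / q).
   rewrite -powRD ?(gt_eqF Ip) ?implybT// -[LHS]powRr1//; congr (_ `^ _).
   by field; rewrite gt_eqF. by move: h2; rewrite {1}e ler_pM2r// powR_gt0.
 have -> : I = (I `^ q^-1) `^ q by rewrite -powRrM mulVf ?powRr1// gt_eqF.
 have -> : expR (q - 1) = expR ((q - 1) / q) `^ q. by rewrite -expRM divfK// gt_eqF.
 by rewrite ge0_ler_powR ?nnegrE ?powR_ge0 ?expR_ge0// ltW.
have mono : (fun n => \int[pi]_x (m n x `^ q)%:E)%E @ \oo --> (\int[pi]_x (f x `^ q)%:E)%E.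
 rewrite (_ : (\int[pi]_x (f x `^ q)%:E)%E = (\int[pi]_x limn (fun n => (m n x `^ q)%:E))%E).
  apply: cvg_monotone_convergence => //.
  - by move=> n; apply/mEFinP; exact: (bq n).1.
  - pos.
  - move=> x _ a b ab; rewrite lee_fin ge0_ler_powR ?nnegrE// ?(ltW q0)//.
   by rewrite le_min !ge_min lexx/= ler_nat ab orbT.
 apply: eq_integral => x _; apply/esym/cvg_lim => //.
 apply: cvg_near_cst; exists (Num.trunc (f x)).+1 => // n /= hn.
 rewrite /m min_l// ltW// (lt_le_trans (truncnS_gt _))// ler_nat//.
apply: (cvge_le _ mono); apply: nearW => n; rewrite -EE// lee_fin; exact: In.
Qed.

End renyi_lemmas.

(** * Closedness of Renyi balls under almost sure limits *)

Section bounded_convergence.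
Context d (T : measurableType d) (R : realType) (P : probability T R).

Lemma E_ae_cvg (f_ : nat -> T -> R) (f : T -> R) (K : R) : (forall n, mfunT (f_ n)) -> mfunT f ->
 (forall n x, `|f_ n x| <= K) -> {ae P, forall x, f_ n x @[n --> \oo] --> f x} ->
 E P (f_ n) @[n --> \oo] --> E P f.
Proof.
move=> mf_ mf fK cf.
have := @dominated_convergence _ _ _ P setT measurableT (fun n => EFin \o f_ n) (EFin \o f) (cst K%:E).
move=> /(_ _ _ _ _ _)/wrap[].
- mes.
- mes.
- by apply: filterS cf => x cx _; apply: cvg_EFin => //; exact: nearW.
- by apply/integrableP; split => //; rewrite integral_cst//= probability_setT mule1 ltry.
- by apply: aeW => x n _ /=; rewrite lee_fin.
move=> [intf _ h].
rewrite /E; apply: fine_cvg; rewrite fineK//.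
exact: (integrable_fin_num measurableT intf).
Qed.

Lemma E_cvg (f_ : nat -> T -> R) (f : T -> R) (K : R) : (forall n, mfunT (f_ n)) -> mfunT f ->
 (forall n x, `|f_ n x| <= K) -> (forall x, f_ n x @[n --> \oo] --> f x) ->
 E P (f_ n) @[n --> \oo] --> E P f.
Proof. by move=> mf_ mf fK cf; apply: E_ae_cvg mf_ mf fK _; exact: aeW. Qed.

Lemma E_distribution d2 (U : measurableType d2) (X : {mfun T >-> U}) (g : U -> R) :
 bmf g -> E (distribution P X) g = E P (g \o X).
Proof.
move=> bg; have bgX : bmf (g \o X).
 by have [mg [K gK]] := bg; split; [exact: mcompT|exists K => x; exact: gK].
rewrite /E integral_distribution//; first exact/mEFinP/bg.1.
exact: bmf_integrable bgX.
Qed.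

End bounded_convergence.

Section continuous_approximation.
Context (R : realType) (d : nat) (P1 P2 : probability 'rV[R]_d R).
Implicit Types (A B : set 'rV[R]_d) (h g : 'rV[R]_d -> R).

Let contC (c : R) : continuous (fun _ : 'rV[R]_d => c).
Proof. by move=> x; apply: cst_continuous. Qed.

Let contB h1 h2 : continuous h1 -> continuous h2 -> continuous (fun x => h1 x - h2 x).
Proof. by move=> c1 c2 x; exact: (cvgB (c1 x) (c2 x)). Qed.

Let contD h1 h2 : continuous h1 -> continuous h2 -> continuous (fun x => h1 x + h2 x).
Proof. by move=> c1 c2 x; exact: (cvgD (c1 x) (c2 x)). Qed.

Let contM h1 h2 : continuous h1 -> continuous h2 -> continuous (fun x => h1 x * h2 x).
Proof. by move=> c1 c2 x; exact: (cvgM (c1 x) (c2 x)). Qed.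

Definition cont01 h : Prop := [/\ mfunT h, continuous h & forall x, 0 <= h x <= 1].

Definition close1 (e : R) g h : Prop :=
 E P1 (fun x => `|g x - h x|) <= e /\ E P2 (fun x => `|g x - h x|) <= e.

(** Approximation in L^1 for two probabilities at once: in [renyi_le1_lsc] the same continuous
    function must be close under the limit law and under [pi]. *)
Definition approximable g : Prop := forall e, 0 < e -> exists2 h, cont01 h & close1 e g h.

Lemma cont01_bmf h : cont01 h -> bmf h. Proof. by move=> [mh _ h01]; exact: bmf01. Qed.

Lemma close1_le (a b e1 e2 : R) g1 g2 g h1 h2 h : bmf g1 -> bmf g2 -> bmf g ->
 bmf h1 -> bmf h2 -> bmf h -> close1 e1 g1 h1 -> close1 e2 g2 h2 -> 0 <= a -> 0 <= b ->
 (forall x, `|g x - h x| <= a * `|g1 x - h1 x| + b * `|g2 x - h2 x|) ->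
 close1 (a * e1 + b * e2) g h.
Proof.
move=> bg1 bg2 bg bh1 bh2 bh [c11 c12] [c21 c22] a0 b0 H.
have b1 : bmf (fun x => `|g1 x - h1 x|) by apply: bmf_norm; exact: bmfB.
have b2 : bmf (fun x => `|g2 x - h2 x|) by apply: bmf_norm; exact: bmfB.
have b3 : bmf (fun x => `|g x - h x|) by apply: bmf_norm; exact: bmfB.
have ba : bmf (fun x => a * `|g1 x - h1 x|) by apply: bmfM => //; exact: bmf_cst.
have bb : bmf (fun x => b * `|g2 x - h2 x|) by apply: bmfM => //; exact: bmf_cst.
have key P : E P (fun x => `|g x - h x|) <=
  a * E P (fun x => `|g1 x - h1 x|) + b * E P (fun x => `|g2 x - h2 x|).
 by rewrite -!EZ// -ED//; apply: le_E => //; exact: bmfD.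
by split; apply: le_trans (key _) _; rewrite lerD// ler_wpM2l.
Qed.

Lemma approximableC A : measurable A -> approximable \1_A -> approximable \1_(~` A).
Proof.
move=> mA H e e0; have [h [mh ch h01] [c1 c2]] := H e e0.
exists (fun x => 1 - h x). split; first exact: mfB. exact: contB. by move=> x; have := h01 x; lra.
have eE x : `|\1_(~` A) x - (1 - h x)| = `|\1_A x - h x|. have -> : \1_(~` A) x = 1 - \1_A x :> R.
  by rewrite !indicE in_setC; case: (x \in A) => /=; rewrite ?subrr ?subr0.
 by rewrite -normrN; congr (`|_|); ring.
by split; rewrite (eq_E _ eE).
Qed.

Lemma approximableU A B : measurable A -> measurable B -> approximable \1_A ->
 approximable \1_B -> approximable \1_(A `|` B).
Proof.
move=> mA mB HA HB e e0; have e20 : 0 < e / 2 by rewrite divr_gt0.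
have [h1 ch1 c1] := HA _ e20; have [h2 ch2 c2] := HB _ e20.
have [mh1 cc1 h101] := ch1; have [mh2 cc2 h201] := ch2.
pose h x := 1 - (1 - h1 x) * (1 - h2 x).
have ch : cont01 h. split; first by apply: mfB => //; apply: mfM; exact: mfB.
  by apply: contB => //; apply: contM; exact: contB.
 by move=> x; have := h101 x; have := h201 x; rewrite /h; nra.
exists h => //.
have -> : e = 1 * (e / 2) + 1 * (e / 2) by field.
apply: (close1_le (bmf_indic R mA) (bmf_indic R mB) (bmf_indic R (measurableU _ _ mA mB))
 (cont01_bmf ch1) (cont01_bmf ch2) (cont01_bmf ch) c1 c2) => // x.
rewrite !mul1r.
have -> : \1_(A `|` B) x = 1 - (1 - \1_A x) * (1 - \1_B x) :> R.
 by rewrite !indicE in_setU; case: (x \in A); case: (x \in B) => /=; ring.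
set a : R := \1_A x; set b : R := \1_B x.
have b01 : 0 <= b <= 1 by rewrite /b indicE ler0n lern1 leq_b1.
have -> : 1 - (1 - a) * (1 - b) - h x = (a - h1 x) * (1 - b) + (1 - h1 x) * (b - h2 x) by rewrite /h; ring.
apply: le_trans (ler_normD _ _) _; rewrite !normrM lerD//. by rewrite ler_piMr// ger0_norm; lra.
rewrite ler_piMl// ger0_norm; have := h101 x; lra.
Qed.

Lemma approximable_cvg (A_ : nat -> set 'rV[R]_d) A : (forall n, measurable (A_ n)) ->
 measurable A -> (forall n, approximable \1_(A_ n)) ->
 (forall x, (\1_(A_ n) x : R) @[n --> \oo] --> (\1_A x : R)) -> approximable \1_A.
Proof.
move=> mA_ mA HA cA e e0; have e20 : 0 < e / 2 by rewrite divr_gt0.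
have key P : \forall n \near \oo, E P (fun x => `|\1_A x - \1_(A_ n) x|) <= e / 2.
 have : E P (fun x => `|\1_A x - \1_(A_ n) x|) @[n --> \oo] --> E P (fun=> 0).
  apply: (@E_cvg _ _ _ _ _ _ 1).
  - move=> n; apply: mcompT => //; apply: mfB; exact: mindic.
  - mes.
  - move=> n x; rewrite normr_id !indicE.
   by case: (_ \in _); case: (_ \in _); rewrite ?subrr ?normr0 ?subr0 ?sub0r ?normrN ?normr1.
  move=> x; rewrite -(normr0 R) -(subrr (\1_A x : R)).
  by apply: (@cvg_norm _ R^o); apply: (@cvgB _ R^o); [exact: cvg_cst|exact: cA].
 rewrite E_cst => /cvgr_le; exact.
near \oo => n.
have h1 : E P1 (fun x => `|\1_A x - \1_(A_ n) x|) <= e / 2 by near: n; exact: key.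
have h2 : E P2 (fun x => `|\1_A x - \1_(A_ n) x|) <= e / 2 by near: n; exact: key.
have [h ch c] := HA n _ e20; exists h => //.
have -> : e = 1 * (e / 2) + 1 * (e / 2) by field.
apply: (close1_le (bmf_indic R mA) (bmf_indic R (mA_ n)) (bmf_indic R mA)
 (bmf_indic R (mA_ n)) (cont01_bmf ch) (cont01_bmf ch) (conj h1 h2) c) => // x.
by rewrite !mul1r (le_trans _ (ler_normD _ _))// addrA subrK.
Unshelve. all: by end_near. Qed.

(** The clamp of t to [0, 1], written with absolute values so that its continuity is immediate. *)
Definition ramp (t : R) : R := (`|t| - `|t - 1| + 1) / 2.

Lemma ramp01 t : 0 <= ramp t <= 1.
Proof.
rewrite /ramp; have [t0|t0] := leP 0 t; have [t1|t1] := leP 1 t.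
- by rewrite !ger0_norm; lra.
- by rewrite ger0_norm// ltr0_norm; lra.
- lra.
- by rewrite !ltr0_norm; lra.
Qed.

Lemma ramp_le0 t : t <= 0 -> ramp t = 0.
Proof. by move=> t0; rewrite /ramp !ler0_norm; [field|lra|lra]. Qed.

Lemma ramp_ge1 t : 1 <= t -> ramp t = 1.
Proof. by move=> t0; rewrite /ramp !ger0_norm; [field|lra|lra]. Qed.

Lemma continuous_ramp : continuous ramp.
Proof.
move=> t; apply: (@cvgM _ R); last exact: cvg_cst.
apply: (@cvgD _ R^o); last exact: cvg_cst.
apply: (@cvgB _ R^o); first by apply: (@cvg_norm _ R^o); exact: cvg_id.
by apply: (@cvg_norm _ R^o); apply: (@cvgB _ R^o); [exact: cvg_id|exact: cvg_cst].
Qed.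

Lemma measurable_ramp : measurable_fun [set: R] ramp.
Proof. exact: cont_mfun continuous_ramp. Qed.

Lemma continuous_coord (i : 'I_d) : continuous (fun v : 'rV[R]_d => v ord0 i).
Proof. exact: coord_continuous. Qed.

Lemma cont01_ramp (i : 'I_d) (k a : R) : cont01 (fun v : 'rV[R]_d => ramp (k * (v ord0 i - a))).
Proof.
split; last by move=> v; exact: ramp01. apply: (mcompT measurable_ramp); apply: mfM => //.
 by apply: mfB => //; exact: mcoord_rV.
move=> v; have : {for v, continuous (ramp \o (fun v : 'rV[R]_d => k * (v ord0 i - a)))}.
 apply: continuous_comp; last exact: continuous_ramp.
 by apply: contM => //; apply: contB => //; exact: continuous_coord.
exact.
Qed.

Lemma ramp_cvg (x a : R) : ramp (n%:R * (x - a)) @[n --> \oo] --> ((a < x)%R%:R : R).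
Proof.
have [xa|ax] := leP x a. rewrite (_ : (fun n => _) = fun=> 0); first exact: cvg_cst.
 by apply/funext => n; rewrite ramp_le0// mulr_ge0_le0// subr_le0.
have x0 : 0 < x - a by pos.
apply: cvg_near_cst; exists (Num.trunc (x - a)^-1).+1 => // n /= hn.
rewrite ramp_ge1// -ler_pdivrMr// div1r ltW// (lt_le_trans (truncnS_gt _))//.
by rewrite ler_nat.
Qed.

Lemma approximable_halfspace (i : 'I_d) (a : R) : approximable \1_[set v | a < v ord0 i].
Proof.
move=> e e0.
have mA : measurable [set v : 'rV[R]_d | a < v ord0 i].
 by rewrite -[X in measurable X]setTI; apply: measurable_fun_ltr => //; exact: mcoord_rV.
have key P : \forall n \near \oo, E P (fun x : 'rV[R]_d => `|\1_[set v : 'rV[R]_d | a < v ord0 i] x - ramp (n%:R * (x ord0 i - a))|) <= e.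
 have : E P (fun x : 'rV[R]_d => `|\1_[set v : 'rV[R]_d | a < v ord0 i] x - ramp (n%:R * (x ord0 i - a))|) @[n --> \oo] --> E P (fun=> 0).
  apply: (@E_cvg _ _ _ _ _ _ 1).
  - move=> n; apply: mcompT => //; apply: mfB; first mes. by have [] := cont01_ramp i n%:R a.
  - mes.
  - move=> n x; rewrite normr_id indicE ler_norml; have := ramp01 (n%:R * (x ord0 i - a)).
   by case: (_ \in _) => /=; lra.
  move=> x; rewrite -(normr0 R) -(subrr (\1_[set v : 'rV[R]_d | a < v ord0 i] x : R)).
  apply: (@cvg_norm _ R^o); apply: (@cvgB _ R^o); first exact: cvg_cst.
  have -> : \1_[set v : 'rV[R]_d | a < v ord0 i] x = (a < x ord0 i)%R%:R :> R.
   by rewrite indicE; have [h|h] := ltP a (x ord0 i); [rewrite mem_set|rewrite memNset//= => /(le_lt_trans h); rewrite ltxx].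
  exact: ramp_cvg. rewrite E_cst => /cvgr_le; exact.
near \oo => n; exists (fun x => ramp (n%:R * (x ord0 i - a))); first exact: cont01_ramp.
by split; near: n; exact: key.
Unshelve. all: by end_near. Qed.

(** The approximable sets form a sigma-algebra, and half-spaces are in it through steep ramps. *)
Lemma approximable_indic A : measurable A -> approximable \1_A.
Proof.
pose G : set (set 'rV[R]_d) := [set A | measurable A /\ approximable \1_A].
suff : measurable `<=` G by move=> h /h[].
have G0 : G set0. split => // e e0; exists (fun=> 0).
  by split; [exact: mcst|exact: contC|move=> x; rewrite lexx ler01].
 by split; rewrite (@eq_E _ _ _ _ _ (fun=> 0)) ?E_cst ?(ltW e0)// => x; rewrite indicE in_set0 subrr normr0.
have GC (B : set 'rV[R]_d) : G B -> G (~` B).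
 by move=> [mA aA]; split; [exact: measurableC|exact: approximableC].
have GU (B C : set 'rV[R]_d) : G B -> G C -> G (B `|` C).
 by move=> [mA aA] [mB aB]; split; [exact: measurableU|exact: approximableU].
have GUn (F : nat -> set 'rV[R]_d) : (forall i, G (F i)) -> G (\bigcup_i F i).
 move=> GF; have mF i := (GF i).1. have GUf n : G (\big[setU/set0]_(i < n) F i).
  by elim: n => [|n IH]; [rewrite big_ord0|rewrite big_ord_recr/=; exact: GU].
 split; first exact: bigcupT_measurable.
 apply: (@approximable_cvg (fun n => \big[setU/set0]_(i < n) F i)) => [n||n|x].
 - exact: (GUf n).1.
 - exact: bigcupT_measurable.
 - exact: (GUf n).2. have [[k _ Fx]|nF] := pselect ((\bigcup_i F i) x).
  apply: cvg_near_cst; exists k.+1 => // n /= kn. rewrite !indicE !mem_set//; first by exists k.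
  by rewrite -bigcup_mkord; exists k.
 apply: cvg_near_cst; apply: nearW => n; rewrite !indicE !memNset// => h; apply: nF.
 by move: h; rewrite -bigcup_mkord => -[i _ Fi]; exists i.
rewrite measurable_orthantE; apply: smallest_sub. by split => // B GB; rewrite setTD; exact: GC.
move=> _ [a _ <-].
(* The finite intersection over coordinates is written with a countable union, padded by [set0]
   beyond the dimension. *)
have -> : orthant a = ~` \bigcup_(n : nat) (if insub n is Some i then ~` [set v : 'rV[R]_d | a i < v ord0 i] else set0).
 apply/seteqP; split => [v va [n _]|v nv i]. by case: insubP => [i _ _|//]; apply; exact: va.
 apply: contrapT => h; apply: nv; exists (val i) => //. by rewrite valK.
apply: (GC); apply: GUn => n; case: insubP => [i _ _|//].
apply: GC; split; last exact: approximable_halfspace.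
by rewrite -[X in measurable X]setTI; apply: measurable_fun_ltr => //; exact: mcoord_rV.
Qed.

(** Binary digits of the values: with A the set where g >= 1/2, g is the average of 1_A and of g' =
    2 g - 1_A, again with values in [0, 1]. Each stage halves the error. *)
Lemma approximable_fun g : mfunT g -> (forall x, 0 <= g x <= 1) -> approximable g.
Proof.
move=> mg g01.
suff H n : forall g, mfunT g -> (forall x, 0 <= g x <= 1) ->
  forall e, 0 < e -> exists2 h, cont01 h & close1 (2^-1 ^+ n + e) g h.
 move=> e e0; have e20 : 0 < e / 2 by rewrite divr_gt0.
 have [n hn] : exists n, 2^-1 ^+ n <= e / 2 :> R. have : (2^-1 : R) ^+ n @[n --> \oo] --> 0.
   by apply: cvg_expr; rewrite ger0_norm; lra.
  move=> /cvgr_le /(_ _ e20)[n _ hn]; exists n; exact: (hn n (leqnn n)).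
 have [h ch [c1 c2]] := H n g mg g01 _ e20; exists h => //.
 by split; [apply: le_trans c1 _|apply: le_trans c2 _]; lra.
elim: n => [|n IH] {mg g01} {}g mg g01 e e0. exists (fun=> 0).
  by split; [exact: mcst|exact: contC|move=> x; rewrite lexx ler01].
 have key P : E P (fun x => `|g x - 0|) <= 2^-1 ^+ 0 + e. rewrite (@le_trans _ _ 1)//; last pos.
  rewrite -[leRHS](E_cst P); apply: le_E; [|exact: bmf_cst|].
   by apply: bmf_norm; apply: bmfB; [exact: bmf01|exact: bmf_cst].
  by move=> x; have := g01 x; rewrite subr0 => /andP[h0 h1]; rewrite ger0_norm.
 by split; exact: key.
pose A := [set x | 2^-1 <= g x].
have mA : measurable A by rewrite -[A]setTI; apply: measurable_fun_ler.
pose g' x := 2 * g x - \1_A x.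
have mg' : mfunT g' by apply: mfB; [exact: mfM|exact: mindic].
have g'01 x : 0 <= g' x <= 1. rewrite /g' indicE; have := g01 x; have [xA|xA] := boolP (x \in A).
  by move: xA; rewrite inE /A/= => ? ?; lra.
 have : g x < 2^-1 by rewrite ltNge; apply: contra xA => h; rewrite inE.
 by move=> ? ?; rewrite /=; lra.
have [h1 ch1 c1] := IH g' mg' g'01 e e0.
have [h2 ch2 c2] := approximable_indic mA e0.
have [mh1 cc1 h101] := ch1; have [mh2 cc2 h201] := ch2.
pose h x := 2^-1 * (h1 x + h2 x).
have ch : cont01 h. split; first by apply: mfM => //; exact: mfD.
  by apply: contM => //; exact: contD. by move=> x; have := h101 x; have := h201 x; rewrite /h; lra.
exists h => //.
have -> : 2^-1 ^+ n.+1 + e = 2^-1 * (2^-1 ^+ n + e) + 2^-1 * e by rewrite exprS; field.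
apply: (close1_le (bmf01 mg' g'01) (bmf_indic R mA) (bmf01 mg g01)
 (cont01_bmf ch1) (cont01_bmf ch2) (cont01_bmf ch) c1 c2) => // x.
have -> : g x - h x = 2^-1 * (g' x - h1 x) + 2^-1 * (\1_A x - h2 x) by rewrite /g' /h; field.
apply: le_trans (ler_normD _ _) _; rewrite !normrM.
by have -> : `|2^-1 : R| = 2^-1 by rewrite ger0_norm.
Qed.

End continuous_approximation.

Section semicontinuity.
Context dO (Omega : measurableType dO) (R : realType) (P : probability Omega R) (d : nat).
Implicit Types (Y : {RV P >-> 'rV[R]_d}) (pi : probability 'rV[R]_d R).

(** Here p is the conjugate exponent q / (q - 1), which lies in [1, 2] because q >= 2. *)
Lemma powR_lip (a b p : R) : 0 <= a <= 1 -> 0 <= b <= 1 -> 1 <= p <= 2 ->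
 a `^ p <= b `^ p + 2 * `|a - b|.
Proof.
move=> /andP[a0 a1] /andP[b0 b1] /andP[p1 p2].
have p0 : 0 < p by pos.
have [ab|ba] := leP a b. apply: (@le_trans _ _ (b `^ p)); last by rewrite lerDl mulr_ge0.
 by rewrite ge0_ler_powR ?nnegrE// ltW.
have a0' : 0 < a by pos.
rewrite ger0_norm ?subr_ge0 ?(ltW ba)//.
have -> : b `^ p = a `^ p * (b / a) `^ p. by rewrite -powRM ?divr_ge0// mulrC divfK// gt_eqF.
set t := b / a; have t01 : 0 <= t <= 1. by rewrite divr_ge0//= ler_pdivrMr// mul1r ltW.
have [t0 t1] := andP t01.
have tp : t ^+ 2 <= t `^ p.
 move: t0; rewrite le_eqVlt => /predU1P[<-|t0]; first by rewrite expr0n/= powR_ge0.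
 by rewrite -powR_mulrn ?(ltW t0)// ger_powR// t0.
have ap : a `^ p <= a. by rewrite -[leRHS]powRr1// ger_powR// a0'.
have -> : a - b = a * (1 - t) by rewrite mulrBr mulr1 /t mulrC divfK// gt_eqF.
have ap0 : 0 <= a `^ p by pos.
set A := a `^ p in ap ap0 *; set B := t `^ p in tp *.
have h1 : A * (1 - B) <= A * (2 * (1 - t)) by rewrite ler_wpM2l//; nra.
have h2 : A * (2 * (1 - t)) <= a * (2 * (1 - t)) by rewrite ler_wpM2r//; lra.
nra.
Qed.

Lemma le_powR_eps (X k Z r : R) : 0 < k -> 0 <= Z -> 0 < r ->
 (forall e, 0 < e -> X <= k * (Z + e) `^ r) -> X <= k * Z `^ r.
Proof.
move=> k0 Z0 r0 H; rewrite leNgt; apply/negP => h.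
have hy : Z `^ r < X / k by rewrite ltr_pdivlMr// mulrC.
have y0 : 0 <= X / k by rewrite (le_trans _ (ltW hy))// powR_ge0.
have hZ : Z < (X / k) `^ r^-1.
 rewrite ltNge; apply/negP => h'; move: hy; rewrite ltNge => /negP; apply.
 have -> : X / k = ((X / k) `^ r^-1) `^ r by rewrite -powRrM mulVf ?powRr1// gt_eqF.
 by rewrite ge0_ler_powR ?nnegrE ?powR_ge0// ltW.
pose e := ((X / k) `^ r^-1 - Z) / 2.
have e0 : 0 < e by pos.
have := H e e0; rewrite leNgt => /negP; apply.
rewrite mulrC -ltr_pdivlMr//.
have {1}<- : ((X / k) `^ r^-1) `^ r = X / k by rewrite -powRrM mulVf ?powRr1// gt_eqF.
rewrite gt0_ltr_powR ?nnegrE ?powR_ge0 ?addr_ge0 ?(ltW e0)//.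
rewrite /e; lra.
Qed.

Lemma dual_bound_scale rho pi (q K : R) (g : 'rV[R]_d -> R) : 1 < q -> 0 < K -> bmf g ->
 (forall x, 0 <= g x) -> dual_bound rho pi q (fun x => K^-1 * g x) -> dual_bound rho pi q g.
Proof.
move=> q1 K0 bg g0; have q0 : 0 < q by exact: lt_trans q1.
have q10 : 0 < q - 1 by pos.
have p0 : 0 < q / (q - 1) by pos.
have Ki : 0 < K^-1 by pos.
rewrite /dual_bound (EZ rho K^-1 bg).
have bgp : bmf (fun x => g x `^ (q / (q - 1))) by apply: bmf_powR => //; exact: ltW.
rewrite (@eq_E _ _ _ pi (fun x => (K^-1 * g x) `^ (q / (q - 1))) (fun x => K^-1 `^ (q / (q - 1)) * g x `^ (q / (q - 1)))); last first.
 by move=> x; rewrite powRM// ltW.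
rewrite EZ// powRM ?powR_ge0//; last by apply: E_ge0 => x; exact: powR_ge0.
rewrite -powRrM; have -> : q / (q - 1) * ((q - 1) / q) = 1 by field; rewrite !gt_eqF.
by rewrite powRr1 ?(ltW Ki)// mulrCA ler_pM2l.
Qed.

(** In dual form the ball is an intersection of inequalities. For continuous g they pass to the
    limit by dominated convergence; the general g, rescaled into [0, 1], is approximated under both
    laws. *)
Lemma renyi_le1_lsc (q : R) (Y_ : nat -> {RV P >-> 'rV[R]_d}) Y pi : 2 <= q ->
 {ae P, forall w, Y_ n w @[n --> \oo] --> Y w} ->
 (forall n, (renyi q (distribution P (Y_ n)) pi <= 1%:E)%E) ->
 (renyi q (distribution P Y) pi <= 1%:E)%E.
Proof.
move=> q2 cY H; have q1 : 1 < q by lra.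
have q0 : 0 < q by pos.
have q10 : 0 < q - 1 by pos.
set p := q / (q - 1); have p12 : 1 <= p <= 2.
 by rewrite /p ler_pdivlMr// mul1r ler_pdivrMr//; apply/andP; split; lra.
have p0 : 0 < p by pos.
set r := (q - 1) / q; have r0 : 0 < r by rewrite divr_gt0.
set k := expR r; have k0 : 0 < k by exact: expR_gt0.
apply: renyi_of_dual_bound => // g bg g0.
have [mg [K0 gK0]] := bg; pose K := K0 + 1.
have Kp : 0 < K by rewrite ltr_wpDl// (le_trans _ (gK0 0)).
apply: (@dual_bound_scale _ _ _ K) => //.
set f := (fun x : 'rV[R]_d => K^-1 * g x).
have mf : mfunT f by exact: mfM.
have f01 x : 0 <= f x <= 1. rewrite /f mulr_ge0 ?invr_ge0 ?(ltW Kp)//= mulrC ler_pdivrMr// mul1r.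
 have := gK0 x; rewrite ger0_norm// => h; rewrite (le_trans h)// lerDl//.
have bf : bmf f by exact: bmf01.
rewrite /dual_bound -/p -/r -/k.
have bpow (h : 'rV[R]_d -> R) : bmf h -> (forall x, 0 <= h x) -> bmf (fun x => h x `^ p).
 by move=> bh h0; apply: bmf_powR => //; exact: ltW.
have f0 x : 0 <= f x by case/andP: (f01 x).
set Z := E pi (fun x => f x `^ p).
have Z0 : 0 <= Z by apply: E_ge0 => x; exact: powR_ge0.
apply: le_powR_eps => // e e0.
apply/ler_addgt0Pr => e' e'0.
pose e2 := Num.min (e / 2) e'; have e20 : 0 < e2 by rewrite lt_min divr_gt0.
have [h [mh ch h01] [c1 c2]] := approximable_fun (distribution P Y) pi mf f01 e20.
have h0 x : 0 <= h x by case/andP: (h01 x).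
have bh : bmf h by exact: bmf01.
have dual_h : E (distribution P Y) h <= k * E pi (fun x => h x `^ p) `^ r.
 have : E P (h \o Y_ n) @[n --> \oo] --> E P (h \o Y). apply: (@E_ae_cvg _ _ _ _ _ _ 1).
  - by move=> n; apply: mcompT.
  - by apply: mcompT.
  - by move=> n x /=; have := h01 (Y_ n x) => /andP[? ?]; rewrite ger0_norm.
  - by apply: filterS cY => w cw; exact: (cvg_comp _ _ cw (ch (Y w))).
 rewrite -E_distribution// => c; apply: (cvgr_to_le c); apply: nearW => n.
 have := dual_bound_of_renyi q1 (H n) bh h0. by rewrite /dual_bound E_distribution.
have bfh : bmf (fun x => `|f x - h x|) by apply: bmf_norm; exact: bmfB.
have e2e' : e2 <= e' by rewrite ge_min lexx orbT.
have e2e : 2 * e2 <= e by have : e2 <= e / 2; [rewrite ge_min lexx|lra].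
apply: (@le_trans _ _ (E (distribution P Y) h + e')).
 rewrite addrC -lerBlDr -EB//; apply: le_trans _ (le_trans c1 e2e').
 apply: le_E => //; first exact: bmfB. by move=> x; exact: ler_norm.
rewrite lerD2r; apply: le_trans dual_h _; rewrite ler_wpM2l ?(ltW k0)//.
have hp0 : 0 <= E pi (fun x => h x `^ p) by apply: E_ge0 => x; exact: powR_ge0.
rewrite ge0_ler_powR ?nnegrE ?(ltW r0) ?addr_ge0 ?(ltW e0)//.
apply: (@le_trans _ _ (Z + 2 * E pi (fun x => `|f x - h x|))); last first.
 rewrite lerD2l; apply: le_trans e2e; rewrite ler_wpM2l//.
rewrite -EZ// -ED; [|exact: bpow|by apply: bmfM => //; exact: bmf_cst].
apply: le_E; first exact: bpow. by apply: bmfD; [exact: bpow|apply: bmfM => //; exact: bmf_cst].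
by move=> x; rewrite distrC; exact: powR_lip.
Qed.

End semicontinuity.

(** * Variance decay along the chain *)

Section measure_le.
Context d (T : measurableType d) (R : realType) (rho pi : probability T R).

Lemma E_measure_le (M : R) f : 0 <= M ->
 (forall A, measurable A -> rho A <= M%:E * pi A)%E -> bmf f -> (forall x, 0 <= f x) ->
 E rho f <= M * E pi f.
Proof.
move=> M0 H bf f0; have [mf _] := bf.
have [p dp _] := renyi_density (measure_le_dominates H).
have [mp p0 _] := dp.
rewrite -lee_fin [leRHS]EFinM !EE// (density_integral dp)//; last mes.
rewrite -integralZ_EFin//.
apply: ae_ge0_le_integral => //.
- by move=> x _; rewrite -EFinM lee_fin mulr_ge0.
- by apply/mEFinP; exact: mfM.
- by move=> x _; rewrite lee_fin mulr_ge0.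
- by apply/mEFinP; exact: mfM.
apply: filterS (density_ae_le M0 dp H) => x; rewrite lee_fin => px _.
by rewrite -EFinM lee_fin mulrC ler_wpM2r.
Qed.

(** Jensen under rho, then rho <= M pi: a variance under [pi] becomes a bound on a mean under rho,
    at the cost of sqrt(M). *)
Lemma E_measure_le_mean (M c : R) f : 0 <= M ->
 (forall A, measurable A -> rho A <= M%:E * pi A)%E -> bmf f ->
 E rho f <= c + Num.sqrt (M * E pi (fun x => (f x - c) ^+ 2)).
Proof.
move=> M0 H bf; have bfc : bmf (fun x => f x - c) by apply: bmfB => //; exact: bmf_cst.
have b2 : bmf (fun x => (f x - c) ^+ 2) by exact: bmfX.
rewrite -lerBlDl -[X in _ - X](E_cst rho c) -EB//; last exact: bmf_cst.
apply: le_trans (ler_norm _) _; rewrite -sqrtr_sqr ler_wsqrtr//.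
apply: le_trans (sqr_E_le _ bfc) _.
by apply: E_measure_le => // x; exact: sqr_ge0.
Qed.

End measure_le.

Section decay.
Context (R : realType) (d : nat) (nu : R).
Hypothesis nu1 : 1 <= nu.
Variable pi : probability 'rV[R]_d R.
Hypothesis gpi : is_gibbs (V_nu nu) pi.
Let n : R := d%:R + nu.
Implicit Types (f g : 'rV[R]_d -> R) (s S : R).

Definition var f : R := E pi (fun x => f x ^+ 2) - E pi f ^+ 2.

Variable s : R.
Hypotheses (s0 : 0 < s) (s1 : s <= 1) (sn : n ^+ 2 * s ^+ 2 <= 64^-1).
Let c : R := cstep d nu s.
Let eta : R := ai_const d nu * s ^+ 3.
Let L : ('rV[R]_d -> R) -> 'rV[R]_d -> R := lmcP c s.

Let n1 : 1 <= n. Proof. by rewrite (le_trans nu1)// lerDr. Qed.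

Lemma cstep01 : 0 <= c <= 1.
Proof.
have n0 : 0 <= n by exact: le_trans n1.
rewrite /c /cstep -/n; apply/andP; split. pos.
have h : n * s ^+ 2 <= n ^+ 2 * s ^+ 2. by rewrite ler_wpM2r ?sqr_ge0// expr2 ler_peMr.
have := le_trans h sn; lra.
Qed.

Lemma eta_ge0 : 0 <= eta.
Proof. by rewrite mulr_ge0 ?ai_const_ge0// exprn_ge0// ltW. Qed.

Lemma lmcP01 g : bmf g -> (forall x, 0 <= g x <= 1) -> forall x, 0 <= L g x <= 1.
Proof.
move=> bg g01 x; apply: E01; last mes.
exact: (bmf_affine _ _ bg).1.
Qed.

(** Almost invariance is one-sided; applied to 1 - g it gives the other side. *)
Lemma mean_lmcP_ge g : bmf g -> (forall x, 0 <= g x <= 1) -> E pi g - eta <= E pi (L g).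
Proof.
move=> bg g01; have bLg : bmf (L g) by apply: bmf_lmcP => //; exact: cstep01.
have b1g : bmf (fun x => 1 - g x) by apply: bmfB => //; exact: bmf_cst.
have := lmcP_almost_invariant nu1 gpi s0 s1 sn b1g _ => /(_ _)/wrap[].
 by move=> x; rewrite subr_ge0; case/andP: (g01 x).
rewrite -/c -/eta (@eq_E _ _ _ pi _ (fun x => 1 - L g x)); last first.
 move=> x; rewrite /L /lmcP /gE EB ?E_cst//; first exact: bmf_cst. exact: bmf_affine.
rewrite !EB ?E_cst//; try exact: bmf_cst.
have := E01 pi bg.1 g01; have := eta_ge0; nra.
Qed.

(** One of the three [eta] comes from the mean of P(g^2), the other two from the difference of the
    squared means. *)
Lemma lvar_mean_le g : bmf g -> (forall x, 0 <= g x <= 1) ->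
 E pi (lvar c s g) <= var g - var (L g) + 3 * eta.
Proof.
move=> bg g01; have c01 := cstep01.
have bg2 : bmf (fun x => g x ^+ 2) by exact: bmfX.
have bL : bmf (L g) by exact: bmf_lmcP.
have bL2 : bmf (fun x => L g x ^+ 2) by exact: bmfX.
have bLg2 : bmf (L (fun x => g x ^+ 2)) by exact: bmf_lmcP.
have -> : E pi (lvar c s g) = E pi (L (fun x => g x ^+ 2)) - E pi (fun x => L g x ^+ 2).
 by rewrite -EB.
have h1 := lmcP_almost_invariant nu1 gpi s0 s1 sn bg2 (fun x => sqr_ge0 (g x)).
rewrite -/c -/eta -/L in h1.
have h2 := mean_lmcP_ge bg g01.
have h3 := E01 pi bg.1 g01.
have h4 := E01 pi bL.1 (lmcP01 bg g01).
have h5 : 0 <= E pi (fun x => g x ^+ 2) <= 1. apply: E01; first exact: bg2.1.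
 by move=> x; rewrite sqr_ge0/= expr_le1//; case/andP: (g01 x).
have := eta_ge0; rewrite /var.
set a := E pi g in h2 h3 *; set b := E pi (L g) in h2 h4 *.
set u := E pi (fun x => g x ^+ 2) in h1 h5 *.
move=> e0; have h6 : a ^+ 2 - b ^+ 2 <= 2 * eta.
 rewrite subr_sqr; have [ab|ba] := leP a b; first by nra.
 by apply: (@le_trans _ _ (eta * (a + b))); [rewrite ler_wpM2r; lra|rewrite mulrC ler_wpM2r; lra].
have : eta * u <= eta by rewrite ler_piMr//; lra.
lra.
Qed.

(** The weak Poincare inequality is applied to L g and not to g: its slope is controlled by the
    local variance of g, whose mean is the variance lost. The factor 12 is 3 times a bound 4 on (1 +
    c)^2. *)
Lemma var_lmcP_le g S : bmf g -> (forall x, 0 <= g x <= 1) -> 1 <= S ->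
 var (L g) <= 4 * expR (- nu * ln S) + 12 * d%:R * S ^+ 3 / s ^+ 2 * (var g - var (L g) + 3 * eta).
Proof.
move=> bg g01 S1; have c01 := cstep01.
have S0 : 0 <= S by pos.
have bv : bmf (lvar c s g) by exact: bmf_lvar.
have k0 : 0 <= (1 + c) / s by pos.
pose A := (fun x : 'rV[R]_d => (1 + c) / s * Num.sqrt (lvar c s g x)).
have [mg [K gK]] := bg.
have A2 x : A x ^+ 2 = ((1 + c) / s) ^+ 2 * lvar c s g x. by rewrite /A exprMn sqr_sqrtr// lvar_ge0.
have bA : bmf A. apply: bmfM; first exact: bmf_cst.
 split; first exact: (mcompT (@measurable_sqrtr R) bv.1).
 exists K => x; rewrite ger0_norm ?sqrtr_ge0//. have K0 : 0 <= K by exact: le_trans (gK 0).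
 by rewrite -(ger0_norm K0) -sqrtr_sqr ler_wsqrtr//; apply: lvar_le.
have := weak_poincare nu1 gpi S1 (bmf_lmcP c s bg).1 (lmcP01 bg g01) bA _ (slope_lmcP c01 s0 bg).
move=> /(_ _)/wrap[]; first pos.
rewrite -/(var (L g)) => h; apply: le_trans h _; rewrite lerD2l.
rewrite (eq_E _ A2) (EZ pi _ bv).
have hv := lvar_mean_le bg g01.
have v0 : 0 <= E pi (lvar c s g) by apply: E_ge0 => x; exact: lvar_ge0.
have c4 : (1 + c) ^+ 2 <= 4 by move: c01 => /andP[? ?]; nra.
rewrite [leRHS](_ : _ = 3 * d%:R * S ^+ 3 * (4 / s ^+ 2 * (var g - var (L g) + 3 * eta))); last pos.
rewrite ler_wpM2l ?mulr_ge0 ?exprn_ge0//.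
rewrite expr_div_n ler_pM ?divr_ge0 ?sqr_ge0//.
by rewrite ler_wpM2r ?invr_ge0 ?sqr_ge0.
Qed.

Lemma bmf_iter_lmcP g k : bmf g -> bmf (iter k L g).
Proof. by move=> bg; elim: k => //= k IH; apply: bmf_lmcP => //; exact: cstep01. Qed.

Lemma iter_lmcP01 g k : bmf g -> (forall x, 0 <= g x <= 1) -> forall x, 0 <= iter k L g x <= 1.
Proof. by move=> bg g01; elim: k => //= k IH; apply: lmcP01 => //; exact: bmf_iter_lmcP. Qed.

Lemma iter_lmcP_mean_le g k : bmf g -> (forall x, 0 <= g x <= 1) ->
 E pi (iter k L g) <= expR (k%:R * eta) * E pi g.
Proof.
move=> bg g01; elim: k => [|k IH] /=; first by rewrite mul0r expR0 mul1r.
have h01 := iter_lmcP01 k bg g01; have bh := bmf_iter_lmcP k bg.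
have h := lmcP_almost_invariant nu1 gpi s0 s1 sn bh (fun x => proj1 (andP (h01 x))).
apply: le_trans h _; rewrite -/c -/eta.
apply: (@le_trans _ _ ((1 + eta) * (expR (k%:R * eta) * E pi g))).
 by rewrite ler_wpM2l// addr_ge0// eta_ge0.
have Eg := E01 pi bg.1 g01.
rewrite mulrA ler_wpM2r ?(proj1 (andP Eg))//.
have -> : k.+1%:R * eta = k%:R * eta + eta by pos.
by rewrite expRD mulrC ler_wpM2l ?expR_ge0// expR_ge1Dx.
Qed.

(** Above the floor [sg] = 4 S^-nu the recursion is a contraction; the additive terms 3 eta simply
    accumulate. *)
Lemma iter_lmcP_var_le g S k : bmf g -> (forall x, 0 <= g x <= 1) -> (0 < d)%N -> 1 <= S ->
 var (iter k L g) <= 4 * expR (- nu * ln S) +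
  expR (- (k%:R * s ^+ 2 / (24 * d%:R * S ^+ 3))) + 3 * (k%:R * eta).
Proof.
move=> bg g01 d0 S1; set sg := 4 * expR _; set lam := s ^+ 2 / (12 * d%:R * S ^+ 3).
have d1 : 1 <= d%:R :> R by rewrite ler1n.
have S3 : 1 <= S ^+ 3 by rewrite exprn_ege1.
have D0 : 1 <= 12 * d%:R * S ^+ 3 by rewrite -[leLHS](mulr1 1) ler_pM//; lra.
have lam0 : 0 < lam by pos.
have lam1 : lam <= 1.
 rewrite ler_pdivrMr ?(lt_le_trans _ D0)// mul1r (le_trans _ D0)// expr_le1// ltW//.
have -> : k%:R * s ^+ 2 / (24 * d%:R * S ^+ 3) = k%:R * (lam / 2).
 rewrite /lam; field; rewrite !gt_eqF ?exprn_gt0 ?ltr0n//; lra.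
have e0 := eta_ge0.
suff : (var (iter k L g) - sg) <= expR (- (k%:R * (lam / 2))) + 3 * (k%:R * eta) by lra.
elim: k => [|k IH]. rewrite mul0r oppr0 expR0 mul0r mulr0 addr0 /=.
 have h5 : 0 <= E pi (fun x => g x ^+ 2) <= 1. apply: E01; first exact: (bmfX 2 bg).1.
  by move=> x; rewrite sqr_ge0/= expr_le1//; case/andP: (g01 x).
 have := sqr_ge0 (E pi g); have := expR_ge0 (- nu * ln S); rewrite /var /sg; lra.
have h := var_lmcP_le (bmf_iter_lmcP k bg) (iter_lmcP01 k bg g01) S1.
rewrite -/sg in h.
set w := var (iter k L g) in IH h; rewrite [iter k.+1 L g]/=.
set w' := var _ in h *.
(* The recursion is implicit: solving it for the new variance gives the factor 1 / (1 + lam), at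
   most e^(- lam / 2) because lam <= 1. This halving turns 12 into 24. *)
have h' : (1 + lam) * (w' - sg) <= w - sg + 3 * eta.
 have : lam * w' <= lam * sg + (w - w' + 3 * eta). have -> : lam * sg + (w - w' + 3 * eta) =
    lam * (sg + 12 * d%:R * S ^+ 3 / s ^+ 2 * (w - w' + 3 * eta)).
   rewrite /lam; field; rewrite !gt_eqF ?exprn_gt0 ?ltr0n//; lra. by rewrite ler_wpM2l// ltW. lra.
have {}h' : w' - sg <= (w - sg + 3 * eta) / (1 + lam). by rewrite ler_pdivlMr 1?mulrC//; lra.
have el : (1 + lam)^-1 <= expR (- (lam / 2)). rewrite expRN lef_pV2 ?posrE ?expR_gt0//; last pos.
 have := expR_ge1Dx (- (lam / 2)); rewrite expRN.
 set y := expR (lam / 2); have y0 : 0 < y by exact: expR_gt0.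
 move=> hy; have : (1 - lam / 2) * y <= 1 by rewrite -ler_pdivlMr// div1r. nra.
apply: le_trans h' _.
apply: (@le_trans _ _ ((expR (- (k%:R * (lam / 2))) + 3 * (k%:R * eta) + 3 * eta) / (1 + lam))).
 by rewrite ler_wpM2r ?invr_ge0 ?lerD2r//; lra.
rewrite -addrA mulrDl lerD//.
 rewrite -[k.+1%:R]natr1 mulrDl mul1r opprD expRD ler_wpM2l ?expR_ge0//.
rewrite ler_pdivrMr; last pos.
have k0 : 0 <= k%:R :> R by [].
have ke0 : 0 <= k%:R * eta by pos.
rewrite -[k.+1%:R]natr1; nra.
Qed.

(** These are the two bounds on events that [renyi_le1_of_sets] asks for: domination by a multiple
    of [pi], and domination by a nearly unit multiple of [pi] plus a small constant. *)
Lemma lmc_measure_estimate (mu0 : probability 'rV[R]_d R) M S k (A : set 'rV[R]_d) :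
 (0 < d)%N -> 0 <= M -> (forall B, measurable B -> mu0 B <= M%:E * pi B)%E -> 1 <= S ->
 measurable A -> E mu0 (iter k L \1_A) <= M * expR (k%:R * eta) * fine (pi A) /\
 E mu0 (iter k L \1_A) <= expR (k%:R * eta) * fine (pi A) + Num.sqrt (M * (4 * expR (- nu * ln S) +
  expR (- (k%:R * s ^+ 2 / (24 * d%:R * S ^+ 3))) + 3 * (k%:R * eta))).
Proof.
move=> d0 M0 H S1 mA.
have bA := bmf_indic R mA.
have A01 x : 0 <= (\1_A x : R) <= 1 by rewrite indicE ler0n lern1 leq_b1.
have Epi : E pi \1_A = fine (pi A) by rewrite /E integral_indic// setIT.
have bk := bmf_iter_lmcP k bA; have k01 := iter_lmcP01 k bA A01.
have hm := iter_lmcP_mean_le k bA A01; rewrite Epi in hm.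
split. have := E_measure_le M0 H bk (fun x => proj1 (andP (k01 x))) => h.
 by apply: le_trans h _; rewrite -mulrA ler_wpM2l.
have := E_measure_le_mean (E pi (iter k L \1_A)) M0 H bk => h.
apply: le_trans h _; rewrite lerD// ler_wsqrtr// ler_wpM2l//.
by rewrite E_sqrB// subrr expr0n addr0; exact: iter_lmcP_var_le.
Qed.

End decay.

(** * The law of the LMC iterates *)

Section lmc_law.
Context (R : realType) (d : nat) (nu h : R).
Hypotheses (nu1 : 1 <= nu) (h0 : 0 < h) (hn : h * (d%:R + nu) <= 1).
Context dO (Omega : measurableType dO) (P : probability Omega R).
Variables x xi : nat -> {RV P >-> 'rV[R]_d}.
Hypothesis lmc : langevin_monte_carlo (V_nu nu) h x xi.
Let s := Num.sqrt (2 * h).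
Let L : ('rV[R]_d -> R) -> 'rV[R]_d -> R := lmcP (cstep d nu s) s.

Lemma sqrt2h_sqr : s ^+ 2 / 2 = h.
Proof. by rewrite sqr_sqrtr ?mulr_ge0 ?(ltW h0)//; field. Qed.

Lemma lmc_next k w : x k.+1 w = drift (cstep d nu s) (x k w) + s *: xi k w.
Proof. by case: lmc => _ _ ->; rewrite driftE /cstep sqrt2h_sqr. Qed.

Lemma gaussian_vector_law (Y : {RV P >-> 'rV[R]_d}) : gaussian_vector P 1 Y ->
 forall A, measurable A -> P (Y @^-1` A) = gauss R d A.
Proof.
move=> gY A mA.
have -> : P (Y @^-1` A) = distribution P Y A by [].
have fin : (distribution P Y setT < +oo)%E by rewrite probability_setT ltry.
apply: (rV_measure_unique_box fin) => //.
by move=> B mB; exact: etrans (gY B mB) (esym (gauss_box mB)).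
Qed.

Lemma lmc_noise_indep k (A B : set 'rV[R]_d) : measurable A -> measurable B ->
 P (x k @^-1` A `&` xi k @^-1` B) = (P (x k @^-1` A) * P (xi k @^-1` B))%E.
Proof.
move=> mA mB; have [_ iY xS] := lmc.
set Y := (fun k => _) in iY.
have mY j : mfunT (Y j) by case: j => [|j]; exact: mfunPT.
pose G : set (set Omega) := [set C | exists2 F : nat -> set 'rV[R]_d,
 (forall i, measurable (F i)) & C = \bigcap_(i < k.+1) (Y i @^-1` F i)].
have Gsub : G `<=` measurable. move=> _ [F mF ->]; apply: fin_bigcap_measurable => // i _.
 by rewrite -[X in measurable X]setTI; exact: mY.
(* [T'] is Omega with the sigma-algebra of x_0 and the first k noises; x_k is measurable for it,
   being computed from them, and it is independent of the next noise. *)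
pose T' := g_sigma_algebraType G.
have mY' j : (j <= k)%N -> measurable_fun [set: T'] (Y j : T' -> 'rV[R]_d).
 move=> jk _ C mC; rewrite setTI; apply: sub_sigma_algebra.
 exists (fun i => if i == j then C else setT); first by move=> i; case: ifP.
 apply/seteqP; split => [w Yw i _|w /(_ j jk)/=]; last by rewrite eqxx.
 by rewrite /=; case: eqP => // ->.
have mx j : (j <= k)%N -> measurable_fun [set: T'] (x j : T' -> 'rV[R]_d).
 elim: j => [|j IH] jk; first exact: (mY' 0).
 rewrite (_ : (x j.+1 : T' -> 'rV[R]_d) = (fun w => drift (cstep d nu s) (x j w) + s *: xi j w)); last first.
  by apply/funext => w; exact: lmc_next. apply: mrVD.
  apply: (mcompT (@measurable_drift _ _ _)); exact: IH (ltnW jk).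
 by apply: mrVZ => //; exact: (mY' j.+1).
have := mx k (leqnn k) measurableT A mA; rewrite setTI => mxA.
rewrite setIC [RHS]muleC.
apply: (@indep_g_sigma1 _ _ _ _ _ G) => //.
- by rewrite -[X in measurable X]setTI; exact: mfunPT.
- move=> _ _ [F mF ->] [F' mF' ->]; exists (fun i => F i `&` F' i). by move=> i; exact: measurableI.
 by rewrite -bigcapI.
- exists (fun=> setT) => //. by apply/seteqP; split => // w _ i _.
move=> _ [F mF ->].
pose F' i := if i == k.+1 then B else F i.
have mF' i : measurable (F' i) by rewrite /F'; case: ifP.
have eF (i : 'I_k.+1) : F' i = F i by rewrite /F' ltn_eqF.
have -> : xi k @^-1` B `&` \bigcap_(i < k.+1) (Y i @^-1` F i) = \bigcap_(i < k.+2) (Y i @^-1` F' i).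
 rewrite !bigcap_mkord [RHS]big_ord_recr/= [F' k.+1]/F' eqxx setIC; congr (_ `&` _).
 by apply: eq_bigr => i _; rewrite eF.
rewrite !iY// big_ord_recr/= [F' k.+1]/F' eqxx muleC; congr (_ * _)%E.
by apply: eq_bigr => i _; rewrite eF.
Qed.

Lemma lmc_law_step k (g : 'rV[R]_d -> R) : bmf g -> E P (g \o x k.+1) = E P (L g \o x k).
Proof.
move=> bg; set c := cstep d nu s.
pose X2 : Omega -> 'rV[R]_d * 'rV[R]_d := fun w => (x k w, xi k w).
have mX2 : mfunT X2 by mes.
pose X2' : {mfun Omega >-> ('rV[R]_d * 'rV[R]_d)%type} := mfun_Sub (mem_set mX2).
pose G (p : 'rV[R]_d * 'rV[R]_d) := g (drift c p.1 + s *: p.2).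
have bG : bmf G. have [mg [K gK]] := bg; split; last by exists K => p; exact: gK.
 apply: (mcompT mg); apply: mrVD. by apply: (mcompT (@measurable_drift _ _ _)); exact: mfst. mes.
have eG : E P (g \o x k.+1) = E (distribution P X2') G.
 by rewrite E_distribution//; apply: eq_E => w; rewrite /G /= lmc_next.
rewrite eG.
have bL : bmf (L g) by exact: bmf_lmcP.
rewrite -(E_distribution P (x k) bL).
have -> : E (distribution P (x k)) (L g) = E (prod_prob (distribution P (x k)) (gauss R d)) G.
 by rewrite E_prod.
rewrite /E; congr fine; apply: eq_measure_integral => C mC _.
apply/esym; apply: (@product_measure_unique _ _ _ _ _ (distribution P (x k)) (gauss R d)) => // A B mA mB.
have gxi : gaussian_vector P 1 (xi k) by case: lmc.
apply: etrans (lmc_noise_indep _ mA mB) _; congr (_ * _)%E.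
exact: gaussian_vector_law.
Qed.

Lemma lmc_law k (g : 'rV[R]_d -> R) : bmf g ->
 E (distribution P (x k)) g = E (distribution P (x 0%N)) (iter k L g).
Proof.
have c01 : 0 <= cstep d nu s <= 1.
 by rewrite /cstep sqrt2h_sqr hn mulr_ge0 ?(ltW h0)// addr_ge0// (le_trans _ nu1).
elim: k g => // k IH g bg.
have bL : bmf (L g) by apply: bmf_lmcP => //; rewrite sqrtr_gt0 mulr_gt0.
by rewrite E_distribution// lmc_law_step// -E_distribution// IH// iterSr.
Qed.

End lmc_law.

(** * Explicit constants and the upper bound for LMC *)

Section numeric.
Context (R : realType).
Implicit Types (q nu n D : R).

Lemma two_le_expR : 2 <= expR (3 / 4) :> R.
Proof.
have -> : 3 / 4 = 6%:R * (1 / 8) :> R by field.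
rewrite expRM_natl; apply: (@le_trans _ _ ((9 / 8) ^+ 6)); first pos.
by rewrite lerXn2r ?nnegrE ?expR_ge0//; have := expR_ge1Dx (1 / 8 : R); lra.
Qed.

(** The numerical condition of [renyi_le1_of_sets] with r = q - 1. Since 2 <= e^(3/4), the first
    term is at most e^(4 r / 5), the exponent 4/5 being 3/4 + 1/20; there remains e^(r / 5) >= 6/5
    to accommodate the second. *)
Lemma renyi_constants r D : 1 <= r -> 48 <= D ->
 (2 * expR (1 / 20)) `^ r + expR (D + 1 / 20) `^ r * (2 * (5 / 2 * expR (D / 2 - (r + 1) * D)))
 <= expR r.
Proof.
move=> r1 D48; have r0 : 0 <= r by lra.
have h1 : (2 * expR (1 / 20)) `^ r <= expR (4 / 5 * r).
 rewrite [expR (4 / 5 * r)]expRM ge0_ler_powR ?nnegrE ?expR_ge0 ?mulr_ge0 ?expR_ge0//.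
 have -> : 4 / 5 = 3 / 4 + 1 / 20 :> R by field. by rewrite expRD ler_wpM2r ?expR_ge0// two_le_expR.
have h2 : expR (D + 1 / 20) `^ r * (2 * (5 / 2 * expR (D / 2 - (r + 1) * D))) <=
  1 / 5 * expR (4 / 5 * r). rewrite -expRM.
 have -> : expR ((D + 1 / 20) * r) * (2 * (5 / 2 * expR (D / 2 - (r + 1) * D))) =
   expR (1 / 20 * r) * (5 * expR (- (D / 2))).
  rewrite [LHS](_ : _ = 5 * (expR ((D + 1 / 20) * r) * expR (D / 2 - (r + 1) * D))); last pos.
  rewrite [RHS]mulrCA; congr (_ * _); rewrite -!expRD; congr expR; by field.
 rewrite mulrC ler_pM ?mulr_ge0 ?expR_ge0//; last by rewrite ler_expR; lra.
 have h : 25 <= expR (D / 2) by have := expR_ge1Dx (D / 2); lra.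
 have : (expR (D / 2))^-1 <= 25^-1 by rewrite lef_pV2 ?posrE ?expR_gt0//; lra. rewrite expRN; lra.
apply: le_trans (lerD h1 h2) _.
have -> : expR r = expR (1 / 5 * r) * expR (4 / 5 * r) by rewrite -expRD; congr expR; field.
have := expR_ge1Dx (1 / 5 * r); have := expR_gt0 (4 / 5 * r).
set y := expR (4 / 5 * r); set x := expR _; nra.
Qed.

(** With t = D / nu, the hypothesis gives t >= C ln n, so nu and t are at most e^t, and 24 q <=
    e^(24 q t). The exponents add up to 24 q + 3 + 6 q. *)
Lemma upper_time_bound q nu n D C : 1 <= q -> 1 <= nu -> 2 <= n -> nu <= n -> 30 * q + 3 <= C ->
 C * (1 + nu * ln n) <= D -> 24 * q * D * expR (2 * q * D / nu) ^+ 3 <= nu^-1 * expR (C * D / nu).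
Proof.
move=> q1 nu1 n2 nun C1 CD; have nu0 : 0 < nu by lra.
set t := D / nu.
have ln2 : 1 / 2 <= ln 2 :> R. rewrite -ler_expR lnK ?posrE//.
 have := expR_ge1Dx (- (1 / 2) : R); rewrite expRN; set y := expR _ => h. have y0 : 0 < y by pos.
 have : (1 - 1 / 2) * y <= 1 by rewrite -ler_pdivlMr// [leRHS]div1r. lra.
have lnn : ln 2 <= ln n by rewrite ler_ln ?posrE//; lra.
have lnnu : ln nu <= ln n by rewrite ler_ln ?posrE//; lra.
have tC : C * ln n <= t. rewrite ler_pdivlMr//; apply: le_trans CD.
 by rewrite mulrDr mulr1 mulrA -[leLHS]mulrAC lerDr; lra.
have t1 : 1 <= t by apply: le_trans tC; nra.
have nut : nu <= expR t.
 by rewrite -[leLHS]lnK ?posrE// ler_expR (le_trans lnnu)// (le_trans _ tC)// ler_peMl//; lra.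
have tt : t <= expR t by have := expR_ge1Dx t; lra.
have qt : 24 * q <= expR (24 * q * t). by have := expR_ge1Dx (24 * q * t); nra.
have -> : D = nu * t by rewrite /t mulrC divfK// gt_eqF.
have -> : 2 * q * (nu * t) / nu = 2 * q * t by field; rewrite gt_eqF.
have -> : C * (nu * t) / nu = C * t by field; rewrite gt_eqF.
rewrite [leRHS]mulrC ler_pdivlMr//.
rewrite -expRM_natl.
apply: (@le_trans _ _ (expR (24 * q * t) * (expR t * expR t) * expR t * expR (3%:R * (2 * q * t)))).
 rewrite [leLHS](_ : _ = (24 * q) * (nu * nu) * t * expR (3%:R * (2 * q * t))); last pos.
 rewrite ler_wpM2r ?expR_ge0//.
 have p1 : nu * nu <= expR t * expR t by apply: ler_pM => //; exact: ltW.
 apply: ler_pM => //; first by nra. by lra. by apply: ler_pM => //; nra.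
rewrite -!expRD ler_expR; nra.
Qed.

End numeric.

Section lmc_upper.
Context (R : realType) (d : nat) (q nu D : R) (pi : probability 'rV[R]_d R).
Hypotheses (q2 : 2 <= q) (nu1 : 1 <= nu) (d0 : (0 < d)%N) (D48 : 48 <= D).
Hypothesis gpi : is_gibbs (V_nu nu) pi.

(** S = e^(2 q D / nu) makes S^-nu equal to e^(- 2 q D), and over this time the decaying term of
    [iter_lmcP_var_le] reaches the same size. *)
Definition mixing_time : R := d%:R * (24 * q * D * expR (2 * q * D / nu) ^+ 3).

Lemma mixing_time_gt0 : 0 < mixing_time.
Proof.
have [D0 q0] : 0 < D /\ 0 < q by split; [exact: lt_le_trans D48|exact: lt_le_trans q2].
have h : 0 < 24 * q * D by pos.
by rewrite mulr_gt0 ?ltr0n// mulr_gt0// exprn_gt0// expR_gt0.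
Qed.

(** The total time is fixed and the step is the time over the number of steps, so the step can be
    shrunk afterwards, both to control the invariance defect and to reach the diffusion. *)
Lemma lmc_renyi_le1 : exists2 h0 : R, 0 < h0 & forall k, mixing_time / k.+1%:R <= h0 ->
 forall dO (Omega : measurableType dO) (P : probability Omega R) (x xi : nat -> {RV P >-> 'rV[R]_d}),
 langevin_monte_carlo (V_nu nu) (mixing_time / k.+1%:R) x xi ->
 (renyi_oo (distribution P (x 0%N)) pi <= D%:E)%E ->
 (renyi q (distribution P (x k.+1)) pi <= 1%:E)%E.
Proof.
have [nu1' q2' D48'] := And3 nu1 q2 D48.
set T := mixing_time; have T0 : 0 < T := mixing_time_gt0.
pose n : R := d%:R + nu; have n1 : 1 <= n by rewrite (le_trans nu1)// lerDr.
pose K := ai_const d nu; have K0 : 0 <= K by exact: ai_const_ge0.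
(* [e] will bound the accumulated defect: 1/20 serves the factor e^(k eta), the other bound makes 3
   k eta at most e^(- 2 q D), the size of the variance terms. *)
pose e := Num.min (1 / 20) (expR (- (2 * q * D)) / 3).
have e0 : 0 < e by rewrite lt_min !divr_gt0 ?expR_gt0.
(* [dl] bounds the noise size s: 1 / (8 n) gives n^2 s^2 <= 1/64, and the last bound is for the
   accumulated defect, which equals 2 T K s. *)
pose dl := Num.min 1 (Num.min (1 / (8 * n)) (e / (2 * T * K + 1))).
have B0 : 0 < 2 * T * K + 1 by rewrite ltr_wpDl// mulr_ge0// ltW// mulr_gt0.
have dl0 : 0 < dl by rewrite !lt_min ltr01 !divr_gt0//; lra.
exists (dl ^+ 2 / 2); first pos.
move=> k hk dO Omega P x xi lmc roo.
set h := T / k.+1%:R in hk lmc; have h0 : 0 < h by rewrite divr_gt0// ltr0n.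
pose s := Num.sqrt (2 * h).
have s2 : s ^+ 2 = 2 * h by rewrite sqr_sqrtr// ltW// mulr_gt0.
have s0 : 0 < s by rewrite sqrtr_gt0 mulr_gt0.
have sdl : s <= dl. rewrite -(ger0_norm (ltW dl0)) -sqrtr_sqr ler_wsqrtr//; lra.
have s1 : s <= 1 by apply: le_trans sdl _; rewrite ge_min lexx.
have sn' : s <= 1 / (8 * n) by apply: le_trans sdl _; rewrite !ge_min lexx orbT.
have se : s <= e / (2 * T * K + 1) by apply: le_trans sdl _; rewrite !ge_min lexx !orbT.
have sn : n ^+ 2 * s ^+ 2 <= 64^-1. have : n * s <= 1 / 8.
  by rewrite mulrC -ler_pdivlMr; [apply: le_trans sn' _; apply: eq_ler; field; lra|lra].
 have ns0 : 0 <= n * s by pos. by rewrite -exprMn; nra.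
have hn : h * n <= 1.
 have : n * s ^+ 2 <= n ^+ 2 * s ^+ 2 by rewrite ler_wpM2r ?sqr_ge0// expr2 ler_peMr//; lra.
 by rewrite s2; nra.
pose eta := K * s ^+ 3.
have ke : k.+1%:R * eta <= e. have -> : k.+1%:R * eta = 2 * T * K * s.
  rewrite /eta exprS s2 /h; field; rewrite gt_eqF//.
 move: se; rewrite ler_pdivlMr// => se; apply: le_trans se.
 by rewrite mulrC ler_wpM2l ?(ltW s0)// lerDl.
have ke0 : 0 <= k.+1%:R * eta by rewrite mulr_ge0// mulr_ge0// exprn_ge0// ltW.
have ke1 : k.+1%:R * eta <= 1 / 20 by apply: le_trans ke _; rewrite ge_min lexx.
have ke2 : 3 * (k.+1%:R * eta) <= expR (- (2 * q * D)).
 have : k.+1%:R * eta <= expR (- (2 * q * D)) / 3 by apply: le_trans ke _; rewrite ge_min lexx orbT.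
 lra.
have nu0 : 0 < nu by lra.
have qD : 0 < q * D by apply: mulr_gt0; lra.
pose S := expR (2 * q * D / nu).
have S1 : 1 <= S. by rewrite -[leLHS]expR0 ler_expR divr_ge0 ?(ltW nu0)// -mulrA mulr_ge0// ltW.
have ex1 : - nu * ln S = - (2 * q * D) by rewrite /S expRK; field; rewrite gt_eqF.
have ex2 : k.+1%:R * s ^+ 2 / (24 * d%:R * S ^+ 3) = 2 * q * D.
 rewrite s2 /h /T /mixing_time -/S; field. by rewrite !gt_eqF ?expR_gt0 ?ltr0n.
have mu0 := renyi_oo_le roo.
have est := fun k A => @lmc_measure_estimate _ _ _ nu1 _ gpi _ s0 s1 sn _ _ _ k A d0 (expR_ge0 D) mu0 S1.
have law A : measurable A -> fine (distribution P (x k.+1) A) =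
  E (distribution P (x 0%N)) (iter k.+1 (lmcP (cstep d nu s) s) \1_A).
 move=> mA; rewrite -(lmc_law nu1 h0 hn lmc)//; last exact: bmf_indic.
 by rewrite /E integral_indic// setIT.
have fin (m : probability 'rV[R]_d R) A : measurable A -> m A = (fine (m A))%:E.
 by move=> mA; rewrite fineK// fin_num_measure.
have p0 A : 0 <= fine (pi A) by exact: fine_ge0.
have ea : expR (k.+1%:R * eta) <= expR (1 / 20) by rewrite ler_expR.
apply: (@renyi_le1_of_sets _ _ _ _ _ _ (expR (1 / 20)) (expR (D + 1 / 20)) (5 / 2 * expR (D / 2 - q * D))).
- lra.
- pos.
- pos.
- pos.
- move=> A mA; rewrite (fin (distribution P (x k.+1)))// (fin pi)// -EFinM -EFinD lee_fin law//.
 have [_ h2] := est k.+1 A mA; apply: le_trans h2 _; apply: lerD. by rewrite ler_wpM2r.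
 (* The three variance terms sum to at most 4 + 1 + 1 = 6 times e^(- 2 q D), and 6 <= (5/2)^2. *)
 rewrite -/K -/eta ex1 ex2. have h3 : 0 <= 5 / 2 * expR (D / 2 - q * D) by pos.
 rewrite -(ger0_norm h3) -sqrtr_sqr ler_wsqrtr//. rewrite exprMn -expRM_natl.
 have -> : 2%:R * (D / 2 - q * D) = D - 2 * q * D by field.
 rewrite expRD; set a := expR D; set b := expR (- (2 * q * D)) in ke2 *. have a0 : 0 <= a by pos.
 have b0 : 0 <= b by pos. rewrite [leRHS]mulrCA ler_wpM2l//; lra.
- move=> A mA; rewrite (fin (distribution P (x k.+1)))// (fin pi)// -EFinM lee_fin law//.
 have [h1 _] := est k.+1 A mA; apply: le_trans h1 _.
 by rewrite ler_wpM2r// expRD ler_wpM2l ?expR_ge0.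
have := @renyi_constants R (q - 1) D; rewrite subrK; apply; lra.
Qed.

End lmc_upper.

(** * Pathwise convergence of the Euler scheme *)

Section continuous_paths.
Context (R : realType).
Implicit Types (f : R -> R) (T e : R).

Lemma continuous_dist f x : {for x, continuous f} -> forall e, 0 < e ->
 exists2 dl, 0 < dl & forall y, `|y - x| < dl -> `|f y - f x| < e.
Proof.
move=> cf e e0; have h : f t @[t --> x] --> f x := cf.
move/cvgr_dist_lt : h => /(_ _ e0); rewrite near_nbhs => /nbhs_ballP[dl dl0 H]; exists dl => // y yx.
by rewrite distrC; apply: H; rewrite /ball/= distrC.
Qed.

Lemma uniform_continuity f T e : 0 <= T -> continuous f -> 0 < e ->
 exists2 dl, 0 < dl & forall s t, 0 <= s -> s <= t -> t <= T -> t - s < dl -> `|f t - f s| <= e.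
Proof.
move=> T0 cf e0; have e20 : 0 < e / 2 by rewrite divr_gt0.
pose P c := exists2 dl, 0 < dl & forall s t, 0 <= s -> s <= t -> t <= c -> t - s < dl -> `|f t - f s| <= e.
rewrite -/(P T).
have ext c : exists2 eta, 0 < eta & forall t t', P t -> c - eta < t -> t' < c + eta -> P t'.
 have [eta eta0 He] := continuous_dist (cf c) e20. exists (eta / 2); first pos.
 move=> t t' [dl dl0 H] ct ct'; exists (Num.min dl (eta / 2)). by rewrite lt_min dl0 divr_gt0.
 move=> s u s0 su ut'; rewrite lt_min => /andP[h1 h2]. have [ut|tu] := leP u t; first exact: H.
 have a1 : `|u - c| < eta by rewrite ltr_norml; apply/andP; split; lra.
 have a2 : `|s - c| < eta by rewrite ltr_norml; apply/andP; split; lra.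
 have := He _ a1; have := He _ a2; rewrite (distrC (f s)) => b2 b1.
 rewrite (_ : f u - f s = (f u - f c) + (f c - f s)); last pos.
 by apply: le_trans (ler_normD _ _) _; lra.
apply: (real_induction T0).
- exists 1 => // s t s0 st t0 _; have -> : t = s by lra. by rewrite subrr normr0 ltW.
- move=> c c0 cT Pc; have [eta eta0 H] := ext c. exists (Num.min T (c + eta / 2)); split.
 + by rewrite lt_min cT; lra.
 + by rewrite ge_min lexx.
 + by apply: (H c) => //; [lra|rewrite gt_min; apply/orP; right; lra].
move=> c c0 cT H; have [eta eta0 He] := ext c.
have [t [t0 ct tc Pt]] := H eta eta0.
by apply: (He t) => //; lra.
Qed.

Lemma integrable_itv_continuous f (a b : R) : continuous f ->
 (@lebesgue_measure R).-integrable `[a, b] (EFin \o f).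
Proof.
move=> cf; apply: continuous_compact_integrable; first exact: segment_compact.
exact: continuous_subspaceT.
Qed.

Lemma Rintegral_increment f (a s t k e : R) : continuous f -> a <= s -> s <= t ->
 (forall u, s <= u -> u <= t -> `|f u - k| <= e) ->
 `|\int[@lebesgue_measure R]_(u in `[a, t]) f u - \int[@lebesgue_measure R]_(u in `[a, s]) f u - (t - s) * k|
 <= (t - s) * e.
Proof.
move=> cf as_ st H.
have intf := integrable_itv_continuous a t cf.
have ints : (@lebesgue_measure R).-integrable `]s, t] (EFin \o f).
 apply: integrableS intf => //; apply: subset_itvr; by rewrite bnd_simp.
have intc c : (@lebesgue_measure R).-integrable `]s, t] (EFin \o (fun=> c)).
 have h : continuous (fun _ : R => c) by move=> x; exact: cvg_cst.
 have i1 := integrable_itv_continuous s t h.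
 by apply: integrableS i1 => //; exact: subset_itv_oc_cc.
rewrite (@Rintegral_itvB R f (BLeft a) (BRight t) s)//; try by rewrite bnd_simp.
have len c : \int[@lebesgue_measure R]_(u in `]s, t]) c = (t - s) * c.
 rewrite Rintegral_cst// mulrC; congr (_ * _).
 have h : lebesgue_measure `]s, t]%classic = (t - s)%:E. rewrite lebesgue_measure_itv/= lte_fin.
  by move: st; rewrite le_eqVlt => /predU1P[->|->//]; rewrite ltxx subrr. exact: (congr1 fine h).
rewrite -len -RintegralB//.
apply: le_trans (le_normr_Rintegral _ _) _ => //.
 by have := @integrableB _ _ _ _ _ _ _ _ ints (intc k) => /(_ (mitv _)).
rewrite -len; apply: le_Rintegral => //.
- have := @integrableB _ _ _ _ _ _ _ _ ints (intc k) => /(_ (mitv _)) h. exact: (integrable_norm h).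
- by move=> u /=; rewrite in_itv/= => /andP[su ut]; apply: H => //; exact: ltW.
Qed.

End continuous_paths.

Section euler.
Context (R : realType) (d : nat) (nu : R).
Hypothesis nu1 : 1 <= nu.
Let n : R := d%:R + nu.
Implicit Types (x y v : 'rV[R]_d).

Lemma sqnorm2D_le (a : R) x y : 0 < a ->
 sqnorm2 (x + y) <= (1 + a) * sqnorm2 x + (1 + a^-1) * sqnorm2 y.
Proof.
move=> a0; rewrite /sqnorm2 !big_distrr/= -big_split/=; apply: ler_sum => i _.
rewrite !mxE; set u := x ord0 i; set v := y ord0 i.
have -> : (1 + a) * u ^+ 2 + (1 + a^-1) * v ^+ 2 = (u + v) ^+ 2 + a^-1 * (a * u - v) ^+ 2.
 by field; rewrite gt_eqF.
by rewrite lerDl mulr_ge0 ?sqr_ge0// invr_ge0 ltW.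
Qed.

Lemma sqnorm2_le_coord (e : R) x : 0 <= e -> (forall i, `|x ord0 i| <= e) ->
 sqnorm2 x <= d%:R * e ^+ 2.
Proof.
move=> e0 H; rewrite /sqnorm2 (@le_trans _ _ (\sum_(i < d) e ^+ 2))//.
 by apply: ler_sum => i _; rewrite -real_normK ?num_real// lerXn2r ?nnegrE.
by rewrite sumr_const card_ord mulr_natl.
Qed.

Lemma sqnorm2_coord x i : `|x ord0 i| ^+ 2 <= sqnorm2 x.
Proof.
rewrite real_normK ?num_real// /sqnorm2 (bigD1 i)//= lerDl.
pos.
Qed.

Lemma rV_cvg (u_ : nat -> 'rV[R]_d) (u : 'rV[R]_d) :
 (forall i, u_ k ord0 i @[k --> \oo] --> u ord0 i) -> u_ @ \oo --> u.
Proof.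
move=> H; apply/cvg_ballP => e e0.
have : \forall k \near \oo, forall i, `|u ord0 i - u_ k ord0 i| < e.
 apply: filter_forall => i; by have /cvgr_dist_lt := H i; apply.
apply: filterS => k hk; split => // i j; rewrite (ord1 i); exact: hk.
Qed.

Lemma rV_cvg_sqnorm2 (u_ : nat -> 'rV[R]_d) (u : 'rV[R]_d) :
 (forall e, 0 < e -> \forall k \near \oo, sqnorm2 (u_ k - u) <= e) -> u_ @ \oo --> u.
Proof.
move=> H; apply: rV_cvg => i; apply/cvgrPdist_le => e e0.
have := H (e ^+ 2) (exprn_gt0 2 e0); apply: filterS => k hk.
rewrite -(@ler_pXn2r _ 2) ?nnegrE ?(ltW e0)//; apply: le_trans hk.
by have := sqnorm2_coord (u_ k - u) i; rewrite !mxE distrC.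
Qed.

Lemma rV_continuous (T : topologicalType) (X : T -> 'rV[R]_d) (x : T) :
 (forall i, {for x, continuous (fun t => X t ord0 i)}) -> {for x, continuous X}.
Proof.
move=> H; apply/cvg_ballP => e e0.
have : \forall t \near x, forall i, `|X x ord0 i - X t ord0 i| < e.
 apply: filter_forall => i; have h : X t ord0 i @[t --> x] --> X x ord0 i := H i.
 by move/cvgr_dist_lt : h; apply.
apply: filterS => k hk; split => // i j; rewrite (ord1 i); exact: hk.
Qed.

(** The LMC recursion for arbitrary increments: with those of sqrt 2 times the driving path, it is
    the Euler scheme of [X], studied here for one fixed path. *)
Fixpoint euler_path (c : R) (zeta : nat -> 'rV[R]_d) x0 k : 'rV[R]_d :=
 if k is k'.+1 then drift c (euler_path c zeta x0 k') + zeta k' else x0.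

Variables (X beta : R -> 'rV[R]_d).
Hypothesis cX : forall i, continuous (fun t => X t ord0 i).
Hypothesis eqX : forall t, 0 <= t -> forall i, X t ord0 i = X 0 ord0 i -
 (\int[@lebesgue_measure R]_(s in `[0, t]) grad (V_nu nu) (X s) ord0 i) + Num.sqrt 2 * beta t ord0 i.

Lemma continuous_grad_path i : continuous (fun t => grad (V_nu nu) (X t) ord0 i).
Proof.
rewrite (_ : (fun t => _) = (fun t => n / Qn (X t) * X t ord0 i)); last first.
 by apply/funext => t; rewrite grad_V_nu mxE.
have cQ : continuous (fun t => Qn (X t)). move=> t; apply: (@cvgD R R^o); first exact: cvg_cst.
 rewrite /sqnorm2; apply: cvg_big => [|j _]; first exact: add_continuous.
 by rewrite /=; apply: (@cvgM R); exact: cX.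
move=> t; apply: (@cvgM R); last exact: cX.
apply: (@cvgM R); first exact: cvg_cst.
by apply: cvgV; [rewrite Qn_neq0|exact: cQ].
Qed.

Let zeta (h : R) k := Num.sqrt 2 *: (beta (k.+1%:R * h) - beta (k%:R * h)).

Let err h k := sqnorm2 (euler_path (h * n) (zeta h) (X 0) k - X (k%:R * h)).

(** The additive noise is common to the scheme and to [X] and cancels, so the local error is that of
    freezing the gradient over one step. The inequality [sqnorm2D_le] with parameter [h] keeps it of
    order h e^2. *)
Lemma euler_one_step h e j : 0 < h -> h <= 1 -> h * n <= 1 -> 0 <= e ->
 (forall s i, j%:R * h <= s -> s <= j.+1%:R * h ->
  `|grad (V_nu nu) (X s) ord0 i - grad (V_nu nu) (X (j%:R * h)) ord0 i| <= e) ->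
 err h j.+1 <= expR (h * (1 + n)) * err h j + 2 * h * (d%:R * e ^+ 2).
Proof.
move=> h0 h1 hn e0 H; pose E := err h.
have n0 : 0 <= n by rewrite addr_ge0// (le_trans _ nu1).
pose t := j%:R * h; pose t' := j.+1%:R * h.
have t0 : 0 <= t by pos.
have dt : t' - t = h by rewrite /t' /t -natr1; ring.
have tt' : t <= t' by pos.
pose r := X t' - (drift (h * n) (X t) + zeta h j).
have rE i : `|r ord0 i| <= h * e.
 have := Rintegral_increment (@continuous_grad_path i) t0 tt' (fun u => H u i).
 rewrite dt; apply: le_trans; rewrite -normrN le_eqVlt; apply/orP; left; apply/eqP.
 congr (`|_|); set g := grad _ (X t); rewrite /r -driftE -/g /zeta -/t -/t' !mxE eqX ?(le_trans t0)// (eqX t0).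
 by ring.
rewrite -/(E j.+1) -/(E j).
have -> : E j.+1 = sqnorm2 ((drift (h * n) (euler_path (h * n) (zeta h) (X 0) j) - drift (h * n) (X t)) + (- r)).
 by rewrite /E /err /= /r -/t'; congr sqnorm2; apply/rowP => i; rewrite !mxE; ring.
apply: le_trans (sqnorm2D_le _ _ h0) _; apply: lerD.
 have c01 : 0 <= h * n <= 1 by rewrite mulr_ge0// ltW.
 apply: (@le_trans _ _ ((1 + h) * ((1 + h * n) * E j))).
  by rewrite ler_wpM2l ?addr_ge0 ?(ltW h0)//; exact: drift_lip.
 rewrite mulrA ler_wpM2r ?sqnorm2_ge0//. have -> : h * (1 + n) = h + h * n by ring.
 rewrite expRD ler_pM ?expR_ge1Dx//. pos. pos.
have r2 : sqnorm2 (- r) <= d%:R * (h * e) ^+ 2. apply: sqnorm2_le_coord; first pos.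
 by move=> i; rewrite mxE normrN.
apply: (@le_trans _ _ ((1 + h^-1) * (d%:R * (h * e) ^+ 2))).
 by rewrite ler_wpM2l// addr_ge0// invr_ge0 ltW.
have -> : (1 + h^-1) * (d%:R * (h * e) ^+ 2) = (h ^+ 2 + h) * (d%:R * e ^+ 2) by field; rewrite gt_eqF.
by rewrite ler_wpM2r ?mulr_ge0 ?sqr_ge0//; nra.
Qed.

(** A discrete Gronwall argument; the modulus of continuity of the gradient along this one path
    takes the place of moment estimates. *)
Lemma euler_cvg T : 0 < T ->
 euler_path (T / N.+1%:R * n) (zeta (T / N.+1%:R)) (X 0) N.+1 @[N --> \oo] --> X T.
Proof.
move=> T0; apply: rV_cvg_sqnorm2 => e e0.
have n0 : 0 < n by rewrite ltr_wpDl// (lt_le_trans _ nu1).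
pose A := expR (T * (1 + n)) * (2 * T * d%:R) + 1.
have A0 : 0 < A by rewrite ltr_wpDl// !mulr_ge0 ?expR_ge0// ltW.
pose e1 := Num.min 1 (e / A).
have e10 : 0 < e1 by rewrite lt_min ltr01 divr_gt0.
have uc : exists2 dl, 0 < dl & forall i s t, 0 <= s -> s <= t -> t <= T -> t - s < dl ->
  `|grad (V_nu nu) (X t) ord0 i - grad (V_nu nu) (X s) ord0 i| <= e1.
 have H i := uniform_continuity (ltW T0) (@continuous_grad_path i) e10.
 pose dl i := projT1 (cid2 (H i)).
 have dlP i : 0 < dl i /\ forall s t, 0 <= s -> s <= t -> t <= T -> t - s < dl i ->
  `|grad (V_nu nu) (X t) ord0 i - grad (V_nu nu) (X s) ord0 i| <= e1. by rewrite /dl; case: cid2.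
 exists (\big[Num.min/1]_i dl i). by apply/bigmin_gtP; split => // i _; case: (dlP i).
 move=> i s t s0 st tT tsd; apply: (dlP i).2 => //; apply: lt_le_trans tsd _. exact: bigmin_le_cond.
have [dl dl0 Hdl] := uc.
pose b := Num.min (dl / 2) (Num.min 1 (1 / n)).
have b0 : 0 < b by rewrite !lt_min !divr_gt0 ?ltr01.
near=> N; set h := T / N.+1%:R.
have h0 : 0 < h by pos.
have hb : h <= b. rewrite /h ler_pdivrMr// mulrC -ler_pdivrMr//.
 apply: (@le_trans _ _ N%:R); last pos. near: N; exact: nbhs_infty_ger.
have h1 : h <= 1 by apply: le_trans hb _; rewrite !ge_min lexx orbT.
have hdl : h < dl.
 apply: le_lt_trans hb _; apply: (@le_lt_trans _ _ (dl / 2)); first by rewrite ge_min lexx. by lra.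
have hn : h * n <= 1. by rewrite -ler_pdivlMr//; apply: le_trans hb _; rewrite !ge_min lexx !orbT.
pose E := err h.
have T_h : N.+1%:R * h = T by rewrite /h mulrC divfK.
have EN k : (k <= N.+1)%N -> E k <= expR (k%:R * h * (1 + n)) * (k%:R * (2 * h * (d%:R * e1 ^+ 2))).
 elim: k => [|k IH] kN. by rewrite /E /err /= !mul0r mulr0 subrr sqnorm20.
 have := @euler_one_step h e1 k h0 h1 hn (ltW e10) _ => /(_ _)/wrap[].
  move=> s i ks sk; apply: Hdl => //.
  - by rewrite mulr_ge0// ltW.
  - apply: le_trans sk _; rewrite -T_h ler_wpM2r ?(ltW h0)//. by rewrite ler_nat.
  - by apply: le_lt_trans hdl; move: sk; rewrite -natr1 mulrDl mul1r; lra.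
 rewrite -/(E k.+1) -/(E k) => h2; apply: le_trans h2 _.
 have c0 : 0 <= 2 * h * (d%:R * e1 ^+ 2) by rewrite !mulr_ge0 ?sqr_ge0// ltW.
 apply: (@le_trans _ _ (expR (h * (1 + n)) * (expR (k%:R * h * (1 + n)) * (k%:R * (2 * h * (d%:R * e1 ^+ 2)))) +
  expR (k.+1%:R * h * (1 + n)) * (2 * h * (d%:R * e1 ^+ 2)))).
  apply: lerD; first by rewrite ler_wpM2l ?expR_ge0// IH// ltnW.
  rewrite ler_peMl// -[leLHS]expR0 ler_expR mulr_ge0//. by rewrite mulr_ge0// ltW.
  by rewrite addr_ge0// ltW. have kS : k.+1%:R = k%:R + 1 :> R by pos.
 have -> : k.+1%:R * h * (1 + n) = h * (1 + n) + k%:R * h * (1 + n) by pos.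
 by rewrite expRD kS le_eqVlt; apply/orP; left; apply/eqP; ring.
have := EN N.+1 (leqnn _); rewrite /E /err T_h => hE; apply: le_trans hE _.
have -> : N.+1%:R * (2 * h * (d%:R * e1 ^+ 2)) = 2 * T * d%:R * e1 ^+ 2 by rewrite -T_h; ring.
have e1e : e1 ^+ 2 <= e / A. apply: (@le_trans _ _ e1); last by rewrite ge_min lexx orbT.
 by rewrite expr2 ler_piMl ?(ltW e10)// ge_min lexx.
apply: (@le_trans _ _ ((A - 1) * (e / A))).
 by rewrite /A addrK -[leRHS]mulrA ler_wpM2l ?expR_ge0// ler_wpM2l// !mulr_ge0// ltW.
rewrite mulrCA -[leRHS]mulr1 ler_wpM2l ?(ltW e0)//.
by rewrite ler_pdivrMr// mul1r gerBl.
Unshelve. all: by end_near. Qed.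

End euler.

Section path_extension.
Context (R : realType) (d : nat).

Lemma max0_lip (x t : R) : `|Num.max 0 x - Num.max 0 t| <= `|x - t|.
Proof.
have [x0|/ltW x0] := leP 0 x; have [t0|/ltW t0] := leP 0 t.
- by [].
- by rewrite subr0 ger0_norm// (le_trans _ (ler_norm _))// lerDl oppr_ge0.
- by rewrite sub0r normrN ger0_norm// distrC (le_trans _ (ler_norm _))// lerDl oppr_ge0.
- by rewrite subrr normr0.
Qed.

(** Freezing the path at its initial value for negative times turns continuity on the half-line into
    continuity on [R]. *)
Lemma within_ge0_coord_continuous (X : R -> 'rV[R]_d) i :
 {within [set t | 0 <= t], continuous X} -> continuous (fun t : R => X (Num.max 0 t) ord0 i).
Proof.
move=> cX x; set y := Num.max 0 x.
have y0 : [set t : R | 0 <= t] y by rewrite /= le_max lexx.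
have h1 : X t @[t --> within [set t : R | 0 <= t] (nbhs y)] --> X y.
 by rewrite (nbhs_subspace_in y0); exact: cX.
have h2 : X t ord0 i @[t --> within [set t : R | 0 <= t] (nbhs y)] --> X y ord0 i.
 exact: (cvg_comp _ _ h1 (@coord_continuous _ _ _ ord0 i (X y))).
apply/cvgrPdist_lt => e e0; move/cvgr_dist_lt : h2 => /(_ _ e0).
rewrite near_withinE near_nbhs => /nbhs_ballP[dl dl0 H].
near=> t; apply: H; last by rewrite /= le_max lexx.
rewrite /ball/= /y; apply: (@le_lt_trans _ _ `|x - t|); last first.
 by near: t; apply: (@cvgr_dist_lt _ _ _ _ _ (fun t : R => t)).
exact: max0_lip.
Unshelve. all: by end_near. Qed.

End path_extension.

(** * Euler schemes of a diffusion as LMC runs *)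

Section langevin_euler.
Context (R : realType) (d : nat) (nu : R).
Hypothesis nu1 : 1 <= nu.
Context dO (Omega : measurableType dO) (P : probability Omega R).
Variables X B : R -> {RV P >-> 'rV[R]_d}.
Hypothesis hl : langevin_diffusion (V_nu nu) X B.
Variable h : R.
Hypothesis h0 : 0 < h.
Let n : R := d%:R + nu.

Let zeta w k := Num.sqrt 2 *: (B (k.+1%:R * h) w - B (k%:R * h) w).

Lemma measurable_euler k : mfunT (fun w => euler_path (h * n) (zeta w) (X 0 w) k).
Proof.
elim: k => [|k IH]; first mes.
apply: mrVD; first exact: (mcompT (@measurable_drift _ _ _) IH).
mes.
Qed.

Lemma measurable_scaled_increment k :
 mfunT (fun w => (Num.sqrt h)^-1 *: (B (k.+1%:R * h) w - B (k%:R * h) w)).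
Proof. mes. Qed.

(** Step 0 is [X 0] itself, so that an assumption on the initial law of the diffusion is literally
    one on the run. *)
Definition euler_rv k : {RV P >-> 'rV[R]_d} :=
 if k is k'.+1 then mfun_Sub (mem_set (measurable_euler k)) else X 0.

Definition euler_noise k : {RV P >-> 'rV[R]_d} :=
 mfun_Sub (mem_set (measurable_scaled_increment k)).

Lemma euler_rvE k w : euler_rv k w = euler_path (h * n) (zeta w) (X 0 w) k.
Proof. by case: k. Qed.

Lemma normal_prob_scale (s : R) (A : set R) : 0 < s -> measurable A ->
 normal_prob 0 s ((fun y => s^-1 * y) @^-1` A) = normal_prob 0 1 A.
Proof.
move=> s0 mA; have mA' : measurable ((fun y => s^-1 * y) @^-1` A).
 by rewrite -[X in measurable X]setTI; apply: mfM.
have := stdnormal_affine 0 s0 mA'; rewrite /normalm /stdnormal /normalm => <-.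
congr (normal_prob 0 1 _); apply/seteqP; split => x /=;
 by rewrite add0r mulrA mulVf ?gt_eqF// mul1r.
Qed.

Lemma euler_noise_gaussian k : gaussian_vector P 1 (euler_noise k).
Proof.
move=> A mA; have [[_ _ gB _] _ _ _] := hl.
have sh : 0 < Num.sqrt h by pos.
have t0 : 0 <= k%:R * h by pos.
have tt : k%:R * h < k.+1%:R * h by rewrite ltr_pM2r// ltr_nat.
have mA' i : measurable ((fun y => (Num.sqrt h)^-1 * y) @^-1` A i).
 by rewrite -[X in measurable X]setTI; apply: mfM.
have := gB _ _ t0 tt _ mA'.
have -> : k.+1%:R * h - k%:R * h = h by pos.
move=> e; transitivity (P [set w | forall i, ((fun y => (Num.sqrt h)^-1 * y) @^-1` A i)
  ((B (k.+1%:R * h) w - B (k%:R * h) w) ord0 i)]).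
 congr (P _); apply/seteqP; split => w /= H i; have := H i; by rewrite !mxE.
rewrite e; apply: eq_bigr => i _; exact: normal_prob_scale.
Qed.

(** The noises are functions of [B] at finitely many grid times, and [X 0] is independent of those
    values. *)
Lemma euler_noise_indep_init m (C : set 'rV[R]_d) (A : nat -> set 'rV[R]_d) :
 measurable C -> (forall i, measurable (A i)) ->
 P (X 0 @^-1` C `&` \bigcap_(i < m) (euler_noise i @^-1` A i)) =
 (P (X 0 @^-1` C) * P (\bigcap_(i < m) (euler_noise i @^-1` A i)))%E.
Proof.
move=> mC mA; have [_ iX _ _] := hl.
pose t (i : nat) := i%:R * h.
have t0 i : 0 <= t i by pos.
pose G : set (set Omega) := [set D | exists2 F : nat -> set 'rV[R]_d,
 (forall i, measurable (F i)) & D = \bigcap_(i < m.+1) (B (t i) @^-1` F i)].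
have Gsub : G `<=` measurable. move=> _ [F mF ->]; apply: fin_bigcap_measurable => // i _.
 by rewrite -[X in measurable X]setTI; exact: mfunPT.
pose T' := g_sigma_algebraType G.
have mB j : (j <= m)%N -> measurable_fun [set: T'] (B (t j) : T' -> 'rV[R]_d).
 move=> jk _ D mD; rewrite setTI; apply: sub_sigma_algebra.
 exists (fun i => if i == j then D else setT); first by move=> i; case: ifP.
 apply/seteqP; split => [w Yw i _|w /(_ j jk)/=]; last by rewrite eqxx.
 by rewrite /=; case: eqP => // ->.
apply: (@indep_g_sigma1 _ _ _ _ _ G) => //.
- by rewrite -[X in measurable X]setTI; exact: mfunPT.
- move=> _ _ [F mF ->] [F' mF' ->]; exists (fun i => F i `&` F' i). by move=> i; exact: measurableI.
 by rewrite -bigcapI.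
- exists (fun=> setT) => //. by apply/seteqP; split => // w _ i _.
- by move=> _ [F mF ->]; exact: iX.
suff : @measurable _ T' (\bigcap_(i < m) (euler_noise i @^-1` A i)) by [].
apply: fin_bigcap_measurable => // i im.
have mx : measurable_fun [set: T'] (euler_noise i : T' -> 'rV[R]_d).
 apply: mrVZ => //; apply: mrVD; first exact: (mB i.+1).
 by apply: measurable_rVN; apply: (mB i); exact: ltnW.
by have := mx measurableT (A i) (mA i); rewrite setTI.
Qed.

Lemma euler_noise_indep : independent_seq P (fun k => euler_noise k).
Proof.
move=> m A mA; have [[_ _ _ iB] _ _ _] := hl.
have mA' i : measurable ((fun y : 'rV[R]_d => (Num.sqrt h)^-1 *: y) @^-1` A i).
 rewrite -[X in measurable X]setTI. mes.
have := iB (fun k => k%:R * h) _ _ m _ mA'; apply.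
- pos.
- by move=> k; rewrite ler_wpM2r ?(ltW h0)// ler_nat.
Qed.

Lemma euler_lmc : langevin_monte_carlo (V_nu nu) h euler_rv euler_noise.
Proof.
split.
- exact: euler_noise_gaussian.
- move=> m A mA; case: m => [|m].
  rewrite big_ord0 (_ : \bigcap_(i < 0) _ = setT) ?probability_setT//. by apply/seteqP; split.
 transitivity (P (X 0 @^-1` A 0%N `&` \bigcap_(i < m) (euler_noise i @^-1` A i.+1))).
  by congr (P _); rewrite !bigcap_mkord big_ord_recl.
 by rewrite euler_noise_indep_init// euler_noise_indep// big_ord_recl.
move=> k w; rewrite !euler_rvE /= driftE; congr (_ + _).
rewrite /zeta /= scalerA; congr (_ *: _).
by rewrite sqrtrM// mulfK// gt_eqF// sqrtr_gt0.
Qed.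

End langevin_euler.

Section langevin_limits.
Context (R : realType) (d : nat) (nu : R).
Hypothesis nu1 : 1 <= nu.
Context dO (Omega : measurableType dO) (P : probability Omega R).
Variables X B : R -> {RV P >-> 'rV[R]_d}.
Hypothesis hl : langevin_diffusion (V_nu nu) X B.

Lemma euler_rv_cvg T : 0 < T ->
 {ae P, forall w, euler_rv nu X B (T / N.+1%:R) N.+1 w @[N --> \oo] --> X T w}.
Proof.
move=> T0; have [_ _ cX eX] := hl.
apply: filterS2 cX eX => w cw ew.
have [Y YE cY] : exists2 Y : R -> 'rV[R]_d, (forall t, 0 <= t -> Y t = X t w) &
  forall i, continuous (fun t => Y t ord0 i).
 exists (fun t => X (Num.max 0 t) w) => [t t0|i]; first by rewrite max_r.
 exact: (@within_ge0_coord_continuous _ _ (X^~ w) i cw).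
have Y0 : Y 0 = X 0 w by exact: (YE 0 (lexx 0)).
have eY t : 0 <= t -> forall i, Y t ord0 i = Y 0 ord0 i -
 (\int[@lebesgue_measure R]_(s in `[0, t]) grad (V_nu nu) (Y s) ord0 i) + Num.sqrt 2 * B t w ord0 i.
 move=> t0 i; have e0 := ew t t0 i.
 have e1 : \int[@lebesgue_measure R]_(s in `[0, t]) grad (V_nu nu) (X s w) ord0 i =
   \int[@lebesgue_measure R]_(s in `[0, t]) grad (V_nu nu) (Y s) ord0 i.
  apply: eq_Rintegral => s; rewrite inE/= in_itv/= => /andP[s0 _]. by rewrite YE.
 rewrite (YE t t0) Y0 e0 e1. by apply: (f_equal2 +%R); first mes.
have := euler_cvg nu1 cY eY T0; rewrite !YE//; last pos.
Qed.

Lemma path_right_cvg (T_ : nat -> R) (T : R) : 0 <= T -> (forall k, 0 <= T_ k) -> T_ @ \oo --> T ->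
 {ae P, forall w, X (T_ k) w @[k --> \oo] --> X T w}.
Proof.
move=> T0 Tk cT; have [_ _ cX _] := hl.
apply: filterS cX => w cw; apply: rV_cvg => i.
have cY := @within_ge0_coord_continuous _ _ (X^~ w) i cw.
have e t : 0 <= t -> X t w ord0 i = X (Num.max 0 t) w ord0 i by move=> t0; rewrite max_r.
rewrite (e T T0); under eq_fun do rewrite e//.
exact: (cvg_comp _ _ cT (cY T)).
Qed.

End langevin_limits.

(** * The upper bound for the diffusion *)

Section langevin_upper.
Context (R : realType) (d : nat) (q nu D : R) (pi : probability 'rV[R]_d R).
Hypotheses (q2 : 2 <= q) (nu1 : 1 <= nu) (d0 : (0 < d)%N) (D48 : 48 <= D).
Hypothesis gpi : is_gibbs (V_nu nu) pi.
Let times := ld_times (renyi q) renyi_oo (V_nu nu) pi D 1.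

(** [X T] is the almost sure limit of runs of total time T with vanishing steps; each ends in the
    Renyi ball, which is closed. *)
Lemma mixing_time_ld : times (mixing_time d q nu D).
Proof.
have T0 := mixing_time_gt0 nu q2 d0 D48; set T := mixing_time d q nu D in T0 *.
have [h0 h00 H] := lmc_renyi_le1 q2 nu1 d0 D48 gpi.
split; first pos.
move=> dO Omega P X B hl roo.
(* Shifting the index by [N0] makes every step of the sequence small enough. *)
pose N0 := Num.trunc (T / h0).
have hN N : T / (N + N0).+1%:R <= h0.
 rewrite ler_pdivrMr// mulrC -ler_pdivrMr// ltW// (lt_le_trans (truncnS_gt _))//.
 by rewrite ler_nat ltnS leq_addl.
have hN0 N : 0 < T / N.+1%:R by pos.
apply: (@renyi_le1_lsc _ _ _ _ _ _ (fun N => euler_rv nu X B (T / (N + N0).+1%:R) (N + N0).+1)) => //.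
 have := euler_rv_cvg nu1 hl T0; apply: filterS => w cw. by rewrite -(@cvg_shiftn N0) in cw.
move=> N; apply: (H (N + N0)%N (hN N) _ _ _ _ (euler_noise B (T / (N + N0).+1%:R))) => //.
exact: euler_lmc.
Qed.

(** The infimum of the admissible times is attained: along admissible times tending to it the paths
    converge, and the Renyi ball is closed under almost sure limits. *)
Lemma ld_complexity_exists : exists2 T, is_complexity_LD (renyi q) renyi_oo (V_nu nu) pi D 1 T &
 T <= mixing_time d q nu D.
Proof.
have hT := mixing_time_ld.
have lb : lbound times 0 by move=> t [].
have hi : has_inf times by split; [exists (mixing_time d q nu D)|exists 0].
exists (inf times); last by apply: inf_lbound => //; exists 0.
split; last by move=> t ht; apply: inf_lbound => //; exists 0.
have i0 : 0 <= inf times by apply: lb_le_inf => //; case: hi.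
split => // dO Omega P X B hl roo.
have H k : exists t, times t /\ t < inf times + k.+1%:R^-1.
 have [t ht tk] := @inf_adherent R times k.+1%:R^-1 (ltac:(by rewrite invr_gt0)) hi. by exists t.
have [T_ HT] := choice H.
have T0 k : 0 <= T_ k by have [[]] := HT k.
apply: (@renyi_le1_lsc _ _ _ _ _ _ (fun k => X (T_ k))) => //. apply: (path_right_cvg hl) => //.
 apply: (@squeeze_cvgr _ _ _ _ (fun=> inf times) (fun k => inf times + k.+1%:R^-1)).
 - apply: nearW => k; have [ht /ltW ->] := HT k; rewrite andbT.
  by apply: inf_lbound => //; exists 0.
 - exact: cvg_cst.
 - rewrite -[X in _ --> X]addr0; apply: (@cvgD R R^o); first exact: cvg_cst.
  exact: (@cvg_harmonic R).
by move=> k; have [[_ ht] _] := HT k; exact: ht hl roo.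
Qed.

End langevin_upper.

(** * Splitting one uniform variable into two independent ones *)

Section independence_of_rays.
Context d (T : measurableType d) (R : realType) (P : probability T R).

Lemma indep_of_rays (X : T -> R) (E : set T) : mfunT X -> measurable E ->
 (forall a : R, P (E `&` X @^-1` `]a, +oo[) = P E * P (X @^-1` `]a, +oo[))%E ->
 forall A, measurable A -> P (E `&` X @^-1` A) = (P E * P (X @^-1` A))%E.
Proof.
move=> mX mE H A mA.
pose G : set (set T) := [set B | B = setT \/ exists a : R, B = X @^-1` `]a, +oo[].
have Gm : G `<=` measurable. move=> _ [->//|[a ->]]; rewrite -[X in measurable X]setTI; exact: mX.
apply: (@indep_g_sigma1 _ _ _ _ _ G) => //.
- move=> B C [->|[a ->]] [->|[b ->]]; rewrite ?setTI ?setIT.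
 + by left.
 + by right; exists b.
 + by right; exists a. right; exists (Num.max a b); apply/seteqP; split => x /=;
  rewrite !in_itv/= !andbT gt_max; first by move=> [-> ->]. by move=> /andP[].
- by left.
- by move=> _ [->|[a ->]] //; rewrite setIT probability_setT mule1.
pose T' := g_sigma_algebraType G.
suff : @measurable _ T' (X @^-1` A) by [].
have mX' : measurable_fun [set: T'] (X : T' -> R).
 apply: (measurability _ (@RGenOInfty.measurableE R)).
 by move=> _ [_ [a ->] <-]; rewrite setTI; apply: sub_sigma_algebra; right; exists a.
by have := mX' measurableT A mA; rewrite setTI.
Qed.

End independence_of_rays.

Section unit_interval.
Context (R : realType).

(** The uniform law on (0, 1), carried by all of [R]; the randomness of the construction below is
    extracted from a single such variable. *)
Definition lam : set R -> \bar R := mrestr (lebR R) (mitv `]0%R, 1%R[).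

HB.instance Definition _ := Measure.on lam.

Let lam_setT : lam setT = 1%E.
Proof.
by rewrite /lam /mrestr setTI /lebR lebesgue_measure_itv/= lte_fin ltr01 sube0.
Qed.

HB.instance Definition _ := @Measure_isProbability.Build _ _ R lam lam_setT.

Lemma lam_ae : {ae lam, forall x, 0 < x < 1}.
Proof.
exists (~` `]0, 1[%classic); split; first exact: measurableC.
 by rewrite /= /lam /mrestr setICl measure0.
pos.
Qed.

Lemma lam_ray (a : R) : lam `]a, +oo[%classic = (Num.max 0 (Num.min 1 (1 - a)))%:E.
Proof.
rewrite /lam /mrestr /lebR.
have -> : `]a, +oo[%classic `&` `]0, 1[%classic = `](Num.max a 0), 1[%classic.
 apply/seteqP; split => x /=; rewrite !in_itv/= andbT gt_max; first by move=> [-> ->]. pos.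
rewrite lebesgue_measure_itv/= lte_fin -EFinD.
have cl (x y : R) : x = y -> x%:E = y%:E by move=> ->.
case: (leP a 0) => a0; case: (leP 1 (1 - a)) => a1.
- by rewrite ltr01 subr0 max_r.
- exfalso; lra.
- exfalso; lra.
by case: ltP => h1; case: (leP 0 (1 - a)) => h2; apply: cl; lra.
Qed.

Lemma lam_ray_lt0 (a : R) : a < 0 -> lam `]a, +oo[%classic = 1%E.
Proof. by move=> a0; rewrite lam_ray min_l ?max_r//; lra. Qed.

Lemma eq_E_lam (f g : R -> R) : bmf f -> bmf g ->
 (forall x, 0 < x < 1 -> f x = g x) -> E lam f = E lam g.
Proof.
move=> [mf _] [mg _] fg; rewrite /E; congr fine; apply: ae_eq_integral => //.
- mes.
- mes.
by apply: filterS lam_ae => x /fg ->.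
Qed.

Lemma le_E_lam (f g : R -> R) : bmf f -> bmf g ->
 (forall x, 0 < x < 1 -> f x <= g x) -> E lam f <= E lam g.
Proof.
move=> bf bg fg.
have mi : measurable (`]0%R, 1%R[%classic : set R) by pos.
have bi := bmf_indic R mi.
rewrite (eq_E_lam bf (bmfM bf bi)); last first.
 by move=> x x01; rewrite indicE mem_set ?mulr1//= in_itv.
rewrite (eq_E_lam bg (bmfM bg bi)); last first.
 by move=> x x01; rewrite indicE mem_set ?mulr1//= in_itv.
apply: le_E => [||x]; [exact: bmfM|exact: bmfM|].
rewrite indicE; have [|_] := boolP (x \in _); last by rewrite !mulr0.
by rewrite inE/= in_itv/= => /fg; rewrite !mulr1.
Qed.

(** On binary expansions, [half] prepends a digit, [bit] reads the first one and [theta] removes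
    it. *)
Definition half (b : bool) (y : R) : R := (b%:R + y) / 2.
Definition bit (x : R) : bool := 2^-1 <= x.
Definition theta (x : R) : R := 2 * x - (bit x)%:R.

Lemma bit_half b y : 0 < y < 1 -> bit (half b y) = b.
Proof.
move=> /andP[y0 y1]; rewrite /bit /half; case: b => /=. by apply/idP; lra.
by apply/negbTE; rewrite -ltNge; lra.
Qed.

Lemma theta_half b y : 0 < y < 1 -> theta (half b y) = y.
Proof. by move=> y01; rewrite /theta bit_half// /half; field. Qed.

Lemma measurable_half b : measurable_fun [set: R] (half b).
Proof. by apply: mfM => //; exact: mfD. Qed.

Lemma measurable_bit : measurable_fun [set: R] (fun x => (bit x)%:R : R).
Proof.
rewrite (_ : (fun x => _) = \1_[set x : R | 2^-1 <= x]).
 apply: mindic; rewrite -[X in measurable X]setTI. exact: measurable_fun_ler.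
apply/funext => x; rewrite indicE /bit; congr (_%:R).
by have [h|h] := boolP (2^-1 <= x); [rewrite mem_set|rewrite memNset//; exact/negP].
Qed.

Lemma measurable_theta : measurable_fun [set: R] theta.
Proof. by apply: mfB; [exact: mfM|exact: measurable_bit]. Qed.

(** Self-similarity: the first digit is a fair coin, independent of the rest. *)
Lemma lam_half (f : R -> R) : bmf f -> (forall x, 0 <= f x) ->
 E lam f = 2^-1 * (E lam (f \o half false) + E lam (f \o half true)).
Proof.
move=> bf f0; have [mf _] := bf.
have bfh b : bmf (f \o half b). have [_ [K fK]] := bf; split; last by exists K => x; exact: fK.
 exact: (mcompT mf (measurable_half b)).
have h20 : 0 <= 2^-1 :> R by [].
pose m (b : bool) : {measure set R -> \bar R} := mscale (NngNum h20) (distribution lam (mfun_Sub (mem_set (measurable_half b)))).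
have key A : measurable A -> lam A = measure_add (m false) (m true) A.
 apply: (@R_measure_unique R lam (measure_add (m false) (m true))).
  exact: (le_lt_trans (probability_le1 lam measurableT) (ltry 1)).
 move=> a; have pre b : half b @^-1` `]a, +oo[ = `](2 * a - b%:R), +oo[%classic.
  apply/seteqP; split => x /=; rewrite !in_itv/= !andbT /half; lra.
 apply: (etrans _ (esym (measure_addE _ _ _))).
 transitivity (2^-1%:E * lam (half false @^-1` `]a, +oo[) + 2^-1%:E * lam (half true @^-1` `]a, +oo[))%E; last by [].
 have cl (x y : R) : x = y -> x%:E = y%:E by move=> ->.
 apply: (etrans (lam_ray a)); rewrite !pre !lam_ray -!EFinM -EFinD; apply: cl; rewrite /=.
 have m01 : Num.max 0 1 = 1 :> R by rewrite max_r.
 case: (leP 1 (1 - a)) => ?; case: (leP 1 (1 - (2 * a - 0))) => ?;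
  case: (leP 1 (1 - (2 * a - 1))) => ?; rewrite ?m01; try lra;
  case: (leP 0 (1 - a)) => ?; try lra; case: (leP 0 (1 - (2 * a - 0))) => ?; try lra;
  by case: (leP 0 (1 - (2 * a - 1))) => ?; lra.
apply: EFin_inj; rewrite EFinM EFinD !EE//.
transitivity (\int[measure_add (m false) (m true)]_x (f x)%:E)%E.
 by apply: eq_measure_integral => A mA _; exact: key.
rewrite ge0_integral_measure_add//; last 2 first. pos. mes.
have mint b : (\int[m b]_x (f x)%:E = 2^-1%:E * \int[lam]_x (f (half b x))%:E)%E.
 rewrite ge0_integral_mscale//; last 2 first.
 - mes.
 - pos. congr (_ * _)%E; rewrite ge0_integral_pushforward//.
 - mes.
 - by move=> x _; rewrite lee_fin.
have p b : (0 <= \int[lam]_x (f (half b x))%:E)%E by apply: integral_ge0 => x _; rewrite lee_fin.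
by rewrite !mint; apply/esym; apply: ge0_muleDr; exact: p.
Qed.

(** Every other digit is kept: in the limit [usplit1] consists of the digits of odd rank, and
    [usplit2], taken after one [theta], of those of even rank. *)
Fixpoint digits (m : nat) (x : R) : R :=
 if m is m'.+1 then half (bit x) (digits m' (theta (theta x))) else 0.

Lemma digits01 m x : 0 <= digits m x <= 1.
Proof.
elim: m x => [|m IH] x /=; first pos.
by have := IH (theta (theta x)); rewrite /half; case: bit => /=; lra.
Qed.

Lemma digits_nd x : nondecreasing_seq (fun m => digits m x).
Proof.
apply/nondecreasing_seqP => m; elim: m x => [|m IH] x. by have := digits01 1 x => /andP[].
by rewrite /= /half ler_pM2r// lerD2l; exact: IH.
Qed.

Definition usplit1 (x : R) : R := limn (fun m => digits m x).
Definition usplit2 (x : R) : R := usplit1 (theta x).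

Lemma digits_cvg x : digits m x @[m --> \oo] --> usplit1 x.
Proof.
apply: nondecreasing_is_cvgn; first exact: digits_nd.
by exists 1 => _ [m _ <-]; case/andP: (digits01 m x).
Qed.

Lemma usplit1E x : usplit1 x = half (bit x) (usplit1 (theta (theta x))).
Proof.
have h1 : digits m.+1 x @[m --> \oo] --> usplit1 x.
 by have := @digits_cvg x; rewrite -(@cvg_shiftS _ (fun m => digits m x)).
have h2 : digits m.+1 x @[m --> \oo] --> half (bit x) (usplit1 (theta (theta x))).
 have h3 : (fun _ : nat => 2^-1) @ \oo --> (2^-1 : R) by exact: cvg_cst.
 have h4 : (fun _ : nat => (bit x)%:R) @ \oo --> ((bit x)%:R : R) by exact: cvg_cst.
 exact: (cvgM (cvgD h4 (@digits_cvg (theta (theta x)))) h3).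
exact: (cvg_unique _ h1 h2).
Qed.

Lemma usplit1_01 x : 0 <= usplit1 x <= 1.
Proof.
apply/andP; split.
 by apply: (cvgr_to_ge (@digits_cvg x)); apply: nearW => m; case/andP: (digits01 m x).
by apply: (cvgr_to_le (@digits_cvg x)); apply: nearW => m; case/andP: (digits01 m x).
Qed.

Lemma measurable_digits m : measurable_fun [set: R] (digits m).
Proof.
elim: m => [|m IH] /=; first mes.
apply: mfM => //; apply: mfD; first exact: measurable_bit.
apply: (mcompT IH); apply: (mcompT measurable_theta).
exact: measurable_theta.
Qed.

Lemma musplit1 : measurable_fun [set: R] usplit1.
Proof.
apply: (measurable_fun_cvg measurable_digits) => x _; exact: digits_cvg.
Qed.

Lemma musplit2 : measurable_fun [set: R] usplit2.
Proof. exact: (mcompT musplit1 measurable_theta). Qed.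

Definition lip01 (L : R) (phi : R -> R) : Prop := [/\ mfunT phi, (forall u, 0 <= phi u <= 1) &
   forall u v, `|phi u - phi v| <= L * `|u - v|].

Lemma lip01_half L phi b : lip01 L phi -> lip01 (L / 2) (phi \o half b).
Proof.
move=> [mphi p01 lp]; split.
- exact: (mcompT mphi (measurable_half b)).
- by move=> u; exact: p01.
move=> u v; apply: le_trans (lp _ _) _.
have -> : half b u - half b v = 2^-1 * (u - v) by rewrite /half; field.
by rewrite normrM ger0_norm// mulrA.
Qed.

Let bmf_comp (phi g : R -> R) : mfunT phi -> (forall u, 0 <= phi u <= 1) ->
 mfunT g -> bmf (fun x => phi (g x)).
Proof.
by move=> mp p01 mg; apply: bmf01; [exact: (mcompT mp mg)|move=> x; exact: p01].
Qed.

(** Conditioning on the first two digits, one of which goes to each half. *)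
Lemma E_split (phi psi : R -> R) : mfunT phi -> mfunT psi ->
 (forall u, 0 <= phi u <= 1) -> (forall u, 0 <= psi u <= 1) ->
 E lam (fun x => phi (usplit1 x) * psi (usplit2 x)) = 4^-1 * (\sum_(b : bool) \sum_(c : bool)
  E lam (fun x => (phi \o half b) (usplit1 x) * (psi \o half c) (usplit2 x))).
Proof.
move=> mphi mpsi phi01 psi01.
have ms1 := musplit1; have ms2 := musplit2.
have ms3 := mcompT ms2 measurable_theta.
have mh b g : measurable_fun [set: R] g -> measurable_fun [set: R] (fun x => half b (g x)).
 by move=> mg; exact: (mcompT (measurable_half b) mg).
have mgh (g : R -> R) b : measurable_fun [set: R] g -> measurable_fun [set: R] (fun x => g (half b x)).
 by move=> mg; exact: (mcompT mg (measurable_half b)).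
have bm g h : measurable_fun [set: R] g -> measurable_fun [set: R] h ->
  bmf (fun x : R => phi (g x) * psi (h x)). by move=> mg mh'; apply: bmfM; exact: bmf_comp.
have pos g h (x : R) : 0 <= phi (g x) * psi (h x).
 by rewrite mulr_ge0//; [case/andP: (phi01 (g x))|case/andP: (psi01 (h x))].
pose G b c := E lam (fun x => (phi \o half b) (usplit1 x) * (psi \o half c) (usplit2 x)).
have step1 b : E lam ((fun x => phi (usplit1 x) * psi (usplit2 x)) \o half b) =
  E lam (fun x => phi (half b (usplit2 x)) * psi (usplit1 x)). apply: eq_E_lam => [||x x01 /=].
 - by apply: bm; exact: mgh.
 - by apply: bm => //; exact: mh.
 by rewrite [usplit1 (half b x)]usplit1E /usplit2 bit_half// theta_half.
have step2 b c : E lam ((fun x => phi (half b (usplit2 x)) * psi (usplit1 x)) \o half c) = G b c.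
 apply: eq_E_lam => [||x x01 /=].
 - by apply: bm; [exact: (mgh (fun x => half b (usplit2 x)) c (mh b _ ms2))|exact: (mgh usplit1)].
 - by apply: bm; exact: mh. by rewrite [usplit1 (half c x)]usplit1E /usplit2 bit_half// theta_half.
rewrite lam_half; last 2 first.
- exact: bm.
- pos.
have lh b : E lam (fun x => phi (half b (usplit2 x)) * psi (usplit1 x)) =
 2^-1 * \sum_(c : bool) G b c. rewrite lam_half; last 2 first.
 - by apply: bm => //; exact: mh.
 - exact: (pos (fun x => half b (usplit2 x)) usplit1). by rewrite !step2 big_bool/= addrC.
rewrite !step1 !lh -/(G _ _); have -> : (\sum_(b : bool) \sum_(c : bool) E lam (fun x => (phi \o half b) (usplit1 x) * (psi \o half c) (usplit2 x))) = \sum_(b : bool) \sum_(c : bool) G b c by [].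
rewrite !big_bool /=; move: (G true true) (G true false) (G false true) (G false false) => *; by field.
Qed.

(** Reading one digit of each half averages over four cells and halves both Lipschitz constants. The
    covariance is trivially at most 4 L, hence at most 4 L 2^-m for every m. *)
Lemma E_split_approx m L phi psi : 0 <= L -> lip01 L phi -> lip01 L psi ->
 `|E lam (fun x => phi (usplit1 x) * psi (usplit2 x)) - E lam phi * E lam psi| <= 4 * L * 2^-1 ^+ m.
Proof.
elim: m L phi psi => [|m IH] L phi psi L0 lphi lpsi; have [mphi phi01 lp] := lphi;
 have [mpsi psi01 lq] := lpsi. have ms1 := musplit1; have ms2 := musplit2.
 have close (f : R -> R) c : bmf f -> (forall x, 0 < x < 1 -> `|f x - c| <= 2 * L) ->
   `|E lam f - c| <= 2 * L. move=> bf H; have bc : bmf (fun _ : R => c) by exact: bmf_cst.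
  rewrite -[X in _ - X](E_cst lam) -EB//; apply: le_trans (ler_norm_E _ _) _; first exact: bmfB.
  rewrite -[leRHS](E_cst lam); apply: le_E_lam => //; first by apply: bmf_norm; exact: bmfB.
  exact: bmf_cst.
 have prod a b a' b' : 0 <= a <= 1 -> 0 <= b' <= 1 -> `|a - a'| <= L -> `|b - b'| <= L ->
   `|a * b - a' * b'| <= 2 * L.
  move=> a01 b01 h1 h2; have -> : a * b - a' * b' = a * (b - b') + (a - a') * b' by ring.
  apply: le_trans (ler_normD _ _) _; rewrite !normrM.
  have [a0 a1] := andP a01; have [b0 b1] := andP b01. rewrite (ger0_norm a0) (ger0_norm b0).
  have := normr_ge0 (a - a'); have := normr_ge0 (b - b').
  set x := `|a - a'| in h1 *; set y := `|b - b'| in h2 *; move=> y0 x0.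
  have : a * y <= L by apply: le_trans h2; rewrite ler_piMl.
  have : x * b' <= L by apply: le_trans h1; rewrite ler_piMr. lra.
 have unit f u : lip01 L f -> 0 <= u <= 1 -> `|f u - f 0| <= L.
  move=> [_ _ lf] /andP[u0 u1]; apply: le_trans (lf _ _) _. by rewrite subr0 ger0_norm// ler_piMr.
 have bphi : bmf phi by exact: bmf01. have bpsi : bmf psi by exact: bmf01.
 have h1 : `|E lam (fun x => phi (usplit1 x) * psi (usplit2 x)) - phi 0 * psi 0| <= 2 * L.
  apply: close; first by apply: bmfM; exact: bmf_comp. move=> x _; apply: prod => //.
   by apply: unit => //; exact: usplit1_01. by apply: unit => //; exact: usplit1_01.
 have mean f : lip01 L f -> bmf f -> `|E lam f - f 0| <= L.
  move=> lf bf; rewrite -[X in _ - X](E_cst lam) -EB//; last exact: bmf_cst.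
  have bd : bmf (fun x => f x - f 0) by apply: bmfB => //; exact: bmf_cst.
  apply: le_trans (ler_norm_E _ bd) _.
  rewrite -[leRHS](E_cst lam); apply: le_E_lam => [||x /andP[x0 x1]].
  - exact: bmf_norm.
  - exact: bmf_cst. by apply: unit => //; rewrite !ltW.
 have h2 : `|E lam phi * E lam psi - phi 0 * psi 0| <= 2 * L.
  by apply: prod; [exact: E01|exact: psi01|exact: mean|exact: mean].
 rewrite expr0 mulr1; rewrite distrC in h2.
 rewrite (_ : _ - _ = (E lam (fun x => phi (usplit1 x) * psi (usplit2 x)) - phi 0 * psi 0) +
  (phi 0 * psi 0 - E lam phi * E lam psi)); last pos. by apply: le_trans (ler_normD _ _) _; lra.
have L2 : 0 <= L / 2 by pos.
rewrite E_split//.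
have bphi : bmf phi by exact: bmf01.
have bpsi : bmf psi by exact: bmf01.
rewrite [E lam phi]lam_half//; last by move=> u; case/andP: (phi01 u).
rewrite [E lam psi]lam_half//; last by move=> u; case/andP: (psi01 u).
have H b c := IH (L / 2) (phi \o half b) (psi \o half c) L2 (lip01_half b lphi) (lip01_half c lpsi).
have Htt := H true true; have Htf := H true false; have Hft := H false true; have Hff := H false false.
rewrite !big_bool/=.
move: Htt Htf Hft Hff; rewrite /=.
set Ett := E lam _; set Pt := E lam (phi \o _); set Qt := E lam (psi \o _).
set Etf := E lam (fun x => _); set Qf := E lam (psi \o half false).
set Eft := E lam (fun x => _); set Pf := E lam (phi \o half false).
set Eff := E lam (fun x => _).
rewrite exprS; set r := 2^-1 ^+ m; rewrite !ler_norml.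
by move=> /andP[? ?] /andP[? ?] /andP[? ?] /andP[? ?]; apply/andP; split; lra.
Qed.

Lemma E_split_lip L phi psi : 0 <= L -> lip01 L phi -> lip01 L psi ->
 E lam (fun x => phi (usplit1 x) * psi (usplit2 x)) = E lam phi * E lam psi.
Proof.
move=> L0 lphi lpsi; apply/eqP; rewrite -subr_eq0 -normr_le0; apply/ler_addgt0Pr => e e0.
rewrite add0r.
have : 4 * L * 2^-1 ^+ m @[m --> \oo] --> 4 * L * 0.
 have h1 : (fun _ : nat => 4 * L) @ \oo --> 4 * L by exact: cvg_cst.
 have h2 : 2^-1 ^+ m @[m --> \oo] --> (0 : R) by apply: cvg_expr; rewrite ger0_norm; lra.
 exact: (cvgM h1 h2).
rewrite mulr0 => /cvgr_le /(_ _ e0)[m _ hm].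
apply: le_trans (E_split_approx m L0 lphi lpsi) _; exact: (hm m (leqnn m)).
Qed.

Lemma lip01_ramp (k : nat) (a : R) : lip01 k%:R (fun u => ramp (k%:R * (u - a))).
Proof.
have rl (x y : R) : `|ramp x - ramp y| <= `|x - y|.
 have h1 := ler_dist_dist x y; have h2 := ler_dist_dist (x - 1) (y - 1).
 have e : x - 1 - (y - 1) = x - y by ring. rewrite e in h2.
 have -> : ramp x - ramp y = (`|x| - `|y|) / 2 - (`|x - 1| - `|y - 1|) / 2 by rewrite /ramp; field.
 apply: le_trans (ler_normB _ _) _.
 have n2 (z : R) : `|z / 2| = `|z| / 2 by rewrite normrM [`|2^-1|]ger0_norm. by rewrite !n2; lra.
split.
- apply: (mcompT (@measurable_ramp R)); apply: mfM => //. exact: mfB.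
- by move=> u; exact: ramp01.
move=> u v; apply: le_trans (rl _ _) _.
by rewrite -mulrBr opprB addrA subrK normrM ger0_norm.
Qed.

Lemma indic_ray_cvg (a x : R) : ramp (k%:R * (x - a)) @[k --> \oo] --> (\1_(`]a, +oo[%classic : set R) x : R).
Proof.
have -> : \1_(`]a, +oo[%classic : set R) x = (a < x)%R%:R :> R.
 rewrite indicE; have [h|h] := ltP a x; first by rewrite mem_set//= in_itv/= h.
 by rewrite memNset//= in_itv/= andbT => /(le_lt_trans h); rewrite ltxx.
exact: ramp_cvg.
Qed.

(** Indicators of rays are limits of the Lipschitz ramps, for which independence is known. *)
Lemma lam_split_rays (a c : R) : lam (usplit1 @^-1` `]a, +oo[ `&` usplit2 @^-1` `]c, +oo[) =
 (lam `]a, +oo[%classic * lam `]c, +oo[%classic)%E.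
Proof.
have ms1 := musplit1; have ms2 := musplit2.
have mray (b : R) : measurable (`]b, +oo[%classic : set R) by pos.
have mpre g (b : R) : measurable_fun [set: R] g -> measurable (g @^-1` `]b, +oo[).
 by move=> mg; rewrite -[X in measurable X]setTI; exact: mg.
pose f k x := ramp (k%:R * (usplit1 x - a)) * ramp (k%:R * (usplit2 x - c)).
have mf k : mfunT (f k). have [m1 _ _] := lip01_ramp k a; have [m2 _ _] := lip01_ramp k c.
 by apply: mfM; [exact: (mcompT m1 ms1)|exact: (mcompT m2 ms2)].
have r01 := @ramp01 R.
have fle k x : `|f k x| <= 1.
 rewrite normrM /f; have [h1 h2] := andP (r01 (k%:R * (usplit1 x - a))).
 have [h3 h4] := andP (r01 (k%:R * (usplit2 x - c))). by rewrite !ger0_norm// -[leRHS]mulr1 ler_pM.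
have c1 : E lam (f k) @[k --> \oo] --> E lam (\1_(usplit1 @^-1` `]a, +oo[ `&` usplit2 @^-1` `]c, +oo[)).
 apply: (@E_cvg _ _ _ _ _ _ 1) => //. by apply: mindic; apply: measurableI; exact: mpre.
 move=> x; rewrite indicE in_setI -mulnb natrM.
 exact: (cvgM (indic_ray_cvg (a := a) (x := usplit1 x)) (indic_ray_cvg (a := c) (x := usplit2 x))).
have ray b : E lam (fun u => ramp (k%:R * (u - b))) @[k --> \oo] --> E lam (\1_(`]b, +oo[%classic : set R)).
 apply: (@E_cvg _ _ _ _ _ _ 1).
 - by move=> k; have [] := lip01_ramp k b.
 - mes.
 - by move=> k x; have [h1 h2] := andP (r01 (k%:R * (x - b))); rewrite ger0_norm.
 - by move=> x; exact: indic_ray_cvg.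
have c2 : E lam (f k) @[k --> \oo] --> E lam (\1_(`]a, +oo[%classic : set R)) * E lam (\1_(`]c, +oo[%classic : set R)).
 rewrite (_ : (fun k => E lam (f k)) = (fun k => E lam (fun u => ramp (k%:R * (u - a))) *
  E lam (fun u => ramp (k%:R * (u - c))))). exact: (cvgM (ray a) (ray c)).
 apply/funext => k; exact: (E_split_lip (ler0n R k) (lip01_ramp k a) (lip01_ramp k c)).
have Ei B : measurable B -> E lam (\1_B : R -> R) = fine (lam B).
 by move=> mB; rewrite /E integral_indic// setIT.
have mAC := measurableI _ _ (mpre _ a ms1) (mpre _ c ms2).
have e : E lam (\1_(usplit1 @^-1` `]a, +oo[ `&` usplit2 @^-1` `]c, +oo[) : R -> R) =
  E lam (\1_(`]a, +oo[%classic : set R)) * E lam (\1_(`]c, +oo[%classic : set R)).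
 exact: (cvg_unique _ c1 c2).
rewrite !Ei// in e.
rewrite -(fineK (fin_num_measure lam _ mAC)) e EFinM.
by rewrite (fineK (fin_num_measure lam _ (mray a))) (fineK (fin_num_measure lam _ (mray c))).
Qed.

Lemma lam_usplit1 A : measurable A -> lam (usplit1 @^-1` A) = lam A.
Proof.
move=> mA; apply/esym; apply: (@R_measure_unique R lam (distribution lam (mfun_Sub (mem_set musplit1)))) => //.
 exact: (le_lt_trans (probability_le1 lam measurableT) (ltry 1)).
move=> a; have := lam_split_rays a (-1).
rewrite (lam_ray_lt0 (ltrN10 R)) mule1 => e; apply: etrans (esym e) _; rewrite /distribution /pushforward/=; congr lam.
apply/seteqP; split => x /=; first by move=> [].
move=> h; split => //; rewrite in_itv/= andbT; have := usplit1_01 (theta x); rewrite /usplit2; lra.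
Qed.

Lemma lam_usplit2 A : measurable A -> lam (usplit2 @^-1` A) = lam A.
Proof.
move=> mA; apply/esym; apply: (@R_measure_unique R lam (distribution lam (mfun_Sub (mem_set musplit2)))) => //.
 exact: (le_lt_trans (probability_le1 lam measurableT) (ltry 1)).
move=> a; have := lam_split_rays (-1) a.
rewrite (lam_ray_lt0 (ltrN10 R)) mul1e => e; apply: etrans (esym e) _; rewrite /distribution /pushforward/=; congr lam.
apply/seteqP; split => x /=; first by move=> [].
move=> h; split => //; rewrite in_itv/= andbT; have := usplit1_01 x; lra.
Qed.

Lemma lam_split A C : measurable A -> measurable C ->
 lam (usplit1 @^-1` A `&` usplit2 @^-1` C) = (lam A * lam C)%E.
Proof.
move=> mA mC; rewrite -[in RHS](lam_usplit1 mA) -[in RHS](lam_usplit2 mC).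
have mray (b : R) : measurable (`]b, +oo[%classic : set R) by pos.
have mpre g (B : set R) : measurable B -> measurable_fun [set: R] g -> measurable (g @^-1` B).
 by move=> mB mg; rewrite -[X in measurable X]setTI; exact: mg.
have ms1 := musplit1; have ms2 := musplit2.
apply: indep_of_rays => //; first exact: mpre.
move=> c; rewrite setIC muleC; apply: indep_of_rays => //; first exact: mpre.
move=> a; rewrite setIC.
exact: etrans (lam_split_rays a c) (etrans (f_equal2 _ (esym (lam_usplit1 (mray a))) (esym (lam_usplit2 (mray c)))) (muleC _ _)).
Qed.

End unit_interval.

Section independent_pair.
Context d d1 d2 (T : measurableType d) (T1 : measurableType d1) (T2 : measurableType d2)
 (R : realType) (P : probability T R).
Variables (m1 : probability T1 R) (m2 : probability T2 R) (X : T -> T1) (Y : T -> T2).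
Hypotheses (mX : mfunT X) (mY : mfunT Y).
Hypothesis XY : forall A B, measurable A -> measurable B ->
 P (X @^-1` A `&` Y @^-1` B) = (m1 A * m2 B)%E.

Lemma pair_law C : measurable C -> P ((fun w => (X w, Y w)) @^-1` C) = prod_prob m1 m2 C.
Proof.
move=> mC; have mXY : mfunT (fun w => (X w, Y w)) by exact: mfun_pair.
have -> : P ((fun w => (X w, Y w)) @^-1` C) = distribution P (mfun_Sub (mem_set mXY)) C by [].
apply/esym; apply: (@product_measure_unique _ _ _ _ _ m1 m2) => // A B mA mB.
Qed.

Lemma E_pair (f : T1 * T2 -> R) : bmf f ->
 E P (fun w => f (X w, Y w)) = E m1 (fun x => E m2 (fun y => f (x, y))).
Proof.
move=> bf; have mXY : mfunT (fun w => (X w, Y w)) by exact: mfun_pair.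
rewrite -E_prod//; have := E_distribution P (mfun_Sub (mem_set mXY)) bf.
rewrite /comp/= => <-; rewrite /E; congr fine; apply: eq_measure_integral => C mC _.
exact: pair_law.
Qed.

End independent_pair.

(** * The quantile transform *)

Section quantile.
Context (R : realType) (mu : probability R R).

Let G (x : R) : R := fine (mu `]x, +oo[%classic).

Let mray (b : R) : measurable (`]b, +oo[%classic : set R).
Proof. exact: mitv. Qed.

Let GE x : mu `]x, +oo[%classic = (G x)%:E.
Proof. by rewrite /G fineK// fin_num_measure. Qed.

Let G_le x y : x <= y -> G y <= G x.
Proof.
move=> xy; rewrite -lee_fin -!GE; apply: le_measure; rewrite ?inE//.
by move=> z /=; rewrite !in_itv/= !andbT; exact: le_lt_trans.
Qed.

Let G1 x : G x <= 1.
Proof. by rewrite -lee_fin -GE; exact: probability_le1. Qed.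

Let G_right a u : u < G a -> exists2 y, a < y & u < G y.
Proof.
move=> ua; pose F (n : nat) := (`](a + n.+1%:R^-1), +oo[%classic : set R).
have : mu (F n) @[n --> \oo] --> mu (\bigcup_n F n).
 apply: nondecreasing_cvg_mu; [by move=> n; exact: mray|apply: bigcupT_measurable => n; exact: mray|].
 move=> n m nm; apply/subsetPset => x; rewrite /F /= !in_itv/= !andbT.
 by apply: le_lt_trans; rewrite lerD2l lef_pV2 ?posrE// ler_nat ltnS.
have -> : \bigcup_n F n = `]a, +oo[%classic. apply/seteqP; split => x /=.
  by move=> [n _]; rewrite /F /= !in_itv/= !andbT; apply: le_lt_trans; rewrite lerDl.
 rewrite in_itv/= andbT => ax; have xa : 0 < x - a by rewrite subr_gt0.
 exists (Num.trunc (x - a)^-1) => //; rewrite /F /= in_itv/= andbT -ltrBrDl.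
 by rewrite invf_plt ?posrE// truncnS_gt.
move=> c; have {}c : G (a + n.+1%:R^-1) @[n --> \oo] --> G a. by apply: fine_cvg; rewrite -GE.
move/cvgr_gt : c => /(_ _ ua)[n _ hn].
by exists (a + n.+1%:R^-1); [rewrite ltrDl|exact: (hn n (leqnn n))].
Qed.

Let G_ninfty u : u < 1 -> exists x, u < G x.
Proof.
move=> u1; pose F (n : nat) := (`](- n%:R), +oo[%classic : set R).
have : mu (F n) @[n --> \oo] --> mu (\bigcup_n F n).
 apply: nondecreasing_cvg_mu; [by move=> n; exact: mray|apply: bigcupT_measurable => n; exact: mray|].
 move=> n m nm; apply/subsetPset => x; rewrite /F /= !in_itv/= !andbT.
 by apply: le_lt_trans; rewrite lerN2 ler_nat.
have -> : \bigcup_n F n = setT. apply/seteqP; split => // x _; exists (Num.trunc `|x|).+1 => //.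
 rewrite /F /= in_itv/= andbT ltrNl; apply: le_lt_trans (truncnS_gt _).
 by rewrite (le_trans (ler_norm _))// normrN.
rewrite probability_setT => c; have {}c : G (- n%:R) @[n --> \oo] --> (1 : R). by apply: fine_cvg.
move/cvgr_gt : c => /(_ _ u1)[n _ hn].
by exists (- n%:R); exact: (hn n (leqnn n)).
Qed.

Let G_pinfty u : 0 < u -> exists x, G x < u.
Proof.
move=> u0; pose F (n : nat) := (`](n%:R : R), +oo[%classic : set R).
have : mu (F n) @[n --> \oo] --> mu (\bigcap_n F n). apply: nonincreasing_cvg_mu.
 - exact: (le_lt_trans (probability_le1 mu (mray _)) (ltry 1)).
 - by move=> n; exact: mray.
 - by apply: bigcapT_measurable => n; exact: mray.
 - move=> n m nm; apply/subsetPset => x; rewrite /F /= !in_itv/= !andbT.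
  by apply: le_lt_trans; rewrite ler_nat.
have -> : \bigcap_n F n = set0.
 apply/seteqP; split => // x /(_ (Num.trunc `|x|).+1 I); rewrite /F /= in_itv/= andbT.
 by move=> /ltW /(lt_le_trans (truncnS_gt _)) => /lt_le_trans/(_ (ler_norm x)); rewrite ltxx.
rewrite measure0 => c; have {}c : G n%:R @[n --> \oo] --> (0 : R). by apply: fine_cvg.
move/cvgr_lt : c => /(_ _ u0)[n _ hn].
by exists n%:R; exact: (hn n (leqnn n)).
Qed.

(** Generalised inverse of the survival function x -> mu ]x, oo[, hence decreasing. With strict
    inequalities, rays pull back exactly to intervals; 0 is a default value outside (0, 1), a null
    set for [lam]. *)
Definition quantile (u : R) : R :=
 if 0 < u < 1 then sup [set x | u < fine (mu `]x, +oo[%classic)] else 0.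

Lemma quantile_gt a u : 0 < u < 1 -> (a < quantile u) = (u < fine (mu `]a, +oo[%classic)).
Proof.
move=> u01; rewrite /quantile u01; have [u0 u1] := andP u01.
rewrite -/(G a); set S := [set x | u < G x].
have [x Gx] := G_pinfty u0.
have ubS : ubound S x. move=> y /= uy; rewrite leNgt; apply/negP => xy.
 by have := le_lt_trans (G_le (ltW xy)) Gx; rewrite ltNge (ltW uy).
have hS : has_sup S by split; [have [y uy] := G_ninfty u1; exists y|exists x].
apply/idP/idP => [|ua].
 move=> /(sup_gt hS.1)[y Sy ay]; apply: lt_le_trans Sy _; exact: G_le (ltW ay).
have [y ay uy] := G_right ua.
by apply: lt_le_trans ay _; apply: sup_ubound => //; exact: hS.2.
Qed.

Lemma measurable_quantile : measurable_fun [set: R] quantile.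
Proof.
apply: (measurability _ (@RGenOInfty.measurableE R)) => _ [_ [a ->] <-]; rewrite setTI.
have m01 : measurable (`]0%R, 1%R[%classic : set R) by exact: mitv.
have -> : quantile @^-1` `]a, +oo[ = (`]0%R, 1%R[%classic `&` `]-oo, G a[%classic) `|`
  ((~` `]0%R, 1%R[%classic) `&` [set u | a < 0]).
 apply/seteqP; split => u /=; rewrite !in_itv/= andbT. have [u01|/negP u01] := boolP (0 < u < 1).
   by rewrite quantile_gt//; left. by rewrite /quantile (negbTE (introN idP u01)); right.
 by move=> [[u01 ?]|[/negP/negbTE u01 ?]]; [rewrite quantile_gt|rewrite /quantile u01].
apply: measurableU; first exact: measurableI.
apply: measurableI; first exact: measurableC.
by case: (boolP (a < 0)) => h; [rewrite (_ : mkset _ = setT)//; apply/seteqP; split|rewrite (_ : mkset _ = set0)//; apply/seteqP; split => //= x].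
Qed.

Lemma lam_quantile A : measurable A -> lam (quantile @^-1` A) = mu A.
Proof.
move=> mA; apply: (@R_measure_unique R (distribution (lam (R := R)) (mfun_Sub (mem_set measurable_quantile))) mu) => //.
 exact: (le_lt_trans (probability_le1 _ measurableT) (ltry 1)).
move=> a; apply: (etrans _ (esym (GE a))); rewrite /distribution /pushforward /= /lam /mrestr.
have -> : quantile @^-1` `]a, +oo[ `&` `]0%R, 1%R[%classic = `]0%R, (G a)[%classic.
 apply/seteqP; split => u /=; rewrite !in_itv/= andbT.
  by move=> [h u01]; move: h; rewrite quantile_gt// => ->; case/andP: u01 => ->.
 move=> /andP[u0 uG]; have u01 : 0 < u < 1 by rewrite u0 (lt_le_trans uG). by rewrite quantile_gt.
rewrite /lebR lebesgue_measure_itv/= lte_fin; case: ltP => [h|h]; first by rewrite sube0.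
have : 0 <= G a by exact: fine_ge0.
by move=> h'; congr (_%:E); apply/eqP; rewrite eq_le h h'.
Qed.

End quantile.

(** * Rotation invariance and Gaussian sequences *)

Section gaussian_rotation.
Context (R : realType) (d : nat).
Variables (c s : R).
Hypotheses (s0 : 0 < s) (cs : c ^+ 2 + s ^+ 2 = 1).

(** Reversibility of the Ornstein-Uhlenbeck kernel y = c a + s z for the standard Gaussian. *)
Lemma gpdf_swap (a y : 'rV[R]_d) : gpdf (c *: a) s y * gpdf 0 1 a = gpdf (c *: y) s a * gpdf 0 1 y.
Proof.
have h1 (u v : 'rV[R]_d) : sqnorm2 (u - c *: v) = sqnorm2 u + c ^+ 2 * sqnorm2 v - 2 * c * dotp u v.
 have -> : u - c *: v = 1 *: u + (- c) *: v by rewrite scale1r scaleNr.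
 by rewrite sqnorm2_comb sqrrN; ring.
have dC : dotp y a = dotp a y by apply: eq_bigr => i _; exact: mulrC.
have p1 (u v : 'rV[R]_d) : gpdf (c *: v) s u * gpdf 0 1 v = normal_peak s ^+ d * normal_peak 1 ^+ d *
 expR (- ((sqnorm2 u + c ^+ 2 * sqnorm2 v - 2 * c * dotp u v) / (s ^+ 2 *+ 2) + sqnorm2 v / 2)).
 rewrite [gpdf (c *: v) s u]gpdfE ?gt_eqF// [gpdf 0 1 v]gpdfE ?oner_eq0// mulrACA -expRD h1 subr0.
 by congr (_ * expR _); rewrite expr1n; field; rewrite gt_eqF.
rewrite !p1 dC; congr (_ * expR (- _)).
have -> : c ^+ 2 = 1 - s ^+ 2 by rewrite -cs addrK.
by field; rewrite gt_eqF.
Qed.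

(** No change of variables in dimension 2 d is needed: pass from b to y = c a + s b, exchange a and
    y by reversibility, then pass from a to (a - c y) / s, which is the second rotated variable s a
    - c b. *)
Lemma gauss_rotation (F : 'rV[R]_d -> 'rV[R]_d -> \bar R) :
 mfunT (fun p : 'rV[R]_d * 'rV[R]_d => F p.1 p.2) -> (forall a b, 0 <= F a b)%E ->
 (\int[gauss R d]_a \int[gauss R d]_b F (c *: a + s *: b)%R (s *: a - c *: b)%R =
 \int[gauss R d]_a \int[gauss R d]_b F a b)%E.
Proof.
move=> mF F0.
have mF2 dT (T : measurableType dT) (g h : T -> 'rV[R]_d) : mfunT g ->
  mfunT h -> mfunT (fun x => F (g x) (h x)). move=> mg mh; exact: (mcompT mF (mfun_pair mg mh)).
pose H (a y : 'rV[R]_d) := (F y (s^-1 *: (a - c *: y)))%R.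
have mid : measurable_fun [set: 'rV[R]_d] (fun y : 'rV[R]_d => y) by exact: measurable_id.
have mZ dT (T : measurableType dT) (k : R) (g : T -> 'rV[R]_d) : mfunT g ->
  mfunT (fun x => k *: g x)%R by move=> mg; exact: mrVZ.
have mB dT (T : measurableType dT) (g h : T -> 'rV[R]_d) : mfunT g ->
  mfunT h -> mfunT (fun x => g x - h x)%R.
 by move=> mg mh; apply: mrVD => //; exact: measurable_rVN.
have e1 (a : 'rV[R]_d) : (\int[gauss R d]_b F (c *: a + s *: b)%R (s *: a - c *: b)%R =
  \int[lebesgue_rV R d]_y (H a y * (gpdf (c *: a) s y)%:E))%E.
 rewrite -(ge0_gauss_affine (f := H a) (c *: a) s0)//.
 - apply: eq_integral => b _; rewrite /H; congr (F _ _).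
  apply/rowP => i; rewrite !mxE; set u := a ord0 i; set v := b ord0 i.
  rewrite (_ : u - c * (c * u + s * v) = (1 - c ^+ 2) * u - s * (c * v))%R; last by ring.
  rewrite (_ : 1 - c ^+ 2 = s ^+ 2)%R; last by rewrite -cs addrC addKr. by field; rewrite gt_eqF.
 - by apply: mF2 => //; apply: (mZ); apply: mB => //; exact: mZ.
 - by move=> x; exact: F0.
have mg0 : mfunT (gpdf (0 : 'rV[R]_d) 1) by exact: mgpdf.
have g0 (u : 'rV[R]_d) t y : (0 <= gpdf u t y)%R by exact: gpdf_ge0.
have leb0 (f : 'rV[R]_d -> \bar R) : mfunT f -> (forall x, 0 <= f x)%E ->
  (\int[gauss R d]_a f a = \int[lebesgue_rV R d]_y (f y * (gpdf 0 1 y)%:E))%E.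
 move=> mf f0; rewrite -(ge0_gauss_affine 0 ltr01)//.
 by apply: eq_integral => z _; rewrite scale1r add0r.
have mgp (k : R) : mfunT (fun p : 'rV[R]_d * 'rV[R]_d => gpdf (k *: p.1) s p.2).
 rewrite (_ : (fun p : 'rV[R]_d * 'rV[R]_d => gpdf (k *: p.1) s p.2) = (fun p : 'rV[R]_d * 'rV[R]_d =>
  normal_peak s ^+ d * expR (- sqnorm2 (p.2 - k *: p.1) / (s ^+ 2 *+ 2)))%R).
  apply: mfM => //; apply: mcompT => //; apply: mfM => //.
  apply: mcompT => //; apply: msqnorm2; apply: mB; first exact: msnd. by apply: mZ; exact: mfst.
 by apply/funext => z; rewrite gpdfE// gt_eqF.
pose K (p : 'rV[R]_d * 'rV[R]_d) := (H p.1 p.2 * (gpdf (c *: p.1) s p.2 * gpdf 0 1 p.1)%:E)%E.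
have mH : mfunT (fun p : 'rV[R]_d * 'rV[R]_d => H p.1 p.2). apply: mF2; first exact: msnd.
 by apply: (mZ); apply: (mB); [exact: mfst|apply: (mZ); exact: msnd].
have mK : mfunT K. apply: emfunM => //; apply/mEFinP; apply: mfM => //.
 by apply: (mcompT mg0); exact: mfst.
have K0 p : (0 <= K p)%E by apply: mule_ge0; [exact: F0|rewrite lee_fin mulr_ge0].
transitivity (\int[lebesgue_rV R d]_a \int[lebesgue_rV R d]_y K (a, y))%E. rewrite leb0.
 - apply: eq_integral => a _; rewrite e1 muleC -ge0_integralZl//.
  + by apply: eq_integral => y _; rewrite /K /= muleCA -EFinM [(gpdf 0 1 a * _)%R]mulrC.
  + apply: emfunM; first exact: (mcompT mH (measurable_pair1 a)).
   by apply/mEFinP; exact: (mcompT (mgp c) (measurable_pair1 a)).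
  + by move=> y _; apply: mule_ge0; [exact: F0|rewrite lee_fin].
  + by rewrite lee_fin.
 - apply: (@mfubini_F _ _ _ _ R (gauss R d)
   (fun p : 'rV[R]_d * 'rV[R]_d => F (c *: p.1 + s *: p.2)%R (s *: p.1 - c *: p.2)%R)).
   apply: mF2; last by apply: (mB); apply: (mZ); [exact: mfst|exact: msnd].
   by apply: mrVD; apply: (mZ); [exact: mfst|exact: msnd]. by move=> p; exact: F0.
 - by move=> x; apply: integral_ge0 => y _; exact: F0.
rewrite (@fubini_tonelli _ _ _ _ R (lebesgue_rV R d) (lebesgue_rV R d) K)//.
rewrite leb0; last 2 first.
- apply: (@mfubini_F _ _ _ _ R (gauss R d) (fun p : 'rV[R]_d * 'rV[R]_d => F p.1 p.2)) => //.
- by move=> x; apply: integral_ge0 => y _; exact: F0.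
apply: eq_integral => y _.
transitivity (\int[lebesgue_rV R d]_a ((gpdf 0 1 y)%:E * (H a y * (gpdf (c *: y) s a)%:E)))%E.
 apply: eq_integral => a _; rewrite /K /= gpdf_swap muleCA -EFinM.
 by rewrite [(gpdf 0 1 y * _)%R]mulrC.
have mHy : mfunT (H^~ y) by exact: (mcompT mH (measurable_pair2 y)).
rewrite ge0_integralZl//.
- rewrite muleC; congr (_ * _)%E.
 rewrite -(ge0_gauss_affine (f := H^~ y) (c *: y) s0)//; last by move=> x; exact: F0.
 apply: eq_integral => z _; rewrite /H [(c *: y + _)%R]addrC addrK scalerA mulVf ?gt_eqF//.
 by rewrite scale1r.
- apply: emfunM => //; apply/mEFinP. exact: mgpdf.
- by move=> a _; apply: mule_ge0; [exact: F0|rewrite lee_fin].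
- by rewrite lee_fin.
Qed.

End gaussian_rotation.

Section gaussian_sequence.
Context (R : realType) (d : nat).

Fixpoint gmap (n : nat) (u : R) : 'rV[R]_n :=
 if n is n'.+1 then cons_rV (quantile (stdnormal R) (usplit1 u), gmap n' (usplit2 u)) else 0.

Lemma measurable_gmap n : measurable_fun [set: R] (gmap n).
Proof.
elim: n => [|n IH] /=; first exact: mcst.
apply: (mcompT (@mcons_rV R n)); apply: mfun_pair.
 exact: (mcompT (measurable_quantile _) (@musplit1 R)).
exact: (mcompT IH (@musplit2 R)).
Qed.

Lemma mpreimage dT dU (T : measurableType dT) (U : measurableType dU) (f : T -> U) A :
 mfunT f -> measurable A -> measurable (f @^-1` A).
Proof. by move=> mf mA; rewrite -[X in measurable X]setTI; exact: mf. Qed.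

Lemma lam_gmap n A : measurable A -> lam (gmap n @^-1` A) = gauss R n A.
Proof.
elim: n A => [|n IH] A mA. rewrite /= diracE; have [h|h] := boolP (0 \in A).
  have -> : gmap 0 @^-1` A = setT by apply/seteqP; split => // x _ /=; rewrite inE in h.
  exact: probability_setT. have -> : gmap 0 @^-1` A = set0.
  by apply/seteqP; split => // x /= Ax; move/negP: h; apply; rewrite inE. exact: measure0.
have mq := measurable_quantile (stdnormal R).
rewrite [RHS]/=/distribution /pushforward /=.
have mcA : measurable (@cons_rV R n @^-1` A) by apply: mpreimage => //; exact: mcons_rV.
rewrite -(@pair_law _ _ _ _ _ _ R (lam (R := R)) (stdnormal R) (gauss R n)
 (quantile (stdnormal R) \o @usplit1 R) (gmap n \o @usplit2 R))//.
- exact: (mcompT mq (@musplit1 R)).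
- exact: (mcompT (@measurable_gmap n) (@musplit2 R)).
move=> B C mB mC; have mqB := mpreimage mq mB.
have mgC := mpreimage (@measurable_gmap n) mC.
by have := lam_split mqB mgC; rewrite (lam_quantile (stdnormal R) mB) (IH _ mC).
Qed.

(** The k-th vector takes the first half of what its predecessors left. In [gseq_iid] the remainder
    [iter n usplit2] stays in the statement, uniform and independent, for later use. *)
Definition gseq (k : nat) (u : R) : 'rV[R]_d := gmap d (usplit1 (iter k (@usplit2 R) u)).

Lemma measurable_iter_usplit2 k : measurable_fun [set: R] (iter k (@usplit2 R)).
Proof.
elim: k => [|k IH]; first exact: measurable_id.
exact: (mcompT (@musplit2 R) IH).
Qed.

Lemma measurable_gseq k : measurable_fun [set: R] (gseq k).
Proof.
apply: (mcompT (@measurable_gmap d)).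
exact: (mcompT (@musplit1 R) (measurable_iter_usplit2 k)).
Qed.

Lemma gseq_iid n (A : nat -> set 'rV[R]_d) (C : set R) : (forall i, measurable (A i)) -> measurable C ->
 lam ((\bigcap_(i < n) (gseq i @^-1` A i)) `&` (iter n (@usplit2 R) @^-1` C)) =
 (\prod_(i < n) gauss R d (A i) * lam C)%E.
Proof.
move=> mA mC; elim: n A mA => [|n IH] A mA.
 by rewrite big_ord0 mul1e; congr lam; apply/seteqP; split => u //= [].
have -> : (\bigcap_(i < n.+1) (gseq i @^-1` A i)) `&` (iter n.+1 (@usplit2 R) @^-1` C) =
  (@usplit1 R @^-1` (gmap d @^-1` A 0%N)) `&` (@usplit2 R @^-1`
  ((\bigcap_(i < n) (gseq i @^-1` A i.+1)) `&` (iter n (@usplit2 R) @^-1` C))).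
 apply/seteqP; split => u /=. move=> [H Cu]; split; first exact: (H 0%N).
  split; last by rewrite -iterSr.
  by move=> i /= ni; have := H i.+1 ni; rewrite /gseq /= -iterS iterSr.
 move=> [H0 [H Cu]]; split; last by rewrite -iterS iterSr.
 by move=> [|i] /= ni; [exact: H0|have := H i ni; rewrite /gseq /= -iterS iterSr].
rewrite lam_split.
- by rewrite lam_gmap// IH// big_ord_recl muleA.
- by apply: mpreimage => //; exact: measurable_gmap.
- apply: measurableI; last by apply: mpreimage => //; exact: measurable_iter_usplit2.
 by apply: fin_bigcap_measurable => // i _; apply: mpreimage => //; exact: measurable_gseq.
Qed.

End gaussian_sequence.

Ltac mes_step k ::= first [ apply: mrVD; k tt | apply: mrVZ; k tt | apply: measurable_rVN; k tt
 | apply: msqnorm2; k tt | exact: mgpdf | exact: measurable_normal_pdf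
 | apply: (mcompT (@measurable_drift _ _ _)); k tt | apply: (mcompT (@measurable_sqrtr _)); k tt
 | apply: mpreimage; k tt | apply: (mcompT (@measurable_ramp _)); k tt ].

(** * Dyadic refinement of Gaussian increments *)

Section gaussian_sums.
Context (R : realType) (d : nat).
Implicit Types (g : 'rV[R]_d -> R) (D : set 'rV[R]_d).

Lemma measurable_lincomb (a b : R) : mfunT (fun p : 'rV[R]_d * 'rV[R]_d => a *: p.1 + b *: p.2).
Proof.
by apply: mrVD; apply: mrVZ.
Qed.

Lemma gauss_sum N g : bmf g -> (forall x, 0 <= g x) ->
 E (gauss R d) (fun z => E (gauss R d) (fun y => g (Num.sqrt N%:R *: z + y))) =
 E (gauss R d) (fun z => g (Num.sqrt N.+1%:R *: z)).
Proof.
move=> bg g0; have [mg _] := bg.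
set t := Num.sqrt N.+1%:R; have t0 : 0 < t by rewrite sqrtr_gt0 ltr0n.
have t2 : t ^+ 2 = N%:R + 1 by rewrite sqr_sqrtr// natr1.
pose c := Num.sqrt N%:R / t; pose s := t^-1.
have s0 : 0 < s by pos.
have cs : c ^+ 2 + s ^+ 2 = 1.
 by rewrite /c /s expr_div_n exprVn sqr_sqrtr// t2; field; rewrite natr1 pnatr_eq0.
have mG : mfunT (fun p : 'rV[R]_d * 'rV[R]_d => (g (t *: p.1))%:E).
 apply/mEFinP; apply: (mcompT mg); apply: mrVZ; [exact: mcst|exact: mfst].
have := @gauss_rotation R d c s s0 cs (fun a b => (g (t *: a))%:E) mG (fun a b => g0 (t *: a)).
have e1 (a b : 'rV[R]_d) : t *: (c *: a + s *: b) = Num.sqrt N%:R *: a + b.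
 rewrite scalerDr !scalerA /c /s mulfV ?gt_eqF// scale1r; congr (_ *: _ + _).
 by field; rewrite gt_eqF.
have bf : bmf (fun p : 'rV[R]_d * 'rV[R]_d => g (Num.sqrt N%:R *: p.1 + p.2)).
 have [_ [K gK]] := bg; split; last by exists K => p; exact: gK.
 apply: (mcompT mg); apply: mrVD; last mes. mes.
have bf1 (z : 'rV[R]_d) : bmf (fun y : 'rV[R]_d => g (Num.sqrt N%:R *: z + y)) by exact: (bmf_pairl bf z).
have bt : bmf (fun z : 'rV[R]_d => g (t *: z)).
 have [_ [K gK]] := bg; split; last by exists K => p; exact: gK.
 by apply: (mcompT mg); apply: (@mrVZ _ _ _ _ (fun=> t) (fun y => y)).
have bE := bmf_E2 (gauss R d) bf; rewrite /= in bE.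
move=> H; apply: EFin_inj; rewrite (EE _ bE) (EE _ bt).
transitivity (\int[gauss R d]_a \int[gauss R d]_b (g (t *: (c *: a + s *: b)))%:E)%E.
 apply: eq_integral => a _; rewrite (EE _ (bf1 a)); apply: eq_integral => b _. by rewrite e1.
rewrite H; apply: eq_integral => a _; rewrite integral_cst//.
by have := probability_setT (gauss R d) => /= ->; rewrite mule1.
Qed.

(** The rotation by 45 degrees: normalised sum and difference of two independent Gaussians are again
    independent Gaussians. This is one refinement of a Brownian increment. *)
Lemma gauss_rotation_prob D D' : measurable D -> measurable D' -> let k := (Num.sqrt 2)^-1 in
 prod_prob (gauss R d) (gauss R d)
  [set p | D (k *: (p.1 + p.2)) /\ D' (k *: (p.1 - p.2))] = (gauss R d D * gauss R d D')%E.
Proof.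
move=> mD mD' k; have k0 : 0 < k by rewrite invr_gt0 sqrtr_gt0.
have kk : k ^+ 2 + k ^+ 2 = 1 by rewrite /k exprVn sqr_sqrtr//; field.
set M := [set p | _].
have mM : measurable M.
 rewrite (_ : M = (fun p : 'rV[R]_d * 'rV[R]_d => (k *: p.1 + k *: p.2, k *: p.1 + (- k) *: p.2)) @^-1` (D `*` D')).
  apply: mpreimage; last exact: measurableX. by apply: mfun_pair; exact: measurable_lincomb.
 by apply/seteqP; split => p; rewrite /M /= scalerDr scalerBr scaleNr.
have mX : measurable (D `*` D') by exact: measurableX.
pose F (a b : 'rV[R]_d) : \bar R := (\1_(D `*` D') (a, b))%:E.
have mF : mfunT (fun p : 'rV[R]_d * 'rV[R]_d => F p.1 p.2).
 rewrite (_ : (fun p : 'rV[R]_d * 'rV[R]_d => F p.1 p.2) = EFin \o \1_(D `*` D')); last by apply/funext => -[].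
 mes.
have F0 a b : (0 <= F a b)%E by rewrite lee_fin.
have := gauss_rotation k0 kk mF F0.
rewrite -(@prod_probE _ _ _ _ R (gauss R d) (gauss R d))//.
have mI (A : set ('rV[R]_d * 'rV[R]_d)) : measurable A -> prod_prob (gauss R d) (gauss R d) A =
 (\int[gauss R d]_a \int[gauss R d]_b (\1_A (a, b))%:E)%E.
 move=> mA; rewrite -(@ge0_integral_prod_prob _ _ _ _ R (gauss R d) (gauss R d) (EFin \o \1_A)).
 - by rewrite integral_indic// setIT.
 - mes.
 - by move=> x; rewrite lee_fin.
rewrite (mI M mM) (mI _ mX) => <-.
apply: eq_integral => a _; apply: eq_integral => b _; rewrite /F; congr EFin.
have e : M (a, b) <-> (D `*` D') (k *: a + k *: b, k *: a - k *: b).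
 by rewrite /M /= scalerDr scalerBr.
rewrite !indicE; have [h|h] := pselect (M (a, b)); first by rewrite (mem_set h) (mem_set (e.1 h)).
by rewrite (memNset h) memNset// => /e.2.
Qed.

End gaussian_sums.

Section refinement.
Context (R : realType) (d : nat).
Implicit Types (A D : nat -> set 'rV[R]_d) (C : set R).

Definition level_noise (m k : nat) (u : R) : 'rV[R]_d := gseq d k (usplit1 (iter m (@usplit2 R) u)).

(** The increment over the j-th interval of length 2^-m, rescaled to unit variance. An interval is
    halved by adding or subtracting a fresh noise and dividing by sqrt 2: the construction of Levy,
    written on increments. *)
Fixpoint delta (m j : nat) (u : R) : 'rV[R]_d := if m is m'.+1 then
  (Num.sqrt 2)^-1 *: (delta m' j./2 u + (if odd j then -1 else 1) *: level_noise m j./2 u)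
 else level_noise 0 j u.

Lemma measurable_level_noise m k : measurable_fun [set: R] (level_noise m k).
Proof.
apply: (mcompT (@measurable_gseq R d k)).
exact: (mcompT (@musplit1 R) (@measurable_iter_usplit2 R m)).
Qed.

Lemma measurable_delta m j : measurable_fun [set: R] (delta m j).
Proof.
elim: m j => [|m IH] j; first exact: measurable_level_noise.
apply: mrVZ => //; apply: mrVD; first mes.
by apply: mrVZ => //; exact: measurable_level_noise.
Qed.

(** The event on the remainder states that the randomness reserved for later levels is independent
    of level [m]; the induction over levels needs it. *)
Definition delta_law m := forall n A C, (forall i, measurable (A i)) -> measurable C ->
 lam ((\bigcap_(j < n) (delta m j @^-1` A j)) `&` (iter m.+1 (@usplit2 R) @^-1` C)) =
 (\prod_(j < n) gauss R d (A j) * lam C)%E.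

Lemma measurable_bigcap_preimage n (f : nat -> R -> 'rV[R]_d) A :
 (forall j, mfunT (f j)) -> (forall i, measurable (A i)) ->
 measurable (\bigcap_(j < n) (f j @^-1` A j)).
Proof.
move=> mf mA; apply: fin_bigcap_measurable => // j _; exact: mpreimage.
Qed.

Lemma delta_noise_rect m n A (B : nat -> set 'rV[R]_d) C : delta_law m ->
 (forall i, measurable (A i)) -> (forall i, measurable (B i)) -> measurable C ->
 lam ((\bigcap_(j < n) (delta m j @^-1` A j `&` level_noise m.+1 j @^-1` B j)) `&`
  (iter m.+2 (@usplit2 R) @^-1` C)) = (\prod_(j < n) (gauss R d (A j) * gauss R d (B j)) * lam C)%E.
Proof.
move=> Hm mA mB mC.
have mgB : measurable (\bigcap_(j < n) (gseq d j @^-1` B j)).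
 by apply: measurable_bigcap_preimage => // j; exact: measurable_gseq.
pose C' := @usplit1 R @^-1` (\bigcap_(j < n) (gseq d j @^-1` B j)) `&` @usplit2 R @^-1` C.
have mC' : measurable C'.
 by apply: measurableI; apply: mpreimage => //; [exact: musplit1|exact: musplit2].
rewrite (_ : _ `&` _ = (\bigcap_(j < n) (delta m j @^-1` A j)) `&` (iter m.+1 (@usplit2 R) @^-1` C')); last first.
 apply/seteqP; split => u.
  by move=> [H Cu]; split; [move=> j jn; exact: (H j jn).1|split => // j jn; exact: (H j jn).2].
 by move=> [H1 [H2 Cu]]; split => // j jn; split; [exact: H1|exact: H2].
rewrite Hm// lam_split//.
have := gseq_iid n mB (@measurableT _ R).
rewrite preimage_setT setIT probability_setT mule1 => ->.
by rewrite big_split/= muleA.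
Qed.

Lemma delta_noise_pair m k (A B : set 'rV[R]_d) : delta_law m -> measurable A -> measurable B ->
 lam (delta m k @^-1` A `&` level_noise m.+1 k @^-1` B) = (gauss R d A * gauss R d B)%E.
Proof.
move=> Hm mA mB; pose A' j := if j == k then A else setT; pose B' j := if j == k then B else setT.
have mA' j : measurable (A' j) by rewrite /A'; case: ifP.
have mB' j : measurable (B' j) by rewrite /B'; case: ifP.
have := delta_noise_rect k.+1 Hm mA' mB' (@measurableT _ R).
rewrite preimage_setT setIT probability_setT mule1 big_ord_recr/= /A' /B' eqxx -/A' -/B'.
rewrite big1 ?mul1e; last first. by move=> i _; rewrite ltn_eqF// !probability_setT mule1.
move=> <-; congr lam; apply/seteqP; split => u; last by move=> /(_ k (leqnn _)); rewrite eqxx.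
by move=> ABu j _ /=; case: eqP => [->|].
Qed.

(** The pairs formed by an increment and its fresh noise are independent with Gaussian components,
    and each pair is rotated into its two children. *)
Lemma delta_lawS m : delta_law m -> delta_law m.+1.
Proof.
move=> Hm.
pose p k u := (delta m k u, level_noise m.+1 k u).
have mp k : measurable_fun [set: R] (p k).
 by apply: mfun_pair; [exact: measurable_delta|exact: measurable_level_noise].
have plaw k (M : set ('rV[R]_d * 'rV[R]_d)) : measurable M -> lam (p k @^-1` M) = prod_prob (gauss R d) (gauss R d) M.
 apply: pair_law; [exact: measurable_delta|exact: measurable_level_noise|].
 by move=> A B mA mB; exact: delta_noise_pair.
have indep n (M : nat -> set ('rV[R]_d * 'rV[R]_d)) C : (forall i, measurable (M i)) -> measurable C ->
  lam ((\bigcap_(j < n) (p j @^-1` M j)) `&` (iter m.+2 (@usplit2 R) @^-1` C)) =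
  (\prod_(j < n) prod_prob (gauss R d) (gauss R d) (M j) * lam C)%E. move=> mM mC.
 (* Indices below [n] stand for the pairs, generated by rectangles; index [n] stands for the
    remaining randomness. *)
 pose G (i : nat) : set (set R) := if (i < n)%N then
   [set X | exists A B : set 'rV[R]_d, [/\ measurable A, measurable B & X = p i @^-1` (A `*` B)]]
  else [set X | exists2 C', measurable C' & X = iter m.+2 (@usplit2 R) @^-1` C'].
 have lamC C' : measurable C' -> lam (iter m.+2 (@usplit2 R) @^-1` C') = lam C'.
  move=> mC'; have := delta_noise_rect 0 Hm (fun=> @measurableT _ _) (fun=> @measurableT _ _) mC'.
  rewrite big_ord0 mul1e => <-; congr lam; by apply/seteqP; split => u //= [].
 have GI i : setI_closed (G i). rewrite /G; case: ifP => _.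
   move=> _ _ [A [B [mA mB ->]]] [A' [B' [mA' mB' ->]]].
   exists (A `&` A'), (B `&` B'); split; [exact: measurableI|exact: measurableI|].
   by rewrite -preimage_setI setXI. move=> _ _ [A mA ->] [B mB ->]; exists (A `&` B); first mes.
  by rewrite preimage_setI. have GT i : G i setT. rewrite /G; case: ifP => _; last by exists setT.
  by exists setT, setT; split => //; rewrite setXTT preimage_setT.
 have Gm i : G i `<=` measurable. rewrite /G; case: ifP => _ X.
   by move=> [A [B [mA mB ->]]]; apply: mpreimage => //; exact: measurableX.
  by move=> [C' mC' ->]; apply: mpreimage => //; exact: (@measurable_iter_usplit2 R m.+2).
 have Grect (X : nat -> set R) : (forall i, G i (X i)) ->
   lam (\bigcap_(i < n.+1) X i) = (\prod_(i < n.+1) lam (X i))%E. move=> GX.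
  have /choice[AB HAB] : forall i, exists AB : set 'rV[R]_d * set 'rV[R]_d,
    [/\ measurable AB.1, measurable AB.2 & (i < n)%N -> X i = p i @^-1` (AB.1 `*` AB.2)].
   move=> i; have := GX i; rewrite /G; case: ifP => [_ [A [B [mA mB ->]]]|_ _]. by exists (A, B).
   exists (setT, setT); split; [exact: measurableT|exact: measurableT|by []].
  have [C' mC' XC] : exists2 C', measurable C' & X n = iter m.+2 (@usplit2 R) @^-1` C'.
   by have := GX n; rewrite /G ltnn. have mAB1 i : measurable (AB i).1 by case: (HAB i).
  have mAB2 i : measurable (AB i).2 by case: (HAB i).
  have XE i : (i < n)%N -> X i = delta m i @^-1` (AB i).1 `&` level_noise m.+1 i @^-1` (AB i).2.
   by move=> i_n; have [_ _ ->] := HAB i. rewrite bigcap_mkord !big_ord_recr/= XC lamC//.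
  rewrite (eq_bigr (fun i : 'I_n => delta m i @^-1` (AB i).1 `&` level_noise m.+1 i @^-1` (AB i).2)); last first.
   by move=> i _; rewrite XE.
  rewrite -(bigcap_mkord n (fun i => delta m i @^-1` (AB i).1 `&` level_noise m.+1 i @^-1` (AB i).2)).
  rewrite delta_noise_rect//; congr (_ * _)%E; apply: eq_bigr => i _.
  by rewrite XE// delta_noise_pair.
 pose X i := if (i < n)%N then p i @^-1` M i else iter m.+2 (@usplit2 R) @^-1` C.
 have sX i : <<s G i >> (X i).
  rewrite /X /G; case: ifP => _; last by apply: sub_sigma_algebra; exists C. set H := [set Y | _].
  pose T' := g_sigma_algebraType H. suff : @measurable _ T' (p i @^-1` M i) by [].
  have mf1 : measurable_fun [set: T'] (delta m i : T' -> 'rV[R]_d).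
   move=> _ Y mY; rewrite setTI; apply: sub_sigma_algebra; exists Y, setT; split => //.
   by apply/seteqP; split => u //= [].
  have mf2 : measurable_fun [set: T'] (level_noise m.+1 i : T' -> 'rV[R]_d).
   move=> _ Y mY; rewrite setTI; apply: sub_sigma_algebra; exists setT, Y; split => //.
   by apply/seteqP; split => u //= []. exact: (mpreimage (mfun_pair mf1 mf2) (mM i)).
 have := indep_g_sigma GI GT Gm Grect sX. rewrite bigcap_mkord !big_ord_recr/= /X ltnn lamC// => e.
 transitivity (lam (\big[setI/setT]_(i < n) (if (i < n)%N then p i @^-1` M i else iter m.+2 (@usplit2 R) @^-1` C) `&`
  iter m.+2 (@usplit2 R) @^-1` C)).
  by congr (lam (_ `&` _)); rewrite bigcap_mkord; apply: eq_bigr => i _; rewrite ltn_ord.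
 rewrite e; congr (_ * _)%E; apply: eq_bigr => i _; by rewrite ltn_ord plaw.
have even n A C : (forall i, measurable (A i)) -> measurable C ->
 lam ((\bigcap_(j < n.*2) (delta m.+1 j @^-1` A j)) `&` (iter m.+2 (@usplit2 R) @^-1` C)) =
 (\prod_(j < n.*2) gauss R d (A j) * lam C)%E. move=> mA mC; set k := (Num.sqrt 2)^-1 : R.
 pose M j : set ('rV[R]_d * 'rV[R]_d) := [set q | A j.*2 (k *: (q.1 + q.2)) /\ A j.*2.+1 (k *: (q.1 - q.2))].
 have mM j : measurable (M j).
  rewrite (_ : M j = (fun q : 'rV[R]_d * 'rV[R]_d => (k *: q.1 + k *: q.2, k *: q.1 + (- k) *: q.2)) @^-1` (A j.*2 `*` A j.*2.+1)).
   apply: mpreimage; last exact: measurableX. by apply: mfun_pair; exact: measurable_lincomb.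
  by apply/seteqP; split => q; rewrite /M /= scalerDr scalerBr scaleNr. have := indep n M C mM mC.
 have -> : \bigcap_(j < n) (p j @^-1` M j) = \bigcap_(j < n.*2) (delta m.+1 j @^-1` A j).
  apply/seteqP; split => u H j jn /=.
   have jn2 : (j./2 < n)%N by move: jn; rewrite /= ltn_half_double.
   have [H1 H2] := H j./2 jn2; have := odd_double_half j; case: (odd j) => /= e.
    by rewrite scaleN1r; move: H2; rewrite -[(j./2.*2).+1]add1n e.
   by rewrite add0n in e; rewrite scale1r; move: H1; rewrite e.
  have h0 := H j.*2; have h1 := H j.*2.+1; split.
   by move: (h0 ltac:(by rewrite /= ltn_double)) => /=; rewrite doubleK odd_double scale1r.
  move: (h1 ltac:(by rewrite /= -doubleS leq_double)) => /=.
  by rewrite uphalf_double odd_double /= scaleN1r. move=> ->; congr (_ * _)%E.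
 elim: n => [|n IH]; first by rewrite !big_ord0.
 by rewrite doubleS !big_ord_recr/= IH (gauss_rotation_prob (mA _) (mA _)) muleA.
move=> n A C mA mC.
(* Children come in pairs; an arbitrary number of them is padded to an even one by full sets. *)
pose A' j := if (j < n)%N then A j else setT.
have mA' j : measurable (A' j) by rewrite /A'; case: ifP.
have nn : (n <= n.*2)%N by rewrite -addnn leq_addr.
have := even n A' C mA' mC.
have -> : \bigcap_(j < n.*2) (delta m.+1 j @^-1` A' j) = \bigcap_(j < n) (delta m.+1 j @^-1` A j).
 apply/seteqP; split => u H j jn. by have := H j (leq_trans jn nn); rewrite /A' jn.
 by rewrite /A'; case: ifP => [jn'|//]; exact: H.
move=> ->; congr (_ * _)%E.
rewrite -(big_mkord xpredT (fun j => gauss R d (A' j))) (big_cat_nat (leq0n n) nn)//=.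
rewrite [X in (_ * X)%E]big_nat_cond [X in (_ * X)%E]big1 ?mule1; last first.
 by move=> j; rewrite andbT => /andP[nj _]; rewrite /A' ltnNge nj/=; exact: probability_setT.
by rewrite big_mkord; apply: eq_bigr => j _; rewrite /A' ltn_ord.
Qed.

Lemma delta_iid m n A : (forall i, measurable (A i)) ->
 lam (\bigcap_(j < n) (delta m j @^-1` A j)) = (\prod_(j < n) gauss R d (A j))%E.
Proof.
move=> mA; suff H : delta_law m.
 by have := H n A setT mA measurableT; rewrite preimage_setT setIT probability_setT mule1.
elim: m => [|m]; last exact: delta_lawS.
move=> {mA}n {}A C mA mC.
have mg : measurable (\bigcap_(j < n) (gseq d j @^-1` A j)).
 by apply: measurable_bigcap_preimage => // j; exact: measurable_gseq.
have := lam_split mg mC; rewrite /delta /level_noise /=.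
have := gseq_iid n mA (@measurableT _ R).
by rewrite preimage_setT setIT probability_setT mule1 => ->.
Qed.

End refinement.

(** * Sums of independent Gaussian vectors *)

Section iid_gaussian_sums.
Context (R : realType) (d : nat) dT (T : measurableType dT) (P : probability T R).
Variable zeta : nat -> T -> 'rV[R]_d.
Hypothesis mz : forall j, mfunT (zeta j).
Hypothesis iid : forall n A, (forall i, measurable (A i)) ->
 P (\bigcap_(j < n) (zeta j @^-1` A j)) = (\prod_(j < n) gauss R d (A j))%E.

Definition past (p : nat) : set (set T) := [set C | exists2 F : nat -> set 'rV[R]_d,
 (forall i, measurable (F i)) & C = \bigcap_(i < p) (zeta i @^-1` F i)].

Definition adapted dU (U : measurableType dU) (p : nat) (Z : T -> U) : Prop :=
 forall A, measurable A -> <<s past p >> (Z @^-1` A).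

Lemma adapted_fun dU (U : measurableType dU) p (Z : T -> U) :
 adapted p Z <-> @measurable_fun _ _ (g_sigma_algebraType (past p)) U setT Z.
Proof.
split; first by move=> aZ _ A mA; rewrite setTI; exact: aZ.
by move=> mZ A mA; have := mZ measurableT A mA; rewrite setTI.
Qed.

Lemma past_measurable p A : <<s past p >> A -> measurable A.
Proof.
apply: smallest_sub; first exact: sigma_algebra_measurable.
move=> _ [F mF ->]; apply: fin_bigcap_measurable => // i _; exact: mpreimage.
Qed.

Lemma adapted_measurable dU (U : measurableType dU) p (Z : T -> U) : adapted p Z -> mfunT Z.
Proof. by move=> aZ _ A mA; rewrite setTI; apply: (@past_measurable p); exact: aZ. Qed.

Lemma past_mono p q A : (p <= q)%N -> <<s past p >> A -> <<s past q >> A.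
Proof.
move=> pq; apply: smallest_sub; first mes.
move=> _ [F mF ->]; apply: sub_sigma_algebra.
exists (fun i => if (i < p)%N then F i else setT); first by move=> i; case: ifP.
apply/seteqP; split => w H i ip; first by rewrite /=; case: ifP => [h|//]; exact: H.
by have := H i (leq_trans ip pq); rewrite ip.
Qed.

Lemma adapted_zeta j p : (j < p)%N -> adapted p (zeta j).
Proof.
move=> jp A mA; apply: sub_sigma_algebra.
exists (fun i => if i == j then A else setT); first by move=> i; case: ifP.
apply/seteqP; split => [w Zw i _|w /(_ j jp)/=]; last by rewrite eqxx.
by rewrite /=; case: eqP => // ->.
Qed.

Lemma zeta_law j B : measurable B -> P (zeta j @^-1` B) = gauss R d B.
Proof.
move=> mB; pose F i := if i == j then B else setT.
have mF i : measurable (F i) by rewrite /F; case: ifP.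
have := iid j.+1 mF; rewrite big_ord_recr/= big1 ?mul1e; last first.
 by move=> i _; rewrite /F ltn_eqF//; exact: probability_setT.
rewrite /F eqxx => <-; congr (P _); apply/seteqP; split => w.
 by move=> Bw i _ /=; case: eqP => [->|].
by move=> /(_ j (leqnn _)); rewrite /= eqxx.
Qed.

Lemma past_indep p E' B : <<s past p >> E' -> measurable B ->
 P (E' `&` zeta p @^-1` B) = (P E' * gauss R d B)%E.
Proof.
move=> sE mB; rewrite -(zeta_law p mB) setIC muleC.
apply: (@indep_g_sigma1 _ _ _ _ _ (past p)) => //.
- mes.
- move=> _ _ [F mF ->] [F' mF' ->]; exists (fun i => F i `&` F' i). by move=> i; exact: measurableI.
 by rewrite -bigcapI.
- by exists (fun=> setT) => //; apply/seteqP; split => // w _ i _.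
- by move=> A hA; apply: (@past_measurable p); exact: sub_sigma_algebra.
move=> _ [F mF ->]; pose F' i := if i == p then B else F i.
have mF' i : measurable (F' i) by rewrite /F'; case: ifP.
have eF (i : 'I_p) : F' i = F i by rewrite /F' ltn_eqF.
have -> : zeta p @^-1` B `&` \bigcap_(i < p) (zeta i @^-1` F i) = \bigcap_(i < p.+1) (zeta i @^-1` F' i).
 rewrite !bigcap_mkord [RHS]big_ord_recr/= [F' p]/F' eqxx setIC; congr (_ `&` _).
 by apply: eq_bigr => i _; rewrite eF.
rewrite !iid// big_ord_recr/= [F' p]/F' eqxx zeta_law// muleC; congr (_ * _)%E.
by apply: eq_bigr => i _; rewrite eF.
Qed.

Definition psum p N w : 'rV[R]_d := \sum_(i < N) zeta (p + i) w.

Lemma adapted_psum p N : adapted (p + N) (psum p N).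
Proof.
apply/adapted_fun; rewrite /psum; elim: N => [|N IH].
 rewrite (_ : (fun w => _) = (fun=> 0)); first mes. by apply/funext => w; rewrite big_ord0.
rewrite (_ : (fun w => _) = (fun w => psum p N w + zeta (p + N) w)); last first.
 by apply/funext => w; rewrite big_ord_recr.
apply: mrVD. apply/adapted_fun => A mA; apply: (@past_mono (p + N)); first by rewrite addnS.
 by have /adapted_fun := IH; apply.
by apply/adapted_fun; apply: adapted_zeta; rewrite addnS.
Qed.

Lemma ramp_id (t : R) : 0 <= t <= 1 -> ramp t = t.
Proof.
by move=> /andP[t0 t1]; rewrite /ramp ger0_norm// ler0_norm; [field|lra].
Qed.

(** With a factor [Z] from the past, the induction yields at once the Gaussian law of the sum and
    its independence of the past. *)
Lemma E_psum p N (Z : T -> R) (g : 'rV[R]_d -> R) : adapted p Z -> (forall w, 0 <= Z w <= 1) ->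
 bmf g -> (forall x, 0 <= g x) ->
 E P (fun w => Z w * g (psum p N w)) = E P Z * E (gauss R d) (fun z => g (Num.sqrt N%:R *: z)).
Proof.
move=> aZ Z01; have mZ := adapted_measurable aZ; have bZ : bmf Z by exact: bmf01.
elim: N g => [|N IH] g bg g0.
 rewrite sqrtr0 (@eq_E _ _ _ (gauss R d) _ (fun=> g 0)); last by move=> z; rewrite scale0r.
 rewrite E_cst mulrC -EZ//; apply: eq_E => w. by rewrite /psum big_ord0 mulrC.
have [mg [K gK]] := bg.
have aX A B : measurable A -> measurable B -> P ((fun w => (Z w, psum p N w)) @^-1` A `&` zeta (p + N) @^-1` B) =
  (distribution P (mfun_Sub (mem_set (mfun_pair mZ (adapted_measurable (@adapted_psum p N))))) A * gauss R d B)%E.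
 move=> mA mB; rewrite /distribution /pushforward /= past_indep//.
 have aZ' : @measurable_fun _ _ (g_sigma_algebraType (past (p + N))) R setT Z.
  by apply/adapted_fun => C mC; apply: (@past_mono p); [exact: leq_addr|exact: aZ].
 have aS : @measurable_fun _ _ (g_sigma_algebraType (past (p + N))) 'rV[R]_d setT (psum p N).
  by apply/adapted_fun; exact: adapted_psum.
 by have := mfun_pair aZ' aS measurableT mA; rewrite setTI.
(* [ramp] is the identity on the values of [Z], and makes [f] bounded on the whole product space. *)
pose f (q : (R * 'rV[R]_d) * 'rV[R]_d) := ramp q.1.1 * g (q.1.2 + q.2).
have mplus : mfunT (fun q : (R * 'rV[R]_d) * 'rV[R]_d => q.1.2 + q.2). apply: mrVD; last mes. mes.
have bf : bmf f. apply: bmfM. apply: bmf01; last by move=> q; exact: ramp01.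
  apply: (mcompT (@measurable_ramp R)). exact: (mcompT mfst mfst).
 by split; [exact: (mcompT mg mplus)|exists K => q; exact: gK].
pose h (s : 'rV[R]_d) := E (gauss R d) (fun y => g (s + y)).
have bgp : bmf (fun q : 'rV[R]_d * 'rV[R]_d => g (q.1 + q.2)).
 split; last by exists K => q; exact: gK.
 apply: (mcompT mg); apply: mrVD; [exact: mfst|exact: msnd].
have bh : bmf h by exact: (bmf_E2 (gauss R d) bgp).
have bgs (s : 'rV[R]_d) : bmf (fun y : 'rV[R]_d => g (s + y)) by exact: (bmf_pairl bgp s).
have h0 s : 0 <= h s by apply: E_ge0 => y; exact: g0.
transitivity (E P (fun w => f ((Z w, psum p N w), zeta (p + N) w))).
 by apply: eq_E => w; rewrite /f /= ramp_id// /psum big_ord_recr.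
rewrite (E_pair (mfun_pair mZ (adapted_measurable (@adapted_psum p N))) (mz (p + N)) aX bf).
have bfZ : bmf (fun q : R * 'rV[R]_d => ramp q.1 * h q.2). apply: bmfM.
  apply: bmf01; last by move=> q; exact: ramp01. exact: (mcompT (@measurable_ramp R) mfst).
 have [mh [K' hK]] := bh. by split; [exact: (mcompT mh msnd)|exists K' => q; exact: hK].
rewrite (@eq_E _ _ _ _ _ (fun q : R * 'rV[R]_d => ramp q.1 * h q.2)); last first.
 by move=> q; rewrite /f /= EZ.
rewrite E_distribution//= -(gauss_sum N bg g0) -(IH h bh h0).
by apply: eq_E => w /=; rewrite ramp_id.
Qed.

Lemma E_blocks K (n : nat -> nat) (a : R) (f : nat -> 'rV[R]_d -> R) :
 (forall k, (n k <= n k.+1)%N) -> (forall k, mfunT (f k)) -> (forall k x, 0 <= f k x <= 1) ->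
 E P (fun w => \prod_(k < K) f k (a *: psum (n k) (n k.+1 - n k) w)) =
 \prod_(k < K) E (gauss R d) (fun z => f k ((a * Num.sqrt (n k.+1 - n k)%:R) *: z)).
Proof.
move=> nn mf f01; elim: K => [|K IH].
 by rewrite big_ord0 -[RHS](E_cst P); apply: eq_E => w; rewrite big_ord0.
pose Z w := \prod_(k < K) f k (a *: psum (n k) (n k.+1 - n k) w).
have Z01 w : 0 <= Z w <= 1.
 apply/andP; split; first by apply: prodr_ge0 => k _; case/andP: (f01 k (a *: psum (n k) (n k.+1 - n k) w)).
 apply: (@le_trans _ _ (\prod_(k < K) (1 : R))); last by rewrite prodr_const expr1n.
 by apply: ler_prod => k _; exact: f01.
have nmono k j : (k <= j)%N -> (n k <= n j)%N.
 by move=> /subnKC <-; elim: (j - k)%N => [|i Hi]; rewrite ?addn0// addnS (leq_trans Hi).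
have aZ : adapted (n K) Z.
 apply/adapted_fun; rewrite /Z; set T' := g_sigma_algebraType (past (n K)).
 suff mJ J : (J <= K)%N -> measurable_fun [set: T']
   (fun w => \prod_(k < J) f k (a *: psum (n k) (n k.+1 - n k) w) : R) by exact: mJ.
 elim: J => [|J IHJ] JK. rewrite (_ : (fun w => _) = (fun=> 1)); first mes.
  by apply/funext => w; rewrite big_ord0.
 rewrite (_ : (fun w => _) = (fun w => (\prod_(k < J) f k (a *: psum (n k) (n k.+1 - n k) w)) *
   f J (a *: psum (n J) (n J.+1 - n J) w))); last by apply/funext => w; rewrite big_ord_recr.
 apply: mfM; first by apply: IHJ; exact: ltnW. apply: (mcompT (mf J)); apply: mrVZ => //.
 apply/adapted_fun => A mA; apply: (@past_mono (n J + (n J.+1 - n J))).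
  by rewrite subnKC//; exact: nmono. exact: adapted_psum.
have bfa : bmf (fun x : 'rV[R]_d => f K (a *: x)). apply: bmf01; last mes.
 by apply: (mcompT (mf K)); apply: (@mrVZ _ _ _ _ (fun=> a) (fun y => y)).
have := @E_psum (n K) (n K.+1 - n K) Z (fun x : 'rV[R]_d => f K (a *: x)) aZ Z01 bfa.
rewrite big_ord_recr/= -IH => e; transitivity (E P (fun w => Z w * f K (a *: psum (n K) (n K.+1 - n K) w))).
 by apply: eq_E => w; rewrite big_ord_recr.
rewrite e; last by move=> x; case/andP: (f01 K (a *: x)).
by congr (_ * _); apply: eq_E => z; rewrite scalerA.
Qed.

End iid_gaussian_sums.

(** * Almost sure uniform convergence of the dyadic walks *)

Section dyadic_limit.
Context (R : realType) (f : nat -> R -> R) (r : R) (M : nat).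
Hypotheses (r01 : 0 < r < 1).
Hypothesis f_step : forall m t, (M <= m)%N -> t < 2 ^+ m -> `|f m.+1 t - f m t| <= r ^+ m.
Hypothesis f_flat : forall m s t, (M <= m)%N -> s < 2 ^+ m -> t < 2 ^+ m ->
 `|s - t| < 2^-1 ^+ m -> `|f m s - f m t| <= r ^+ m.

Let r0 : 0 < r. Proof. by case/andP: r01. Qed.
Let r1 : r < 1. Proof. by case/andP: r01. Qed.

Let f_tail m p t : (M <= m)%N -> t < 2 ^+ m -> `|f (m + p)%N t - f m t| <= r ^+ m / (1 - r).
Proof.
move=> Mm tm.
have r1' := r1; have r0' := r0.
suff H : `|f (m + p)%N t - f m t| <= r ^+ m / (1 - r) * (1 - r ^+ p).
 apply: (le_trans H); rewrite ler_piMr//; first pos. by rewrite gerBl exprn_ge0//; lra.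
elim: p => [|p IH]; first by rewrite addn0 subrr normr0 expr0 subrr mulr0.
rewrite addnS (_ : _ - _ = (f (m + p).+1 t - f (m + p)%N t) + (f (m + p)%N t - f m t)); last pos.
have tp : t < 2 ^+ (m + p) by apply: (lt_le_trans tm); rewrite ler_weXn2l ?leq_addr//; lra.
have h := f_step (leq_trans Mm (leq_addr p m)) tp.
apply: (le_trans (ler_normD _ _)); apply: (le_trans (lerD h IH)).
rewrite exprD exprS le_eqVlt; apply/orP; left; apply/eqP; field; lra.
Qed.

Let small (e t : R) : 0 < e -> exists m, [/\ (M <= m)%N, t + 1 < 2 ^+ m & r ^+ m / (1 - r) * 3 < e].
Proof.
move=> e0; have r1' := r1; have r0' := r0.
have c1 : r ^+ m @[m --> \oo] --> (0 : R) by apply: cvg_expr; rewrite ger0_norm//; lra.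
have e' : 0 < e * (1 - r) / 3 by pos.
move/cvgr_lt : c1 => /(_ _ e')[n _ hn].
pose k := (Num.truncn (t + 1)).+1.
exists (M + n + k)%N; split; first by rewrite -addnA leq_addr.
 apply: (lt_le_trans (truncnS_gt (t + 1))); rewrite -/k.
 rewrite -natrX ler_nat; apply: (leq_trans (leq_addl (M + n) k)); apply: ltnW; exact: ltn_expl.
have := hn (M + n + k)%N; rewrite /= => /(_ _) h.
have {}h : r ^+ (M + n + k) < e * (1 - r) / 3 by apply: h; rewrite -addnA addnCA leq_addr.
rewrite mulrAC ltr_pdivrMr; last pos.
by lra.
Qed.

Lemma dyadic_limit_cvg t : f m t @[m --> \oo] --> limn (fun m => f m t).
Proof.
apply/cauchy_cvgP/cauchy_exP => e e0.
have r1' := r1; have r0' := r0.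
have [m [Mm tm he]] := small t e0.
exists (f m t); exists m => // n /= mn.
rewrite -(subnKC mn) /ball /= distrC.
have tm' : t < 2 ^+ m by pos.
apply: (le_lt_trans (f_tail (n - m) Mm tm')); apply: le_lt_trans he.
have : 0 <= r ^+ m / (1 - r) by pos.
by lra.
Qed.

(** The approximations are step functions: at level m they are within a geometric tail of the limit
    on t < 2^m, and by [f_flat] they vary by at most r^m at distance 2^-m. *)
Lemma dyadic_limit_continuous : continuous (fun t => limn (fun m => f m t)).
Proof.
have r1' := r1; have r0' := r0.
have close m t : (M <= m)%N -> t < 2 ^+ m -> `|limn (fun m => f m t) - f m t| <= r ^+ m / (1 - r).
 move=> Mm tm. have cst : (fun _ : nat => f m t) @ \oo --> f m t by exact: cvg_cst.
 have c : `|f n t - f m t| @[n --> \oo] --> `|limn (fun m => f m t) - f m t|.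
  exact: (cvg_norm (cvgB (@dyadic_limit_cvg t) cst)).
 rewrite -(cvg_lim _ c)//; apply: limr_le; first by apply/cvg_ex; eexists; exact: c.
 by exists m => // n /= mn; rewrite -(subnKC mn); exact: f_tail.
move=> t; apply/cvgrPdist_lt => e e0.
have [m [Mm tm he]] := small t e0.
have m0 : 0 < 2^-1 ^+ m :> R by pos.
have m1 : 2^-1 ^+ m <= 1 :> R by rewrite exprn_ile1 ?invr_ge0// invf_le1//; lra.
have tm' : t < 2 ^+ m by pos.
near=> s.
have st : `|t - s| < 2^-1 ^+ m by pos.
have sm : s < 2 ^+ m by move: st; rewrite ltr_norml => /andP[? ?]; lra.
have h1 := close m t Mm tm'; have h2 := close m s Mm sm; have h3 := f_flat Mm tm' sm st.
set a := limn _ in h1 *; set b := limn _ in h2 *.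
rewrite (_ : a - b = (a - f m t) + (f m t - f m s) + (f m s - b)); last by ring.
rewrite distrC in h2.
have h4 : r ^+ m <= r ^+ m / (1 - r).
 by rewrite ler_pdivlMr; [rewrite ler_piMr ?exprn_ge0//; lra|lra].
apply: le_lt_trans he.
apply: (le_trans (ler_normD _ _)); apply: (le_trans (lerD (ler_normD _ _) (lexx _))).
by lra.
Unshelve. all: by end_near.
Qed.

End dyadic_limit.

Section dyadic_walks.
Context (R : realType) (d : nat).

Let kap : R := (Num.sqrt 2)^-1.

Let kap0 : 0 < kap. Proof. pos. Qed.
Let kap2 : kap * kap = 2^-1.
Proof. by rewrite -invfM -expr2 sqr_sqrtr. Qed.

Definition walk (m k : nat) (u : R) : 'rV[R]_d := kap ^+ m *: \sum_(j < k) delta d m j u.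

Lemma walkS m k u : walk m k.+1 u = walk m k u + kap ^+ m *: delta d m k u.
Proof. by rewrite /walk big_ord_recr/= scalerDr. Qed.

(** Refinement keeps the values at the old dyadic times, since the noises of two siblings cancel. *)
Lemma walk_double m k u : walk m.+1 k.*2 u = walk m k u.
Proof.
rewrite /walk exprS; elim: k => [|k IH]; first by rewrite !big_ord0 !scaler0.
rewrite doubleS !big_ord_recr/= !scalerDr IH -addrA; congr (_ + _).
rewrite /= odd_double doubleK uphalf_double /= -/kap -!scalerDr scalerA scale1r scaleN1r.
rewrite addrACA subrr addr0 -mulr2n -scaler_nat scalerA; congr (_ *: _).
rewrite (_ : kap * kap ^+ m * kap * 2%:R = (kap * kap) * kap ^+ m * 2); last pos.
by rewrite kap2; field.
Qed.

Definition dyadic_bm (m : nat) (t : R) (u : R) : 'rV[R]_d := walk m (Num.truncn (2 ^+ m * t)) u.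

Let truncn_double (x : R) : exists b : bool, Num.truncn (2 * x) = (b + (Num.truncn x).*2)%N.
Proof.
have [x0|x0] := leP 0 x; last first.
 by exists false; rewrite !(truncn0Pn _ _)//; rewrite -ltNge; lra.
have /andP[l1 l2] := truncn_itv x0.
have [h|h] := leP ((Num.truncn x).*2.+1%:R) (2 * x).
 exists true; apply: truncn_def; rewrite h /= -doubleS -muln2 natrM.
 by move: l2; rewrite mulrC; lra.
exists false; apply: truncn_def; rewrite h andbT add0n -muln2 natrM; lra.
Qed.

(** The threshold 2^(m/2) for the squared rescaled increment grows fast enough for Borel-Cantelli,
    while the increment itself, at most 2^(-m/2) 2^(m/4) = 2^(-m/4) = r^m, still decays
    geometrically. The 4^m increments of level m cover the times below 2^m. *)
Let bad1 m k : set R := [set u | Num.sqrt 2 ^+ m < sqnorm2 (delta d m k u)].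

Let bad (m : nat) : set R := \big[setU/set0]_(k < 4 ^ m) bad1 m k.

Let r : R := Num.sqrt kap.
Let r01 : 0 < r < 1.
Proof.
rewrite sqrtr_gt0 kap0 /= -sqrtr1 ltr_sqrt//.
by rewrite invf_lt1 ?sqrtr_gt0// -[ltLHS]sqrtr1 ltr_sqrt//; lra.
Qed.

Let coord_le (v : 'rV[R]_d) i : v ord0 i ^+ 2 <= sqnorm2 v.
Proof. by rewrite /sqnorm2 (bigD1 i)//= lerDl sumr_ge0// => j _; exact: sqr_ge0. Qed.

Let delta_small m k u i : ~ bad m u -> (k < 4 ^ m)%N -> `|(kap ^+ m *: delta d m k u) ord0 i| <= r ^+ m.
Proof.
move=> nb km.
have h : sqnorm2 (delta d m k u) <= Num.sqrt 2 ^+ m.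
 rewrite leNgt; apply/negP => h; apply: nb; rewrite /bad -(bigcup_mkord (4 ^ m) (bad1 m)); exists k => //.
have /andP[r0 _] := r01.
have rm0 : 0 <= r ^+ m by pos.
rewrite -(ler_pXn2r (n := 2)) ?nnegrE ?normr_ge0//.
rewrite -normrX ger0_norm ?sqr_ge0// mxE exprMn -[leRHS]exprM mulnC [leRHS]exprM sqr_sqrtr; last pos.
have k0 : 0 < kap ^+ m by pos.
rewrite -[leRHS]mulr1 [_ ^+ m ^+ 2]expr2 -mulrA ler_pM2l//.
apply: (@le_trans _ _ (kap ^+ m * Num.sqrt 2 ^+ m)).
 by rewrite ler_pM2l//; apply: le_trans h; exact: coord_le.
by rewrite -exprMn mulVf ?expr1n// gt_eqF// sqrtr_gt0.
Qed.

Lemma dyadic_bm_step m t u i : ~ bad m.+1 u -> t < 2 ^+ m ->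
 `|dyadic_bm m.+1 t u ord0 i - dyadic_bm m t u ord0 i| <= r ^+ m.
Proof.
move=> nb tm; have /andP[r0 r1] := r01; rewrite /dyadic_bm exprS -mulrA.
have [b ->] := truncn_double (2 ^+ m * t); set k := Num.truncn _.
case: b; last by rewrite walk_double subrr normr0 exprn_ge0// ltW.
have -> : walk m.+1 (true + k.*2) u = walk m k u + kap ^+ m.+1 *: delta d m.+1 k.*2 u.
 by rewrite -(walk_double m k u) -walkS.
rewrite mxE addrAC subrr add0r; apply: (@le_trans _ _ (r ^+ m.+1)); last first.
 by rewrite exprS ler_piMl ?exprn_ge0// ltW.
apply: delta_small => //; rewrite -muln2 expnS -[4%N]/(2 * 2)%N -mulnA mulnC ltn_pmul2l//.
apply: (@leq_trans (4 ^ m)); last by rewrite leq_pmull.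
rewrite -(ltr_nat R) natrX; have [t0|t0] := leP 0 t; last first.
 rewrite /k (truncn0Pn _ _) ?exprn_gt0//; rewrite -ltNge.
 by apply: (@lt_trans _ _ 0) => //; rewrite pmulr_rlt0.
have p0 : 0 <= 2 ^+ m * t by pos.
have /andP[l1 l2] := truncn_itv p0; apply: (le_lt_trans l1).
by rewrite (_ : 4%:R = 2 * 2 :> R) ?exprMn ?ltr_pM2l//; ring.
Qed.

Let truncn_close (x y : R) : `|x - y| < 1 -> (Num.truncn x <= (Num.truncn y).+1)%N.
Proof.
rewrite ltr_norml => /andP[h1 h2]; rewrite truncn_le_nat.
by have := truncnS_gt y; rewrite -[(Num.truncn y).+2%:R]natr1; lra.
Qed.

Lemma dyadic_bm_flat m s t u i : ~ bad m u -> s < 2 ^+ m -> t < 2 ^+ m -> `|s - t| < 2^-1 ^+ m ->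
 `|dyadic_bm m s u ord0 i - dyadic_bm m t u ord0 i| <= r ^+ m.
Proof.
move=> nb; have /andP[r0 r1] := r01.
wlog st : s t / (Num.truncn (2 ^+ m * s) <= Num.truncn (2 ^+ m * t))%N.
 move=> H sm tm st; case: (leqP (Num.truncn (2 ^+ m * s)) (Num.truncn (2 ^+ m * t))) => h.
  exact: H. by rewrite distrC; apply: H => //; [exact: ltnW|rewrite distrC].
move=> sm tm d1.
have d2 : `|2 ^+ m * t - 2 ^+ m * s| < 1.
 rewrite -mulrBr normrM gtr0_norm// distrC -(@ltr_pM2l _ (2^-1 ^+ m)) ?exprn_gt0 ?invr_gt0//.
 by rewrite mulr1 mulrA -exprMn mulVf// expr1n mul1r.
have := truncn_close d2; rewrite /dyadic_bm leq_eqVlt => /orP[/eqP->|]; last first.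
 rewrite ltnS => h; have -> : Num.truncn (2 ^+ m * t) = Num.truncn (2 ^+ m * s).
  by apply/eqP; rewrite eqn_leq st h. by rewrite subrr normr0 exprn_ge0// ltW.
set k := Num.truncn _; rewrite walkS [in X in _ - X]mxE opprD addrA subrr add0r normrN.
apply: delta_small => //.
rewrite -(ltr_nat R) natrX; have [s0|s0] := leP 0 s; last first.
 rewrite /k (truncn0Pn _ _) ?exprn_gt0//; rewrite -ltNge.
 by apply: (@lt_trans _ _ 0) => //; rewrite pmulr_rlt0.
have p0 : 0 <= 2 ^+ m * s by pos.
have /andP[l1 l2] := truncn_itv p0; apply: (le_lt_trans l1).
by rewrite (_ : 4%:R = 2 * 2 :> R) ?exprMn ?ltr_pM2l//; ring.
Qed.

Let mbad m : measurable (bad m).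
Proof.
rewrite /bad; apply: bigsetU_measurable => k _.
rewrite (_ : bad1 m k = (fun u => sqnorm2 (delta d m k u)) @^-1` `]Num.sqrt 2 ^+ m, +oo[%classic); last first.
 by apply/seteqP; split => u /=; rewrite in_itv/= andbT.
apply: mpreimage; last mes.
apply: msqnorm2; exact: measurable_delta.
Qed.

Let lam_delta m k A : measurable A -> lam (delta d m k @^-1` A) = gauss R d A.
Proof. by move=> mA; apply: (zeta_law (@delta_iid R d m)). Qed.

Let Kd : R := (normal_peak 1 / normal_peak (Num.sqrt 2)) ^+ d.

(** Markov with the exponential moment, keeping only the sixth power: for a = 2^(m/2) it gives a^-6
    = 8^-m, which beats the 4^m events of a level. *)
Lemma gauss_tail (a : R) : 0 < a ->
 (gauss R d [set z | (a < sqnorm2 z)%R] <= (Kd * (6`!%:R / (a / 4) ^+ 6))%:E)%E.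
Proof.
move=> a0; have a4 : 0 < a / 4 by rewrite divr_gt0.
set A := [set z | _].
have mA : measurable A. rewrite (_ : A = (fun z => sqnorm2 z) @^-1` `]a, +oo[%classic); last first.
  by apply/seteqP; split => u /=; rewrite in_itv/= andbT.
 by apply: mpreimage; [apply: msqnorm2; exact: measurable_id|exact: mitv].
pose c : R := (a / 4) ^+ 6 / 6`!%:R.
have c0 : 0 < c by rewrite divr_gt0 ?exprn_gt0// ltr0n fact_gt0.
have -> : Kd * (6`!%:R / (a / 4) ^+ 6) = c^-1 * Kd by rewrite /c invf_div mulrC.
rewrite EFinM lee_pdivlMl//.
rewrite -gauss_exp_moment -(setIT A) -integral_indic// -ge0_integralZl//; last 2 first.
- mes.
- pos.
apply: ge0_le_integral => //.
- by move=> x _; rewrite lee_fin mulr_ge0// ltW.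
- by apply/mEFinP; apply: mfM.
- apply/mEFinP; apply: (mcompT (@measurable_expR R)).
 by apply: mfM; [apply: msqnorm2; exact: measurable_id|exact: mcst].
move=> z _; rewrite -EFinM lee_fin indicE; case: (boolP (z \in A)) => [/set_mem zA|_]; last first.
 by rewrite mulr0 expR_ge0.
rewrite mulr1; have h := expR_ge1Dxn 5 (ltW a4).
apply: (@le_trans _ _ (expR (a / 4))); first by apply: le_trans h; rewrite /c lerDr.
by rewrite ler_expR ler_pM2r//; exact: ltW.
Qed.

Let lam_bad m : (lam (bad m) <= (Kd * 6`!%:R * 4 ^+ 6 * 2^-1 ^+ m)%:E)%E.
Proof.
have Kd0 : 0 <= Kd by rewrite exprn_ge0// divr_ge0// normal_peak_ge0.
pose a : R := Num.sqrt 2 ^+ m.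
have a0 : 0 < a by pos.
have mb1 k : measurable (bad1 m k).
 rewrite (_ : bad1 m k = delta d m k @^-1` [set z | a < sqnorm2 z]) //.
 apply: mpreimage; first exact: measurable_delta.
 rewrite (_ : [set z | _] = (fun z => sqnorm2 z) @^-1` `]a, +oo[%classic); last first.
  by apply/seteqP; split => u /=; rewrite in_itv/= andbT.
 by apply: mpreimage; [apply: msqnorm2; exact: measurable_id|exact: mitv].
have le1 k : (lam (bad1 m k) <= (Kd * (6`!%:R / (a / 4) ^+ 6))%:E)%E.
 rewrite (_ : bad1 m k = delta d m k @^-1` [set z | a < sqnorm2 z])// lam_delta; first exact: gauss_tail.
 rewrite (_ : [set z | _] = (fun z => sqnorm2 z) @^-1` `]a, +oo[%classic); last first.
  by apply/seteqP; split => u /=; rewrite in_itv/= andbT.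
 by apply: mpreimage; [apply: msqnorm2; exact: measurable_id|exact: mitv].
have h : (lam (bad m) <= \sum_(k < 4 ^ m) lam (bad1 m k))%E.
 by apply: content_subadditive => // k _; exact: mb1.
apply: (le_trans h).
apply: (@le_trans _ _ (\sum_(k < 4 ^ m) (Kd * (6`!%:R / (a / 4) ^+ 6))%:E)%E).
 by apply: lee_sum => k _; exact: le1.
rewrite sumEFin lee_fin sumr_const card_ord -[leLHS]mulr_natl natrX.
have a6 : a ^+ 6 = (2 * 2 * 2) ^+ m. rewrite /a -exprM mulnC exprM; congr (_ ^+ m).
 by rewrite (_ : 6%N = (2 * 3)%N)// exprM sqr_sqrtr//; ring.
rewrite expr_div_n a6 le_eqVlt; apply/orP; left; apply/eqP.
rewrite invf_div (_ : 4%:R = 2 * 2 :> R); last pos.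
rewrite !exprMn exprVn; field; rewrite expf_neq0//.
Qed.

Definition bm_good : set R := ~` lim_sup_set bad.

Let mlim_sup : measurable (lim_sup_set bad).
Proof.
rewrite /lim_sup_set; apply: bigcapT_measurable => n.
by apply: bigcup_measurable => k _; exact: mbad.
Qed.

Lemma measurable_bm_good : measurable bm_good.
Proof. exact: measurableC. Qed.

Lemma bm_good_ae : {ae (@lam R), forall u, bm_good u}.
Proof.
exists (lim_sup_set bad); split; [exact: mlim_sup| |by rewrite /bm_good setCK].
apply: lim_sup_set_cvg0 => //.
pose K : R := Kd * 6`!%:R * 4 ^+ 6.
apply: (@le_lt_trans _ _ (\sum_(0 <= n <oo) (geometric K 2^-1 n)%:E)%E).
 by apply: lee_nneseries => // m _ ; exact: lam_bad.
have h : `|2^-1| < 1 :> R by rewrite ger0_norm ?invr_ge0// invf_lt1//; lra.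
have c := @cvg_geometric_series _ K _ h.
have e : (\sum_(0 <= n < k) (geometric K 2^-1 n)%:E)%E @[k --> \oo] --> (K * (1 - 2^-1)^-1)%:E.
 under eq_fun do rewrite sumEFin. by apply: cvg_EFin; [exact: nearW|exact: c].
by rewrite (cvg_lim _ e)// ltry.
Qed.

Lemma dyadic_bm_cvg u : bm_good u -> forall i,
 (forall t, dyadic_bm m t u ord0 i @[m --> \oo] --> limn (fun m => dyadic_bm m t u ord0 i)) /\
 continuous (fun t => limn (fun m => dyadic_bm m t u ord0 i)).
Proof.
move=> gu i.
have [M hM] : exists M, forall m, (M <= m)%N -> ~ bad m u.
 apply/not_existsP => h; apply: gu => n _; have /existsNP[m] := h n.
 by move=> /not_implyP[nm /contrapT bm]; exists m.
have st m t : (M <= m)%N -> t < 2 ^+ m -> `|dyadic_bm m.+1 t u ord0 i - dyadic_bm m t u ord0 i| <= r ^+ m.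
 by move=> Mm tm; apply: dyadic_bm_step => //; apply: hM; exact: leqW.
have fl m s t : (M <= m)%N -> s < 2 ^+ m -> t < 2 ^+ m -> `|s - t| < 2^-1 ^+ m ->
  `|dyadic_bm m s u ord0 i - dyadic_bm m t u ord0 i| <= r ^+ m.
 by move=> Mm sm tm st'; apply: dyadic_bm_flat => //; exact: hM.
split; first by move=> t; exact: (dyadic_limit_cvg r01 st).
exact: (dyadic_limit_continuous r01 st fl).
Qed.

(** The indicator sets the path to 0 on the exceptional null set, so that every path is
    continuous. *)
Definition bm (t u : R) : 'rV[R]_d := \row_i limn (fun m => (\1_bm_good u * dyadic_bm m t u ord0 i : R)).

Lemma bm_cvg t u i : \1_bm_good u * dyadic_bm m t u ord0 i @[m --> \oo] --> bm t u ord0 i.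
Proof.
rewrite mxE indicE; case: (boolP (u \in bm_good)) => [/set_mem gu|_] /=.
 under eq_fun do rewrite mul1r. by have [h _] := dyadic_bm_cvg gu i; exact: h.
under eq_fun do rewrite mul0r.
by rewrite lim_cst//; exact: cvg_cst.
Qed.

Lemma bm_good_cvg t u i : bm_good u -> dyadic_bm m t u ord0 i @[m --> \oo] --> bm t u ord0 i.
Proof.
move=> gu; have := @bm_cvg t u i; rewrite indicE mem_set//=.
by under eq_fun do rewrite mul1r.
Qed.

Lemma bm_continuous u i : continuous (fun t => bm t u ord0 i).
Proof.
case: (pselect (bm_good u)) => gu. have [_ h] := dyadic_bm_cvg gu i.
 rewrite (_ : (fun t => _) = fun t => limn (fun m => dyadic_bm m t u ord0 i))//.
 by apply/funext => t; apply/esym/cvg_lim => //; exact: bm_good_cvg.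
rewrite (_ : (fun t => _) = fun=> 0); first by move=> t; exact: cvg_cst.
apply/funext => t; have := @bm_cvg t u i; rewrite indicE memNset//=.
under eq_fun do rewrite mul0r.
by move=> /cvg_lim <- //; rewrite lim_cst.
Qed.

Lemma bm0 u : bm 0 u = 0.
Proof.
apply/rowP => i; rewrite [RHS]mxE; have := @bm_cvg 0 u i.
have e m : \1_bm_good u * dyadic_bm m 0 u ord0 i = 0 :> R.
 by rewrite /dyadic_bm mulr0 truncn0 /walk big_ord0 scaler0 mxE mulr0.
under eq_fun do rewrite e.
by move=> /cvg_lim <- //; rewrite lim_cst.
Qed.

Lemma measurable_walk m k : measurable_fun [set: R] (walk m k).
Proof.
elim: k => [|k IH]. rewrite (_ : walk m 0 = fun=> 0); first mes.
 by apply/funext => u; rewrite /walk big_ord0 scaler0.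
rewrite (_ : walk m k.+1 = fun u => walk m k u + kap ^+ m *: delta d m k u); last first.
 by apply/funext => u; rewrite walkS.
by apply: mrVD => //; apply: mrVZ => //; exact: measurable_delta.
Qed.

Lemma measurable_bm t : measurable_fun [set: R] (bm t).
Proof.
apply: measurable_fun_rV => i.
apply: (@measurable_fun_cvg _ _ _ _ (fun m u => \1_bm_good u * dyadic_bm m t u ord0 i : R)) => //.
- move=> m; apply: mfM; first by apply: mindic; exact: measurable_bm_good.
 exact: (mcompT (mcoord_rV i) (measurable_walk m _)).
- by move=> u _; exact: bm_cvg.
Qed.

End dyadic_walks.

Lemma cvg_ord_prod (R : realType) K (a : nat -> nat -> R) (b : nat -> R) :
 (forall k, a m k @[m --> \oo] --> b k) -> \prod_(k < K) a m k @[m --> \oo] --> \prod_(k < K) b k.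
Proof.
move=> ab; elim: K => [|K IH].
 by rewrite big_ord0; under eq_fun do rewrite big_ord0; exact: cvg_cst.
rewrite big_ord_recr/=; under eq_fun do rewrite big_ord_recr/=.
exact: (cvgM IH (ab K)).
Qed.

Lemma dist_prod_le (R : realType) K (a b : nat -> R) : (forall k, 0 <= a k <= 1) ->
 (forall k, 0 <= b k <= 1) -> `|\prod_(k < K) a k - \prod_(k < K) b k| <= \sum_(k < K) `|a k - b k|.
Proof.
move=> a01 b01; elim: K => [|K IH]; first by rewrite !big_ord0 subrr normr0.
rewrite !big_ord_recr/=; set x := \prod_(k < K) a k in IH *; set y := \prod_(k < K) b k in IH *.
have y01 : 0 <= y <= 1. apply/andP; split; first by apply: prodr_ge0 => k _; case/andP: (b01 k).
 apply: (@le_trans _ _ (\prod_(k < K) (1 : R))); last by rewrite prodr_const expr1n.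
 by apply: ler_prod => k _; exact: b01.
rewrite (_ : _ - _ = (x - y) * a K + y * (a K - b K)); last pos.
apply: (le_trans (ler_normD _ _)); rewrite !normrM; apply: lerD.
 apply: le_trans IH; rewrite ler_piMr//. by have /andP[h1 h2] := a01 K; rewrite ger0_norm.
by rewrite ler_piMl//; have /andP[h1 h2] := y01; rewrite ger0_norm.
Qed.

Lemma measurable_rVB dT (T : measurableType dT) (R : realType) d (f g : T -> 'rV[R]_d) :
 mfunT f -> mfunT g -> mfunT (fun x => f x - g x).
Proof.
mes.
Qed.

(** * The law of Brownian increments, and Brownian motion *)

Section brownian_increments.
Context (R : realType) (d : nat).

Lemma walk_increment m k k' u : (k <= k')%N ->
 walk d m k' u - walk d m k u = (Num.sqrt 2)^-1 ^+ m *: psum (delta d m) k (k' - k) u :> 'rV[R]_d.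
Proof.
move=> /subnKC <-; rewrite addKn; elim: (k' - k)%N => [|i IH].
 by rewrite addn0 subrr /psum big_ord0 scaler0.
by rewrite addnS walkS addrAC IH /psum big_ord_recr/= scalerDr.
Qed.

Section times.
Variable t : nat -> R.
Hypotheses (t0 : 0 <= t 0%N) (tt : forall k, t k <= t k.+1).

Let tge0 k : 0 <= t k.
Proof. by elim: k => // k IH; exact: le_trans IH (tt k). Qed.

Let n m k := Num.truncn (2 ^+ m * t k).

Let n_mono m k : (n m k <= n m k.+1)%N.
Proof. by apply: le_truncn; rewrite ler_pM2l ?exprn_gt0. Qed.

Let n_cvg k : (Num.sqrt 2)^-1 ^+ m * Num.sqrt (n m k.+1 - n m k)%:R @[m --> \oo] --> Num.sqrt (t k.+1 - t k).
Proof.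
have e m : (Num.sqrt 2)^-1 ^+ m * Num.sqrt (n m k.+1 - n m k)%:R =
  Num.sqrt (2^-1 ^+ m * (n m k.+1)%:R - 2^-1 ^+ m * (n m k)%:R) :> R.
 rewrite natrB// -mulrBr sqrtrM ?exprn_ge0 ?invr_ge0//; congr (_ * _).
 elim: m => [|m IH]; first by rewrite !expr0 sqrtr1. by rewrite !exprS IH sqrtrM ?invr_ge0// sqrtrV.
under eq_fun do rewrite e.
have c j : 2^-1 ^+ m * (n m j)%:R @[m --> \oo] --> t j.
 have c1 : t j - 2^-1 ^+ m @[m --> \oo] --> t j.
  rewrite -[X in _ --> X]subr0; apply: cvgB; first exact: cvg_cst.
  by apply: cvg_expr; rewrite ger0_norm ?invr_ge0// invf_lt1//; lra.
 have c2 : (fun _ : nat => t j) @ \oo --> t j by exact: cvg_cst.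
 apply: (squeeze_cvgr _ c1 c2); apply: nearW => m. have p2 : 0 < 2 ^+ m :> R by pos.
 have /andP[l1 l2] := truncn_itv (mulr_ge0 (ltW p2) (tge0 j)).
 rewrite exprVn mulrC ler_pdivrMr// [t j * _]mulrC l1 andbT -/(n m j).
 rewrite ler_pdivlMr// mulrBl mulVf ?gt_eqF// [t j * _]mulrC lerBlDr.
 by apply: ltW; move: l2; rewrite -/(n m j) -[(n m j).+1%:R]natr1.
have cc : 2^-1 ^+ m * (n m k.+1)%:R - 2^-1 ^+ m * (n m k)%:R @[m --> \oo] --> t k.+1 - t k.
 exact: (cvgB (c k.+1) (c k)).
exact: (cvg_comp _ _ cc (@sqrt_continuous R _)).
Qed.

Lemma measurable_bm_increment a b : measurable_fun [set: R] (fun u => bm d a u - bm d b u).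
Proof. by apply: measurable_rVB; exact: measurable_bm. Qed.

(** At level m the increments are block sums of independent Gaussians, with variances tending to the
    t(k+1) - t(k); continuous test functions let both sides converge. *)
Lemma E_bm_cont K (f : nat -> 'rV[R]_d -> R) : (forall k, cont01 (f k)) ->
 E (@lam R) (fun u => \prod_(k < K) f k (bm d (t k.+1) u - bm d (t k) u)) =
 \prod_(k < K) E (gauss R d) (fun z => f k (Num.sqrt (t k.+1 - t k) *: z)).
Proof.
move=> cf; have mf k : mfunT (f k) by have [] := cf k.
have f01 k x : 0 <= f k x <= 1 by have [] := cf k.
have prod01 (x : nat -> 'rV[R]_d) : `|\prod_(k < K) f k (x k)| <= 1.
 rewrite ger0_norm; last by apply: prodr_ge0 => k _; case/andP: (f01 k (x k)).
 apply: (@le_trans _ _ (\prod_(k < K) (1 : R))); last by rewrite prodr_const expr1n.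
 by apply: ler_prod => k _; exact: f01.
pose L m := E (@lam R) (fun u => \prod_(k < K) f k (dyadic_bm d m (t k.+1) u - dyadic_bm d m (t k) u)).
have Lr : L @ \oo --> \prod_(k < K) E (gauss R d) (fun z => f k (Num.sqrt (t k.+1 - t k) *: z)).
 have e m : L m = \prod_(k < K) E (gauss R d) (fun z => f k (((Num.sqrt 2)^-1 ^+ m * Num.sqrt (n m k.+1 - n m k)%:R) *: z)).
  rewrite -(E_blocks (@measurable_delta R d m) (@delta_iid R d m) _ _ (n_mono m) mf f01).
  by apply: eq_E => u; apply: eq_bigr => k _; rewrite /dyadic_bm walk_increment// n_mono.
 rewrite (funext e : L = _).
 apply: (@cvg_ord_prod _ K (fun m k => E (gauss R d) (fun z => f k (((Num.sqrt 2)^-1 ^+ m * Num.sqrt (n m k.+1 - n m k)%:R) *: z)))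
  (fun k => E (gauss R d) (fun z => f k (Num.sqrt (t k.+1 - t k) *: z)))) => k.
 apply: (@E_cvg _ _ _ _ _ _ 1).
 - by move=> m; apply: (mcompT (mf k)); apply: (@mrVZ _ _ _ _ (fun=> _) (fun y => y)).
 - by apply: (mcompT (mf k)); apply: (@mrVZ _ _ _ _ (fun=> _) (fun y => y)).
 - by move=> m x; have /andP[h1 h2] := f01 k (((Num.sqrt 2)^-1 ^+ m * Num.sqrt (n m k.+1 - n m k)%:R) *: x); rewrite ger0_norm.
 - move=> z; have [_ ck _] := cf k.
  have c : ((Num.sqrt 2)^-1 ^+ m * Num.sqrt (n m k.+1 - n m k)%:R) *: z @[m --> \oo] --> Num.sqrt (t k.+1 - t k) *: z.
   apply: rV_cvg => i; rewrite mxE; under eq_fun do rewrite mxE.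
   have cz : (fun _ : nat => z ord0 i) @ \oo --> z ord0 i by exact: cvg_cst.
   exact: (cvgM (@n_cvg k) cz). exact: (cvg_comp _ _ c (ck _)).
have Ll : L @ \oo --> E (@lam R) (fun u => \prod_(k < K) f k (bm d (t k.+1) u - bm d (t k) u)).
 apply: (@E_ae_cvg _ _ _ _ _ _ 1).
 - move=> m; apply: measurable_prod => k _; apply: (mcompT (mf k)).
  by apply: measurable_rVB; exact: measurable_walk.
 - apply: measurable_prod => k _; apply: (mcompT (mf k)). exact: measurable_bm_increment.
 - by move=> m u; exact: (prod01 (fun k => dyadic_bm d m (t k.+1) u - dyadic_bm d m (t k) u)).
 - apply: filterS (@bm_good_ae R d) => u gu.
  apply: (@cvg_ord_prod _ K (fun m k => f k (dyadic_bm d m (t k.+1) u - dyadic_bm d m (t k) u))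
   (fun k => f k (bm d (t k.+1) u - bm d (t k) u))) => k. have [_ ck _] := cf k.
  have c : dyadic_bm d m (t k.+1) u - dyadic_bm d m (t k) u @[m --> \oo] --> bm d (t k.+1) u - bm d (t k) u.
   apply: rV_cvg => i.
   have subE (v w : 'rV[R]_d) : (v - w) ord0 i = v ord0 i - w ord0 i by rewrite !mxE.
   rewrite subE; under eq_fun do rewrite subE.
   have c a : dyadic_bm d m a u ord0 i @[m --> \oo] --> bm d a u ord0 i by exact: bm_good_cvg.
   exact: (cvgB (c (t k.+1)) (c (t k))). exact: (cvg_comp _ _ c (ck _)).
exact: (cvg_unique _ Ll Lr).
Qed.

Let incr k : {mfun R >-> 'rV[R]_d} := mfun_Sub (mem_set (measurable_bm_increment (t k.+1) (t k))).
Let measurable_scaling (c : R) : measurable_fun [set: 'rV[R]_d] (fun z : 'rV[R]_d => c *: z).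
Proof. mes. Qed.
Let scaling (c : R) : {mfun 'rV[R]_d >-> 'rV[R]_d} := mfun_Sub (mem_set (measurable_scaling c)).

(** Measurable factors are replaced by continuous ones, each close to it under the law of the
    increment and under the candidate Gaussian law; errors of products are at most the sums of the
    errors of the factors. *)
Lemma E_bm K (g : nat -> 'rV[R]_d -> R) : (forall k, mfunT (g k)) ->
 (forall k x, 0 <= g k x <= 1) ->
 E (@lam R) (fun u => \prod_(k < K) g k (bm d (t k.+1) u - bm d (t k) u)) =
 \prod_(k < K) E (gauss R d) (fun z => g k (Num.sqrt (t k.+1 - t k) *: z)).
Proof.
move=> mg g01.
have bg k : bmf (g k) by exact: bmf01.
apply/eqP; rewrite -subr_eq0 -normr_le0; apply/ler_addgt0Pr => e e0; rewrite add0r.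
pose e' := e / (2 * K.+1%:R).
have K0 : 0 < K.+1%:R :> R by pos.
have e'0 : 0 < e' by pos.
pose sg k := Num.sqrt (t k.+1 - t k).
have /choice[f cf] : forall k, exists f, cont01 f /\
  close1 (distribution (@lam R) (incr k)) (distribution (gauss R d) (scaling (sg k))) e' (g k) f.
 move=> k; have [f cf cl] := @approximable_fun R d (distribution (@lam R) (incr k))
  (distribution (gauss R d) (scaling (sg k))) (g k) (mg k) (g01 k) e' e'0. by exists f.
have f01 k x : 0 <= f k x <= 1 by have [[]] := cf k.
have mf k : mfunT (f k) by have [[]] := cf k.
have bf k : bmf (f k) by exact: bmf01.
have bgf k : bmf (fun x : 'rV[R]_d => `|g k x - f k x|) by apply: bmf_norm; exact: bmfB.
have cmpi (h : nat -> 'rV[R]_d -> R) k : mfunT (h k) ->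
  measurable_fun [set: R] (fun u => h k (bm d (t k.+1) u - bm d (t k) u)).
 by move=> mh; apply: (mcompT mh); exact: measurable_bm_increment.
have cmps (h : nat -> 'rV[R]_d -> R) k : mfunT (h k) ->
  measurable_fun [set: 'rV[R]_d] (fun z => h k (sg k *: z)).
 by move=> mh; apply: (mcompT mh); exact: measurable_scaling.
pose G u := \prod_(k < K) g k (bm d (t k.+1) u - bm d (t k) u).
pose F u := \prod_(k < K) f k (bm d (t k.+1) u - bm d (t k) u).
have prod01 (h : nat -> 'rV[R]_d -> R) u : (forall k x, 0 <= h k x <= 1) -> 0 <= \prod_(k < K) h k (bm d (t k.+1) u - bm d (t k) u) <= 1.
 move=> h01; apply/andP; split; first by apply: prodr_ge0 => k _; case/andP: (h01 k (bm d (t k.+1) u - bm d (t k) u)).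
 apply: (@le_trans _ _ (\prod_(k < K) (1 : R))); last by rewrite prodr_const expr1n.
 by apply: ler_prod => k _; exact: h01.
have bG : bmf G.
 by apply: bmf01 => [|u]; [apply: measurable_prod => k _; exact: cmpi|exact: prod01].
have bF : bmf F.
 by apply: bmf01 => [|u]; [apply: measurable_prod => k _; exact: cmpi|exact: prod01].
have Esum n' (h : nat -> R -> R) : (forall k, bmf (h k)) ->
  bmf (fun u => \sum_(k < n') h k u) /\ E (@lam R) (fun u => \sum_(k < n') h k u) = \sum_(k < n') E (@lam R) (h k).
 move=> bh; elim: n' => [|n' [IH1 IH2]].
  rewrite big_ord0 (_ : (fun u => _) = fun=> 0); first by split; [exact: bmf_cst|exact: E_cst].
  by apply/funext => u; rewrite big_ord0.
 rewrite (_ : (fun u => _) = fun u => \sum_(k < n') h k u + h n' u); last first.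
  by apply/funext => u; rewrite big_ord_recr. by split; [exact: bmfD|rewrite ED// IH2 big_ord_recr].
have le1 : `|E (@lam R) G - E (@lam R) F| <= K%:R * e'.
 have bd k : bmf (fun u => `|g k (bm d (t k.+1) u - bm d (t k) u) - f k (bm d (t k.+1) u - bm d (t k) u)|).
  by apply: bmf_norm; apply: bmfB; apply: bmf01 => //; exact: cmpi. have [b1 e1] := Esum K _ bd.
 rewrite -EB//; apply: (le_trans (ler_norm_E _ (bmfB bG bF))).
 apply: (@le_trans _ _ (\sum_(k < K) E (@lam R) (fun u => `|g k (bm d (t k.+1) u - bm d (t k) u) - f k (bm d (t k.+1) u - bm d (t k) u)|))).
  rewrite -e1; apply: le_E => //; first by apply: bmf_norm; exact: bmfB.
  by move=> u; exact: (@dist_prod_le _ K (fun k => g k (bm d (t k.+1) u - bm d (t k) u))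
   (fun k => f k (bm d (t k.+1) u - bm d (t k) u)) (fun k => g01 k _) (fun k => f01 k _)).
 apply: (@le_trans _ _ (\sum_(k < K) e')); last by rewrite sumr_const card_ord mulr_natl.
 apply: ler_sum => k _. by have [_ [+ _]] := cf k; rewrite E_distribution.
pose Gg k := E (gauss R d) (fun z => g k (sg k *: z)).
pose Fg k := E (gauss R d) (fun z => f k (sg k *: z)).
have le2 : `|\prod_(k < K) Gg k - \prod_(k < K) Fg k| <= K%:R * e'.
 apply: (le_trans (@dist_prod_le _ K Gg Fg (fun k => _) (fun k => _))).
 - by move=> k; apply: E01 => [|z]; [exact: cmps|exact: g01].
 - by move=> k; apply: E01 => [|z]; [exact: cmps|exact: f01].
 apply: (@le_trans _ _ (\sum_(k < K) e')); last by rewrite sumr_const card_ord mulr_natl.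
 apply: ler_sum => k _.
 have b1 : bmf (fun z : 'rV[R]_d => g k (sg k *: z)) by apply: bmf01 => //; exact: cmps.
 have b2 : bmf (fun z : 'rV[R]_d => f k (sg k *: z)) by apply: bmf01 => //; exact: cmps.
 rewrite /Gg /Fg -EB//; apply: (le_trans (ler_norm_E _ (bmfB b1 b2))).
 by have [_ [_ +]] := cf k; rewrite E_distribution.
have eF : E (@lam R) F = \prod_(k < K) Fg k by apply: E_bm_cont => k; have [] := cf k.
rewrite -/G (_ : E _ G - _ = (E (@lam R) G - E (@lam R) F) - (\prod_(k < K) Gg k - \prod_(k < K) Fg k)); last first.
 by rewrite eF; ring.
apply: (le_trans (ler_normB _ _)); apply: (le_trans (lerD le1 le2)).
have he : K%:R * e' <= e / 2.
 have -> : K%:R * e' = (K%:R / K.+1%:R) * (e / 2) by rewrite /e'; field; rewrite gt_eqF//; lra.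
 by rewrite ler_piMl ?divr_ge0 ?(ltW e0)// ler_pdivrMr// mul1r ler_nat.
by lra.
Qed.

Lemma lam_bm K (A : nat -> set 'rV[R]_d) : (forall k, measurable (A k)) ->
 lam (\bigcap_(k < K) ((fun u => bm d (t k.+1) u - bm d (t k) u) @^-1` A k)) =
 (\prod_(k < K) gauss R d ((fun z : 'rV[R]_d => Num.sqrt (t k.+1 - t k) *: z) @^-1` A k))%E.
Proof.
move=> mA.
have E_ind dT (T : measurableType dT) (P : probability T R) (C : set T) : measurable C ->
  (E P (\1_C : T -> R))%:E = P C.
 by move=> mC; rewrite EE; [rewrite integral_indic// setIT|exact: bmf_indic].
pose g k : 'rV[R]_d -> R := \1_(A k).
have mg k : mfunT (g k) by exact: mindic.
have g01 k x : 0 <= g k x <= 1 by rewrite /g indicE; case: (_ \in _); rewrite ?lexx ?ler01.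
have minc k : measurable ((fun u => bm d (t k.+1) u - bm d (t k) u) @^-1` A k).
 by apply: mpreimage => //; exact: measurable_bm_increment.
rewrite -(E_ind _ _ (@lam R)); last by apply: fin_bigcap_measurable => // k _; exact: minc.
transitivity (E (@lam R) (fun u => \prod_(k < K) g k (bm d (t k.+1) u - bm d (t k) u)))%:E.
 congr (_%:E); apply: eq_E => u; rewrite /g indicE. case: (boolP (u \in _)) => [/set_mem h|h].
  by rewrite big1// => k _; rewrite indicE mem_set//; exact: (h k (ltn_ord k)).
 have /existsNP[k] : ~ forall k, (k < K)%N -> A k (bm d (t k.+1) u - bm d (t k) u).
  by move=> h'; move/negP: h; apply; apply/mem_set => k kK; exact: h'.
 move=> /not_implyP[kK nA]; rewrite (bigD1 (Ordinal kK))//= indicE memNset// mul0r//.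
rewrite (E_bm K mg g01) -prodEFin; apply: eq_bigr => k _.
rewrite -E_ind; last mes.
by congr (_%:E); apply: eq_E => z; rewrite /g !indicE.
Qed.

End times.
End brownian_increments.

Section brownian_motion.
Context (R : realType) (d : nat).

Lemma gauss_scaling_box (s : R) (A : 'I_d -> set R) : 0 < s -> (forall i, measurable (A i)) ->
 gauss R d ((fun z : 'rV[R]_d => s *: z) @^-1` [set v | forall i, A i (v ord0 i)]) =
 (\prod_(i < d) normal_prob 0 s (A i))%E.
Proof.
move=> s0 mA.
have mA' i : measurable ((fun y : R => s * y) @^-1` A i).
 by rewrite -[X in measurable X]setTI; apply: mfM.
transitivity (gauss R d [set v | forall i, ((fun y : R => s * y) @^-1` A i) (v ord0 i)]).
 by congr (gauss R d _); apply/seteqP; split => v /= H i; have := H i; rewrite mxE.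
rewrite (gauss_box mA'); apply: eq_bigr => i _.
rewrite /stdnormal /normalm -(normal_prob_scale s0 (mA' i)); congr (normal_prob 0 s _).
by apply/seteqP; split => y /=; rewrite mulrA divff ?gt_eqF// mul1r.
Qed.

Let measurable_box_rV (A : 'I_d -> set R) : (forall i, measurable (A i)) ->
 measurable [set v : 'rV[R]_d | forall i, A i (v ord0 i)].
Proof. exact: measurable_box. Qed.

Lemma lam_bm1 (s t : R) (A : set 'rV[R]_d) : 0 <= s -> s <= t -> measurable A ->
 lam ((fun u => bm d t u - bm d s u) @^-1` A) =
 gauss R d ((fun z : 'rV[R]_d => Num.sqrt (t - s) *: z) @^-1` A).
Proof.
(* A single increment is the case of times s, t, t, ... *)
move=> s0 st mA; pose T (k : nat) := if k is 0 then s else t.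
have TT k : T k <= T k.+1 by case: k => //=.
have := @lam_bm R d T s0 TT 1 (fun=> A) (fun=> mA); rewrite big_ord_recl big_ord0 mule1 /= => <-.
congr (lam _); apply/seteqP; split => u; first by move=> h [|//] _.
by move=> /(_ 0%N isT).
Qed.

Context dO (Omega : measurableType dO) (P : probability Omega R) (U : Omega -> R).
Hypotheses (mU : mfunT U) (lawU : forall A, measurable A -> P (U @^-1` A) = lam A).

Let measurable_bmU t : mfunT (fun w => bm d t (U w)).
Proof. exact: (mcompT (@measurable_bm R d t) mU). Qed.

Definition bm_rv (t : R) : {RV P >-> 'rV[R]_d} := mfun_Sub (mem_set (measurable_bmU t)).

Lemma bm_rv_brownian : brownian_motion bm_rv.
Proof.
split.
- by apply: nearW => w; exact: bm0.
- apply: nearW => w; apply: continuous_subspaceT => t; apply: rV_continuous => i; exact: bm_continuous.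
- move=> s t s0 st A mA.
 rewrite -[LHS]/(P (U @^-1` ((fun u => bm d t u - bm d s u) @^-1` [set v | forall i, A i (v ord0 i)]))).
 rewrite lawU; last by apply: mpreimage; [exact: measurable_bm_increment|exact: measurable_box_rV].
 rewrite lam_bm1//; [|exact: ltW|exact: measurable_box_rV].
 by rewrite gauss_scaling_box// sqrtr_gt0 subr_gt0.
move=> t t0 tt n A mA.
have mi k : measurable ((fun u => bm d (t k.+1) u - bm d (t k) u) @^-1` A k).
 by apply: mpreimage => //; exact: measurable_bm_increment.
rewrite -[LHS]/(P (U @^-1` (\bigcap_(i < n) ((fun u => bm d (t i.+1) u - bm d (t i) u) @^-1` A i)))).
rewrite lawU; last by apply: fin_bigcap_measurable => // k _; exact: mi.
rewrite lam_bm//; apply: eq_bigr => k _.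
rewrite -[RHS]/(P (U @^-1` ((fun u => bm d (t k.+1) u - bm d (t k) u) @^-1` A k))).
by rewrite lawU// lam_bm1//; elim: (nat_of_ord k) => // j IH; exact: le_trans IH (tt j).
Qed.

End brownian_motion.

(** * Picard iteration *)

Section geometric_sequences.
Context (R : realType) (a : nat -> R) (K : R).
Hypothesis a_step : forall k, `|a k.+1 - a k| <= K * 2^-1 ^+ k.

Let a_tail k p : `|a (k + p)%N - a k| <= 2 * K * 2^-1 ^+ k.
Proof.
have K0 : 0 <= K by have := a_step 0; rewrite expr0 mulr1; apply: le_trans; exact: normr_ge0.
suff H : `|a (k + p)%N - a k| <= 2 * K * 2^-1 ^+ k * (1 - 2^-1 ^+ p).
 by apply: (le_trans H); rewrite ler_piMr// !mulr_ge0// exprn_ge0// invr_ge0.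
elim: p => [|p IH]; first by rewrite addn0 subrr normr0 expr0 subrr mulr0.
rewrite addnS (_ : _ - _ = (a (k + p).+1 - a (k + p)%N) + (a (k + p)%N - a k)); last pos.
apply: (le_trans (ler_normD _ _)); apply: (le_trans (lerD (a_step (k + p)) IH)).
by rewrite exprD exprS le_eqVlt; apply/orP; left; apply/eqP; field.
Qed.

Lemma geometric_cvg : a @ \oo --> limn a.
Proof.
apply/cauchy_cvgP/cauchy_exP => e e0.
have c1 : 2 * K * 2^-1 ^+ m @[m --> \oo] --> (0 : R). rewrite -[X in _ --> X](mulr0 (2 * K)).
 have c : (fun _ : nat => 2 * K) @ \oo --> 2 * K by exact: cvg_cst.
 apply: (cvgM c); apply: cvg_expr; rewrite ger0_norm ?invr_ge0// invf_lt1//; lra.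
move/cvgr_lt : c1 => /(_ _ e0)[m _ hm].
exists (a m); exists m => // n /= mn; rewrite -(subnKC mn) /ball /= distrC.
by apply: (le_lt_trans (a_tail m (n - m))); exact: (hm m (leqnn m)).
Qed.

Lemma geometric_limit_dist k : `|limn a - a k| <= 2 * K * 2^-1 ^+ k.
Proof.
have cst : (fun _ : nat => a k) @ \oo --> a k by exact: cvg_cst.
have c : `|a n - a k| @[n --> \oo] --> `|limn a - a k| by exact: (cvg_norm (cvgB geometric_cvg cst)).
rewrite -(cvg_lim _ c)//; apply: limr_le; first by apply/cvg_ex; eexists; exact: c.
by exists k => // n /= kn; rewrite -(subnKC kn); exact: a_tail.
Qed.

End geometric_sequences.

Section indefinite_integral.
Context (R : realType).
Implicit Types f g : R -> R.

(** For t <= 0 the integral is 0, so [primitive] is defined on all of [R] without a break at 0. *)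
Definition primitive f (t : R) : R := \int[@lebesgue_measure R]_(s in `[0, t]) f s.

Lemma primitive_le0 f t : t <= 0 -> primitive f t = 0.
Proof.
rewrite le_eqVlt => /predU1P[->|t0]; first by rewrite /primitive set_itv1 /Rintegral integral_set1.
by rewrite /primitive set_itv_ge ?Rintegral_set0// bnd_simp -ltNge.
Qed.

Lemma primitive_lip f (K s t : R) : continuous f -> (forall u, `|f u| <= K) ->
 `|primitive f t - primitive f s| <= K * `|t - s|.
Proof.
move=> cf fK.
have K0 : 0 <= K by apply: le_trans (fK 0); exact: normr_ge0.
have eM u : primitive f u = primitive f (Num.max 0 u).
 by case: (leP 0 u) => // u0; rewrite !primitive_le0// ltW.
have key u v : 0 <= u -> u <= v -> `|primitive f v - primitive f u| <= (v - u) * K.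
 move=> u0 uv; have := @Rintegral_increment R f 0 u v 0 K cf u0 uv.
 by rewrite mulr0 subr0; apply => w _ _; rewrite subr0.
rewrite (eM t) (eM s); apply: (@le_trans _ _ (K * `|Num.max 0 t - Num.max 0 s|)); last first.
 by rewrite ler_wpM2l//; exact: max0_lip.
have t0 : 0 <= Num.max 0 t by rewrite le_max lexx.
have s0 : 0 <= Num.max 0 s by rewrite le_max lexx.
case: (leP (Num.max 0 s) (Num.max 0 t)) => h; rewrite mulrC.
 by rewrite [X in _ <= X * _]ger0_norm ?subr_ge0//; exact: key.
by rewrite distrC [X in _ <= X * _]distrC [X in _ <= X * _]ger0_norm ?subr_ge0 ?(ltW h)//; apply: key => //; exact: ltW.
Qed.

(** In the norm weighted by e^(- l t), integration gains a factor 1 / l; with l twice the Lipschitz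
    constant, the Picard map contracts by 1/2 on the whole half-line. *)
Lemma primitive_dist_exp f g (K l t : R) : continuous f -> continuous g -> 0 < l -> 0 <= t -> 0 <= K ->
 (forall s, 0 <= s -> s <= t -> `|f s - g s| <= K * expR (l * s)) ->
 `|primitive f t - primitive g t| <= K / l * expR (l * t).
Proof.
move=> cf cg l0 t0 K0 H.
have cf' := integrable_itv_continuous 0 t cf; have cg' := integrable_itv_continuous 0 t cg.
have de (c s : R) : is_derive s (1 : R) (fun s => c * expR (l * s)) (c * (l * expR (l * s))).
 have h := is_derive_expRM l s. by apply: is_derive_eq; rewrite /GRing.scale/=; ring.
have ce : continuous (fun s => K * expR (l * s)) by exact: continuous_is_derive (de K).
have ce' := integrable_itv_continuous 0 t ce.
have cfg : continuous (fun s => f s - g s) by move=> s; apply: (@cvgB R R^o); [exact: cf|exact: cg].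
have cfg' := integrable_itv_continuous 0 t cfg.
rewrite /primitive -RintegralB//.
apply: le_trans (le_normr_Rintegral _ _) _ => //.
apply: (@le_trans _ _ (\int[@lebesgue_measure R]_(s in `[0, t]) (K * expR (l * s)))).
 apply: le_Rintegral => //; first exact: (integrable_norm cfg').
 by move=> s /=; rewrite in_itv/= => /andP[? ?]; exact: H.
have dK s : is_derive s (1 : R) (fun s => K / l * expR (l * s)) (K * expR (l * s)).
 have -> : K * expR (l * s) = K / l * (l * expR (l * s)) by field; rewrite gt_eqF. exact: de.
have p0 s : 0 <= K * expR (l * s) by pos.
have e := integral_derive_lebR t0 (fun s _ => dK s) (fun s _ => ce s) (fun s _ => p0 s).
rewrite ge0_integral_lebR in e => //; first last.
- pos.
- by apply/mEFinP; apply: mfTS; exact: cont_mfun.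
by rewrite /Rintegral e /= gerBl mulr_ge0 ?expR_ge0// divr_ge0// ltW.
Qed.

End indefinite_integral.

Section picard.
Context (R : realType) (d : nat) (nu : R).
Hypothesis nu1 : 1 <= nu.
Variables (beta : R -> 'rV[R]_d) (x0 : 'rV[R]_d).
Hypothesis cbeta : forall i, continuous (fun t => beta t ord0 i).
Let n : R := d%:R + nu.
Let n0 : 0 < n. Proof. by have h := nu1; rewrite ltr_wpDl//; lra. Qed.
Let C : R := n * (6 * d%:R + 1).
Let b i (x : 'rV[R]_d) : R := grad (V_nu nu) x ord0 i.

Let b_bound i x : `|b i x| <= n.
Proof.
rewrite /b grad_V_nu mxE normrM normrM normfV (ger0_norm (ltW n0)) (ger0_norm (ltW (Qn_gt0 x))).
rewrite -mulrA ler_piMr ?(ltW n0)// mulrC ler_pdivrMr ?Qn_gt0// mul1r /Qn.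
have := sqnorm2_coord x i; set a := `|_|; have a0 : 0 <= a by exact: normr_ge0.
by nra.
Qed.

Let b_lip (a : R) (x y : 'rV[R]_d) i : 0 <= a -> (forall j, `|x ord0 j - y ord0 j| <= a) -> `|b i x - b i y| <= C * a.
Proof.
move=> a0 xy; have n0' := n0; have d0 : 0 <= d%:R :> R by [].
have C0 : 0 <= C by pos.
have h1 : sqnorm2 (x - y) <= d%:R * a ^+ 2. by apply: sqnorm2_le_coord => // j; rewrite !mxE.
(* The gradient is n times the identity minus the drift with c = 1, so [drift_lip] also provides its
   Lipschitz constant. *)
pose v := (drift 1 y - drift 1 x) + (x - y).
have bE : b i x - b i y = n * v ord0 i. by rewrite /b !grad_V_nu /v /drift !mxE -/n; ring.
have h2 : sqnorm2 v <= 6 * (d%:R * a ^+ 2). apply: (le_trans (sqnorm2D_le _ _ (@ltr01 R))).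
 have := @drift_lip R d 1 y x; rewrite ler01 lexx => /(_ isT) h3.
 by move: h3; rewrite (sqnorm2_subC y x) invr1; lra.
rewrite bE normrM (ger0_norm (ltW n0)) /C -mulrA ler_pM2l//.
have h4 := sqnorm2_coord v i.
have k0 : 0 <= (6 * d%:R + 1) * a by pos.
rewrite -(ler_pXn2r (n := 2)) ?nnegrE//; apply: (le_trans h4); apply: (le_trans h2).
by rewrite exprMn mulrA ler_wpM2r ?sqr_ge0//; nra.
Qed.

Fixpoint picard_path k (t : R) : 'rV[R]_d := \row_i (x0 ord0 i + Num.sqrt 2 * beta t ord0 i -
  if k is k'.+1 then primitive (fun s => b i (picard_path k' s)) t else 0).

Let picS k t i : picard_path k.+1 t ord0 i =
 x0 ord0 i + Num.sqrt 2 * beta t ord0 i - primitive (fun s => b i (picard_path k s)) t.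
Proof. by rewrite /= mxE. Qed.

Let cb (Y : R -> 'rV[R]_d) i : (forall j, continuous (fun t => Y t ord0 j)) -> continuous (fun t => b i (Y t)).
Proof. by move=> cY; exact: (@continuous_grad_path R d nu Y cY i). Qed.

Let cbase i : continuous (fun t => x0 ord0 i + Num.sqrt 2 * beta t ord0 i).
Proof.
move=> t; apply: (@cvgD R R^o); first exact: cvg_cst.
by apply: (@cvgM R); [exact: cvg_cst|exact: cbeta].
Qed.

Let lip_continuous (f : R -> R) (K : R) : (forall s t, `|f t - f s| <= K * `|t - s|) -> continuous f.
Proof.
move=> H t; apply/cvgrPdist_lt => e e0.
have K0 : 0 < `|K| + 1 by pos.
near=> s.
have st : `|t - s| < e / (`|K| + 1).
 by near: s; apply/nbhs_ballP; exists (e / (`|K| + 1)); [exact: divr_gt0|].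
apply: (le_lt_trans (H s t)); move: st; rewrite ltr_pdivlMr// mulrC; apply: le_lt_trans.
by rewrite ler_wpM2r//; have := ler_norm K; lra.
Unshelve. all: by end_near. Qed.

Let cpic k i : continuous (fun t => picard_path k t ord0 i).
Proof.
elim: k i => [|k IH] i.
 rewrite (_ : (fun t => _) = fun t => x0 ord0 i + Num.sqrt 2 * beta t ord0 i); first mes.
 by apply/funext => t; rewrite /= mxE subr0.
rewrite (_ : (fun t => _) = fun t => (x0 ord0 i + Num.sqrt 2 * beta t ord0 i) - primitive (fun s => b i (picard_path k s)) t); last first.
 by apply/funext => t; rewrite /= mxE.
have cp : continuous (primitive (fun s => b i (picard_path k s))).
 apply: (@lip_continuous _ n) => s t; apply: primitive_lip => [|u]; [exact: cb|exact: b_bound].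
by move=> t; apply: (@cvgB R R^o); [exact: cbase|exact: cp].
Qed.

Let pic_step k t i : 0 <= t ->
 `|picard_path k.+1 t ord0 i - picard_path k t ord0 i| <= n * expR (2 * C * t) * 2^-1 ^+ k.
Proof.
have n0' := n0; have d0 : 0 <= d%:R :> R by [].
have nu1' := nu1.
have C1 : 1 <= C by rewrite /C /n; nra.
elim: k t i => [|k IH] t i t0. rewrite expr0 mulr1 /= !mxE subr0 addrAC subrr add0r normrN.
 have := @primitive_lip R (fun s => b i (picard_path 0 s)) n 0 t (@cb _ i (@cpic 0%N)) (fun u => b_bound i _).
 rewrite (primitive_le0 _ (lexx 0)) !subr0 (ger0_norm t0) => h; apply: (le_trans h).
 rewrite ler_pM2l//; apply: (@le_trans _ _ (1 + t)); first pos.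
 by apply: (le_trans (expR_ge1Dx t)); rewrite ler_expR; nra.
rewrite (_ : _ - _ = primitive (fun s => b i (picard_path k s)) t - primitive (fun s => b i (picard_path k.+1 s)) t); last first.
 have gen (x y c p q : R) : x = c - p -> y = c - q -> x - y = q - p by pos.
 exact: (gen _ _ _ _ _ (picS k.+1 t i) (picS k t i)).
have p0 : 0 <= 2^-1 ^+ k :> R by pos.
have l0 : 0 < 2 * C by lra.
have K0 : 0 <= C * n * 2^-1 ^+ k by pos.
have H s : 0 <= s -> s <= t -> `|b i (picard_path k s) - b i (picard_path k.+1 s)| <= C * n * 2^-1 ^+ k * expR (2 * C * s).
 move=> s0 _; rewrite distrC.
 have := @b_lip (n * expR (2 * C * s) * 2^-1 ^+ k) (picard_path k.+1 s) (picard_path k s) i.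
 move=> h; apply: (le_trans (h _ _)); first by rewrite !mulr_ge0 ?expR_ge0// ltW.
  by move=> j; exact: IH. by apply: eq_ler; ring.
have := primitive_dist_exp (@cb _ i (@cpic k)) (@cb _ i (@cpic k.+1)) l0 t0 K0 H => h; apply: (le_trans h).
by rewrite exprS le_eqVlt; apply/orP; left; apply/eqP; field; rewrite gt_eqF//; lra.
Qed.

Definition picard_limit t : 'rV[R]_d := \row_i limn (fun k => picard_path k t ord0 i).

Let pic_neg k t i : t <= 0 -> picard_path k t ord0 i = picard_path 0 t ord0 i.
Proof. by move=> t0; case: k => // k; rewrite /= !mxE primitive_le0. Qed.

Let pic_cvg t i : picard_path k t ord0 i @[k --> \oo] --> picard_limit t ord0 i.
Proof.
rewrite mxE; have [t0|t0] := leP 0 t.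
 by apply: (@geometric_cvg _ _ (n * expR (2 * C * t))) => k; exact: pic_step.
have e k : picard_path k t ord0 i = picard_path 0 t ord0 i by apply: pic_neg; exact: ltW.
by rewrite (_ : (fun k => picard_path k t ord0 i) = fun=> picard_path 0 t ord0 i) ?lim_cst//; [exact: cvg_cst|exact/funext].
Qed.

Let pic_dist k t i : 0 <= t ->
 `|picard_limit t ord0 i - picard_path k t ord0 i| <= 2 * n * 2^-1 ^+ k * expR (2 * C * t).
Proof.
move=> t0; rewrite mxE.
have := @geometric_limit_dist _ (fun k => picard_path k t ord0 i) (n * expR (2 * C * t)) (fun k => pic_step k i t0) k.
by move=> h; apply: (le_trans h); apply: eq_ler; ring.
Qed.

(** Once the noise is subtracted, all iterates are n-Lipschitz because the gradient is bounded by n;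
    the pointwise limit inherits this. *)
Lemma picard_limit_continuous i : continuous (fun t => picard_limit t ord0 i).
Proof.
pose Y t := picard_limit t ord0 i - (x0 ord0 i + Num.sqrt 2 * beta t ord0 i).
pose Z k t := picard_path k t ord0 i - (x0 ord0 i + Num.sqrt 2 * beta t ord0 i).
have cY : continuous Y. apply: (@lip_continuous _ n) => s t. have ct a : Z k a @[k --> \oo] --> Y a.
  have c : (fun _ : nat => x0 ord0 i + Num.sqrt 2 * beta a ord0 i) @ \oo --> x0 ord0 i + Num.sqrt 2 * beta a ord0 i.
   exact: cvg_cst. have c0 : picard_path k a ord0 i @[k --> \oo] --> picard_limit a ord0 i by pos.
  exact: (cvgB c0 c).
 have c : `|Z k t - Z k s| @[k --> \oo] --> `|Y t - Y s| by exact: (cvg_norm (cvgB (ct t) (ct s))).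
 rewrite -(cvg_lim _ c)//; apply: limr_le; first by apply/cvg_ex; eexists; exact: c.
 apply: nearW => k; case: k => [|k]. have -> : Z 0%N t - Z 0%N s = 0 by rewrite /Z /= !mxE; ring.
  by rewrite normr0 mulr_ge0// ltW.
 rewrite (_ : Z k.+1 t - Z k.+1 s = primitive (fun u => b i (picard_path k u)) s - primitive (fun u => b i (picard_path k u)) t); last first.
  by rewrite /Z /= !mxE; ring.
 by rewrite distrC; apply: primitive_lip => [|u]; [exact: cb|exact: b_bound].
rewrite (_ : (fun t => _) = fun t => Y t + (x0 ord0 i + Num.sqrt 2 * beta t ord0 i)); last first.
 by apply/funext => t; rewrite /Y subrK.
by move=> t; apply: (@cvgD R R^o); [exact: cY|exact: cbase].
Qed.

Lemma picard_limit_eq t i : 0 <= t -> picard_limit t ord0 i = x0 ord0 i -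
 (\int[@lebesgue_measure R]_(s in `[0, t]) grad (V_nu nu) (picard_limit s) ord0 i) + Num.sqrt 2 * beta t ord0 i.
Proof.
move=> t0; rewrite -/(primitive (fun s => b i (picard_limit s)) t).
have n0' := n0; have d0 : 0 <= d%:R :> R by [].
have nu1' := nu1.
have C1 : 1 <= C by rewrite /C /n; nra.
have l0 : 0 < 2 * C by lra.
have clim := picard_limit_continuous.
have cp : primitive (fun s => b i (picard_path k s)) t @[k --> \oo] --> primitive (fun s => b i (picard_limit s)) t.
 apply/cvgrPdist_le => e e0. pose M := n * expR (2 * C * t). have M0 : 0 < M by pos.
 have c1 : 2^-1 ^+ m @[m --> \oo] --> (0 : R) by apply: cvg_expr; rewrite ger0_norm ?invr_ge0// invf_lt1//; lra.
 move/cvgr_lt : c1 => /(_ _ (divr_gt0 e0 M0)); apply: filterS => k hk.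
 have p0 : 0 <= 2^-1 ^+ k :> R by pos. have K0 : 0 <= C * (2 * n * 2^-1 ^+ k) by pos.
 have H s : 0 <= s -> s <= t -> `|b i (picard_limit s) - b i (picard_path k s)| <= C * (2 * n * 2^-1 ^+ k) * expR (2 * C * s).
  move=> s0 _; rewrite -mulrA; apply: b_lip; first by rewrite !mulr_ge0 ?expR_ge0// ltW.
  by move=> j; exact: pic_dist.
 have := primitive_dist_exp (@cb _ i clim) (@cb _ i (@cpic k)) l0 t0 K0 H => h; apply: (le_trans h).
 rewrite (_ : _ * expR _ = M * 2^-1 ^+ k); last by rewrite /M; field; rewrite gt_eqF//; lra.
 by rewrite mulrC -ler_pdivlMr// ltW.
have c : (fun _ : nat => x0 ord0 i + Num.sqrt 2 * beta t ord0 i) @ \oo --> x0 ord0 i + Num.sqrt 2 * beta t ord0 i.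
 exact: cvg_cst.
have c1 : picard_path k.+1 t ord0 i @[k --> \oo] --> (x0 ord0 i + Num.sqrt 2 * beta t ord0 i) - primitive (fun s => b i (picard_limit s)) t.
 rewrite (_ : (fun k => _) = fun k => (x0 ord0 i + Num.sqrt 2 * beta t ord0 i) - primitive (fun s => b i (picard_path k s)) t); last first.
  by apply/funext => k; rewrite /= mxE. exact: (cvgB c cp).
have c2 : picard_path k.+1 t ord0 i @[k --> \oo] --> picard_limit t ord0 i.
 by have := @pic_cvg t i; rewrite -(cvg_shiftS (fun k => picard_path k t ord0 i)).
have -> : picard_limit t ord0 i = (x0 ord0 i + Num.sqrt 2 * beta t ord0 i) - primitive (fun s => b i (picard_limit s)) t.
 exact: (cvg_unique _ c2 c1).
by ring.
Qed.

End picard.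

(** * Existence of Langevin diffusions *)

Section langevin_existence.
Context (R : realType) (d : nat) (nu : R).
Hypothesis nu1 : 1 <= nu.
Variable x0 : R -> 'rV[R]_d.
Hypothesis mx0 : measurable_fun [set: R] x0.
Let n : R := d%:R + nu.

Let beta (u t : R) : 'rV[R]_d := bm d t (usplit2 u).
Let Xp (u : R) := picard_limit nu (beta u) (x0 (usplit1 u)).

Let cX u i : continuous (fun t => Xp u t ord0 i).
Proof. by apply: picard_limit_continuous => // j; exact: bm_continuous. Qed.

Let X0 u : Xp u 0 = x0 (usplit1 u).
Proof.
apply/rowP => i; rewrite /Xp picard_limit_eq//; last by move=> j; exact: bm_continuous.
rewrite -/(primitive (fun s => grad (V_nu nu) (picard_limit nu (beta u) (x0 (usplit1 u)) s) ord0 i) 0).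
by rewrite primitive_le0// subr0 /beta bm0 mxE mulr0 addr0.
Qed.

Let eqX u t : 0 <= t -> forall i, Xp u t ord0 i = Xp u 0 ord0 i -
 (\int[@lebesgue_measure R]_(s in `[0, t]) grad (V_nu nu) (Xp u s) ord0 i) + Num.sqrt 2 * beta u t ord0 i.
Proof. by move=> t0 i; rewrite X0 {1}/Xp picard_limit_eq// => j; exact: bm_continuous. Qed.

Let mbeta t : measurable_fun [set: R] (fun u => beta u t).
Proof. exact: (mcompT (@measurable_bm R d t) (@musplit2 R)). Qed.

Let msplit1 : measurable_fun [set: R] (fun u => x0 (usplit1 u)).
Proof. exact: (mcompT mx0 (@musplit1 R)). Qed.

Let measurable_path h k : measurable_fun [set: R] (fun u => euler_path (h * n)
 (fun k => Num.sqrt 2 *: (beta u (k.+1%:R * h) - beta u (k%:R * h))) (Xp u 0) k).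
Proof.
elim: k => [|k IH].
 by rewrite /= (_ : (fun u => _) = fun u => x0 (usplit1 u))//; apply/funext => u; exact: X0.
apply: mrVD; first exact: (mcompT (@measurable_drift _ _ _) IH).
by apply: mrVZ => //; apply: measurable_rVB; exact: mbeta.
Qed.

(** Measurability in the random parameter is read off the Euler scheme, which is visibly measurable
    and converges to the Picard path for t > 0. *)
Let measurable_Xp t : measurable_fun [set: R] (fun u => Xp u t).
Proof.
apply: measurable_fun_rV => i; have [t0|t0|->] := ltgtP t 0; last 1 first.
- by under eq_fun do rewrite X0; exact: (mcompT (mcoord_rV i)).
- rewrite (_ : (fun u => _) = fun u => x0 (usplit1 u) ord0 i + Num.sqrt 2 * beta u t ord0 i).
  apply: mfD; first exact: (mcompT (mcoord_rV i)).
  by apply: mfM => //; exact: (mcompT (mcoord_rV i)). apply/funext => u; rewrite /Xp mxE.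
 rewrite (_ : (fun k => _) = fun=> x0 (usplit1 u) ord0 i + Num.sqrt 2 * beta u t ord0 i) ?lim_cst//.
 by apply/funext => -[|k]; rewrite /= mxE ?primitive_le0 ?(ltW t0)// subr0.
apply: (@measurable_fun_cvg _ _ _ _ (fun N u => euler_path (t / N.+1%:R * n)
 (fun k => Num.sqrt 2 *: (beta u (k.+1%:R * (t / N.+1%:R)) - beta u (k%:R * (t / N.+1%:R)))) (Xp u 0) N.+1 ord0 i)) => //.
- by move=> N; exact: (mcompT (mcoord_rV i) (@measurable_path (t / N.+1%:R) N.+1)).
- move=> u _; have h := @euler_cvg R d nu nu1 (Xp u) (beta u) (@cX u) (@eqX u) t t0.
 exact: (cvg_comp _ _ h (@coord_continuous _ _ _ ord0 i (Xp u t))).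
Qed.

Let P : probability R R := @lam R.

Let X (t : R) : {RV P >-> 'rV[R]_d} := mfun_Sub (mem_set (measurable_Xp t)).

Lemma langevin_diffusion_exists : exists Y B : R -> {RV P >-> 'rV[R]_d},
 langevin_diffusion (V_nu nu) Y B /\ forall u, Y 0 u = x0 (usplit1 u).
Proof.
exists X, (bm_rv d P (@musplit2 R)); split; last by move=> u; exact: X0.
split.
- by apply: bm_rv_brownian => A mA; exact: lam_usplit2.
- move=> m t A F t0 mA mF. pose D := \bigcap_(i < m) (bm d (t i) @^-1` F i). have mD : measurable D.
  apply: fin_bigcap_measurable => // i _; apply: mpreimage => //; exact: measurable_bm.
 have eA : X 0 @^-1` A = (@usplit1 R) @^-1` (x0 @^-1` A).
  by apply/seteqP; split => u /=; rewrite X0. have mA' : measurable (x0 @^-1` A) by mes.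
 have := lam_split mA' mD; rewrite -(lam_usplit1 mA') -(lam_usplit2 mD) -eA. exact.
- by apply: nearW => u; apply: continuous_subspaceT => t; apply: rV_continuous => i; exact: cX.
- by apply: nearW => u t t0 i; exact: eqX.
Qed.

End langevin_existence.

(** * Moments of the standard Gaussian *)

Section gaussian_moments.
Context (R : realType).

(** A standard Gaussian has the law of k (a - b) with k = 1 / sqrt 2, and exchanging a and b changes
    the sign. *)
Lemma gauss_opp d (G : 'rV[R]_d -> \bar R) : mfunT G -> (forall z, 0 <= G z)%E ->
 (\int[gauss R d]_z G (- z)%R = \int[gauss R d]_z G z)%E.
Proof.
move=> mG G0; pose k : R := (Num.sqrt 2)^-1.
have k0 : 0 < k by pos.
have kk : k ^+ 2 + k ^+ 2 = 1 by rewrite exprVn sqr_sqrtr//; field.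
have mN : mfunT (fun z : 'rV[R]_d => G (- z)). mes.
have key (H : 'rV[R]_d -> \bar R) : mfunT H -> (forall z, 0 <= H z)%E ->
  (\int[gauss R d]_z H z = \int[gauss R d]_a \int[gauss R d]_b H (k *: a - k *: b)%R)%E.
 move=> mH H0; have := @gauss_rotation R d k k k0 kk (fun _ b => H b).
 move=> /(_ (mcompT mH msnd) (fun _ b => H0 b)) ->. by rewrite integral_prob_cst.
rewrite (key _ mN (fun z => G0 _)) (key _ mG G0).
have mG2 : mfunT (fun p : 'rV[R]_d * 'rV[R]_d => G (k *: p.1 - k *: p.2)).
 apply: (mcompT mG); apply: mrVD; first mes.
 by apply: measurable_rVN; apply: mrVZ => //; exact: msnd.
rewrite -(ge0_integral_prod_prob (gauss R d) (gauss R d) mG2 (fun p => G0 _)).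
rewrite (ge0_integral_prod_probC (gauss R d) (gauss R d) mG2 (fun p => G0 _)).
apply: eq_integral => a _; apply: eq_integral => b _; congr G.
by apply/rowP => i; rewrite !mxE; ring.
Qed.

Lemma gauss_coord d (f : R -> \bar R) : mfunT f -> (forall t, 0 <= f t)%E ->
 (\int[gauss R d.+1]_z f (z ord0 ord0) = \int[stdnormal R]_t f t)%E.
Proof.
move=> mf f0; rewrite ge0_integral_gaussS//; last first. exact: (mcompT mf (mcoord_rV ord0)).
apply: eq_integral => t _; under eq_integral do rewrite mxE unlift_none /=.
exact: integral_prob_cst.
Qed.

(** t^4 <= 32 e^(t^2 / 4), whose mean is 32 sqrt 2 <= 48. *)
Lemma stdnormal_fourth_moment : (\int[stdnormal R]_t (t ^+ 4)%:E <= 48%:E)%E.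
Proof.
have mexp : mfunT (fun t : R => expR (t ^+ 2 / 4)).
 apply: (mcompT (@measurable_expR R)); exact: mfM.
have e : (\int[stdnormal R]_t (expR (t ^+ 2 / 4))%:E = (Num.sqrt 2)%:E)%E.
 rewrite -(@gauss_coord 0); last 2 first.
 - mes.
 - pos. transitivity (\int[gauss R 1]_z (expR (sqnorm2 z / 4))%:E)%E.
  by apply: eq_integral => z _; rewrite /sqnorm2 big_ord1.
 rewrite gauss_exp_moment expr1; congr (_%:E).
 have a0 : 0 < pi *+ 2 :> R by rewrite pmulrn_lgt0// pi_gt0.
 rewrite /normal_peak expr1n mul1r invrK sqr_sqrtr// -mulrnAr sqrtrM// mulrCA.
 by rewrite mulVf ?mulr1// gt_eqF// sqrtr_gt0.
apply: (@le_trans _ _ (\int[stdnormal R]_t (32 * expR (t ^+ 2 / 4))%:E)%E).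
 apply: le_integral_EFin => //.
 - exact: mfM.
 - by move=> t; rewrite exprn_even_ge0.
 - move=> t _; have t0 : 0 <= t ^+ 2 / 4 by rewrite divr_ge0// sqr_ge0.
  have := expR_ge1Dxn 1 t0; rewrite (_ : 2`!%:R = 2 :> R)// (_ : t ^+ 4 = t ^+ 2 * t ^+ 2); last pos.
  by set a := t ^+ 2; set b := expR _; lra.
rewrite integralZ_EFin// e -EFinM lee_fin.
have : Num.sqrt 2 <= 3 / 2 :> R.
 rewrite -[leRHS]ger0_norm ?divr_ge0// -sqrtr_sqr ler_sqrt ?sqr_ge0//. by rewrite expr_div_n; lra.
by lra.
Qed.

(** The density is at most 1/2, so at least half of the mass lies where t^2 >= 1/4. *)
Lemma stdnormal_second_moment_ge : ((8^-1)%:E <= \int[stdnormal R]_t (t ^+ 2)%:E)%E.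
Proof.
pose D : set R := `[- 2^-1, 2^-1]%classic.
have mD : measurable D by mes.
have pk : normal_peak 1 <= 2^-1 :> R. have a0 : 0 < pi *+ 2 :> R by rewrite pmulrn_lgt0// pi_gt0.
 rewrite /normal_peak expr1n mul1r lef_pV2 ?posrE ?sqrtr_gt0//.
 rewrite -[leLHS]ger0_norm// -sqrtr_sqr ler_sqrt; last pos.
 by have := @pi_ge2 R; rewrite -mulr_natr; lra.
have D2 : (stdnormal R D <= (2^-1)%:E)%E. rewrite -[X in stdnormal R X](setIT D) -integral_indic//.
 rewrite stdnormal_pdfE//; last mes. apply: (@le_trans _ _ (\int[lebR R]_x (2^-1 * \1_D x)%:E)%E).
  apply: ge0_le_integral => //.
  - by move=> x _; rewrite -EFinM lee_fin mulr_ge0 ?normal_pdf_ge0.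
  - apply: emfunM; first mes. by apply/mEFinP; exact: measurable_normal_pdf.
  - by apply/mEFinP; exact: mfM.
  - move=> x _; rewrite -EFinM lee_fin mulrC ler_wpM2r//.
   by apply: le_trans pk; apply: normal_pdf_ub; rewrite oner_eq0.
 rewrite integralZ_EFin// integral_indic// setIT. rewrite -[X in (_ * X <= _)%E]/(lebR R D).
 have -> : lebR R D = 1%:E by rewrite lebR_itvcc; [congr (_%:E); field|lra].
 by rewrite -EFinM lee_fin; lra.
have D3 : (((2^-1 : R))%:E <= stdnormal R (~` D))%E.
 have eD : stdnormal R D = (fine (stdnormal R D))%:E by rewrite fineK// fin_num_measure.
 apply: (@le_trans _ _ (1%:E - stdnormal R D)%E); last by rewrite -probability_setC.
 by move: D2; rewrite eD -EFinB !lee_fin; lra.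
apply: (@le_trans _ _ (\int[stdnormal R]_t (4^-1 * \1_(~` D) t)%:E)%E).
 rewrite integralZ_EFin//; last exact: mindic (measurableC mD).
 rewrite integral_indic ?setIT//; last exact: measurableC.
 apply: (@le_trans _ _ ((4^-1)%:E * (2^-1)%:E)%E); first by rewrite -EFinM lee_fin; lra.
 by rewrite lee_pmul2l// lte_fin.
apply: le_integral_EFin => //.
- by apply: mfM => //; exact: mindic (measurableC mD).
move=> t _; rewrite indicE; case: (boolP (t \in _)) => [/set_mem|_]; last by rewrite mulr0 sqr_ge0.
rewrite /D /= in_itv/= => /negP; rewrite negb_and -!ltNge => /orP[h|h]; nra.
Qed.

End gaussian_moments.

(** * Spread of a chain started from a wide Gaussian *)

Section lmc_expectation.
Context (R : realType) (d : nat) (nu h : R).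
Hypotheses (nu1 : 1 <= nu) (h0 : 0 < h) (hn : h * (d%:R + nu) <= 1).
Context dO (Omega : measurableType dO) (P : probability Omega R).
Variables x xi : nat -> {RV P >-> 'rV[R]_d}.
Hypothesis lmc : langevin_monte_carlo (V_nu nu) h x xi.
Let s := Num.sqrt (2 * h).

(** The analogue of [lmc_law_step] for nonnegative unbounded functions, needed for moments. *)
Lemma ge0_lmc_step k (F : 'rV[R]_d -> \bar R) : mfunT F -> (forall v, 0 <= F v)%E ->
 (\int[P]_w F (x k.+1 w) =
 \int[P]_w \int[gauss R d]_z F (drift (h * (d%:R + nu)) (x k w) + s *: z)%R)%E.
Proof.
move=> mF F0; set c := h * _.
have mX : mfunT (x k) by pos.
have mY : mfunT (xi k) by pos.
have mG : mfunT (fun p : 'rV[R]_d * 'rV[R]_d => F (drift c p.1 + s *: p.2)).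
 apply: (mcompT mF); apply: mrVD. by apply: (mcompT (@measurable_drift _ _ _)); exact: mfst. mes.
have gxi : gaussian_vector P 1 (xi k) by case: lmc.
pose XY : {mfun Omega >-> ('rV[R]_d * 'rV[R]_d)%type} := mfun_Sub (mem_set (mfun_pair mX mY)).
transitivity (\int[distribution P XY]_p F (drift c p.1 + s *: p.2)%R)%E.
 rewrite ge0_integral_distribution//; apply: eq_integral => w _ /=.
 by case: lmc => _ _ ->; rewrite driftE.
transitivity (\int[prod_prob (distribution P (x k)) (gauss R d)]_p F (drift c p.1 + s *: p.2)%R)%E.
 apply: eq_measure_integral => C mC _. have H A B : measurable A -> measurable B ->
   P (x k @^-1` A `&` xi k @^-1` B) = (distribution P (x k) A * gauss R d B)%E.
  move=> mA mB; have := lmc_noise_indep h0 lmc k mA mB; rewrite (gaussian_vector_law gxi mB).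
  exact. exact: (pair_law mX mY H mC).
rewrite ge0_integral_prod_prob//.
apply: ge0_integral_distribution; last by move=> v; apply: integral_ge0 => z _; exact: F0.
by apply: (@mfubini_F _ _ _ _ R (gauss R d) (fun p => F (drift c p.1 + s *: p.2))) => // p; exact: F0.
Qed.

End lmc_expectation.

Section spread.
Context (R : realType) (d : nat) (nu h S : R).
Hypotheses (nu1 : 1 <= nu) (h0 : 0 < h) (hn : h * (d.+1%:R + nu) <= 1) (S1 : 1 <= S).
Context dO (Omega : measurableType dO) (P : probability Omega R).
Variables x xi : nat -> {RV P >-> 'rV[R]_d.+1}.
Hypothesis lmc : langevin_monte_carlo (V_nu nu) h x xi.
Hypothesis x0law : forall A, measurable A ->
 P (x 0%N @^-1` A) = gauss R d.+1 ((fun z : 'rV[R]_d.+1 => S *: z) @^-1` A).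
Let n : R := d.+1%:R + nu.
Let s := Num.sqrt (2 * h).
Let c := h * n.
Let r := 2 * h / S ^+ 2.
Let S0 : 0 < S. Proof. exact: lt_le_trans ltr01 S1. Qed.
Let c0 : 0 <= c. Proof. by have nu1' := nu1; rewrite /c /n mulr_ge0 ?(ltW h0)// addr_ge0//; lra. Qed.
Let c1 : c <= 1. Proof. exact: hn. Qed.
Let s2 : s ^+ 2 = 2 * h. Proof. by rewrite sqr_sqrtr// mulr_ge0// ltW. Qed.
Let r0 : 0 <= r. Proof. pos. Qed.
(** A fourth-moment Lyapunov function at scale [S]; thanks to the added 1, a step multiplies its
    mean by a factor, without an additive term. *)
Let W (a : R) : R := ((a / S) ^+ 2 + 1) ^+ 2.
Let W0 a : 0 <= W a. Proof. pos. Qed.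
Let mW : mfunT W.
Proof.
apply: mfX; apply: mfD => //; apply: mfX.
by apply: mfM.
Qed.
Let msq : mfunT (fun a : R => a ^+ 2).
Proof. mes. Qed.

Let measurable_even (f : R -> R) (u : R) : mfunT f ->
 mfunT (fun t : R => f (u + s * t) + f (u - s * t)).
Proof.
move=> mf; apply: mfD; apply: (mcompT mf). by apply: mfD => //; exact: mfM.
by apply: mfB => //; exact: mfM.
Qed.

(* Averaging over z and - z removes the odd moments of the noise. *)
Let gauss_even (f : R -> R) (u : R) : mfunT f -> (forall a, 0 <= f a) ->
 (2%:E * \int[gauss R d.+1]_z (f (u + s * z ord0 ord0))%:E =
 \int[stdnormal R]_t (f (u + s * t) + f (u - s * t))%:E)%E.
Proof.
move=> mf f0.
have ma (e : R) : mfunT (fun t : R => f (u + e * t)).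
 by apply: (mcompT mf); apply: mfD => //; exact: mfM.
have mc (e : R) : mfunT (fun z : 'rV[R]_d.+1 => (f (u + e * z ord0 ord0))%:E).
 apply/mEFinP; exact: (mcompT (ma e) (mcoord_rV ord0)).
transitivity (\int[gauss R d.+1]_z (f (u + s * z ord0 ord0))%:E + \int[gauss R d.+1]_z (f (u + - s * z ord0 ord0))%:E)%E.
 have -> : (\int[gauss R d.+1]_z (f (u + - s * z ord0 ord0))%:E = \int[gauss R d.+1]_z (f (u + s * z ord0 ord0))%:E)%E.
  rewrite -(gauss_opp (mc s)); last pos. by apply: eq_integral => z _; rewrite mxE mulrN mulNr.
 by rewrite -[2%:E]/(2%:R%:E) mule_natl mule2n.
rewrite (@gauss_coord _ _ (fun t => (f (u + s * t))%:E)); last 2 first.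
- mes.
- pos.
rewrite (@gauss_coord _ _ (fun t => (f (u + - s * t))%:E)); last 2 first.
- mes.
- pos.
rewrite -ge0_integralD//; try (by move=> t _; rewrite lee_fin); try exact/mEFinP.
by apply: eq_integral => t _; rewrite -EFinD mulNr.
Qed.

(** As a^2 <= Qn v, the drift lowers the squared coordinate a^2 by at most 2 c; centred noise can
    only raise its mean. *)
Let sq_step (v : 'rV[R]_d.+1) :
 ((v ord0 ord0 ^+ 2)%:E <= \int[gauss R d.+1]_z (((drift c v + s *: z) ord0 ord0) ^+ 2)%:E + (2 * c)%:E)%E.
Proof.
set u := drift c v ord0 ord0.
have -> : (\int[gauss R d.+1]_z (((drift c v + s *: z) ord0 ord0) ^+ 2)%:E =
  \int[gauss R d.+1]_z ((u + s * z ord0 ord0) ^+ 2)%:E)%E.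
 by apply: eq_integral => z _; rewrite mxE [(s *: z) _ _]mxE.
have h1 : ((u ^+ 2)%:E <= \int[gauss R d.+1]_z ((u + s * z ord0 ord0) ^+ 2)%:E)%E.
 rewrite -(@lee_pmul2l _ 2%:E)//. rewrite (@gauss_even (fun a => a ^+ 2))//; last pos.
 rewrite -EFinM -(integral_prob_cst (stdnormal R) (2 * u ^+ 2)%:E). apply: le_integral_EFin => //.
 - exact: (measurable_even u msq).
 - pos.
 - by move=> t _; have := sqr_ge0 (s * t); nra.
apply: le_trans (leeD2r _ h1); rewrite -EFinD lee_fin /u /drift mxE.
set a := v ord0 ord0; have Q1 := Qn_ge1 v; have Q0 := Qn_gt0 v.
have aQ : a ^+ 2 <= Qn v.
 by have := sqnorm2_coord v ord0; rewrite real_normK ?num_real// /Qn -/a; lra.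
have aQ' : a ^+ 2 / Qn v <= 1 by rewrite ler_pdivrMr// mul1r.
have -> : ((1 - c / Qn v) * a) ^+ 2 + 2 * c = a ^+ 2 + 2 * c * (1 - a ^+ 2 / Qn v) + (c / Qn v * a) ^+ 2.
 by field; rewrite gt_eqF.
have := sqr_ge0 (c / Qn v * a); have := c0.
by set b := a ^+ 2 / Qn v in aQ' *; set e := (_ * a) ^+ 2; nra.
Qed.

(** The drift shrinks the coordinate and hence [W]. In the symmetrised noise only t^2 and t^4 occur,
    with moments at most 1 and 48, which explains 6 r and 48 r^2. *)
Let W_step (v : 'rV[R]_d.+1) : (\int[gauss R d.+1]_z (W ((drift c v + s *: z) ord0 ord0))%:E <=
 ((1 + 6 * r + 48 * r ^+ 2) * W (v ord0 ord0))%:E)%E.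
Proof.
set u := drift c v ord0 ord0.
have -> : (\int[gauss R d.+1]_z (W ((drift c v + s *: z) ord0 ord0))%:E =
  \int[gauss R d.+1]_z (W (u + s * z ord0 ord0))%:E)%E.
 by apply: eq_integral => z _; rewrite mxE [(s *: z) _ _]mxE.
have Wu : W u <= W (v ord0 ord0). have Q1 := Qn_ge1 v; have Q0 := Qn_gt0 v.
 have q1 : 0 <= 1 - c / Qn v <= 1.
  have h1 : c / Qn v <= 1 by rewrite ler_pdivrMr// mul1r; have := c1; lra.
  have h2 : 0 <= c / Qn v by pos. pos. have h1 : (u / S) ^+ 2 <= (v ord0 ord0 / S) ^+ 2.
  rewrite /u /drift mxE -mulrA exprMn ler_piMl ?sqr_ge0// expr_le1//; by case/andP: q1.
 rewrite /W ler_pXn2r ?nnegrE ?addr_ge0 ?sqr_ge0//. by lra.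
apply: (@le_trans _ _ ((1 + 6 * r + 48 * r ^+ 2) * W u)%:E); last first.
 rewrite lee_fin ler_wpM2l//; have := r0; have := sqr_ge0 r; lra.
rewrite -(@lee_pmul2l _ 2%:E)//.
rewrite (@gauss_even W)//.
have pt t : W (u + s * t) + W (u - s * t) <= 2 * W u + 12 * r * W u * t ^+ 2 + 2 * r ^+ 2 * W u * t ^+ 4.
 pose a := u / S; pose b2 := r * t ^+ 2.
 have bE : b2 = (s * t / S) ^+ 2 by rewrite /b2 /r -s2; field; rewrite gt_eqF.
 have -> : W (u + s * t) + W (u - s * t) = 2 * ((a ^+ 2 + 1 + b2) ^+ 2 + 4 * a ^+ 2 * b2).
  by rewrite bE /W /a; field; rewrite gt_eqF.
 have -> : 2 * W u + 12 * r * W u * t ^+ 2 + 2 * r ^+ 2 * W u * t ^+ 4 = 2 * (W u * (1 + 6 * b2 + b2 ^+ 2)).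
  by rewrite /b2; ring. rewrite ler_pM2l// /W -/a. have a0 : 0 <= a ^+ 2 by pos.
 have b0 : 0 <= b2 by pos. set p := a ^+ 2 in a0 *.
 have -> : (p + 1) ^+ 2 * (1 + 6 * b2 + b2 ^+ 2) = (p + 1 + b2) ^+ 2 + 4 * p * b2 +
  (b2 * (4 * p ^+ 2 + 6 * p + 4 + (p ^+ 2 + 2 * p) * b2 + 2 * p ^+ 2 )). by ring.
 have p2 : 0 <= p ^+ 2 by pos. have pb : 0 <= (p ^+ 2 + 2 * p) * b2 by pos.
 by rewrite lerDl mulr_ge0//; lra.
have m2 : mfunT (fun t : R => 12 * r * W u * t ^+ 2) by exact: mfM.
have m4 : mfunT (fun t : R => 2 * r ^+ 2 * W u * t ^+ 4). by apply: mfM => //; exact: mfX.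
have p2 : 0 <= 12 * r * W u by pos.
have p4 : 0 <= 2 * r ^+ 2 * W u by pos.
apply: (@le_trans _ _ (\int[stdnormal R]_t (2 * W u + 12 * r * W u * t ^+ 2 + 2 * r ^+ 2 * W u * t ^+ 4)%:E)%E).
 apply: le_integral_EFin => //.
 - exact: measurable_even.
 - by apply: mfD => //; exact: mfD.
 - pos.
under eq_integral do rewrite EFinD EFinD.
have e4 t : 0 <= t ^+ 4 :> R by rewrite exprn_even_ge0.
rewrite ge0_integralD//; try by move=> t _; rewrite ?adde_ge0// lee_fin mulr_ge0 ?sqr_ge0.
2: by apply: emeasurable_funD => //; exact/mEFinP.
2: exact/mEFinP.
rewrite ge0_integralD//; try by move=> t _; rewrite lee_fin mulr_ge0 ?sqr_ge0.
2: exact/mEFinP.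
rewrite -[X in (X + _ + _)%E]/(\int[stdnormal R]_t cst (2 * W u)%:E t)%E integral_prob_cst.
rewrite (@integralZ_EFin _ _ _ _ _ (12 * r * W u) (fun t : R => t ^+ 2))//; last pos.
rewrite (@integralZ_EFin _ _ _ _ _ (2 * r ^+ 2 * W u) (fun t : R => t ^+ 4))//.
apply: (@le_trans _ _ ((2 * W u)%:E + (12 * r * W u)%:E * 1%:E + (2 * r ^+ 2 * W u)%:E * 48%:E)%E).
 apply: leeD; first by apply: leeD => //; apply: lee_wpmul2l; [rewrite lee_fin|exact: stdnormal_second_moment].
 by apply: lee_wpmul2l; [rewrite lee_fin|exact: stdnormal_fourth_moment].
by rewrite -!EFinM -!EFinD lee_fin le_eqVlt; apply/orP; left; apply/eqP; ring.
Qed.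

Let mcoord (F : R -> R) : mfunT F -> mfunT (fun v : 'rV[R]_d.+1 => (F (v ord0 ord0))%:E).
Proof. by move=> mF; apply/mEFinP; exact: (mcompT mF (mcoord_rV ord0)). Qed.

Let msec (F : R -> R) k : mfunT F -> mfunT (fun w => (F (x k w ord0 ord0))%:E).
Proof. by move=> mF; exact: (mcompT (mcoord mF) (mfunPT (x k))). Qed.

Let V k := (\int[P]_w (x k w ord0 ord0 ^+ 2)%:E)%E.
Let U k := (\int[P]_w (W (x k w ord0 ord0))%:E)%E.

Let mdrift_int (F : R -> R) k : mfunT F -> (forall a, 0 <= F a) ->
 mfunT (fun w => \int[gauss R d.+1]_z (F ((drift c (x k w) + s *: z) ord0 ord0))%:E)%E.
Proof.
move=> mF F0.
have mG : mfunT (fun p : 'rV[R]_d.+1 * 'rV[R]_d.+1 => (F ((drift c p.1 + s *: p.2) ord0 ord0))%:E).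
 apply: (mcompT (mcoord mF)); apply: mrVD.
  by apply: (mcompT (@measurable_drift _ _ _)); exact: mfst. mes.
have mI := @mfubini_F _ _ _ _ R (gauss R d.+1)
 (fun p : 'rV[R]_d.+1 * 'rV[R]_d.+1 => (F ((drift c p.1 + s *: p.2) ord0 ord0))%:E).
have F0' (p : 'rV[R]_d.+1 * 'rV[R]_d.+1) : (0 <= (F ((drift c p.1 + s *: p.2) ord0 ord0))%:E)%E by pos.
have := mcompT (mI mG F0') (mfunPT (x k)).
exact.
Qed.

Let V_lower k : (V 0 <= V k + (2 * c * k%:R)%:E)%E.
Proof.
elim: k => [|k IH]; first by rewrite mulr0 adde0.
apply: (le_trans IH).
have hV : (V k <= V k.+1 + (2 * c)%:E)%E.
 rewrite [V k.+1](ge0_lmc_step h0 lmc k (mcoord msq)); last pos.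
 rewrite -(integral_prob_cst P (2 * c)%:E) -ge0_integralD//;
  try by (move=> w _; apply: integral_ge0 => z _; rewrite lee_fin sqr_ge0).
 2: by apply: (@mdrift_int (fun a => a ^+ 2)) => // a; exact: sqr_ge0.
 2: by move=> w _; rewrite lee_fin mulr_ge0 ?c0. apply: ge0_le_integral => //.
 - pos.
 - exact: (msec k msq).
 - apply: emeasurable_funD; last mes.
  by apply: (@mdrift_int (fun a => a ^+ 2)) => // a; exact: sqr_ge0.
apply: (le_trans (leeD2r _ hV)); rewrite -addeA -EFinD leeD2l// lee_fin -natr1.
by apply: eq_ler; ring.
Qed.

Let U_upper k : (U k <= (98 * (1 + 6 * r + 48 * r ^+ 2) ^+ k)%:E)%E.
Proof.
have b0 : 0 <= 1 + 6 * r + 48 * r ^+ 2 by have := r0; have := sqr_ge0 r; lra.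
have Ws := W_step; set b := 1 + 6 * r + 48 * r ^+ 2 in b0 Ws *.
elim: k => [|k IH]. rewrite mulr1; have -> : U 0 = (\int[stdnormal R]_t ((t ^+ 2 + 1) ^+ 2)%:E)%E.
  transitivity (\int[distribution P (x 0%N)]_v (W (v ord0 ord0))%:E)%E.
   rewrite ge0_integral_distribution//; first exact: mcoord. pos.
  transitivity (\int[distribution (gauss R d.+1) (mfun_Sub (mem_set (@mrVZ _ _ _ _ (fun=> S) (fun z : 'rV[R]_d.+1 => z) (@mcst _ _ _ _ _ S) (@measurable_id _ _ _))))]_v (W (v ord0 ord0))%:E)%E.
   by apply: eq_measure_integral => A mA _; exact: x0law.
  rewrite ge0_integral_distribution//=; last 2 first.
  - exact: mcoord.
  - pos. rewrite -(@gauss_coord _ d (fun t => ((t ^+ 2 + 1) ^+ 2)%:E)); last 2 first.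
  - by apply/mEFinP; apply: mfX; apply: mfD.
  - pos. by apply: eq_integral => z _; rewrite /W mxE mulrAC divff ?gt_eqF// mul1r.
 have m4 : mfunT (fun t : R => 2 * t ^+ 4) by apply: mfM => //; exact: mfX.
 (* 98 = 2 * 48 + 2. *)
 apply: (@le_trans _ _ (\int[stdnormal R]_t (2 * t ^+ 4 + 2)%:E)%E). apply: le_integral_EFin => //.
  - by apply: mfX; apply: mfD.
  - exact: mfD.
  - pos.
  - by move=> t _; have := sqr_ge0 (t ^+ 2 - 1); rewrite (_ : t ^+ 4 = t ^+ 2 * t ^+ 2); [set a := t ^+ 2; nra|ring].
 under eq_integral do rewrite EFinD. have e4 t : 0 <= t ^+ 4 :> R by rewrite exprn_even_ge0.
 rewrite ge0_integralD//; try by move=> t _; rewrite lee_fin mulr_ge0. 2: exact/mEFinP.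
 rewrite integralZ_EFin//.
 rewrite -[X in (_ + X)%E]/(\int[stdnormal R]_t cst 2%:E t)%E integral_prob_cst.
 apply: (@le_trans _ _ (2%:E * 48%:E + 2%:E)%E); last by rewrite -EFinM -EFinD lee_fin; lra.
 by apply: leeD => //; apply: lee_wpmul2l; [rewrite lee_fin|exact: stdnormal_fourth_moment].
have hU : (U k.+1 <= b%:E * U k)%E. rewrite [U k.+1](ge0_lmc_step h0 lmc k (mcoord mW)); last pos.
 rewrite /U -ge0_integralZl//; last 2 first.
 - exact: msec.
 - pos. apply: ge0_le_integral => //.
 - by move=> w _; apply: integral_ge0 => z _; rewrite lee_fin.
 - exact: mdrift_int.
 - by apply: emfunM; [exact: mcst|exact: msec].
 - by move=> w _; rewrite -EFinM; exact: Ws.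
apply: (le_trans hU); rewrite exprS mulrCA EFinM; apply: lee_wpmul2l => //.
Qed.

Let V0_ge : ((S ^+ 2 / 8)%:E <= V 0)%E.
Proof.
have -> : V 0 = (\int[stdnormal R]_t (S ^+ 2 * t ^+ 2)%:E)%E.
 transitivity (\int[distribution P (x 0%N)]_v (v ord0 ord0 ^+ 2)%:E)%E.
  rewrite ge0_integral_distribution//; first exact: (mcoord msq). pos.
 transitivity (\int[distribution (gauss R d.+1) (mfun_Sub (mem_set (@mrVZ _ _ _ _ (fun=> S) (fun z : 'rV[R]_d.+1 => z) (@mcst _ _ _ _ _ S) (@measurable_id _ _ _))))]_v (v ord0 ord0 ^+ 2)%:E)%E.
  by apply: eq_measure_integral => A mA _; exact: x0law.
 rewrite ge0_integral_distribution//=; last 2 first.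
 - exact: (mcoord msq).
 - pos. rewrite -(@gauss_coord _ d (fun t => (S ^+ 2 * t ^+ 2)%:E)); last 2 first.
 - by apply/mEFinP; exact: mfM.
 - by move=> t; rewrite lee_fin mulr_ge0// sqr_ge0.
 by apply: eq_integral => z _; rewrite mxE exprMn.
rewrite integralZ_EFin//; last 2 first.
- pos.
- pos.
by rewrite EFinM; apply: lee_wpmul2l; [rewrite lee_fin sqr_ge0|exact: stdnormal_second_moment_ge].
Qed.

(** Up to this time the second moment is still at least 3 S^2 / 32 and the mean of [W] at most 200.
    Taking means in the pointwise bound [pt], with 200 / 6400 = 1/32, leaves S^2 / 32 <= 1600 S^2
    P(A), and 32 * 1600 = 80 * 640. *)
Lemma lmc_spread k : k%:R * h <= S ^+ 2 / (216 * n) ->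
 (((80 * 640)^-1)%:E <= P (x k @^-1` [set v : 'rV[R]_d.+1 | (S ^+ 2 / 32 < v ord0 ord0 ^+ 2)%R]))%E.
Proof.
move=> hk; have nu1' := nu1; have r0' := r0; have h0' := h0.
have n2 : 2 <= n by rewrite /n -natr1; have : 0 <= d%:R :> R by []; lra.
have S2 : 0 < S ^+ 2 by pos.
have hk1 : k%:R * h * (216 * n) <= S ^+ 2 by rewrite -ler_pdivlMr// mulr_gt0//; lra.
have kh0 : 0 <= k%:R * h by pos.
have hkc : 2 * c * k%:R <= S ^+ 2 / 32.
 by rewrite (_ : 2 * c * k%:R = 2 * (k%:R * h * n)); [nra|rewrite /c; ring].
have r1 : r <= 1. rewrite /r ler_pdivrMr// mul1r; have : 1 <= S ^+ 2 by rewrite exprn_ege1.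
 by have := c1; rewrite /c; nra.
have U2 : (U k <= 200%:E)%E. apply: (le_trans (U_upper k)); rewrite lee_fin.
 have e1 : (1 + 6 * r + 48 * r ^+ 2) ^+ k <= expR (k%:R * (54 * r)).
  rewrite expRM_natl; apply: lerXn2r; rewrite ?nnegrE ?expR_ge0//. by have := sqr_ge0 r; lra.
  by apply: (le_trans _ (expR_ge1Dx (54 * r))); nra. have e2 : k%:R * (54 * r) <= 2^-1.
  rewrite (_ : _ * _ = k%:R * h * 108 / S ^+ 2); last by rewrite /r; field; rewrite gt_eqF.
  by rewrite ler_pdivrMr//; nra. have e3 : expR (2^-1) <= 2 :> R.
  have := expR_ge1Dx (- 2^-1 : R); rewrite expRN => h1.
  by rewrite -[leLHS]invrK -[leRHS]invrK lef_pV2 ?posrE ?invr_gt0 ?expR_gt0//; lra.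
 have e4 : expR (k%:R * (54 * r)) <= 2 by apply: le_trans e3; rewrite ler_expR. by lra.
set A := [set v | _].
have mA : measurable A.
 rewrite (_ : A = (fun v : 'rV[R]_d.+1 => v ord0 ord0 ^+ 2) @^-1` `]S ^+ 2 / 32, +oo[%classic); last first.
  by apply/seteqP; split => v /=; rewrite in_itv/= andbT. apply: mpreimage; last mes.
 exact: (mcompT msq (mcoord_rV ord0)).
have mA' : measurable (x k @^-1` A) by mes.
(* Paley-Zygmund in additive form. With y = (a / S)^2, on A one uses y + 1 <= ((y + 1) / 80)^2 +
   40^2, and off A simply y <= 1/32. *)
have pt w : x k w ord0 ord0 ^+ 2 <= S ^+ 2 * 32^-1 + (S ^+ 2 / (80 * 80) * W (x k w ord0 ord0) + S ^+ 2 * (40 * 40) * \1_(x k @^-1` A) w).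
 set a := x k w ord0 ord0; pose y := (a / S) ^+ 2.
 have aE : a ^+ 2 = S ^+ 2 * y by rewrite /y; field; rewrite gt_eqF. have y0 : 0 <= y by pos.
 have -> : S ^+ 2 / (80 * 80) * W a = S ^+ 2 * ((y + 1) ^+ 2 / (80 * 80)) by rewrite /W -/y; ring.
 rewrite -[_ * (40 * 40) * _]mulrA aE -!mulrDr ler_pM2l// indicE; case: (boolP (w \in _)) => [_|/negP hw].
  by rewrite mulr1; have := sqr_ge0 (y + 1 - (32 * 100)); nra. have : y <= 32^-1.
  rewrite leNgt; apply/negP => h1; apply: hw; apply/mem_set; suff : S ^+ 2 / 32 < a ^+ 2 by [].
  by rewrite aE ltr_pM2l. by rewrite /= mulr0 => hy; have := sqr_ge0 (y + 1); lra.
have k1 : 0 <= S ^+ 2 / (80 * 80) by lra.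
have k2 : 0 <= S ^+ 2 * (40 * 40) by lra.
have hV : (V k <= (S ^+ 2 * 32^-1)%:E + ((S ^+ 2 / (80 * 80))%:E * U k + (S ^+ 2 * (40 * 40))%:E * P (x k @^-1` A)))%E.
 have mI : mfunT (fun w => \1_(x k @^-1` A) w : R) by exact: mindic.
 have mWx : mfunT (fun w => W (x k w ord0 ord0)) by apply/mEFinP; exact: msec.
 rewrite -(setIT (x k @^-1` A)) -integral_indic// /U -!integralZ_EFin//; try (by rewrite !mulr_ge0 ?ltW ?invr_ge0); try (by rewrite divr_ge0// ltW).
 rewrite -(integral_prob_cst P (S ^+ 2 * 32^-1)%:E) -!ge0_integralD//.
 - apply: ge0_le_integral => //.
  + pos.
  + exact: (msec k msq).
  + apply: emeasurable_funD; first mes. by apply: emeasurable_funD; apply/mEFinP; exact: mfM.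
  + by move=> w _; rewrite -!EFinD lee_fin; exact: pt.
 - by move=> w _; rewrite lee_fin; have := ltW S2; lra.
 - move=> w _; have a0 := ltW S2; have w0 := W0 (x k w ord0 ord0).
  by apply: adde_ge0; rewrite lee_fin; apply: mulr_ge0.
 - by apply: emeasurable_funD; apply/mEFinP; exact: mfM.
 - by move=> w _; rewrite lee_fin; apply: mulr_ge0.
 - by apply/mEFinP; exact: mfM.
 - by move=> w _; rewrite lee_fin; apply: mulr_ge0.
 - by apply/mEFinP; exact: mfM.
have hU : ((S ^+ 2 / (80 * 80))%:E * U k <= (S ^+ 2 / 32)%:E)%E.
 apply: (@le_trans _ _ ((S ^+ 2 / (80 * 80))%:E * 200%:E)%E).
  by apply: lee_wpmul2l => //; rewrite lee_fin divr_ge0// ltW. by rewrite -EFinM lee_fin; lra.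
have pE : P (x k @^-1` A) = (fine (P (x k @^-1` A)))%:E by rewrite fineK// fin_num_measure.
have := le_trans V0_ge (le_trans (V_lower k) (leeD2r _ (le_trans hV (leeD2l _ (leeD2r _ hU))))).
rewrite pE -EFinM -!EFinD !lee_fin => h1.
rewrite -(@ler_pM2l _ (S ^+ 2))//; lra.
Qed.

End spread.

(** * Mass and tails of the target *)

Section gibbs_estimates.
Context (R : realType).

Lemma normal_peak_expR (w : R) : normal_peak (expR w) = expR (- w) * normal_peak 1.
Proof.
rewrite /normal_peak -!mulrnAr [Num.sqrt (expR w ^+ 2 * _)]sqrtrM ?sqr_ge0//.
by rewrite sqrtr_sqr ger0_norm ?expR_ge0// expr1n mul1r invfM expRN.
Qed.

Lemma expR_half_le2 : expR 2^-1 <= 2 :> R.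
Proof.
have := expR_ge1Dx (- 2^-1 : R); rewrite expRN => h1.
by rewrite -[leLHS]invrK -[leRHS]invrK lef_pV2 ?posrE ?invr_gt0 ?expR_gt0//; lra.
Qed.

(** Enlarging the scale from e^a to e^w loses only the normalisation e^(d (w - a)) <= e, since the
    exponential factor increases. *)
Lemma gpdf_scale_le d (a w : R) (y : 'rV[R]_d) : a <= w -> d%:R * (w - a) <= 1 ->
 gpdf 0 (expR a) y <= expR 1 * gpdf 0 (expR w) y.
Proof.
move=> aw dw; rewrite !gpdfE ?gt_eqF ?expR_gt0// !normal_peak_expR !exprMn -!expRM_natl.
have p0 : 0 <= normal_peak 1 ^+ d :> R by rewrite exprn_ge0// normal_peak_ge0.
set N := normal_peak 1 ^+ d in p0 *; set z := sqnorm2 _; have z0 : 0 <= z by exact: sqnorm2_ge0.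
rewrite (_ : expR (d%:R * - a) * N * _ = N * expR (d%:R * - a + - z / (expR (2%:R * a) *+ 2))); last first.
 by rewrite expRD; ring.
rewrite (_ : expR 1 * _ = N * expR (1 + d%:R * - w + - z / (expR (2%:R * w) *+ 2))); last first.
 by rewrite !expRD; ring.
rewrite ler_wpM2l// ler_expR.
have h : z / (expR (2%:R * w) *+ 2) <= z / (expR (2%:R * a) *+ 2).
 rewrite ler_wpM2l// lef_pV2 ?posrE ?pmulrn_lgt0 ?expR_gt0//.
 by rewrite ler_pMn2r// ler_expR ler_pM2l.
by rewrite !mulNr; lra.
Qed.

Lemma measurable_scale d (s : R) : measurable_fun [set: 'rV[R]_d] (fun z : 'rV[R]_d => s *: z).
Proof. by apply: (@mrVZ _ _ _ _ (fun=> _) (fun y => y)). Qed.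

Lemma measurable_scale_preimage d (s : R) (A : set 'rV[R]_d) : measurable A ->
 measurable ((fun z : 'rV[R]_d => s *: z) @^-1` A).
Proof. by move=> mA; have := @measurable_scale d s measurableT _ mA; rewrite setTI. Qed.

Lemma gauss_scale_indic d (s : R) (A : set 'rV[R]_d) : measurable A ->
 gauss R d ((fun z : 'rV[R]_d => s *: z) @^-1` A) = (\int[gauss R d]_z (\1_A (s *: z))%:E)%E.
Proof.
move=> mA; have mA' : measurable ((fun z : 'rV[R]_d => s *: z) @^-1` A) by exact: measurable_scale_preimage.
by rewrite -[in LHS](setIT (_ @^-1` A)) -integral_indic.
Qed.

Lemma gauss_scale_le d (a w : R) (A : set 'rV[R]_d) : measurable A -> a <= w -> d%:R * (w - a) <= 1 ->
 (gauss R d ((fun z : 'rV[R]_d => expR a *: z) @^-1` A) <=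
 (expR 1)%:E * gauss R d ((fun z : 'rV[R]_d => expR w *: z) @^-1` A))%E.
Proof.
move=> mA aw dw; rewrite !gauss_scale_indic//.
have mI : mfunT (fun y : 'rV[R]_d => (\1_A y : R)%:E) by exact/mEFinP.
have I0 (y : 'rV[R]_d) : (0 <= (\1_A y : R)%:E)%E by rewrite lee_fin.
have e b : (\int[gauss R d]_z (\1_A (expR b *: z) : R)%:E =
  \int[lebesgue_rV R d]_y (\1_A y * gpdf 0 (expR b) y)%:E)%E.
 have := @ge0_gauss_affine R d 0 (expR b) _ (expR_gt0 b) mI I0.
 by under eq_integral do rewrite add0r; move=> ->; apply: eq_integral => y _; rewrite -EFinM.
rewrite !e -integralZ_EFin ?expR_ge0//; last 2 first.
- by apply: mfM; [exact: mindic|exact: mgpdf].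
- by move=> y; rewrite mulr_ge0// gpdf_ge0.
apply: le_integral_EFin => //.
- by apply: mfM; [exact: mindic|exact: mgpdf].
- apply: mfM => //. by apply: mfM; [exact: mindic|exact: mgpdf].
- by move=> y; rewrite mulr_ge0// gpdf_ge0.
- by move=> y _; rewrite mulrCA ler_wpM2l//; exact: gpdf_scale_le.
Qed.

Lemma measurable_gauss_scale d (F : 'rV[R]_d -> \bar R) : mfunT F -> (forall v, 0 <= F v)%E ->
 measurable_fun [set: R] (fun w => \int[gauss R d]_z F (expR w *: z)%R)%E.
Proof.
move=> mF F0.
have mG : mfunT (fun p : R * 'rV[R]_d => F (expR p.1 *: p.2)).
 apply: (mcompT mF); apply: mrVZ; last exact: msnd. exact: (mcompT (@measurable_expR R) mfst).
exact: (@mfubini_F _ _ _ _ R (gauss R d) (fun p : R * 'rV[R]_d => F (expR p.1 *: p.2)) mG (fun p => F0 _)).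
Qed.

Variables (d : nat) (nu : R) (pi : probability 'rV[R]_d R).
Hypotheses (nu1 : 1 <= nu) (gpi : is_gibbs (V_nu nu) pi).
Let n : R := d%:R + nu.

(** Keep only the scales with w in [a, a + 1/n] in the mixture. In 5/2, one unit is for comparing
    the Gaussians, one for nu (w - a), and 1/2 for the double exponential; n is the inverse length
    of the window. *)
Lemma gauss_le_gibbs (a : R) (A : set 'rV[R]_d) : 0 <= a -> measurable A ->
 (gauss R d ((fun z : 'rV[R]_d => expR a *: z) @^-1` A) <=
 (mixM nu * n * expR (nu * a + 5 / 2))%:E * pi A)%E.
Proof.
move=> a0 mA; have nu1' := nu1; have d0 : 0 <= d%:R :> R by [].
have n0 : 0 < n by rewrite /n; lra.
have M0 := mixM_gt0 nu1.
pose g b := gauss R d ((fun z : 'rV[R]_d => expR b *: z) @^-1` A).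
have gE b : g b = (fine (g b))%:E by rewrite fineK// fin_num_measure//; exact: measurable_scale_preimage.
have g0 b : 0 <= fine (g b) by rewrite fine_ge0.
rewrite -/(g a) gE.
pose D : set R := `[a, a + n^-1]%classic.
have mD : measurable D by exact: mitv.
have mI : mfunT (fun y : 'rV[R]_d => (\1_A y : R)%:E) by exact/mEFinP.
have I0 (y : 'rV[R]_d) : (0 <= (\1_A y : R)%:E)%E by rewrite lee_fin.
have mg : mfunT g. rewrite (_ : g = fun w => \int[gauss R d]_z (\1_A (expR w *: z) : R)%:E)%E.
  exact: (measurable_gauss_scale mI I0). by apply/funext => w; rewrite /g gauss_scale_indic.
have piE : pi A = ((mixM nu)^-1%:E * \int[lebR R]_w ((mixw nu w)%:E * g w))%E.
 rewrite -(setIT A) -integral_indic// (gibbs_mixture nu1 gpi mI I0); congr (_ * _)%E.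
 by apply: eq_integral => w _; rewrite /g gauss_scale_indic.
pose kap := expR (- nu * a - 5 / 2) * fine (g a).
have kap0 : 0 <= kap by rewrite mulr_ge0// expR_ge0.
have low : ((kap / n)%:E <= \int[lebR R]_w ((mixw nu w)%:E * g w))%E.
 apply: (@le_trans _ _ (\int[lebR R]_(w in D) ((mixw nu w)%:E * g w))%E); last first.
  apply: ge0_subset_integral => //.
  - by apply: emfunM => //; apply/mEFinP; exact: mmixw.
  - by move=> w _; rewrite mule_ge0// lee_fin mixw_ge0.
 apply: (@le_trans _ _ (\int[lebR R]_(w in D) (cst kap%:E) w)%E).
  rewrite integral_cst// [X in (_ <= _ * X)%E](lebR_itvcc (_ : a <= a + n^-1)); last first.
   by rewrite lerDl invr_ge0 ltW. by rewrite -EFinM addrAC subrr add0r.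
 apply: ge0_le_integral => //.
 - apply: mfTS; apply: emfunM => //. by apply/mEFinP; exact: mmixw.
 - move=> w; rewrite /D /= in_itv/= => /andP[aw wa]. have dw : d%:R * (w - a) <= 1.
   apply: (@le_trans _ _ (n * n^-1)); last by rewrite divff// gt_eqF.
   by apply: ler_pM => //; rewrite ?subr_ge0// /n; lra. have nw : nu * (w - a) <= 1.
   apply: (@le_trans _ _ (n * n^-1)); last by rewrite divff// gt_eqF.
   by apply: ler_pM => //; rewrite ?subr_ge0// /n; lra.
  have h1 := gauss_scale_le mA aw dw; rewrite -/(g a) -/(g w) gE (gE w) -EFinM lee_fin in h1.
  rewrite (gE w) -EFinM lee_fin. have h2 : expR (- nu * a - 3 / 2) <= mixw nu w.
   rewrite /mixw ler_expR. have : expR (- 2 * w) <= 1 by rewrite -[leRHS]expR0 ler_expR; lra.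
   by lra. apply: (@le_trans _ _ (expR (- nu * a - 3 / 2) * fine (g w))); last by rewrite ler_wpM2r.
  rewrite /kap (_ : - nu * a - 5 / 2 = (- nu * a - 3 / 2) - 1); last by field.
  rewrite expRD -mulrA ler_pM2l ?expR_gt0// expRN.
  by rewrite -ler_pdivlMl ?invr_gt0 ?expR_gt0// invrK.
rewrite piE; apply: (@le_trans _ _ ((mixM nu * n * expR (nu * a + 5 / 2))%:E * ((mixM nu)^-1%:E * (kap / n)%:E))%E).
 rewrite -!EFinM lee_fin /kap le_eqVlt; apply/orP; left; apply/eqP.
 have e1 : expR (nu * a + 5 / 2) * expR (- nu * a - 5 / 2) = 1.
  by rewrite -expRD (_ : _ + _ = 0) ?expR0//; ring.
 rewrite (_ : _ * _ * _ * (_ * _) = (expR (nu * a + 5 / 2) * expR (- nu * a - 5 / 2)) * fine (g a)).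
  by rewrite e1 mul1r. by field; rewrite !gt_eqF.
apply: lee_wpmul2l; first by rewrite lee_fin !mulr_ge0 ?expR_ge0// ltW.
by apply: lee_wpmul2l => //; rewrite lee_fin invr_ge0 ltW.
Qed.

End gibbs_estimates.

Section gibbs_tail.
Context (R : realType) (d : nat) (nu : R) (pi : probability 'rV[R]_d.+1 R).
Hypotheses (nu2 : 2 <= nu) (gpi : is_gibbs (V_nu nu) pi).

Let measurable_slab (r : R) : measurable [set v : 'rV[R]_d.+1 | r ^+ 2 < v ord0 ord0 ^+ 2].
Proof.
rewrite (_ : mkset _ = (fun v : 'rV[R]_d.+1 => v ord0 ord0 ^+ 2) @^-1` `]r ^+ 2, +oo[%classic); last first.
 by apply/seteqP; split => v /=; rewrite in_itv/= andbT.
apply: mpreimage; last exact: mitv.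
by apply: mfX; exact: mcoord_rV.
Qed.

(** Split at the scale sqrt(r): larger scales have mass at most 4 r^(- nu / 2) <= 4 / r as nu >= 2,
    and at smaller ones Chebyshev gives 1 / r. *)
Lemma gibbs_tail (r : R) : 1 <= r ->
 (pi [set v : 'rV[R]_d.+1 | (r ^+ 2 < v ord0 ord0 ^+ 2)%R] <= (5 / r)%:E)%E.
Proof.
move=> r1; have nu2' := nu2; have nu1 : 1 <= nu by lra.
have nu0 : 0 < nu by lra.
have r0 : 0 < r by lra.
set A := mkset _; have mA : measurable A by exact: measurable_slab.
have mI : mfunT (fun y : 'rV[R]_d.+1 => (\1_A y : R)%:E) by exact/mEFinP.
have I0 (y : 'rV[R]_d.+1) : (0 <= (\1_A y : R)%:E)%E by rewrite lee_fin.
have M0 := mixM_gt0 nu1.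
pose t := ln r / 2; pose D : set R := `[t, +oo[%classic.
have mD : measurable D by exact: mitv.
have pt w : (\int[gauss R d.+1]_z (\1_A (expR w *: z) : R)%:E <= (\1_D w + r^-1)%:E)%E.
 have r'0 : 0 <= r^-1 by rewrite invr_ge0 ltW. have [tw|wt] := leP t w.
  apply: (@le_trans _ _ 1%E); last first.
   by rewrite lee_fin indicE mem_set/= ?lerDl// /D /= in_itv/= tw.
  rewrite -gauss_scale_indic//; apply: probability_le1. exact: measurable_scale_preimage.
 rewrite (_ : \1_D w = 0) ?add0r; last first.
  by rewrite indicE memNset// /D /= in_itv/= andbT; apply/negP; rewrite -ltNge.
 apply: (@le_trans _ _ (\int[gauss R d.+1]_z (r^-1 * z ord0 ord0 ^+ 2)%:E)%E).
  apply: le_integral_EFin => //.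
  - exact: (mcompT (mindic mA) (@measurable_scale R d.+1 (expR w))).
  - apply: mfM => //; apply: mfX; exact: mcoord_rV.
  - move=> z _; rewrite indicE; case: (boolP (_ \in _)) => [/set_mem|_]; last first.
    by rewrite mulr_ge0// sqr_ge0. rewrite /A /= mxE exprMn => h. have e2 : expR w ^+ 2 <= r.
    rewrite -expRM_natl -[leRHS]lnK ?posrE// ler_expR; move: wt; rewrite /t; lra.
   rewrite ler_pdivlMl// mulr1 ltW// -(@ltr_pM2l _ r)// -expr2; apply: (lt_le_trans h).
   by rewrite ler_wpM2r// sqr_ge0.
 rewrite (@gauss_coord _ d (fun t => (r^-1 * t ^+ 2)%:E)); last 2 first.
 - by apply/mEFinP; apply: mfM.
 - by move=> u; rewrite lee_fin mulr_ge0// sqr_ge0.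
 rewrite integralZ_EFin//; last by move=> u; exact: sqr_ge0.
 rewrite -[leRHS]mule1; apply: lee_wpmul2l; first by rewrite lee_fin.
 exact: stdnormal_second_moment.
have mm := mmixw nu.
rewrite -(setIT A) -integral_indic// (gibbs_mixture nu1 gpi mI I0).
apply: (@le_trans _ _ ((mixM nu)^-1%:E * (\int[lebR R]_w (mixw nu w * \1_D w)%:E + \int[lebR R]_w (r^-1 * mixw nu w)%:E))%E).
 apply: lee_wpmul2l; first by rewrite lee_fin invr_ge0 ltW.
 rewrite -ge0_integralD//; try by move=> w _; rewrite lee_fin mulr_ge0 ?mixw_ge0 ?invr_ge0 ?(ltW r0).
 - apply: ge0_le_integral => //.
  + by move=> w _; rewrite mule_ge0 ?lee_fin ?mixw_ge0//; apply: integral_ge0.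
  + by apply: emfunM; [exact/mEFinP|exact: (measurable_gauss_scale mI I0)].
  + by apply: emeasurable_funD; apply/mEFinP; exact: mfM.
  + move=> w _; rewrite -EFinD [r^-1 * _]mulrC -mulrDr EFinM; apply: lee_wpmul2l; last exact: pt.
   by rewrite lee_fin mixw_ge0.
 - by apply/mEFinP; exact: mfM.
 - by apply/mEFinP; exact: mfM.
have e1 : (\int[lebR R]_w (mixw nu w * \1_D w)%:E <= (expR (- nu * t) / nu)%:E)%E.
 apply: (le_trans _ (mixw_tail t nu0)); rewrite [leRHS]integral_mkcond.
 rewrite le_eqVlt; apply/orP; left; apply/eqP; apply: eq_integral => w _.
 by rewrite patchE indicE; case: ifP => _; rewrite ?mulr1 ?mulr0.
rewrite integralZ_EFin ?invr_ge0 ?(ltW r0)//; last by move=> w; exact: mixw_ge0.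
rewrite -(mixME nu0).
apply: (@le_trans _ _ ((mixM nu)^-1%:E * ((expR (- nu * t) / nu)%:E + r^-1%:E * (mixM nu)%:E))%E).
 by apply: lee_wpmul2l; [rewrite lee_fin invr_ge0 ltW|exact: leeD2r].
rewrite -(EFinM r^-1) -EFinD -EFinM lee_fin mulrDr [X in _ + X](_ : _ = r^-1); last first.
 by field; rewrite !gt_eqF.
have hM : (mixM nu)^-1 <= 4 * nu. have := mixM_lower nu1; rewrite -(mixME nu0) lee_fin => h.
 have e3 := expR_half_le2 R.
 rewrite -[leRHS]invrK lef_pV2 ?posrE ?invr_gt0 ?mulr_gt0//; apply: le_trans h.
 rewrite expRN -invfM lef_pV2 ?posrE ?mulr_gt0 ?expR_gt0//; nra.
have ht : expR (- nu * t) <= r^-1. rewrite -[r in r^-1]lnK ?posrE// -expRN ler_expR /t.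
 have : 0 <= ln r by rewrite ln_ge0. by nra.
have p1 : (mixM nu)^-1 * (expR (- nu * t) / nu) <= 4 * nu * (r^-1 / nu).
 apply: ler_pM => //; rewrite ?invr_ge0 ?divr_ge0 ?expR_ge0 ?(ltW M0) ?(ltW nu0)//.
 by rewrite ler_wpM2r// invr_ge0 ltW.
apply: (le_trans (lerD p1 (lexx _))).
by rewrite le_eqVlt; apply/orP; left; apply/eqP; field; rewrite !gt_eqF.
Qed.

End gibbs_tail.

(** * Lower bounds on the two complexities *)

Section lower_bound.
Context (R : realType) (d : nat) (q nu D : R) (pi : probability 'rV[R]_d.+1 R).
Hypotheses (q2 : 2 <= q) (nu2 : 2 <= nu) (gpi : is_gibbs (V_nu nu) pi).
Let n : R := d.+1%:R + nu.
Let L := ln n.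
Hypothesis D105 : 105 * (1 + nu * L) <= D.
(** Logarithm of the starting scale. The margin 5 L, worth 5 nu L in the exponent, pays for the
    constant of [gauss_le_gibbs], that is, for [mixM nu] and n. *)
Let a := D / nu - 5 * L.
Let S := expR a.

Let n2 : 2 <= n. Proof. by rewrite /n; have : 0 <= d.+1%:R :> R by []; have h := nu2; lra. Qed.
Let n0 : 0 < n. Proof. by have h := n2; lra. Qed.
Let nE : n = expR L. Proof. by rewrite lnK// posrE. Qed.

Let L2 : 2^-1 <= L.
Proof. by rewrite -ler_expR -nE; apply: le_trans n2; exact: expR_half_le2. Qed.

Let DL : 105 * L <= D / nu.
Proof.
have nu2' := nu2; have L2' := L2; have nu0 : 0 < nu by lra.
rewrite ler_pdivlMr//; apply: (le_trans _ D105); have : 0 <= nu * L by rewrite mulr_ge0; lra.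
by rewrite -mulrA [L * nu]mulrC; lra.
Qed.

(** From 105 - 5 = 100 and L >= 1/2; the size 105 is chosen to make S astronomically larger than the
    constants of [lmc_spread]. *)
Let a50 : 50 <= a.
Proof. by have h := DL; have h2 := L2; rewrite /a; lra. Qed.

Let S1 : 1 <= S.
Proof. by rewrite -[leLHS]expR0 ler_expR; have h := a50; lra. Qed.

Lemma wide_scale_ge1 : 1 <= S.
Proof. exact: S1. Qed.

Lemma wide_start (rho : probability 'rV[R]_d.+1 R) :
 (forall A, measurable A -> rho A = gauss R d.+1 ((fun z : 'rV[R]_d.+1 => S *: z) @^-1` A)) ->
 (renyi_oo rho pi <= D%:E)%E.
Proof.
move=> hrho; have nu2' := nu2; have L2' := L2; have nu1 : 1 <= nu by lra.
have nu0 : 0 < nu by lra.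
apply: renyi_oo_ge => A mA; rewrite hrho//.
have a0 : 0 <= a by have h := a50; lra.
apply: (le_trans (gauss_le_gibbs nu1 gpi a0 mA)); apply: lee_wpmul2r => //.
rewrite lee_fin -/n.
have hM : mixM nu <= expR ((nu + 1) / 2 * L + 1).
 have := mixM_bound nu0; rewrite -(mixME nu0) lee_fin => h; apply: (le_trans h).
 have h1 : expR ((nu + 1) / 2 * ln (nu + 1)) <= expR ((nu + 1) / 2 * L).
  rewrite ler_expR ler_wpM2l//; first by lra. rewrite ler_ln ?posrE//; last by lra.
  by rewrite /n -natr1; have : 0 <= d%:R :> R by []; lra.
 have h2 : nu^-1 <= 1 by rewrite invf_le1//. have h3 : 1 <= expR ((nu + 1) / 2 * L).
  by rewrite -[leLHS]expR0 ler_expR mulr_ge0//; lra. rewrite expRD; have h4 := expR_ge1Dx (1 : R).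
 by nra.
rewrite {1}nE; have hn := nE.
apply: (@le_trans _ _ (expR ((nu + 1) / 2 * L + 1) * expR L * expR (nu * a + 5 / 2))).
 by rewrite ler_wpM2r ?expR_ge0// ler_wpM2r ?expR_ge0.
rewrite -!expRD ler_expR.
have -> : nu * a = D - 5 * (nu * L) by rewrite /a; field; rewrite gt_eqF.
have : 2 * L <= nu * L by rewrite ler_wpM2r//; lra.
by lra.
Qed.

(** Powers of two: S >= e^50 >= 2^66 because 2 <= e^(3/4), while 80 * 640 < 2^17 and 9 * 30 < 2^9,
    and 34 + 9 <= 66. *)
Let cS : 3 ^+ 2 * (30 / S) < ((80 * 640)^-1) ^+ 2.
Proof.
pose t : R := 80 * 640; pose w : R := 3 ^+ 2 * 30.
have t0 : 0 < t by rewrite /t; lra.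
have w0 : 0 < w by rewrite /w !exprS expr0; lra.
have e2 : t ^+ 2 <= 2 ^+ 34. have -> : 2 ^+ 34 = (2 ^+ 17) ^+ 2 :> R by rewrite -exprM.
 by apply: lerXn2r; rewrite ?nnegrE ?exprn_ge0 ?(ltW t0)// /t !exprS expr0; lra.
have e3 : w < 2 ^+ 9 by rewrite /w !exprS expr0; lra.
have S0 : 0 < S by exact: expR_gt0.
have h : 2 ^+ 66 <= S. have -> : 2 ^+ 66 = (2 ^+ 4) ^+ 16 * 2 ^+ 2 :> R by rewrite -exprM -exprD.
 have h0 k : (2 : R) ^+ k <= expR (k%:R * (3 / 4)).
  by rewrite expRM_natl; apply: lerXn2r; rewrite ?nnegrE ?expR_ge0//; exact: two_le_expR.
 rewrite -exprM -exprD; apply: (le_trans (h0 _)); rewrite ler_expR. by have h3 := a50; lra.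
rewrite mulrA ltr_pdivrMr// -/t -/w exprVn mulrC ltr_pdivlMr ?exprn_gt0//.
apply: (@le_lt_trans _ _ (w * 2 ^+ 34)); first by rewrite ler_pM2l.
apply: (@lt_le_trans _ _ (2 ^+ 9 * 2 ^+ 34)); first by rewrite ltr_pM2r// exprn_gt0.
by apply: le_trans h; rewrite -exprD ler_weXn2l// ler1n.
Qed.

(** Duality on the indicator of A gives rho(A) <= e^p pi(A)^p with p = (q - 1) / q in [1/2, 1],
    hence at most 3 sqrt(pi(A)), and pi(A) <= 30 / S is too small. *)
Lemma spread_not_close (rho : probability 'rV[R]_d.+1 R) :
 (((80 * 640)^-1)%:E <= rho [set v : 'rV[R]_d.+1 | ((S / 6) ^+ 2 < v ord0 ord0 ^+ 2)%R])%E ->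
 ~ (renyi q rho pi <= 1%:E)%E.
Proof.
move=> hr hq; have q2' := q2; have q1 : 1 < q by lra.
set A := [set v | _] in hr.
have mA : measurable A.
 rewrite (_ : A = (fun v : 'rV[R]_d.+1 => v ord0 ord0 ^+ 2) @^-1` `](S / 6) ^+ 2, +oo[%classic); last first.
  by apply/seteqP; split => v /=; rewrite in_itv/= andbT. apply: mpreimage; last exact: mitv.
 by apply: mfX; exact: mcoord_rV.
have S0 : 0 < S by exact: expR_gt0.
have S6 : 1 <= S / 6.
 rewrite ler_pdivlMr// mul1r; have := expR_ge1Dx a; have h := a50; rewrite -/S; lra.
have hp := gibbs_tail nu2 gpi S6; rewrite -/A in hp.
have bI : bmf (\1_A : 'rV[R]_d.+1 -> R) by exact: bmf_indic.
have EI (m : probability 'rV[R]_d.+1 R) : (E m (\1_A : 'rV[R]_d.+1 -> R))%:E = m A.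
 by rewrite EE// integral_indic// setIT.
have I0 (x : 'rV[R]_d.+1) : 0 <= (\1_A x : R) by [].
have := dual_bound_of_renyi q1 hq bI I0; rewrite /dual_bound.
have q'0 : q / (q - 1) != 0 by rewrite gt_eqF// divr_gt0//; lra.
rewrite (@eq_E _ _ _ pi (fun x => (\1_A x : R) `^ (q / (q - 1))) \1_A); last first.
 by move=> x; rewrite indicE; case: (_ \in _); rewrite /= ?powR1// powR0.
set e := E pi \1_A; set f := E rho \1_A => h.
have e1 : e <= 30 / S. have : (e%:E <= (5 / (S / 6))%:E)%E by rewrite EI.
 by rewrite lee_fin (_ : 5 / (S / 6) = 30 / S)//; field; rewrite gt_eqF.
have f1 : (80 * 640)^-1 <= f by rewrite -lee_fin EI.
have /andP[e0 e01] : 0 <= e <= 1. apply: E01 => [|x]; first exact: mindic.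
 by rewrite indicE; case: (_ \in _); rewrite /= ?lexx ?ler01.
set p := (q - 1) / q in h.
have p1 : 2^-1 <= p by rewrite /p ler_pdivlMr; lra.
have p2 : p <= 1 by rewrite /p ler_pdivrMr; lra.
have h3 : expR p <= 3. apply: (@le_trans _ _ (expR 1)); first by rewrite ler_expR.
 have h6 : expR 6^-1 <= 6 / 5 :> R. have := expR_ge1Dx (- 6^-1 : R); rewrite expRN => h1.
  by rewrite -[leLHS]invrK -[leRHS]invrK lef_pV2 ?posrE ?invr_gt0 ?expR_gt0//; lra.
 rewrite (_ : 1 = 6%:R * 6^-1 :> R); last by field.
 rewrite expRM_natl; apply: (@le_trans _ _ ((6 / 5) ^+ 6)).
  by rewrite lerXn2r ?nnegrE ?expR_ge0//; lra. by rewrite !exprS expr0; lra.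
have h4 : e `^ p <= Num.sqrt e.
 rewrite -powR12_sqrt//; move: e0; rewrite le_eqVlt => /predU1P[<-|e0].
  by rewrite !powR0// gt_eqF//; lra. by apply: ger_powR; rewrite ?e0.
have h5 : f <= 3 * Num.sqrt e.
 by apply: (le_trans h); apply: ler_pM => //; rewrite ?expR_ge0 ?powR_ge0.
have b0 : 0 < (80 * 640)^-1 :> R by rewrite invr_gt0; lra.
have := cS; move: b0 f1; move: ((80 * 640)^-1) => b b0 f1 bS.
have f0 : 0 <= f by lra.
have h6 : b ^+ 2 <= 3 ^+ 2 * e. apply: (@le_trans _ _ (f ^+ 2)).
  by apply: lerXn2r => //; rewrite nnegrE ltW. rewrite -[X in _ <= _ * X](sqr_sqrtr e0) -exprMn.
 by apply: lerXn2r => //; rewrite nnegrE mulr_ge0// sqrtr_ge0.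
have : 3 ^+ 2 * e <= 3 ^+ 2 * (30 / S) by rewrite ler_wpM2l// exprn_ge0.
by lra.
Qed.

(** S^2 = e^(2 D / nu) n^-10, and the prefactors are at most n^10; a whole factor e^(D / nu) >=
    n^105 is available against n^20. *)
Lemma relaxation_time_ge : d.+1%:R / (4 * nu) * expR (D / nu) <= S ^+ 2 / (216 * n).
Proof.
have nu2' := nu2; have L2' := L2; have n2' := n2; have n0' := n0.
have nu0 : 0 < nu by lra.
rewrite ler_pdivlMr; last by lra.
have h1 : d.+1%:R / (4 * nu) <= n. rewrite ler_pdivrMr; last by lra.
 have : d.+1%:R <= n by rewrite /n; lra. by nra.
have h2 : 216 <= n ^+ 8. apply: (@le_trans _ _ (2 ^+ 8)); first by rewrite !exprS expr0; lra.
 by rewrite lerXn2r ?nnegrE//; lra.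
have h3 : d.+1%:R / (4 * nu) * (216 * n) <= expR (10 * L).
 rewrite expRM_natl -nE (_ : n ^+ 10 = n * (n ^+ 8 * n)); last by ring.
 have n8 : 0 < n ^+ 8 by rewrite exprn_gt0. apply: ler_pM => //; last by rewrite ler_pM2r.
  by rewrite divr_ge0//; lra. by lra.
rewrite mulrAC; apply: (@le_trans _ _ (expR (10 * L) * expR (D / nu))); first by rewrite ler_pM2r ?expR_gt0.
rewrite -expRD /S -expRM_natl ler_expR /a; have h := DL; lra.
Qed.

End lower_bound.

Section complexity_lower.
Context (R : realType) (d : nat) (q nu D : R) (pi : probability 'rV[R]_d.+1 R).
Hypotheses (q2 : 2 <= q) (nu2 : 2 <= nu) (gpi : is_gibbs (V_nu nu) pi).
Let n : R := d.+1%:R + nu.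
Hypothesis D105 : 105 * (1 + nu * ln n) <= D.
Let S : R := expR (D / nu - 5 * ln n).
Let nu1 : 1 <= nu. Proof. by have h := nu2; lra. Qed.
Let n0 : 0 < n. Proof. by rewrite /n; have : 0 <= d.+1%:R :> R by []; have h := nu2; lra. Qed.
Let S1 : 1 <= S. Proof. exact: (wide_scale_ge1 nu2 D105). Qed.

Let x0 (u : R) : 'rV[R]_d.+1 := S *: gmap d.+1 u.

Let mx0 : measurable_fun [set: R] x0.
Proof. by apply: mrVZ => //; exact: measurable_gmap. Qed.

Let x0law A : measurable A ->
 lam ((fun u => x0 (usplit1 u)) @^-1` A) = gauss R d.+1 ((fun z : 'rV[R]_d.+1 => S *: z) @^-1` A).
Proof.
move=> mA; have mA' := @measurable_scale_preimage R d.+1 S A mA.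
rewrite -(lam_gmap mA') -(lam_usplit1 (mpreimage (@measurable_gmap R d.+1) mA')).
by [].
Qed.

Let spread_subset : [set v : 'rV[R]_d.+1 | S ^+ 2 / 32 < v ord0 ord0 ^+ 2] `<=`
 [set v : 'rV[R]_d.+1 | (S / 6) ^+ 2 < v ord0 ord0 ^+ 2].
Proof.
move=> v /=; apply: le_lt_trans; rewrite expr_div_n ler_wpM2l ?sqr_ge0//.
by rewrite lef_pV2 ?posrE ?exprn_gt0//; lra.
Qed.

Let measurable_square (b : R) : measurable [set v : 'rV[R]_d.+1 | b < v ord0 ord0 ^+ 2].
Proof.
rewrite (_ : mkset _ = (fun v : 'rV[R]_d.+1 => v ord0 ord0 ^+ 2) @^-1` `]b, +oo[%classic); last first.
 by apply/seteqP; split => v /=; rewrite in_itv/= andbT.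
apply: mpreimage; last mes.
by apply: mfX; exact: mcoord_rV.
Qed.

(** The required run is the Euler scheme of the constructed diffusion, with the wide Gaussian as
    initial law. *)
Lemma lmc_steps_ge (h : R) k : 0 < h -> h * n <= 1 ->
 lmc_steps (renyi q) renyi_oo (V_nu nu) pi h D 1 k ->
 d.+1%:R / (4 * h * nu) * expR (D / nu) <= k%:R.
Proof.
move=> h0 hn hk; rewrite leNgt; apply/negP => kl.
have [X [B [hl X0]]] := langevin_diffusion_exists nu1 mx0.
have lmc := euler_lmc hl h0.
have law0 A : measurable A -> lam (euler_rv nu X B h 0 @^-1` A) =
  gauss R d.+1 ((fun z : 'rV[R]_d.+1 => S *: z) @^-1` A).
 move=> mA; rewrite -x0law//; congr (lam _); apply/seteqP; split => u /=; by rewrite X0.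
have start := wide_start nu2 gpi D105 (rho := distribution (@lam R) (euler_rv nu X B h 0)) law0.
have kh : k%:R * h <= S ^+ 2 / (216 * n). apply: le_trans (relaxation_time_ge nu2 D105).
 rewrite -ler_pdivlMr//; apply: (le_trans (ltW kl)). have nu0 : 0 < nu by have h' := nu2; lra.
 by apply: eq_ler; field; rewrite !gt_eqF.
have sp := lmc_spread nu1 h0 hn S1 lmc law0 kh.
apply: (spread_not_close q2 nu2 gpi D105 _ (hk _ _ _ _ _ lmc start)).
apply: (le_trans sp); apply: le_measure; rewrite ?inE.
- mes.
- mes.
- by move=> u; exact: spread_subset.
Qed.

(** The spread of the Euler schemes passes to the limit through a continuous function squeezed
    between the indicators of two nested sets, hence the two thresholds S^2 / 32 and S^2 / 36. *)
Lemma ld_times_ge (T : R) : ld_times (renyi q) renyi_oo (V_nu nu) pi D 1 T ->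
 d.+1%:R / (4 * nu) * expR (D / nu) <= T.
Proof.
move=> [T0 hT]; rewrite leNgt; apply/negP => Tl.
have [X [B [hl X0]]] := langevin_diffusion_exists nu1 mx0.
have law0 h A : measurable A -> lam (euler_rv nu X B h 0 @^-1` A) =
  gauss R d.+1 ((fun z : 'rV[R]_d.+1 => S *: z) @^-1` A).
 move=> mA; rewrite -x0law//; congr (lam _); apply/seteqP; split => u /=; by rewrite X0.
have start := wide_start nu2 gpi D105 (rho := distribution (@lam R) (X 0)) (law0 0).
have TS : T <= S ^+ 2 / (216 * n) by apply: le_trans (relaxation_time_ge nu2 D105); exact: ltW.
have S0 : 0 < S by pos.
apply: (spread_not_close q2 nu2 gpi D105 _ (hT _ _ _ _ _ hl start)).
(* At T = 0 only the initial law matters: [lmc_spread] after 0 steps, with the arbitrary step 1 /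
   n. *)
move: T0; rewrite le_eqVlt => /predU1P[T0|T0]. rewrite -T0 in TS *. have nV : 0 < n^-1 by pos.
 have nn : n^-1 * n <= 1 by rewrite mulVf// gt_eqF. have lmc := euler_lmc hl nV.
 have sp : (((80 * 640)^-1)%:E <= lam (euler_rv nu X B n^-1 0 @^-1` [set v : 'rV[R]_d.+1 | (S ^+ 2 / 32 < v ord0 ord0 ^+ 2)%R]))%E.
  by apply: (lmc_spread nu1 nV nn S1 lmc (law0 _)); rewrite mul0r.
 apply: (le_trans sp); apply: le_measure; rewrite ?inE.
 - mes.
 - mes.
 - by move=> u; exact: spread_subset.
(* 288 / S^2 is the slope for which the ramp rises from 0 to 1 between S^2 / 36 and S^2 / 32. *)
pose g (v : 'rV[R]_d.+1) : R := ramp (288 / S ^+ 2 * (v ord0 ord0 ^+ 2 - (S / 6) ^+ 2)).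
have mg : mfunT g. apply: (mcompT (@measurable_ramp R)); apply: mfM => //.
 by apply: mfB => //; apply: mfX; exact: mcoord_rV.
have cpoly : continuous (fun t : R => 288 / S ^+ 2 * (t ^+ 2 - (S / 6) ^+ 2)).
 move=> t; apply: (@cvgM R); first exact: cvg_cst.
 by apply: (@cvgB R R^o); [exact: exprn_continuous|exact: cvg_cst].
have cphi : continuous (fun t : R => ramp (288 / S ^+ 2 * (t ^+ 2 - (S / 6) ^+ 2))).
 by move=> t; exact: (cvg_comp _ _ (cpoly t) (@continuous_ramp R _)).
have cg : continuous g.
 move=> v; have c1 : (w : 'rV[R]_d.+1) ord0 ord0 @[w --> v] --> v ord0 ord0 by exact: continuous_coord.
 exact: (cvg_comp _ _ c1 (cphi _)).
have g01 v : 0 <= g v <= 1 by exact: ramp01.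
have bg : bmf g by exact: bmf01.
have S20 : 0 < S ^+ 2 by pos.
have g_le v : g v <= \1_[set v : 'rV[R]_d.+1 | (S / 6) ^+ 2 < v ord0 ord0 ^+ 2] v.
 rewrite indicE; case: (boolP (_ \in _)) => [_|/negP hv]; first by case/andP: (g01 v).
 rewrite /g ramp_le0// mulr_ge0_le0 ?divr_ge0 ?(ltW S20)// subr_le0 leNgt; apply/negP => h.
 by apply: hv; rewrite inE.
have g_ge v : \1_[set v : 'rV[R]_d.+1 | S ^+ 2 / 32 < v ord0 ord0 ^+ 2] v <= g v.
 rewrite indicE; case: (boolP (_ \in _)) => [|_]; last by case/andP: (g01 v).
 rewrite inE /= => hv; rewrite /g ramp_ge1// mulrAC ler_pdivlMr// mul1r expr_div_n. by lra.
have EI (A : set R) : measurable A -> (E (@lam R) (\1_A : R -> R))%:E = lam A.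
 by move=> mA; rewrite EE; [rewrite integral_indic// setIT|exact: bmf_indic].
have bgY (Y : {RV (@lam R) >-> 'rV[R]_d.+1}) : bmf (fun u => g (Y u)).
 by apply: bmf01 => [|u //]; exact: (mcompT mg (mfunPT Y)).
have lim : E (@lam R) (fun u => g (euler_rv nu X B (T / N.+1%:R) N.+1 u)) @[N --> \oo] --> E (@lam R) (fun u => g (X T u)).
 apply: (@E_ae_cvg _ _ _ _ _ _ 1).
 - by move=> N; case: (bgY (euler_rv nu X B (T / N.+1%:R) N.+1)).
 - by case: (bgY (X T)).
 - by move=> N u; case/andP: (g01 (euler_rv nu X B (T / N.+1%:R) N.+1 u)) => h1 h2; rewrite ger0_norm.
 - apply: filterS (euler_rv_cvg nu1 hl T0) => u hu. exact: (cvg_comp _ _ hu (cg _)).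
have c_le : (80 * 640)^-1 <= E (@lam R) (fun u => g (X T u)).
 rewrite -(cvg_lim _ lim)//; apply: limr_ge; first by apply/cvg_ex; eexists; exact: lim. near=> N.
 have h0 : 0 < T / N.+1%:R by pos. have hn : T / N.+1%:R * n <= 1.
  rewrite mulrAC ler_pdivrMr// mul1r; apply: (@le_trans _ _ N%:R); last by rewrite ler_nat.
  by near: N; exact: nbhs_infty_ger. have lmc := euler_lmc hl h0.
 have kh : N.+1%:R * (T / N.+1%:R) <= S ^+ 2 / (216 * n) by rewrite mulrC divfK.
 have sp := lmc_spread nu1 h0 hn S1 lmc (law0 _) kh. rewrite -lee_fin; apply: (le_trans sp).
 have mA : measurable (euler_rv nu X B (T / N.+1%:R) N.+1 @^-1` [set v : 'rV[R]_d.+1 | S ^+ 2 / 32 < v ord0 ord0 ^+ 2]).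
  exact: mpreimage (mfunPT _) (measurable_square _).
 rewrite -[leLHS](EI _ mA) lee_fin; apply: le_E => //; first exact: bmf_indic.
 by move=> u; have := g_ge (euler_rv nu X B (T / N.+1%:R) N.+1 u); rewrite !indicE.
have mA : measurable (X T @^-1` [set v : 'rV[R]_d.+1 | (S / 6) ^+ 2 < v ord0 ord0 ^+ 2]).
 exact: mpreimage (mfunPT _) (measurable_square _).
rewrite -[leRHS](EI _ mA) lee_fin; apply: (le_trans c_le); apply: le_E => //; first exact: bmf_indic.
Unshelve. all: by end_near. Qed.

End complexity_lower.

Theorem corollary12 (R : realType) (q : R) (hq : 2 <= q) :
  exists C : R,
  forall (d : nat) (hd : (0 < d)%N) (nu : R) (hnu : 2 * q / (q - 1) < nu)
    (pi : probability 'rV[R]_d R) (hpi : is_gibbs (V_nu nu) pi)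
    (Delta0 : R) (hDelta0 : C * (1 + nu * ln (d%:R + nu)) <= Delta0),
  (exists T : R,
     [/\ is_complexity_LD (renyi q) renyi_oo (V_nu nu) pi Delta0 1 T,
         d%:R / (4 * nu) * expR (Delta0 / nu) <= T &
         T <= d%:R / nu * expR (C * Delta0 / nu)]) /\
  (exists2 h : R, 0 < h &
   exists k : nat,
     [/\ is_complexity_LMC (renyi q) renyi_oo (V_nu nu) pi h Delta0 1 k,
         d%:R / (4 * h * nu) * expR (Delta0 / nu) <= k%:R &
         k%:R <= d%:R / (h * nu) * expR (C * Delta0 / nu)]).
Proof.
(* This dominates both 30 q + 3, asked by [upper_time_bound], and 105, asked by the lower bounds. *)
exists (30 * q + 105) => -[//|d] _ nu hnu pi hpi D hD.
have nu2 : 2 <= nu. apply: (le_trans _ (ltW hnu)); rewrite ler_pdivlMr; last pos. by lra.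
have nu1 : 1 <= nu by lra.
have nu0 : 0 < nu by lra.
set n := d.+1%:R + nu in hD.
have d1 : 1 <= d.+1%:R :> R by rewrite ler1n.
have n2 : 2 <= n by rewrite /n; lra.
have nun : nu <= n by rewrite /n; lra.
have L0 : 0 <= nu * ln n by rewrite mulr_ge0 ?ln_ge0//; lra.
have D105 : 105 * (1 + nu * ln n) <= D. by apply: le_trans hD; rewrite ler_wpM2r//; lra.
have D48 : 48 <= D by pos.
have q1 : 1 <= q by lra.
have Cq : 30 * q + 3 <= 30 * q + 105 by lra.
set C := 30 * q + 105 in hD Cq *.
set M := mixing_time d.+1 q nu D.
have M0 : 0 < M by exact: mixing_time_gt0.
have MC : M <= d.+1%:R / nu * expR (C * D / nu).
 by rewrite /M /mixing_time -[leRHS]mulrA ler_wpM2l//; exact: (upper_time_bound q1 nu1 n2 nun Cq hD).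
split. have [T hT TM] := ld_complexity_exists hq nu1 (ltn0Sn d) D48 hpi.
 exists T; split => //; first by apply: (ld_times_ge hq nu2 hpi D105); case: hT.
 exact: le_trans TM MC.
have [h0 h00 hM] := lmc_renyi_le1 hq nu1 (ltn0Sn d) D48 hpi.
have n0 : 0 < n by lra.
(* The step must be below the threshold [h0] of the upper bound and satisfy h n <= 1 for the moment
   estimates; it is chosen as a fraction of [M], so that k.+1 steps last exactly [M]. *)
pose b := Num.min h0 n^-1.
have b0 : 0 < b by rewrite lt_min h00 invr_gt0.
pose k := Num.truncn (M / b).
have hk : M / k.+1%:R <= b. by rewrite ler_pdivrMr// -ler_pdivrMl// mulrC ltW// truncnS_gt.
set h := M / k.+1%:R in hk.
have hh : 0 < h by rewrite divr_gt0.
have hn : h * n <= 1.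
 by rewrite -ler_pdivlMr// mul1r; apply: (le_trans hk); rewrite ge_min lexx orbT.
have steps : lmc_steps (renyi q) renyi_oo (V_nu nu) pi h D 1 k.+1.
 move=> dO Omega P x xi lmc; apply: (hM k) lmc. by apply: (le_trans hk); rewrite ge_min lexx.
have ex : exists j, `[< lmc_steps (renyi q) renyi_oo (V_nu nu) pi h D 1 j >].
 by exists k.+1; apply/asboolP.
exists h => //; exists (ex_minn ex); case: ex_minnP => j /asboolP hj jmin; split.
- by split => // i hi; rewrite leEnat; apply: jmin; exact/asboolP.
- exact: (lmc_steps_ge hq nu2 hpi D105 hh hn hj).
- apply: (@le_trans _ _ k.+1%:R); first by rewrite ler_nat; apply: jmin; exact/asboolP.
 rewrite (_ : k.+1%:R = M / h); last by rewrite /h; field; rewrite !gt_eqF.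
 rewrite ler_pdivrMr//; apply: (le_trans MC). by apply: eq_ler; field; rewrite !gt_eqF.
Qed.
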